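(* Let $(M,g)$ be a smooth Riemannian manifold, $\phi:M\to\mathbb{R}$ a smooth function, $\Omega=\{\phi>0\}$, $\Gamma=\{\phi=0\}$ compact with $d\phi\ne0$ on $\Gamma$, and $G=g/\phi$ on $\Omega$. For sufficiently small $\varepsilon>0$ the billiard map $T$ of $G$ is well defined on the set $$U=\{(q,p)\in T^*\Gamma:\|p\|\ge\varepsilon^{-1}\},$$ and it is close to the $\pi$-time map $\Phi_N^\pi$ of the flow $\Phi_N^\varphi$ of the Hamiltonian system on $T^*\Gamma$ (away from the zero section) with the Hamiltonian $$N(q,p)=-K_0^{-1/2}(q,p)+\frac38\,\frac{K_1(q,p)}{K_0^{5/2}(q,p)}=-K_0^{-1/2}(q,p)+O(\|p\|^{-3}).$$ More precisely, $$T(q,p)=\Phi_N^\pi(q,p)+\big(O(\|p\|^{-4}),\,O(\|p\|^{-3})\big).$$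
   Context: Semigeodesic coordinates and $K_0,K_1$. Let $\rho(x)$ be the $G$-distance from $x\in\Omega$ to $\Gamma$ (infimum of $G$-lengths of curves joining $x$ with $\Gamma$ in $\overline\Omega$; finite, with $\rho=0$ on $\Gamma$), and $s=\rho^2/4$. In a neighborhood $W$ of $\Gamma$ in $\overline\Omega$ each point $x\in W\setminus\Gamma$ is joined with $\Gamma$ by a unique shortest $G$-geodesic, ending at $q(x)\in\Gamma$, and $x\mapsto(q(x),s(x))$ extends to a smooth diffeomorphism of $W$ onto $\Gamma\times[0,\varepsilon_0]$. In these coordinates $G=\frac1s\big(ds^2+\langle B(q,s)\,dq,dq\rangle\big)$ with $B(q,s):T_q\Gamma\to T^*_q\Gamma$ positive definite and smooth up to $s=0$. Put $C(q,s)=B(q,s)^{-1}$ and, for $p\in T_q^*\Gamma$, $$K_0(q,p)=\langle C(q,0)p,p\rangle,\qquad K_1(q,p)=\langle\partial_sC(q,0)p,p\rangle.$$ Billiard map. Let $H(x,p_x)=\phi(x)\|p_x\|_g^2$ on $T^*\Omega$ (dual norm of $g$). Let $\hat\Omega=\{(x,\xi)\in M\times\mathbb{R}:x\in\overline\Omega,\ \xi^2=2\phi(x)\}$, $\pi(x,\xi)=x$, $\hat\Gamma=\pi^{-1}(\Gamma)=\{\xi=0\}\cong\Gamma$; $\hat\Omega$ is a smooth manifold (the double of $\overline\Omega$). The function $\hat H(y,p_y)=H\big(\pi(y),(d\pi(y)^* )^{-1}p_y\big)$, $y\in\hat\Omega\setminus\hat\Gamma$, extends to a smooth function on $T^*\hat\Omega$;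 its Hamiltonian flow $\Phi^t$ (standard symplectic form $dp_y\wedge dy$) is the regularized flow. Let $\mathcal{S}=\{(y,p_y):y\in\hat\Gamma,\ \hat H(y,p_y)=1\}=\mathcal{S}^+\cup\mathcal{S}^-$, where $\mathcal{S}^\pm$ is the part on which $\pm\dot\xi>0$ along the flow; each $\mathcal{S}^\pm$ is identified with $T^*\Gamma$ by $(y,p_y)\mapsto(\pi(y),p_y|_{T_y\hat\Gamma})$. The first return map to $\mathcal{S}$ of the flow $\Phi^t$, $t>0$, defined at those points whose forward orbit returns to $\mathcal{S}$, takes $\mathcal{S}^\pm$ to $\mathcal{S}^\mp$, and under the identifications both restrictions define the same map $T$ from a subset of $T^*\Gamma$ to $T^*\Gamma$: the billiard map. Conventions. $\|p\|$ is the norm of $p\in T_q^*\Gamma$ dual to $g|_\Gamma$. The Hamiltonian flow $\Phi_N^\varphi$ (time denoted $\varphi$) is taken with respect to the standard symplectic form $dp\wedge dq$ on $T^*\Gamma$: $\frac{dq}{d\varphi}=\partial_pN$, $\frac{dp}{d\varphi}=-\partial_qN$. The difference of two points of $T^*\Gamma$ is understood in local coordinates $q\in\mathbb{R}^{n-1}$ ($n=\dim M$) on $\Gamma$ with conjugate momenta $p\in\mathbb{R}^{n-1}$, for a fixed finite atlas whose charts extend to charts on neighborhoods of the closures of their domains; the first $O$-term refers to $q$-components and the second to $p$-components, and $O$ is uniform as $\|p\|\to\infty$. *)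

(* Defs.v *)
From mathcomp Require Export all_boot all_order all_algebra.
From mathcomp Require Export all_classical all_reals all_analysis.
Set Implicit Arguments.
Unset Strict Implicit.
Unset Printing Implicit Defensive.
Import Order.TTheory GRing.Theory Num.Theory.
Import numFieldNormedType.Exports.
Local Open Scope classical_set_scope.
Local Open Scope ring_scope.

Section Smoothness.
Context {R : realType}.

(* Meaningful for open U. *)
Fixpoint Ck (m k : nat) (U : set 'rV[R]_m) (f : 'rV[R]_m -> R) : Prop :=
  (forall x, U x -> {for x, continuous f}) /\
  match k with
  | 0%N => True
  | k'.+1 => forall i : 'I_m,
      (forall x, U x -> derivable f x (delta_mx 0 i)) /\
      Ck k' U (fun x => 'D_(delta_mx 0 i) f x)
  end.

(* C^oo on an arbitrary subset D of R^m: near each point of D, f agrees on D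
   with a C^oo function on an open set.  For D = V x [0, e] this is smoothness
   up to the boundary. *)
Definition smooth_on (m : nat) (D : set 'rV[R]_m) (f : 'rV[R]_m -> R) : Prop :=
  forall x, D x -> exists (U : set 'rV[R]_m) (F : 'rV[R]_m -> R),
    [/\ open U, U x, (forall k, Ck k U F) &
        forall y, U y -> D y -> F y = f y].

End Smoothness.

Section Charts.
Context {R : realType}.

(* chart_to is meaningful on chart_dom only, and chart_from on chart_img
   only. *)
Record chart (T : Type) (k : nat) := Chart {
  chart_dom : set T;
  chart_to : T -> 'rV[R]_k;
  chart_from : 'rV[R]_k -> T }.

Definition chart_img (T : Type) (k : nat) (c : chart T k) : set 'rV[R]_k :=
  chart_to c @` chart_dom c.

Definition euclidean_atlas (k : nat) : set (chart 'rV[R]_k k) :=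
  [set Chart setT id id].
Arguments euclidean_atlas k : clear implicits.

Definition line_atlas : set (chart R 1) :=
  [set Chart setT (fun t : R => const_mx t) (fun v : 'rV[R]_1 => v 0 0)].

Definition prod_chart (T T' : Type) (k l : nat) (a : chart T k)
    (b : chart T' l) : chart (T * T')%type (k + l) :=
  Chart (chart_dom a `*` chart_dom b)
    (fun x => row_mx (chart_to a x.1) (chart_to b x.2))
    (fun v => (chart_from a (lsubmx v), chart_from b (rsubmx v))).

Definition prod_atlas (T T' : Type) (k l : nat) (A : set (chart T k))
    (B : set (chart T' l)) : set (chart (T * T')%type (k + l)) :=
  [set c | exists a b, [/\ A a, B b & c = prod_chart a b]].

(* f : D -> T' is smooth, D being an arbitrary subset of T. *)
Definition smooth_map (T T' : topologicalType) (k l : nat)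
    (A : set (chart T k)) (D : set T) (A' : set (chart T' l)) (f : T -> T')
    : Prop :=
  {within D, continuous f} /\
  forall a a', A a -> A' a' -> forall j : 'I_l,
    smooth_on (chart_to a @` (chart_dom a `&` D `&` (f @^-1` chart_dom a')))
      (fun u => chart_to a' (f (chart_from a u)) 0 j).

Definition smooth_manifold (T : topologicalType) (k : nat)
    (A : set (chart T k)) : Prop :=
  [/\ hausdorff_space T, @second_countable T,
      (forall x, exists2 a, A a & chart_dom a x),
      (forall a, A a ->
        [/\ open (chart_dom a), open (chart_img a),
            (forall x, chart_dom a x -> chart_from a (chart_to a x) = x),
            {within chart_dom a, continuous (chart_to a)} &
            {within chart_img a, continuous (chart_from a)}]) &
      (forall a b, A a -> A b -> forall j : 'I_k,
        smooth_on (chart_to a @` (chart_dom a `&` chart_dom b))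
          (fun u => chart_to b (chart_from a u) 0 j))].

(* All the charts of the k-dimensional embedded submanifold S: the
   diffeomorphisms between a relatively open subset of S and an open subset of
   R^k. *)
Definition submanifold_atlas (T : topologicalType) (m k : nat)
    (A : set (chart T m)) (S : set T) : set (chart T k) :=
  [set c | [/\ (exists2 O : set T, open O & chart_dom c = O `&` S),
      open (chart_img c),
      (forall x, chart_dom c x -> chart_from c (chart_to c x) = x),
      smooth_map (euclidean_atlas k) (chart_img c) A (chart_from c) &
      smooth_map A (chart_dom c) (euclidean_atlas k) (chart_to c)]].

End Charts.
Arguments chart R T k : clear implicits.
Arguments euclidean_atlas R k : clear implicits.
Arguments line_atlas R : clear implicits.

Section Cotangent.
Context {R : realType} {T : topologicalType} {k : nat}.

(* A covector is the family of its coordinates, one row p c for each chart c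
   around the base point.  As 'J f u acts on the right of row vectors,
   the pull-back of p by f is p *m ('J f u)^T. *)
Definition covector : Type := (T * (chart R T k -> 'rV[R]_k))%type.

(* The last clause fixes the irrelevant values of the family, so that equality
   in the cotangent bundle is Leibniz equality. *)
Definition cotangent (A : set (chart R T k)) : set covector :=
  [set z | [/\ (exists2 c, A c & chart_dom c z.1),
     (forall c d, A c -> A d -> chart_dom c z.1 -> chart_dom d z.1 ->
        z.2 c = z.2 d *m
          ('J (fun u => chart_to d (chart_from c u)) (chart_to c z.1))^T) &
     (forall c, ~ (A c /\ chart_dom c z.1) -> z.2 c = 0)]].

(* A function on the cotangent bundle, given by its coordinate expressions
   F c u p. *)
Definition fiber_eval (A : set (chart R T k))
    (F : chart R T k -> 'rV[R]_k -> 'rV[R]_k -> R) (z : covector) : R :=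
  xget 0 [set r | exists c, [/\ A c, chart_dom c z.1 &
                                r = F c (chart_to c z.1) (z.2 c)]].

(* z solves y' = dF/dp, p' = - dF/dy on the open set I of times. *)
Definition hamiltonian_curve (A : set (chart R T k))
    (F : chart R T k -> 'rV[R]_k -> 'rV[R]_k -> R) (I : set R)
    (z : R -> covector) : Prop :=
  forall t, I t ->
    [/\ cotangent A (z t),
        {for t, continuous (fun r => (z r).1)} &
        forall c, A c -> chart_dom c (z t).1 -> forall i : 'I_k,
          let u := chart_to c (z t).1 in let p := (z t).2 c in
          is_derive t 1 (fun r => chart_to c (z r).1 0 i)
            ('D_(delta_mx 0 i) (F c u) p) /\
          is_derive t 1 (fun r => (z r).2 c 0 i)
            (- 'D_(delta_mx 0 i) (fun v => F c v p) u)].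

End Cotangent.
Arguments covector R T k : clear implicits.

Section Metric.
Context {R : realType} {M : topologicalType} {m : nat}.
Variable A : set (chart R M m).
Implicit Type g : chart R M m -> M -> 'M[R]_m.

Definition sym_posdef (l : nat) (S : 'M[R]_l) : Prop :=
  S^T = S /\ forall v : 'rV[R]_l, v != 0 -> 0 < (v *m S *m v^T) 0 0.

(* g a x is the Gram matrix of the metric at x in the chart a. *)
Definition riemannian_metric g : Prop :=
  [/\ (forall a x, A a -> chart_dom a x -> sym_posdef (g a x)),
      (forall a, A a -> forall i j : 'I_m,
         smooth_on (chart_img a) (fun u => g a (chart_from a u) i j)) &
      (forall a b x, A a -> A b -> chart_dom a x -> chart_dom b x ->
         let J := 'J (fun u => chart_to b (chart_from a u)) (chart_to a x) in
         g a x = J *m g b x *m J^T)].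

Definition pullback_metric g (l : nat) (f : 'rV[R]_l -> M) (u : 'rV[R]_l)
    : 'M[R]_l :=
  xget 0 [set S | exists a, [/\ A a, chart_dom a (f u) &
    let J := 'J (fun v => chart_to a (f v)) u in
    S = J *m g a (f u) *m J^T]].

(* The norm dual to the metric induced on a submanifold with chart c. *)
Definition dual_norm g (k : nat) (c : chart R M k) (u p : 'rV[R]_k) : R :=
  Num.sqrt ((p *m invmx (pullback_metric g (chart_from c) u) *m p^T) 0 0).

End Metric.
Arguments dual_norm {R M m} A g {k} c u p.

Section Billiard.
Context {R : realType} {n : nat} {M : topologicalType}.
Variables (A : set (chart R M n.+1)) (g : chart R M n.+1 -> M -> 'M[R]_n.+1).
Variable phi : M -> R.

Definition Omega : set M := [set x | 0 < phi x].
Definition Gamma : set M := [set x | phi x = 0].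

Definition dphi_nonzero : Prop :=
  forall a x, A a -> chart_dom a x -> Gamma x ->
    exists i, 'D_(delta_mx 0 i) (fun u => phi (chart_from a u)) (chart_to a x)
              != 0.

Definition Gamma_atlas : set (chart R M n) := submanifold_atlas A Gamma.

Definition jacobi_metric (a : chart R M n.+1) (x : M) : 'M[R]_n.+1 :=
  (phi x)^-1 *: g a x.

(* G is infinite on Gamma, where only zero vectors have finite length; this
   gives rho = 0 on Gamma. *)
Definition G_speed (gam : R -> M) (t : R) : \bar R :=
  let v2 := pullback_metric A g (fun w : 'rV[R]_1 => gam (w 0 0))
              (const_mx t) 0 0 in
  if v2 == 0 then 0%E
  else if 0 < phi (gam t) then (Num.sqrt (v2 / phi (gam t)))%:E else +oo%E.

Definition G_length (gam : R -> M) : \bar R :=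
  (\int[@lebesgue_measure R]_(t in `[0%R, 1%R]) G_speed gam t)%E.

(* No regularity (gam' <> 0) is asked, so that piecewise smooth curves are
   covered up to reparametrization. *)
Definition curve_to_Gamma (x : M) (gam : R -> M) : Prop :=
  [/\ smooth_map (line_atlas R) `[0, 1] A gam,
      (forall t, `[0, 1]%classic t -> closure Omega (gam t)),
      gam 0 = x & Gamma (gam 1)].

Definition rho (x : M) : \bar R :=
  ereal_inf [set G_length gam | gam in curve_to_Gamma x].

Definition s_coord (x : M) : R := fine (rho x) ^+ 2 / 4.

Definition unique_shortest (x q : M) : Prop :=
  exists gam, [/\ curve_to_Gamma x gam, gam 1 = q,
    G_length gam = rho x, (rho x < +oo)%E &
    forall gam', curve_to_Gamma x gam' -> G_length gam' = rho x ->
      gam' @` `[0, 1] = gam @` `[0, 1]].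

(* Semigeodesic coordinates x |-> (q x, s_coord x) on the neighborhood W of
   Gamma in the closure of Omega, with inverse X; B c u s is the matrix of
   B(q, s) in the coordinates u = c(q) on Gamma. *)
Record semigeodesic (W : set M) (eps0 : R) (q : M -> M) (X : M * R -> M)
    (B : chart R M n -> 'rV[R]_n -> R -> 'M[R]_n) : Prop := {
  semigeodesic_eps0 : 0 < eps0;
  semigeodesic_sub : W `<=` closure Omega;
  semigeodesic_nbhs : exists O : set M,
    [/\ open O, Gamma `<=` O & O `&` closure Omega `<=` W];
  semigeodesic_shortest : forall x, W x -> ~ Gamma x -> unique_shortest x (q x);
  semigeodesic_Gamma : forall x, Gamma x -> q x = x;
  semigeodesic_smooth_q : smooth_map A W A q;
  semigeodesic_smooth_s : smooth_map A W (line_atlas R) s_coord;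
  semigeodesic_smooth_X : smooth_map (prod_atlas A (line_atlas R))
    (Gamma `*` `[0, eps0]) A X;
  semigeodesic_to : forall x, W x ->
    [/\ Gamma (q x), 0 <= s_coord x <= eps0 & X (q x, s_coord x) = x];
  semigeodesic_from : forall y s, Gamma y -> 0 <= s <= eps0 ->
    [/\ W (X (y, s)), q (X (y, s)) = y & s_coord (X (y, s)) = s];
  semigeodesic_B_posdef : forall c u s, Gamma_atlas c -> chart_img c u ->
    0 <= s <= eps0 -> sym_posdef (B c u s);
  semigeodesic_B_smooth : forall c, Gamma_atlas c -> forall i j : 'I_n,
    smooth_on [set w : 'rV[R]_(n + 1) |
        chart_img c (lsubmx w) /\ 0 <= rsubmx w 0 0 <= eps0]
      (fun w => B c (lsubmx w) (rsubmx w 0 0) i j);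
  (* G = s^-1 (<B dq, dq> + ds^2) *)
  semigeodesic_metric : forall c u s, Gamma_atlas c -> chart_img c u ->
    0 < s < eps0 ->
    pullback_metric A jacobi_metric
      (fun w : 'rV[R]_(n + 1) => X (chart_from c (lsubmx w), rsubmx w 0 0))
      (row_mx u (const_mx s))
    = s^-1 *: block_mx (B c u s) 0 0 1%:M }.

Section Averaged_system.
Variable B : chart R M n -> 'rV[R]_n -> R -> 'M[R]_n.

Definition C_mx (c : chart R M n) (u : 'rV[R]_n) (s : R) : 'M[R]_n :=
  invmx (B c u s).

Definition dC_mx (c : chart R M n) (u : 'rV[R]_n) : 'M[R]_n :=
  \matrix_(i, j)
    lim ((fun s => s^-1 * (C_mx c u s i j - C_mx c u 0 i j)) @ 0^'+).

Definition K0 (c : chart R M n) (u p : 'rV[R]_n) : R :=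
  (p *m C_mx c u 0 *m p^T) 0 0.

Definition K1 (c : chart R M n) (u p : 'rV[R]_n) : R :=
  (p *m dC_mx c u *m p^T) 0 0.

Definition N_ham (c : chart R M n) (u p : 'rV[R]_n) : R :=
  - (K0 c u p `^ (- (1 / 2))) + 3 / 8 * (K1 c u p / K0 c u p `^ (5 / 2)).

Definition norm_cov (z : covector R M n) : R :=
  fiber_eval Gamma_atlas (dual_norm A g) z.

Definition U_set (eps : R) : set (covector R M n) :=
  [set z | cotangent Gamma_atlas z /\ eps^-1 <= norm_cov z].

(* z' = Phi_N^pi(z) *)
Definition N_flow_pi (z z' : covector R M n) : Prop :=
  exists (Z : R -> covector R M n) (a b : R),
    [/\ a < 0 /\ pi < b, hamiltonian_curve Gamma_atlas N_ham `]a, b[ Z,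
        (forall t, a < t < b -> norm_cov (Z t) != 0),
        Z 0 = z & Z pi = z'].

End Averaged_system.

Definition Omega_hat : set (M * R) :=
  [set y | closure Omega y.1 /\ y.2 ^+ 2 = 2 * phi y.1].

Definition Omega_hat_atlas : set (chart R (M * R)%type n.+1) :=
  submanifold_atlas (prod_atlas A (line_atlas R)) Omega_hat.

(* H(x, P) = phi(x) |P|_g^2, P being the coordinates of p_x in the chart a. *)
Definition H_ham (a : chart R M n.+1) (x : M) (P : 'rV[R]_n.+1) : R :=
  phi x * (P *m invmx (g a x) *m P^T) 0 0.

(* Hh is (the family of coordinate expressions of) the smooth function on the
   cotangent bundle of Omega_hat such that Hh(y, dpi(y)^* P) = H(pi(y), P)
   off Gamma_hat, where dpi(y) is invertible; as the complement of Gamma_hat is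
   dense, Hh is determined on the cotangent bundle. *)
Definition regularized_hamiltonian
    (Hh : chart R (M * R)%type n.+1 -> 'rV[R]_n.+1 -> 'rV[R]_n.+1 -> R)
    : Prop :=
  forall d, Omega_hat_atlas d ->
    smooth_on [set w : 'rV[R]_(n.+1 + n.+1) | chart_img d (lsubmx w)]
      (fun w => Hh d (lsubmx w) (rsubmx w)) /\
    forall u, chart_img d u -> (chart_from d u).2 != 0 ->
      forall a, A a -> chart_dom a (chart_from d u).1 ->
      forall P : 'rV[R]_n.+1,
        Hh d u (P *m ('J (fun v => chart_to a (chart_from d v).1) u)^T)
        = H_ham a (chart_from d u).1 P.

Section ReturnMap.
Variable Hh : chart R (M * R)%type n.+1 -> 'rV[R]_n.+1 -> 'rV[R]_n.+1 -> R.

Definition section_S : set (covector R (M * R)%type n.+1) :=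
  [set z | [/\ cotangent Omega_hat_atlas z, Gamma z.1.1 &
               fiber_eval Omega_hat_atlas Hh z = 1]].

(* The derivative of xi along the flow. *)
Definition xi_dot (d : chart R (M * R)%type n.+1) (u p : 'rV[R]_n.+1) : R :=
  \sum_(i < n.+1) 'D_(delta_mx 0 i) (Hh d u) p *
                  'D_(delta_mx 0 i) (fun v => (chart_from d v).2) u.

(* S^- for minus = true, S^+ for minus = false. *)
Definition section_half (minus : bool) : set (covector R (M * R)%type n.+1) :=
  [set z | section_S z /\
     0 < (-1) ^+ minus * fiber_eval Omega_hat_atlas xi_dot z].

(* The identification of S^+ and S^- with the cotangent bundle of Gamma: w is
   the restriction of z to the tangent space of Gamma_hat = Gamma x {0}. *)
Definition restricts_to (z : covector R (M * R)%type n.+1)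
    (w : covector R M n) : Prop :=
  [/\ z.1 = (w.1, 0), cotangent Gamma_atlas w &
      forall c d, Gamma_atlas c -> Omega_hat_atlas d ->
        chart_dom c w.1 -> chart_dom d z.1 ->
        w.2 c = z.2 d *m
          ('J (fun u => chart_to d (chart_from c u, 0)) (chart_to c w.1))^T].

Definition first_return (minus : bool) (w w' : covector R M n) : Prop :=
  exists (Z : R -> covector R (M * R)%type n.+1) (a b tau : R),
    [/\ [/\ a < 0, 0 < tau & tau < b],
        hamiltonian_curve Omega_hat_atlas Hh `]a, b[ Z,
        section_half minus (Z 0) /\ section_half (~~ minus) (Z tau),
        (forall t, 0 < t < tau -> ~ section_S (Z t)) &
        restricts_to (Z 0) w /\ restricts_to (Z tau) w'].

(* w' = T(w) *)
Definition billiard_map (w w' : covector R M n) : Prop :=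
  forall minus : bool, first_return minus w w'.

End ReturnMap.

(* A finite atlas of Gamma by the charts c i, each extended by e i to a
   neighborhood of the closure of its domain. *)
Definition finite_extended_atlas (m : nat) (c e : 'I_m -> chart R M n) : Prop :=
  (forall x, Gamma x -> exists i, chart_dom (c i) x) /\
  forall i, [/\ Gamma_atlas (c i), Gamma_atlas (e i),
    closure (chart_dom (c i)) `<=` chart_dom (e i) &
    forall x, chart_dom (c i) x -> chart_to (e i) x = chart_to (c i) x].

End Billiard.

(* Main.v *)
(* Near a point of Gamma take semigeodesic coordinates (u, s) and put
   s = sigma^2: then (sigma, u) is a chart of the double of Omega in which the
   regularized Hamiltonian is p_sigma^2 / 4 + sigma^2 <C(u, sigma^2) p_u, p_u>.
   With k = |p_u|, p_u = k P, sigma = y / k and time measured in units of 1 / k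
   the flow becomes an oscillator y'' = - K y + O(k^-2), K = <C(u, 0) P, P>,
   coupled to the slow variables (u, P), which move with velocity k^-2 y^2 times
   the Hamiltonian vector field X of K.  Over the half-period between two zeros
   of y the integral of y^2 is pi / (2 K^(3/2)) + O(k^-2), and X / (2 K^(3/2)) is
   the Hamiltonian vector field F0 of - K^(-1/2).  In the same variables the flow
   of N is (u, P)' = k^-2 (F0 + k^-2 F1), where F1 comes from the K1-term.  Hence
   both maps displace (u, P) by k^-2 pi F0 + O(k^-4): at this order first-order
   averaging suffices and the K1-term does not enter.  As p = k P, the
   difference is O(k^-4) in u and O(k^-3) in p, uniformly because Gamma and the
   unit sphere of the P are compact.  That the return is unique follows from
   the uniqueness of Hamiltonian curves. *)

Require Import Defs.
From mathcomp Require Import all_boot all_order all_algebra.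
From mathcomp Require Import all_classical all_reals all_analysis.
From mathcomp Require Import ring lra.
From HB Require Import structures.
Set Implicit Arguments.
Unset Strict Implicit.
Unset Printing Implicit Defensive.
Import Order.TTheory GRing.Theory Num.Theory.
Import numFieldNormedType.Exports.
Local Open Scope classical_set_scope.
Local Open Scope ring_scope.

(** * Calculus in coordinates *)

(** C and X are given only for s >= 0, whereas partial derivatives are two-sided; near a point of
    Gamma each is replaced by a smooth extension across s = 0, of which the flow, by s = sigma^2,
    sees only the part s >= 0. The projection of the double onto the closure of Omega degenerates on
    sigma = 0, so identities for the regularized Hamiltonian are proved for sigma != 0 and extended
    by continuity. The integral of y^2 comes from (t - y v)' = 1 - v^2 + K y^2 with v = y', up to
    O(k^-2): the energy v^2 + K y^2 stays near 1, so the right side is close to 2 K y^2, while y v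
    vanishes at both ends. A curve is constructed in one chart, but Hamiltonian curves and return
    points are defined through all charts; hence the invariance of each Hamiltonian under chart
    changes. The oscillator sees only y^2, so sigma -> - sigma exchanges S^+ and S^-, and both give
    the same map. For uniformity one large L serves as error constant, as lower bound of k and as
    inverse radius; what holds near each point for all large L then holds with one L on a compact
    set. *)

Definition pd {R : realType} {m} (i : 'I_m) (f : 'rV[R]_m -> R)
  (x : 'rV[R]_m) : R := 'D_(delta_mx 0 i) f x.

Ltac feed := match goal with |- (?P -> ?Q) -> ?G =>
  let h := fresh in (have h : P; [ | move=> /(_ h) {h} ]) end.

Lemma near_forall (T : topologicalType) n (P : 'I_n -> T -> Prop) (x : T) :
  (forall i, \forall y \near x, P i y) -> \forall y \near x, forall i, P i y.
Proof. by move=> h; apply: filter_forall. Qed.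

Section RowVectors.
Context {R : realType}.

Lemma near_normP (V : normedModType R) (x : V) (P : V -> Prop) :
  (\forall y \near x, P y) <->
  (exists2 r, 0 < r & forall y, `|y - x| < r -> P y).
Proof.
rewrite -nbhs_nearE nbhs_ballP; split => -[r /= r0 h]; exists r => // y.
  by move=> yx; apply: h; rewrite -ball_normE /= distrC.
by rewrite -ball_normE /= distrC => yx; apply: h.
Qed.

Lemma cont_near_dist (T : topologicalType) (f : T -> R) (x : T) (e : R) :
  {for x, continuous f} -> 0 < e -> \forall y \near x, `|f y - f x| <= e.
Proof.
move=> cf e0; have /cvgrPdist_le /(_ e e0) : f y @[y --> x] --> f x by exact: cf.
by apply: filterS => y; rewrite distrC.
Qed.

Lemma cont_near_lt (T : topologicalType) (W : normedModType R) (f : T -> W) (x : T) (e : R) :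
  {for x, continuous f} -> 0 < e -> \forall y \near x, `|f y - f x| < e.
Proof.
move=> cf e0; have /cvgrPdist_lt /(_ e e0) : f y @[y --> x] --> f x by exact: cf.
by apply: filterS => y; rewrite distrC.
Qed.

Lemma near_dist_cont (T : topologicalType) (W : normedModType R) (f : T -> W) (x : T) :
  (forall e : R, 0 < e -> \forall y \near x, `|f y - f x| <= e) ->
  {for x, continuous f}.
Proof.
move=> h; apply/cvgrPdist_le => e e0.
by apply: filterS (h e e0) => y; rewrite distrC.
Qed.

Lemma lipschitz_cont (V W : normedModType R) (f : V -> W) (L : R) :
  0 < L -> (forall x y : V, `|f x - f y| <= L * `|x - y|) -> continuous f.
Proof.
move=> L0 h x; apply: near_dist_cont => e e0; apply/near_normP.
exists (e / L) => [|y yx]; first by rewrite divr_gt0.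
by apply: le_trans (h y x) _; rewrite mulrC -ler_pdivlMr // ltW.
Qed.

Lemma coord_le_norm m (v : 'rV[R]_m) i : `|v 0 i| <= `|v|.
Proof.
rewrite [leRHS]/Num.norm /= mx_normrE.
exact: (@le_bigmax_cond _ _ _ 0 (0, i) (fun=> true) (fun ij : 'I_1 * 'I_m => `|v ij.1 ij.2|)).
Qed.

Lemma norm_le_coord m (v : 'rV[R]_m) c : 0 <= c ->
  (forall i, `|v 0 i| <= c) -> `|v| <= c.
Proof.
move=> c0 h; rewrite [leLHS]/Num.norm /= mx_normrE.
by apply/bigmax_leP; split => // -[i j] _ /=; rewrite ord1.
Qed.

Lemma norm_lt_coord m (v : 'rV[R]_m) c : 0 < c ->
  (forall i, `|v 0 i| < c) -> `|v| < c.
Proof.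
move=> c0 h; rewrite [ltLHS]/Num.norm /= mx_normrE.
by apply/bigmax_ltP; split => // -[i j] _ /=; rewrite ord1.
Qed.

Lemma is_derive_ext (V W : normedModType R) (f g : V -> W) x v df dg :
  f =1 g -> df = dg -> is_derive x v f df -> is_derive x v g dg.
Proof. by move=> /funext -> ->. Qed.

Lemma derive_lin_coord m (x v : 'rV[R]_m) i :
  is_derive x v (fun y : 'rV[R]_m => y 0 i) (v 0 i).
Proof.
have lin : linear (fun y : 'rV[R]_m => y 0 i) by move=> a b c; rewrite !mxE.
pose L : {linear 'rV[R]_m -> R} := HB.pack (fun y : 'rV[R]_m => y 0 i)
  (GRing.isLinear.Build _ _ _ _ _ lin).
have cL : continuous L by move=> y; exact: coord_continuous.
have dL : differentiable L x by exact: linear_differentiable.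
apply: DeriveDef; first exact: diff_derivable.
have := deriveE v dL; rewrite (diff_lin x cL); exact.
Qed.

Lemma continuous_row (T : topologicalType) m (f : T -> 'rV[R]_m) t :
  (forall i, {for t, continuous (fun s => f s 0 i)}) -> {for t, continuous f}.
Proof.
move=> h; apply/cvgrPdist_lt => e e0.
have : \forall s \near t, forall i : 'I_m, `|f t 0 i - f s 0 i| < e.
  apply: filter_forall => i.
  by have /cvgrPdist_lt := h i; apply.
apply: filterS => s hs; apply: norm_lt_coord => // i.
by rewrite !mxE; exact: hs.
Qed.

Lemma continuous_sumf (T : topologicalType) n (F : 'I_n -> T -> R) t :
  (forall i, {for t, continuous (F i)}) ->
  {for t, continuous (fun s => \sum_i F i s)}.
Proof.
move=> h; rewrite -fct_sumE; elim/big_ind : _ => //; first exact: cvg_cst.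
by move=> f g cf cg; apply: continuousD.
Qed.

Lemma continuous_coord (T : topologicalType) m (f : T -> 'rV[R]_m) t i :
  {for t, continuous f} -> {for t, continuous (fun s => f s 0 i)}.
Proof.
by move=> h; apply: (@continuous_comp _ _ _ f (fun v : 'rV[R]_m => v 0 i)) => //;
  exact: coord_continuous.
Qed.

Lemma is_derive_near (V : normedModType R) (f g : V -> R) x v d :
  (\forall y \near x, f y = g y) -> is_derive x v f d -> is_derive x v g d.
Proof. exact: near_eq_is_derive. Qed.

Lemma is_derive1_cont (V : normedModType R) (f : R -> V) (x : R) df :
  is_derive x 1 f df -> {for x, continuous f}.
Proof.
move=> [h _]; apply: differentiable_continuous.
by apply/derivable1_diffP.
Qed.

Lemma is_derive_line (V : normedModType R) (f : V -> R) (x v : V) t df :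
  is_derive (x + t *: v) v f df ->
  is_derive t 1 (fun s : R => f (x + s *: v)) df.
Proof.
move=> [d e].
have E : (fun h : R => h^-1 *: (((fun s : R => f (x + s *: v)) \o shift t) (h *: 1%R)
    - f (x + t *: v)))
  = (fun h : R => h^-1 *: ((f \o shift (x + t *: v)) (h *: v) - f (x + t *: v))).
  apply/funext => h /=; congr (_ *: (f _ - _)).
  by rewrite [h *: 1]mulr1 scalerDl addrCA.
by apply: DeriveDef; rewrite /derivable /derive E.
Qed.

Lemma is_derive_line0 (V : normedModType R) (f : V -> R) (x v : V) (df : R) :
  is_derive (0 : R) 1 (fun s : R => f (x + s *: v)) df -> is_derive x v f df.
Proof.
have E : (fun h : R => h^-1 *: (((fun s : R => f (x + s *: v)) \o shift 0) (h *: 1%R)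
    - f (x + 0 *: v)))
  = (fun h : R => h^-1 *: ((f \o shift x) (h *: v) - f x)).
  apply/funext => h /=.
  by rewrite [h *: 1]mulr1 scale0r !addr0 [x + _]addrC.
move=> [d e]; move: d e; rewrite /derivable /derive E => d e.
exact: DeriveDef.
Qed.

Lemma isdD (V : normedModType R) (f g : V -> R) x v df dg :
  is_derive x v f df -> is_derive x v g dg ->
  is_derive x v (fun y => f y + g y) (df + dg).
Proof. exact: is_deriveD. Qed.

Lemma isdN (V : normedModType R) (f : V -> R) x v df :
  is_derive x v f df -> is_derive x v (fun y => - f y) (- df).
Proof. exact: is_deriveN. Qed.

Lemma isdB (V : normedModType R) (f g : V -> R) x v df dg :
  is_derive x v f df -> is_derive x v g dg ->
  is_derive x v (fun y => f y - g y) (df - dg).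
Proof. exact: is_deriveB. Qed.

Lemma isdM (V : normedModType R) (f g : V -> R) x v df dg :
  is_derive x v f df -> is_derive x v g dg ->
  is_derive x v (fun y => f y * g y) (df * g x + f x * dg).
Proof.
move=> hf hg; apply: is_derive_eq (is_deriveM hf hg) _.
by rewrite addrC mulrC.
Qed.

Lemma isd_cst (V : normedModType R) (c : R) (x v : V) :
  is_derive x v (fun=> c) 0.
Proof. exact: is_derive_cst. Qed.

Lemma isdZ (V : normedModType R) (f : V -> R) x v df (c : R) :
  is_derive x v f df -> is_derive x v (fun y => c * f y) (c * df).
Proof.
move=> h; apply: is_derive_eq (isdM (isd_cst c x v) h) _.
by rewrite mul0r add0r.
Qed.

Lemma isd_id (s : R) : is_derive s 1 (fun t : R => t) 1.
Proof. exact: is_derive_id. Qed.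

Lemma isd_affine (a b s : R) : is_derive s 1 (fun t : R => a + t * b) b.
Proof.
apply: is_derive_eq (isdD (isd_cst a s 1) (isdM (isd_id s) (isd_cst b s 1))) _.
by rewrite mulr0 addr0 add0r mul1r.
Qed.

Lemma isd_sum (V : normedModType R) n (f : 'I_n -> V -> R) x v df :
  (forall i, is_derive x v (f i) (df i)) ->
  is_derive x v (fun y => \sum_i f i y) (\sum_i df i).
Proof. by move=> h; rewrite -fct_sumE; exact: is_derive_sum. Qed.

Lemma isd_comp1 (V : normedModType R) (f : V -> R) (g : R -> R) x v df dg :
  is_derive x v f df -> is_derive (f x) 1 g dg ->
  is_derive x v (fun y => g (f y)) (dg * df).
Proof.
move=> hf hg; apply: is_derive_line0.
apply: (@is_derive1_comp _ g (fun s : R => f (x + s *: v))).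
  by rewrite scale0r addr0.
by apply: is_derive_line; rewrite scale0r addr0.
Qed.

Lemma isdV (V : normedModType R) (f : V -> R) x v df : f x != 0 ->
  is_derive x v f df ->
  is_derive x v (fun y => (f y)^-1) (- df * ((f x)^-1 * (f x)^-1)).
Proof.
move=> fx0 [d <-]; apply: DeriveDef; first exact: derivableV.
rewrite (deriveV fx0 d) /GRing.scale /= expr2 invfM; ring.
Qed.

Lemma isd_sqrt (V : normedModType R) (f : V -> R) x v df : 0 < f x ->
  is_derive x v f df ->
  is_derive x v (fun y => Num.sqrt (f y)) (2^-1 * (Num.sqrt (f x))^-1 * df).
Proof.
move=> fx0 h; apply: isd_comp1 => //.
by apply: is_derive_eq (is_derive1_sqrt fx0) _; rewrite invfM.
Qed.

Lemma MVT_bound (f df : R -> R) (a b M : R) : a <= b ->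
  (forall t, a <= t <= b -> is_derive t 1 f (df t)) ->
  (forall t, a <= t <= b -> `|df t| <= M) ->
  `|f b - f a| <= M * (b - a).
Proof.
move=> ab h hM.
have [||c /andP[ac cb] ->] := @MVT_segment R f df a b ab.
- move=> x; rewrite in_itv /= => /andP[ax xb]; apply: h; rewrite !ltW //.
- apply: derivable_within_continuous => x; rewrite in_itv /= => /h [] //.
rewrite normrM [ `|b - a| ]ger0_norm ?subr_ge0 // ler_wpM2r ?subr_ge0 //.
by apply: hM; apply/andP; split.
Qed.

(** Go from x to x + h one coordinate at a time and apply the mean value theorem on each leg to f
    minus its linear part. In the sup norm all corner points stay within |h| of x, so the m legs
    contribute at most e |h| each. *)
Lemma C1_increment m (f : 'rV[R]_m -> R) x r e (a : 'I_m -> R) : 0 <= e ->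
  (forall y, `|y - x| < r -> forall i : 'I_m, derivable f y (delta_mx 0 i) /\
     `|pd i f y - a i| <= e) ->
  forall h, `|h| < r ->
    `|f (x + h) - f x - \sum_i h 0 i * a i| <= m%:R * e * `|h|.
Proof.
move=> e0 H h hr.
(* [P k] is x with its first k coordinates already moved to those of x + h. *)
pose P (k : nat) := \row_i (x 0 i + (if (i < k)%N then h 0 i else 0)).
have main k : (k <= m)%N ->
    `|f (P k) - f x - \sum_(i < m | (i < k)%N) h 0 i * a i| <= k%:R * e * `|h|.
  elim: k => [_|k IH km].
    rewrite big1 => [|i]; last by rewrite ltn0.
    have -> : P 0%N = x by apply/rowP => i; rewrite !mxE ltn0 addr0.
    by rewrite subrr subr0 normr0 !mul0r.
  pose K := Ordinal km.
  rewrite (bigD1 K) /=; last exact: ltnSn.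
  rewrite (eq_bigl (fun i : 'I_m => (i < k)%N)); last first.
    move=> i /=; rewrite ltnS leq_eqVlt -(inj_eq val_inj) /=.
    by case: ltngtP.
  have PS : P k.+1 = P k + h 0 K *: delta_mx 0 K.
    apply/rowP => i; rewrite !mxE eqxx /= -addrA; congr (_ + _).
    rewrite ltnS leq_eqVlt -(inj_eq val_inj) /=.
    by case: ltngtP => ik; rewrite ?mulr0 ?mulr1 ?addr0 ?add0r //;
      congr (h 0 _); exact: val_inj.
  pose g s := f (P k + (s * h 0 K) *: delta_mx 0 K) - s * (h 0 K * a K).
  pose dg s := pd K f (P k + (s * h 0 K) *: delta_mx 0 K) * h 0 K - h 0 K * a K.
  have near01 (s : R) : 0 <= s <= 1 -> `|P k + (s * h 0 K) *: delta_mx 0 K - x| < r.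
    move=> /andP[s0 s1]; apply: le_lt_trans hr; apply: norm_le_coord => // i.
    rewrite !mxE eqxx /= -(inj_eq val_inj) /= addrAC [x 0 i + _]addrC addrK.
    have hi : `|h 0 i| <= `|h| by exact: coord_le_norm.
    case: ltngtP => ik; rewrite ?mulr0 ?mulr1 ?addr0 ?add0r ?normr0 //.
    rewrite normrM ger0_norm //; apply: le_trans (coord_le_norm _ K).
    by rewrite ler_piMl.
  have dgP (s : R) : 0 <= s <= 1 -> is_derive s 1 g (dg s).
    move=> s01; rewrite /g /dg.
    apply: is_deriveB; last first.
      apply: is_derive_ext (is_deriveM (is_derive_id s 1) (is_derive_cst (h 0 K * a K) s 1)) => //.
      by rewrite /= scaler0 add0r [_ *: _]mulr1.
    apply: (is_derive1_comp (f := fun s => f (P k + s *: delta_mx 0 K)) (g := fun s => s * h 0 K)).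
      apply: is_derive_line; apply: derivableP.
      by have [] := H _ (near01 s s01) K.
    apply: is_derive_ext (is_deriveM (is_derive_id s 1) (is_derive_cst (h 0 K) s 1)) => //.
    by rewrite /= scaler0 add0r [_ *: _]mulr1.
  have := @MVT_bound g dg 0 1 (e * `|h|) ler01 dgP.
  feed; last first.
    rewrite /g !mul1r !mul0r scale0r addr0 subr0 -PS subr0 mulr1 => B.
    have -> : f (P k.+1) - f x - (h 0 K * a K + \sum_(i < m | (i < k)%N) h 0 i * a i)
      = (f (P k) - f x - \sum_(i < m | (i < k)%N) h 0 i * a i)
        + (f (P k.+1) - h 0 K * a K - f (P k)) by ring.
    apply: le_trans (ler_normD _ _) _.
    rewrite -natr1 mulrDl mul1r mulrDl lerD //.
    by apply: IH; exact: ltnW.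
  move=> t t01; rewrite /dg [h 0 K * _]mulrC -mulrBl normrM.
  apply: ler_pM => //; last exact: coord_le_norm.
  by have [] := H _ (near01 t t01) K.
have := main m (leqnn m).
have -> : P m = x + h by apply/rowP => i; rewrite !mxE ltn_ord.
by under eq_bigl => i do rewrite ltn_ord.
Qed.

(** [C1_increment] with the slopes at x bounds the error of the linear map built from the partial
    derivatives; continuity of these makes the slope error e as small as desired. *)
Lemma C1_differentiable m (f : 'rV[R]_m -> R) x :
  (forall i : 'I_m, \forall y \near x, derivable f y (delta_mx 0 i)) ->
  (forall i : 'I_m, {for x, continuous (fun y => pd i f y)}) ->
  differentiable f x /\
  forall v, 'd f x v = \sum_i v 0 i * pd i f x.
Proof.
move=> H1 H2.
have lin : linear (fun v : 'rV[R]_m => \sum_i v 0 i * pd i f x).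
  move=> c u v; rewrite scaler_sumr -big_split /=; apply: eq_bigr => i _.
  by rewrite !mxE mulrDl scalerAl.
pose L : {linear 'rV[R]_m -> R} := HB.pack (fun v : 'rV[R]_m => \sum_i v 0 i * pd i f x)
  (GRing.isLinear.Build _ _ _ _ _ lin).
have cL : continuous L.
  move=> y; apply: continuous_sumf => i.
  apply: (@continuousM _ _ (fun s : 'rV[R]_m => s 0 i) (cst (pd i f x))).
    exact: coord_continuous.
  exact: cst_continuous.
have E : f \o shift x = cst (f x) + L +o_ (0 : 'rV[R]_m) id.
  apply/eqaddoP => e e0.
  have m0 : 0 < m%:R + 1 :> R by rewrite ltr_wpDl.
  (* The sum over m legs multiplies the slope error by m; the extra 1 keeps the divisor positive for
     m = 0. *)
  pose e' := e / (m%:R + 1).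
  have e'0 : 0 < e' by rewrite divr_gt0.
  have : \forall y \near x, forall i : 'I_m, derivable f y (delta_mx 0 i) /\
     `|pd i f y - pd i f x| <= e'.
    apply: near_forall => i.
    have /cvgrPdist_le /(_ _ e'0) h2 := H2 i.
    by apply: filterS2 (H1 i) h2 => y dy; rewrite distrC.
  move=> /near_normP[r r0 Hr].
  apply/(@near_normP _ (0 : 'rV[R]_m)); exists r => // h.
  rewrite subr0 => hr.
  have := @C1_increment m f x r e' (fun i => pd i f x) (ltW e'0) _ h hr.
  feed; first by move=> y yx; apply: Hr.
  rewrite [x + h]addrC /= => B.
  rewrite [X in `|X|](_ : _ = f (h + x) - f x - \sum_i h 0 i * pd i f x); last first.
    by rewrite -addrA -opprD.
  apply: le_trans B _; apply: ler_wpM2r => //.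
  rewrite /e' mulrCA ler_piMr //; first exact: ltW.
  by rewrite ler_pdivrMr // mul1r lerDl.
have dE := diff_unique cL E.
split; last by move=> v; rewrite dE.
by apply/diff_locallyP; rewrite dE.
Qed.

Lemma is_derive_curve m (f : 'rV[R]_m -> R) (y : R -> 'rV[R]_m) t (dy : 'rV[R]_m) :
  differentiable f (y t) ->
  (forall i, is_derive t 1 (fun s => y s 0 i) (dy 0 i)) ->
  is_derive t 1 (fun s => f (y s)) ('d f (y t) dy).
Proof.
move=> df h.
have dery : derivable y t 1.
  by apply/derivable_mxP => i j; rewrite ord1; have [] := h j.
have dify : differentiable y t by apply/derivable1_diffP.
have Ey : 'd y t 1 = dy.
  rewrite -deriveE // derive_mx //; apply/rowP => i; rewrite !mxE.
  by have [_] := h i.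
apply: DeriveDef.
  by apply/diff_derivable/(differentiable_comp dify df).
rewrite deriveE; last exact: (differentiable_comp dify df).
by rewrite (diff_comp dify df) /= Ey.
Qed.

End RowVectors.

(** * Functions of class C^k on an open set *)

Section CkCalculus.
Context {R : realType}.

Lemma near_cont (T T' : topologicalType) (f g : T -> T') x :
  (\forall y \near x, f y = g y) -> {for x, continuous f} ->
  {for x, continuous g}.
Proof.
move=> fg cf; have E : f x = g x by exact: (nbhs_singleton fg).
have : f y @[y --> x] --> f x by exact: cf.
by rewrite E; apply: cvg_trans; apply: near_eq_cvg.
Qed.

Section OneDim.
Context {m : nat}.
Implicit Types (U V : set 'rV[R]_m) (f g : 'rV[R]_m -> R).

Lemma Ck_cont k U f x : Ck k U f -> U x -> {for x, continuous f}.
Proof. by case: k => [|k] [h _]; exact: h. Qed.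

Lemma Ck_sub k U V f : V `<=` U -> Ck k U f -> Ck k V f.
Proof.
move=> VU; elim: k f => [|k IH] f [h1 h2]; split => //.
- by move=> x /VU; exact: h1.
- by move=> x /VU; exact: h1.
- move=> i; have [h3 h4] := h2 i; split; last exact: IH.
  by move=> x /VU; exact: h3.
Qed.

(** On an open set equality of values is equality of germs, hence of all partial derivatives. *)
Lemma Ck_ext k U f g : open U -> (forall x, U x -> f x = g x) ->
  Ck k U f -> Ck k U g.
Proof.
move=> oU; elim: k f g => [|k IH] f g fg [h1 h2].
  split => // x Ux; apply: near_cont (h1 x Ux).
  by apply: filterS (open_nbhs_nbhs (conj oU Ux)) => y /fg.
have nfg x : U x -> \forall y \near x, f y = g y.
  by move=> Ux; apply: filterS (open_nbhs_nbhs (conj oU Ux)) => y /fg.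
split.
  by move=> x Ux; apply: near_cont (h1 x Ux); exact: nfg.
move=> i; have [h3 h4] := h2 i; split.
  by move=> x Ux; apply: near_eq_derivable (h3 x Ux); exact: nfg.
apply: IH h4 => x Ux; apply: near_eq_derive; exact: nfg.
Qed.

Lemma Ck_pred k U f : Ck k.+1 U f -> Ck k U f.
Proof.
elim: k f => [|k IH] f [h1 h2]; split => //.
by move=> i; have [h3 h4] := h2 i; split => //; exact: IH.
Qed.

Lemma Ck_derivable k U f x (i : 'I_m) : Ck k.+1 U f -> U x -> derivable f x (delta_mx 0 i).
Proof. by move=> [_ /(_ i)[h _]]; exact: h. Qed.

Lemma Ck_D k U f (i : 'I_m) : Ck k.+1 U f -> Ck k U (fun x => pd i f x).
Proof. by move=> [_ /(_ i)[_ h]]. Qed.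

Lemma Ck_diff k U f x : open U -> Ck k.+1 U f -> U x ->
  differentiable f x /\ forall v, 'd f x v = \sum_i v 0 i * pd i f x.
Proof.
move=> oU h Ux; apply: C1_differentiable => i.
  by apply: filterS (open_nbhs_nbhs (conj oU Ux)) => y Uy; exact: (@Ck_derivable k U f y i h Uy).
exact: (Ck_cont (Ck_D i h)).
Qed.

Lemma Ck_is_derive k U f x (i : 'I_m) : Ck k.+1 U f -> U x ->
  is_derive x (delta_mx 0 i : 'rV[R]_m) f (pd i f x).
Proof. by move=> h Ux; apply: derivableP; exact: (@Ck_derivable k U f x i h Ux). Qed.

Lemma Ck_cst k U (c : R) : Ck k U (fun=> c).
Proof.
elim: k c => [|k IH] c; split => //; try by move=> x _; exact: cst_continuous.
move=> i; split; first by move=> x _; exact: derivable_cst.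
have -> : (fun x : 'rV[R]_m => 'D_(delta_mx 0 i) (fun=> c) x) = fun=> 0 :> R.
  by apply/funext => x; exact: derive_cst.
exact: IH.
Qed.

Lemma Ck_coord k U (j : 'I_m) : Ck k U (fun x => x 0 j).
Proof.
case: k => [|k]; split => //; try by move=> x _; exact: coord_continuous.
move=> i; split.
  by move=> x _; have [] := derive_lin_coord x (delta_mx 0 i) j.
have -> : (fun x => pd i (fun x : 'rV[R]_m => x 0 j) x) = fun=> (delta_mx 0 i : 'rV[R]_m) 0 j.
  by apply/funext => x; have [_] := derive_lin_coord x (delta_mx 0 i) j.
exact: Ck_cst.
Qed.

Lemma Ck_add k U f g : open U -> Ck k U f -> Ck k U g ->
  Ck k U (fun x => f x + g x).
Proof.
move=> oU; elim: k f g => [|k IH] f g hf hg; split => //;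
  try by move=> x Ux; apply: continuousD; [exact: (Ck_cont hf)|exact: (Ck_cont hg)].
move=> i; split.
  by move=> x Ux; have [] := isdD (Ck_is_derive i hf Ux) (Ck_is_derive i hg Ux).
apply: (Ck_ext (f := fun x => pd i f x + pd i g x)) => //.
  by move=> x Ux; have [_] := isdD (Ck_is_derive i hf Ux) (Ck_is_derive i hg Ux).
by apply: IH; exact: Ck_D.
Qed.

Lemma Ck_mul k U f g : open U -> Ck k U f -> Ck k U g ->
  Ck k U (fun x => f x * g x).
Proof.
move=> oU; elim: k f g => [|k IH] f g hf hg; split => //;
  try by move=> x Ux; apply: continuousM; [exact: (Ck_cont hf)|exact: (Ck_cont hg)].
move=> i; split.
  by move=> x Ux; have [] := isdM (Ck_is_derive i hf Ux) (Ck_is_derive i hg Ux).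
apply: (Ck_ext (f := fun x => pd i f x * g x + f x * pd i g x)) => //.
  by move=> x Ux; have [_] := isdM (Ck_is_derive i hf Ux) (Ck_is_derive i hg Ux).
by apply: Ck_add => //; apply: IH; try exact: Ck_D; exact: Ck_pred.
Qed.

Lemma Ck_sum k U n (F : 'I_n -> 'rV[R]_m -> R) : open U ->
  (forall i, Ck k U (F i)) -> Ck k U (fun x => \sum_i F i x).
Proof.
move=> oU h; rewrite -fct_sumE; elim/big_ind : _ => //; first exact: Ck_cst.
by move=> f g; exact: Ck_add.
Qed.

Lemma Ck_opp k U f : open U -> Ck k U f -> Ck k U (fun x => - f x).
Proof.
move=> oU h; have := Ck_mul oU (Ck_cst k U (-1)) h.
by apply: Ck_ext => // x _; rewrite mulN1r.
Qed.

(** Induction on k: the derivative of 1 / f is - f' / f^2, a product of f', of class C^k, and of two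
    copies of 1 / f, of class C^k by induction. The square root below works the same way. *)
Lemma Ck_inv k U f : open U -> (forall x, U x -> f x != 0) -> Ck k U f ->
  Ck k U (fun x => (f x)^-1).
Proof.
move=> oU f0; elim: k => [|k IH] hf; split => //;
  try by move=> x Ux; apply: continuousV; [exact: f0|exact: (Ck_cont hf)].
move=> i; split.
  by move=> x Ux; have [] := isdV (f0 x Ux) (Ck_is_derive i hf Ux).
apply: (Ck_ext (f := fun x => - pd i f x * ((f x)^-1 * (f x)^-1))) => //.
  by move=> x Ux; have [_] := isdV (f0 x Ux) (Ck_is_derive i hf Ux).
apply: Ck_mul => //; first by apply: Ck_opp => //; exact: Ck_D.
by apply: Ck_mul => //; apply: IH; exact: Ck_pred.
Qed.

Lemma Ck_sqrt k U f : open U -> (forall x, U x -> 0 < f x) -> Ck k U f ->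
  Ck k U (fun x => Num.sqrt (f x)).
Proof.
move=> oU f0; elim: k => [|k IH] hf; split => //;
  try by move=> x Ux; apply: (@continuous_comp _ _ _ f Num.sqrt);
   [exact: (Ck_cont hf)|exact: sqrt_continuous].
move=> i; split.
  by move=> x Ux; have [] := isd_sqrt (f0 x Ux) (Ck_is_derive i hf Ux).
apply: (Ck_ext (f := fun x => 2^-1 * (Num.sqrt (f x))^-1 * pd i f x)) => //.
  by move=> x Ux; have [_] := isd_sqrt (f0 x Ux) (Ck_is_derive i hf Ux).
apply: Ck_mul => //; last exact: Ck_D.
apply: Ck_mul => //; first exact: Ck_cst.
apply: Ck_inv => //; last by apply: IH; exact: Ck_pred.
by move=> x /f0 fx; rewrite gt_eqF // sqrtr_gt0.
Qed.

End OneDim.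

Lemma is_derive_comp_rV (V : normedModType R) m (f : 'rV[R]_m -> R)
    (y : V -> 'rV[R]_m) (x v : V) (dy : 'rV[R]_m) :
  differentiable f (y x) ->
  (forall i, is_derive x v (fun z => y z 0 i) (dy 0 i)) ->
  is_derive x v (fun z => f (y z)) ('d f (y x) dy).
Proof.
move=> df h; apply: is_derive_line0.
have <- : 'd f (y (x + 0 *: v)) dy = 'd f (y x) dy by rewrite scale0r addr0.
apply: (@is_derive_curve _ _ f (fun s : R => y (x + s *: v))).
  by rewrite scale0r addr0.
move=> i; apply: (@is_derive_line _ _ (fun z => y z 0 i)).
by rewrite scale0r addr0.
Qed.

(** Induction on k with f general, because the chain rule feeds the partial derivatives of f back
    into the induction hypothesis. *)
Lemma Ck_comp m l k (U : set 'rV[R]_m) (W : set 'rV[R]_l) (f : 'rV[R]_l -> R)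
    (y : 'rV[R]_m -> 'rV[R]_l) : open U -> open W ->
  (forall x, U x -> W (y x)) -> (forall i, Ck k U (fun x => y x 0 i)) ->
  Ck k W f -> Ck k U (fun x => f (y x)).
Proof.
move=> oU oW UW; elim: k f => [|k IH] f hy hf.
  split => // x Ux; apply: (@continuous_comp _ _ _ y f).
    by apply: continuous_row => i; exact: (Ck_cont (hy i)).
  by apply: (Ck_cont hf); exact: UW.
split.
  move=> x Ux; apply: (@continuous_comp _ _ _ y f).
    by apply: continuous_row => i; exact: (Ck_cont (hy i)).
  by apply: (Ck_cont hf); exact: UW.
move=> i.
have main x : U x -> is_derive x (delta_mx 0 i : 'rV[R]_m) (fun z => f (y z))
    (\sum_j pd i (fun z => y z 0 j) x * pd j f (y x)).
  move=> Ux; have [d e] := Ck_diff oW hf (UW x Ux).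
  have := @is_derive_comp_rV _ _ f y x (delta_mx 0 i)
    (\row_j pd i (fun z => y z 0 j) x) d.
  rewrite e; under eq_bigr => j _ do rewrite mxE; apply => j.
  by rewrite mxE; exact: (Ck_is_derive _ (hy j)).
split; first by move=> x /main [].
apply: (Ck_ext (f := fun x => \sum_j pd i (fun z => y z 0 j) x * pd j f (y x))) => //.
  by move=> x /main [].
apply: Ck_sum => // j; apply: Ck_mul => //; first exact: Ck_D.
apply: (IH (fun z => pd j f z)); last exact: Ck_D.
by move=> i'; exact: Ck_pred.
Qed.

End CkCalculus.

Lemma pdE {R : realType} m (i : 'I_m) (f : 'rV[R]_m -> R) x :
  pd i f x = 'D_(delta_mx 0 i) f x.
Proof. by []. Qed.

Opaque pd.

(** * Germs of smooth functions *)

Section Germs.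
Context {R : realType}.

(** One neighbourhood serves all orders k. Smoothness at x is thus an open condition ([sm_near]) and
    depends only on the germ ([sm_ext]). *)
Definition sm m (f : 'rV[R]_m -> R) (x : 'rV[R]_m) : Prop :=
  exists U, [/\ open U, U x & forall k, Ck k U f].

Definition smv m l (f : 'rV[R]_m -> 'rV[R]_l) (x : 'rV[R]_m) : Prop :=
  forall j, sm (fun u => f u 0 j) x.

Lemma open_near (T : topologicalType) (U : set T) x : open U -> U x -> \forall y \near x, U y.
Proof. by move=> oU Ux; exact: (open_nbhs_nbhs (conj oU Ux)). Qed.

Lemma near_all (T : topologicalType) (P : T -> Prop) (x : T) :
  (forall y, P y) -> \forall y \near x, P y.
Proof. by move=> h; apply: nearW. Qed.

Lemma near_imp (T : topologicalType) (P Q : T -> Prop) (x : T) :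
  (forall y, P y -> Q y) -> (\forall y \near x, P y) -> \forall y \near x, Q y.
Proof. by move=> h; apply: filterS. Qed.

Lemma near_and (T : topologicalType) (P Q : T -> Prop) (x : T) :
  (\forall y \near x, P y) -> (\forall y \near x, Q y) ->
  \forall y \near x, P y /\ Q y.
Proof. by apply: filterS2 => y; split. Qed.

Lemma near_cont_comp (T T' : topologicalType) (f : T -> T') (P : T' -> Prop) x :
  {for x, continuous f} -> (\forall y \near f x, P y) -> \forall z \near x, P (f z).
Proof. by move=> h; apply: h. Qed.

Lemma pd_near m (f g : 'rV[R]_m -> R) (x : 'rV[R]_m) (i : 'I_m) :
  (\forall y \near x, f y = g y) -> pd i f x = pd i g x.
Proof. by move=> h; rewrite !pdE; exact: near_eq_derive. Qed.

Section Scalar.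
Context {m : nat}.
Implicit Types (f g : 'rV[R]_m -> R) (x : 'rV[R]_m).

Lemma sm_near f x : sm f x -> \forall y \near x, sm f y.
Proof.
by move=> [U [oU Ux h]]; apply: filterS (open_near oU Ux) => y Uy; exists U.
Qed.

Lemma sm_ext f g x : (\forall y \near x, f y = g y) -> sm f x -> sm g x.
Proof.
move=> /near_normP[r r0 fg] [U [oU Ux h]].
exists (U `&` ball x r); split.
- by apply: openI => //; exact: ball_open.
- by split => //; exact: ballxx.
- move=> k; apply: (Ck_ext (f := f)).
  + by apply: openI => //; exact: ball_open.
  + by move=> y [_]; rewrite -ball_normE /= distrC => /fg.
  + by apply: Ck_sub (h k) => y [].
Qed.

Lemma sm_cst c x : sm (fun=> c) x.
Proof. by exists setT; split => // [|k]; [exact: openT|exact: Ck_cst]. Qed.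

Lemma sm_coord (j : 'I_m) x : sm (fun u => u 0 j) x.
Proof. by exists setT; split => // [|k]; [exact: openT|exact: Ck_coord]. Qed.

Lemma sm_op2 (op : R -> R -> R) f g x :
  (forall k (U : set 'rV[R]_m) f g, open U -> Ck k U f -> Ck k U g ->
    Ck k U (fun u => op (f u) (g u))) ->
  sm f x -> sm g x -> sm (fun u => op (f u) (g u)) x.
Proof.
move=> hop [U [oU Ux hU]] [V [oV Vx hV]]; exists (U `&` V); split => //.
  exact: openI.
move=> k; apply: hop; first exact: openI.
  by apply: Ck_sub (hU k) => y [].
by apply: Ck_sub (hV k) => y [].
Qed.

Lemma sm_add f g x : sm f x -> sm g x -> sm (fun u => f u + g u) x.
Proof. by apply: sm_op2 => *; exact: Ck_add. Qed.

Lemma sm_mul f g x : sm f x -> sm g x -> sm (fun u => f u * g u) x.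
Proof. by apply: sm_op2 => *; exact: Ck_mul. Qed.

Lemma sm_opp f x : sm f x -> sm (fun u => - f u) x.
Proof. by move=> [U [oU Ux h]]; exists U; split => // k; exact: Ck_opp. Qed.

Lemma sm_sum (I : Type) (r : seq I) (P : pred I) (F : I -> 'rV[R]_m -> R) x :
  (forall i, P i -> sm (F i) x) -> sm (fun u => \sum_(i <- r | P i) F i u) x.
Proof.
move=> h; rewrite -fct_sumE; elim/big_ind : _ => //; first exact: sm_cst.
by move=> f g; exact: sm_add.
Qed.

Lemma sm_prod (I : Type) (r : seq I) (P : pred I) (F : I -> 'rV[R]_m -> R) x :
  (forall i, P i -> sm (F i) x) -> sm (fun u => \prod_(i <- r | P i) F i u) x.
Proof.
move=> h; elim: r => [|i r IH].
  by apply: sm_ext (sm_cst 1 x); apply: near_all => y; rewrite big_nil.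
apply: (sm_ext (f := fun u => (if P i then F i u else 1) * \prod_(i <- r | P i) F i u)).
  by apply: near_all => y; rewrite big_cons; case: ifP => //; rewrite mul1r.
apply: sm_mul => //; case: (boolP (P i)) => Pi; [exact: h|exact: sm_cst].
Qed.

Lemma sm_cont f x : sm f x -> {for x, continuous f}.
Proof. by move=> [U [oU Ux h]]; exact: (Ck_cont (h 0%N)). Qed.

Lemma sm_inv f x : f x != 0 -> sm f x -> sm (fun u => (f u)^-1) x.
Proof.
move=> fx0 hf; have [U [oU Ux h]] := hf.
have [r r0 hr] : exists2 r : R, 0 < r & forall y : 'rV[R]_m, `|y - x| < r -> f y != 0.
  apply/near_normP; have /cvgr_neq0 := sm_cont hf; exact.
exists (U `&` ball x r); have oI : open (U `&` ball x r).
  by apply: openI => //; exact: ball_open.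
split => //; first by split => //; exact: ballxx.
move=> k; apply: Ck_inv => //; last by apply: Ck_sub (h k) => y [].
by move=> y [_]; rewrite -ball_normE /= distrC; exact: hr.
Qed.

Lemma sm_sqrt f x : 0 < f x -> sm f x -> sm (fun u => Num.sqrt (f u)) x.
Proof.
move=> fx0 hf; have [U [oU Ux h]] := hf.
have [r r0 hr] : exists2 r : R, 0 < r & forall y : 'rV[R]_m, `|y - x| < r -> 0 < f y.
  apply/near_normP; have /cvgr_gt := sm_cont hf; exact.
exists (U `&` ball x r); have oI : open (U `&` ball x r).
  by apply: openI => //; exact: ball_open.
split => //; first by split => //; exact: ballxx.
move=> k; apply: Ck_sqrt => //; last by apply: Ck_sub (h k) => y [].
by move=> y [_]; rewrite -ball_normE /= distrC; exact: hr.
Qed.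

Lemma sm_pd f x (i : 'I_m) : sm f x -> sm (fun u => pd i f u) x.
Proof. by move=> [U [oU Ux h]]; exists U; split => // k; exact: Ck_D. Qed.

Lemma sm_derive f x (i : 'I_m) : sm f x ->
  is_derive x (delta_mx 0 i : 'rV[R]_m) f (pd i f x).
Proof. by move=> [U [oU Ux h]]; exact: (Ck_is_derive i (h 1%N)). Qed.

Lemma sm_diff f x : sm f x ->
  differentiable f x /\ forall v, 'd f x v = \sum_i v 0 i * pd i f x.
Proof. by move=> [U [oU Ux h]]; exact: (Ck_diff oU (h 1%N)). Qed.

Lemma sm_comp_derive (V : normedModType R) f (y : V -> 'rV[R]_m) (z v : V)
    (dy : 'rV[R]_m) : sm f (y z) ->
  (forall i, is_derive z v (fun s => y s 0 i) (dy 0 i)) ->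
  is_derive z v (fun s => f (y s)) (\sum_i dy 0 i * pd i f (y z)).
Proof.
by move=> /sm_diff[d e] h; rewrite -e; exact: is_derive_comp_rV.
Qed.

Lemma sm_local_lipschitz f x : sm f x -> exists2 r : R, 0 < r &
  exists2 L : R, 0 <= L & forall y z : 'rV[R]_m, `|y - x| < r -> `|z - x| < r ->
    `|f y - f z| <= L * `|y - z|.
Proof.
move=> hf; have : \forall y \near x, sm f y /\ forall i : 'I_m, `|pd i f y| <= `|pd i f x| + 1.
  apply: near_and; first exact: sm_near.
  apply: near_forall => i.
  apply: near_imp (cont_near_dist (sm_cont (sm_pd i hf)) ltr01) => y hy.
  by rewrite -lerBlDl; apply: le_trans (lerB_dist _ _) _.
move=> /near_normP[r r0 hr]; exists r => //.
pose B : R := \sum_i (`|pd i f x| + 1).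
have B0 : 0 <= B by apply: sumr_ge0 => i _; rewrite addr_ge0.
exists B => // y z yr zr.
pose l (s : R) : 'rV[R]_m := z + s *: (y - z).
have lr (s : R) : 0 <= s <= 1 -> `|l s - x| < r.
  move=> /andP[s0 s1].
  have -> : l s - x = s *: (y - x) + (1 - s) *: (z - x).
    by apply/rowP => i; rewrite !mxE; ring.
  apply: le_lt_trans (ler_normD _ _) _.
  rewrite !normrZ (ger0_norm s0) ger0_norm ?subr_ge0 //.
  have [->|sn0] := eqVneq s 0; first by rewrite mul0r add0r subr0 mul1r.
  have sp : 0 < s by rewrite lt_neqAle eq_sym sn0.
  apply: (@lt_le_trans _ _ (s * r + (1 - s) * r)); last by rewrite -mulrDl subrKC mul1r.
  by apply: ltr_leD; rewrite ?ltr_pM2l // ler_wpM2l ?subr_ge0 // ltW.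
have dl (s : R) : 0 <= s <= 1 -> is_derive s (1 : R) (fun s : R => f (l s)) (\sum_i (y - z) 0 i * pd i f (l s) : R).
  move=> /lr /hr h.
  apply: (@sm_comp_derive _ f l s (1:R) (y - z)); first by have [] := h.
  move=> i; apply: is_derive_ext (isd_affine (z 0 i) ((y - z) 0 i) s) => // u.
  by rewrite !mxE.
have := MVT_bound (M := B * `|y - z|) ler01 dl.
feed.
  move=> t /lr /hr h; apply: le_trans (ler_norm_sum _ _ _) _.
  rewrite /B mulr_suml; apply: ler_sum => i _; rewrite normrM mulrC.
  by apply: ler_pM => //; [have [_] := h; exact|exact: coord_le_norm].
by rewrite /l scale0r addr0 scale1r subrKC subr0 mulr1.
Qed.

(** The second difference over a square of side h equals h^2 times the mixed derivative up to e h^2: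
    the mean value theorem in the direction i reduces it to an increment of the i-th derivative, and
    the mean value theorem in the direction j estimates that increment. *)
Lemma schwarz_incr f x (i j : 'I_m) (e : R) : sm f x -> 0 < e ->
  exists2 r : R, 0 < r & forall h : R, 0 < h < r ->
  `|f (x + h *: delta_mx 0 i + h *: delta_mx 0 j) - f (x + h *: delta_mx 0 i)
    - f (x + h *: delta_mx 0 j) + f x
    - h * h * pd j (fun u => pd i f u) x| <= e * h * h.
Proof.
move=> hf e0; set D : R := pd j _ x.
have : \forall y \near x, sm f y /\ `|pd j (fun u => pd i f u) y - D| <= e.
  apply: near_and; first exact: sm_near.
  exact: cont_near_dist (sm_cont (sm_pd j (sm_pd i hf))) e0.
move=> /near_normP[r r0 hr]; exists (r / 2); first by rewrite divr_gt0.
move=> h /andP[h0 hh].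
have inb (s t : R) : 0 <= s <= h -> 0 <= t <= h ->
    `|x + s *: delta_mx 0 i + t *: delta_mx 0 j - x| < r.
  move=> /andP[s0 sh] /andP[t0 th]; 
  rewrite [X in `|X|](_ : _ = s *: delta_mx 0 i + t *: delta_mx 0 j); last first.
    by apply/rowP => k; rewrite !mxE; ring.
  apply: le_lt_trans (ler_normD _ _) _; rewrite !normrZ (ger0_norm s0) (ger0_norm t0).
  have e1 (k : 'I_m) : `|delta_mx 0 k : 'rV[R]_m| <= 1.
    by apply: norm_le_coord => // l; rewrite mxE eqxx /=; case: (_ == _); rewrite ?normr1 ?normr0.
  have a1 := ler_wpM2l s0 (e1 i); have a2 := ler_wpM2l t0 (e1 j).
  by lra.
pose phi s := f (x + s *: delta_mx 0 i + h *: delta_mx 0 j) - f (x + s *: delta_mx 0 i) - s * (h * D).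
pose dphi s := pd i f (x + s *: delta_mx 0 i + h *: delta_mx 0 j) - pd i f (x + s *: delta_mx 0 i) - h * D.
have hh0 : 0 <= h <= h by rewrite ltW /=.
have z0 : 0 <= (0 : R) <= h by rewrite lexx ltW.
have add0 (s : R) : x + s *: delta_mx 0 i = x + s *: delta_mx 0 i + 0 *: delta_mx 0 j.
  by rewrite scale0r addr0.
have dphiP (s : R) : 0 <= s <= h -> is_derive s 1 phi (dphi s).
  move=> sh; apply: isdB; first apply: isdB.
  - apply: (is_derive_ext (f := fun s : R => f ((x + h *: delta_mx 0 j) + s *: delta_mx 0 i))) _ _ => //.
      by move=> u; rewrite addrAC.
    apply: is_derive_line; rewrite addrAC.
    by apply: sm_derive; have [] := hr _ (inb s h sh hh0).
  - apply: is_derive_line; apply: sm_derive; rewrite add0.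
    by have [] := hr _ (inb s 0 sh z0).
  - apply: is_derive_eq (isdM (is_derive_id s 1) (isd_cst (h * D) s 1)) _.
    by rewrite mulr0 addr0 mul1r.
have psi (s : R) : 0 <= s <= h -> `|dphi s| <= e * h.
  move=> sh.
  pose psi t := pd i f (x + s *: delta_mx 0 i + t *: delta_mx 0 j) - t * D.
  have dpsi (t : R) : 0 <= t <= h -> is_derive t 1 psi (pd j (fun u => pd i f u) (x + s *: delta_mx 0 i + t *: delta_mx 0 j) - D).
    move=> th; apply: isdB.
    - apply: (is_derive_line (f := fun u => pd i f u)); apply: sm_derive.
      by apply: sm_pd; have [] := hr _ (inb s t sh th).
    - apply: is_derive_eq (isdM (is_derive_id t 1) (isd_cst D t 1)) _.
      by rewrite mulr0 addr0 mul1r.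
  have := MVT_bound (M := e) (ltW h0) dpsi; feed.
    by move=> t th; have [] := hr _ (inb s t sh th).
  rewrite /psi scale0r addr0 mul0r !subr0 /dphi => hb.
  by apply: le_trans hb; rewrite le_eqVlt; apply/orP; left; apply/eqP; congr (`|_|); ring.
have := MVT_bound (ltW h0) dphiP psi.
rewrite /phi scale0r !addr0 mul0r !subr0 => hb.
by apply: le_trans hb; rewrite le_eqVlt; apply/orP; left; apply/eqP; congr (`|_|); ring.
Qed.

(** The second difference is symmetric in i and j, so after division by h^2 the two mixed
    derivatives are within e / 2 of the same number, for every e > 0. *)
Lemma sm_schwarz f x (i j : 'I_m) : sm f x ->
  pd j (fun u => pd i f u) x = pd i (fun u => pd j f u) x.
Proof.
move=> hf; apply/eqP; rewrite -subr_eq0 -normr_le0; apply/ler_addgt0Pr => /= e e0.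
have e20 : 0 < e / 2 by rewrite divr_gt0.
have [r1 r10 h1] := schwarz_incr i j hf e20.
have [r2 r20 h2] := schwarz_incr j i hf e20.
pose h : R := Num.min r1 r2 / 2.
have h0 : 0 < h by rewrite divr_gt0 // lt_min r10.
have hr1 : 0 < h < r1.
  rewrite h0 /= /h; apply: (@lt_le_trans _ _ (Num.min r1 r2)); last by rewrite ge_min lexx.
  by rewrite ltr_pdivrMr // ltr_pMr ?lt_min ?r10 // ltr1n.
have hr2 : 0 < h < r2.
  rewrite h0 /= /h; apply: (@lt_le_trans _ _ (Num.min r1 r2)); last by rewrite ge_min lexx orbT.
  by rewrite ltr_pdivrMr // ltr_pMr ?lt_min ?r10 // ltr1n.
have := h1 h hr1; have := h2 h hr2.
rewrite [x + h *: delta_mx 0 j + _]addrAC.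
set A : R := pd j _ x; set B : R := pd i _ x.
set a : R := f _; set b : R := f _; set c : R := f _; set d : R := f _.
move: A B a b c d => A B a b c d.
move=> H1 H2.
have H : `|h * h * (A - B)| <= e * (h * h).
  have -> : h * h * (A - B) = (a - b - c + d - h * h * B) - (a - c - b + d - h * h * A) by ring.
  apply: le_trans (ler_normB _ _) _.
  have -> : e * (h * h) = e / 2 * h * h + e / 2 * h * h by field.
  exact: lerD.
have hh0 : 0 < h * h by rewrite mulr_gt0.
rewrite add0r -(ler_pM2l hh0) [h * h * e]mulrC; apply: le_trans H.
by rewrite normrM ger0_norm // ltW.
Qed.

End Scalar.

Lemma sm_comp m l (f : 'rV[R]_l -> R) (y : 'rV[R]_m -> 'rV[R]_l) x :
  smv y x -> sm f (y x) -> sm (fun u => f (y u)) x.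
Proof.
move=> hy [W [oW Wx h]].
have : \forall z \near x, W (y z) /\ forall i, sm (fun u => y u 0 i) z.
  apply: near_and; last by apply: near_forall => i; exact: sm_near.
  have cy : {for x, continuous y} by apply: continuous_row => i; exact: sm_cont.
  by apply: near_cont_comp cy _; exact: open_near.
move=> /near_normP[r r0 hr].
have [V oV] : exists2 V : 'I_l -> set 'rV[R]_m, (forall i, open (V i) /\ V i x) &
    forall i k, Ck k (V i) (fun u => y u 0 i).
  have /choice[V hV] : forall i, exists U : set 'rV[R]_m, [/\ open U, U x & forall k, Ck k U (fun u => y u 0 i)].
    exact: hy.
  by exists V => [i|i k]; have [] := hV i.
move=> hV; pose U : set 'rV[R]_m := ball x r `&` \bigcap_(i in [set: 'I_l]) V i.
have oU : open U.
  apply: openI; first exact: ball_open.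
  rewrite openE => z hz; apply: (@near_imp _ (fun z => forall i, V i z)).
    by move=> w hw i _.
  by apply: near_forall => i; apply: open_near; [have [] := oV i|exact: hz].
exists U; split => //.
  by split; [exact: ballxx|move=> i _; have [] := oV i].
move=> k; apply: (Ck_comp oU oW) (h k).
  by move=> z [+ _]; rewrite -ball_normE /= distrC => /hr[].
by move=> i; apply: Ck_sub (hV i k) => z [_]; exact.
Qed.

Lemma smooth_on_sm m (D : set 'rV[R]_m) f x : smooth_on D f -> D x ->
  (\forall y \near x, D y) -> sm f x.
Proof.
move=> h Dx nD; have [U [F [oU Ux hF FE]]] := h x Dx.
apply: (sm_ext (f := F)); last by exists U.
by apply: filterS2 (open_near oU Ux) nD => y; exact: FE.
Qed.

(** At a boundary point of D only an extension F of the function is smooth. This is how data given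
    for s >= 0 are carried across s = 0; at interior points [smooth_on_sm] returns the function
    itself. *)
Lemma smooth_on_ext m (D : set 'rV[R]_m) f x : smooth_on D f -> D x ->
  exists2 F, sm F x & \forall y \near x, D y -> F y = f y.
Proof.
move=> h Dx; have [U [F [oU Ux hF FE]]] := h x Dx; exists F; first by exists U.
by apply: filterS (open_near oU Ux) => y; exact: FE.
Qed.

Lemma sm_smooth_on m (D : set 'rV[R]_m) f :
  (forall x, D x -> exists2 F, sm F x & \forall y \near x, D y -> F y = f y) ->
  smooth_on D f.
Proof.
move=> h x Dx; have [F [U [oU Ux hF]] /near_normP[r r0 hr]] := h x Dx.
exists (U `&` ball x r), F; split.
- by apply: openI => //; exact: ball_open.
- by split => //; exact: ballxx.
- by move=> k; apply: Ck_sub (hF k) => y [].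
- by move=> y [_]; rewrite -ball_normE /= distrC => /hr; exact.
Qed.

Section Vector.
Context {m l : nat}.
Implicit Types (f g : 'rV[R]_m -> 'rV[R]_l) (x : 'rV[R]_m).

Lemma smv_near f x : smv f x -> \forall y \near x, smv f y.
Proof. by move=> h; apply: near_forall => j; exact: sm_near. Qed.

Lemma smv_ext f g x : (\forall y \near x, f y = g y) -> smv f x -> smv g x.
Proof.
by move=> fg h j; apply: sm_ext (h j); apply: near_imp fg => y ->.
Qed.

Lemma smv_cont f x : smv f x -> {for x, continuous f}.
Proof. by move=> h; apply: continuous_row => i; exact: sm_cont. Qed.

Lemma smv_differentiable f x : smv f x -> differentiable f x.
Proof.
move=> h; have -> : f = \sum_j (fun u => f u 0 j *: (delta_mx 0 j : 'rV[R]_l)).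
  by apply/funext => u; rewrite fct_sumE -row_sum_delta.
apply: differentiable_sum => j; apply: differentiableZl.
by have [] := sm_diff (h j).
Qed.

Lemma jacE f x i j : smv f x -> 'J f x i j = pd i (fun u => f u 0 j) x.
Proof.
move=> h; have d := smv_differentiable h.
rewrite pdE /jacobian mxE -deriveE // derive_mx ?mxE //.
exact: diff_derivable.
Qed.

Opaque jacobian.

Lemma jac_near f g x : (\forall y \near x, f y = g y) -> smv f x ->
  'J f x = 'J g x.
Proof.
move=> fg h; apply/matrixP => i j.
apply: (etrans (jacE i j h)); apply/esym/(etrans (jacE i j (smv_ext fg h))).
by apply: pd_near; apply: near_imp fg => y ->.
Qed.

Lemma sm_jac f x i j : smv f x -> sm (fun u => 'J f u i j) x.
Proof.
move=> h; apply: sm_ext (sm_pd i (h j)).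
by apply: filterS (smv_near h) => y hy; rewrite jacE.
Qed.

End Vector.

Lemma smv_id m (x : 'rV[R]_m) : smv id x.
Proof. by move=> j; exact: sm_coord. Qed.

Lemma jac_id m (x : 'rV[R]_m) : 'J id x = 1%:M.
Proof.
apply/matrixP => i j; rewrite jacE; last exact: smv_id.
rewrite pdE; have [_ ->] := derive_lin_coord x (delta_mx 0 i) j.
by rewrite !mxE eqxx /= eq_sym.
Qed.

Lemma smv_comp m l k (f : 'rV[R]_l -> 'rV[R]_k) (y : 'rV[R]_m -> 'rV[R]_l) x :
  smv y x -> smv f (y x) -> smv (fun u => f (y u)) x.
Proof. by move=> hy hf j; apply: (sm_comp hy (f := fun u => f u 0 j)). Qed.

(** Jacobians act on row vectors from the right, so the factor of the inner map stands on the
    left. *)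
Lemma jac_comp m l k (f : 'rV[R]_l -> 'rV[R]_k) (y : 'rV[R]_m -> 'rV[R]_l) x :
  smv y x -> smv f (y x) -> 'J (fun u => f (y u)) x = 'J y x *m 'J f (y x).
Proof.
move=> hy hf; apply/matrixP => i j; rewrite jacE ?mxE; last exact: smv_comp.
have := @sm_comp_derive l _ (fun u => f u 0 j) y x (delta_mx 0 i)
  (\row_j pd i (fun u => y u 0 j) x) (hf j).
feed; first by move=> i'; rewrite mxE; exact: sm_derive.
rewrite pdE => -[_ ->]; apply: eq_bigr => i' _.
by rewrite mxE !jacE.
Qed.

End Germs.

(** * Ordinary differential equations *)

Section ODE.
Context {R : realType}.

Lemma MVT_ge0 (f df : R -> R) (a b : R) : a <= b ->
  (forall t, a <= t <= b -> is_derive t (1 : R) f (df t)) ->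
  (forall t, a <= t <= b -> 0 <= df t) -> f a <= f b.
Proof.
move=> ab h hM; rewrite -subr_ge0.
have [||c /andP[ac cb] ->] := @MVT_segment R f df a b ab.
- move=> x; rewrite in_itv /= => /andP[ax xb]; apply: h; rewrite !ltW //.
- apply: derivable_within_continuous => x; rewrite in_itv /= => /h [] //.
rewrite mulr_ge0 ?subr_ge0 //.
by apply: hM; apply/andP; split.
Qed.

Lemma isd_scale_arg (f : R -> R) (c t d : R) :
  is_derive (c * t) (1 : R) f d -> is_derive t (1 : R) (fun s : R => f (c * s)) (c * d).
Proof.
move=> h; have h1 : is_derive t (1 : R) (fun s : R => c * s) c.
  by apply: is_derive_ext (isdZ c (isd_id t)); rewrite ?mulr1.
by apply: is_derive_ext (isd_comp1 h1 h) => //; rewrite mulrC.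
Qed.

Lemma primitive_on (g : R -> R) (T : R) : 0 < T -> continuous g ->
  exists2 G : R -> R, G 0 = 0 & forall t, `|t| < T -> is_derive t (1 : R) G (g t).
Proof.
move=> T0 cg.
pose F (x : R) : R := \int[@lebesgue_measure R]_(t in `[- T, x]) g t.
have ig : (@lebesgue_measure R).-integrable `[- T, T] (EFin \o g).
  apply: continuous_compact_integrable; first exact: segment_compact.
  exact: continuous_subspaceT.
have dF t : `|t| < T -> is_derive t (1 : R) F (g t).
  rewrite ltr_norml => /andP[t1 t2].
  have [d e] := @continuous_FTC1_closed R g (- T) t T t2 ig t1 (cg t).
  apply: DeriveDef; first exact: d.
  by rewrite -derive1E.
exists (fun t => F t - F 0) => [|t tT]; first by rewrite subrr.
by apply: is_derive_ext (isdB (dF t tT) (isd_cst (F 0) t 1)); rewrite ?subr0.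
Qed.

(** Primitives vanishing at 0 on growing symmetric intervals agree wherever two of them are defined,
    because their difference has zero derivative; so they glue to a primitive on the whole line. *)
Lemma exists_primitive (g : R -> R) : continuous g ->
  exists2 G : R -> R, G 0 = 0 & forall t : R, is_derive t (1 : R) G (g t).
Proof.
move=> cg.
have /choice[G hG] : forall n : nat, exists G : R -> R, G 0 = 0 /\
    forall t, `|t| < n.+1%:R -> is_derive t (1 : R) G (g t).
  by move=> n; have [|G h1 h2] := @primitive_on g n.+1%:R _ cg; [rewrite ltr0n|exists G].
pose N (t : R) := (Num.truncn `|t|).+1.
have GG n k t : `|t| < n.+1%:R -> `|t| < k.+1%:R -> G n t = G k t.
  move=> tn tk; have [Gn0 dn] := hG n; have [Gk0 dk] := hG k.
  have d s : `|s| <= `|t| -> is_derive s (1 : R) (fun s => G n s - G k s) 0.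
    move=> st; apply: is_derive_ext (isdB (dn s (le_lt_trans st tn)) (dk s (le_lt_trans st tk))) => //.
    by rewrite subrr.
  apply/eqP; rewrite -subr_eq0 -normr_le0.
  have [t0|t0] := lerP 0 t.
    have := @MVT_bound R (fun s => G n s - G k s) (fun=> 0) 0 t 0 t0.
    feed; first by move=> s /andP[s0 st]; apply: d; rewrite !ger0_norm.
    feed; first by move=> *; rewrite normr0.
    by rewrite Gn0 Gk0 subrr subr0 mul0r.
  have := @MVT_bound R (fun s => G n s - G k s) (fun=> 0) t 0 0 (ltW t0).
  feed; first by move=> s /andP[s0 st]; apply: d; rewrite ler0_norm // ler0_norm ?(ltW t0) // lerN2.
  feed; first by move=> *; rewrite normr0.
  by rewrite Gn0 Gk0 subrr mul0r sub0r normrN.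
have N1 t : `|t| < (N t).+1%:R.
  rewrite /N; have := truncnS_gt `|t|; move/lt_le_trans; apply.
  by rewrite ler_nat.
exists (fun t => G (N t) t) => [|t]; first by have [] := hG (N 0).
have [_ /(_ t (N1 t))] := hG (N t).
apply: is_derive_near.
have : \forall s \near t, `|s| < (N t).+1%:R.
  have /cvgr_lt := @norm_continuous _ _ t; apply; exact: N1.
by apply: near_imp => s hs; apply: GG => //; exact: N1.
Qed.

(** In the weight expR (2 L |t|) integration of an L-Lipschitz increment halves the constant, since
    c / 2 expR (2 L t) has the derivative c L expR (2 L t). Hence the Picard operator contracts by
    1/2 on the whole line at once. Negative times follow by reflection. *)
Lemma exp_comparison (D d : R -> R) (c L : R) : 0 <= c -> 0 < L -> D 0 = 0 ->
  (forall t : R, is_derive t (1 : R) D (d t)) ->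
  (forall t, `|d t| <= c * L * expR (2 * L * `|t|)) ->
  forall t, `|D t| <= c / 2 * expR (2 * L * `|t|).
Proof.
move=> c0 L0.
have dE (t : R) : is_derive t (1 : R) (fun s => c / 2 * expR (2 * L * s)) (c * L * expR (2 * L * t)).
  apply: is_derive_ext (isdZ (c / 2) (isd_scale_arg (is_derive_expR (2 * L * t)))) => //.
  by field.
have main (D1 d1 : R -> R) : D1 0 = 0 -> (forall t : R, is_derive t (1 : R) D1 (d1 t)) ->
    (forall t, `|d1 t| <= c * L * expR (2 * L * `|t|)) -> forall t, 0 <= t ->
    `|D1 t| <= c / 2 * expR (2 * L * `|t|).
  move=> D10 hd hb t t0.
  have E0 : 0 <= c / 2 by rewrite divr_ge0.
  have H1 := @MVT_ge0 (fun s => c / 2 * expR (2 * L * s) - D1 s) _ 0 t t0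
    (fun s _ => isdB (dE s) (hd s)).
  have H2 := @MVT_ge0 (fun s => c / 2 * expR (2 * L * s) + D1 s) _ 0 t t0
    (fun s _ => isdD (dE s) (hd s)).
  rewrite (ger0_norm t0) ler_norml; apply/andP; split.
    have : c / 2 * expR (2 * L * 0) + D1 0 <= c / 2 * expR (2 * L * t) + D1 t.
      apply: H2 => s /andP[s0 _]; have := hb s; rewrite (ger0_norm s0) ler_norml.
      by move=> /andP[h _]; rewrite -lerBlDl sub0r.
    rewrite D10 addr0 mulr0 expR0 mulr1 => h.
    by rewrite -subr_ge0 opprK addrC; apply: le_trans h.
  have : c / 2 * expR (2 * L * 0) - D1 0 <= c / 2 * expR (2 * L * t) - D1 t.
    apply: H1 => s /andP[s0 _]; have := hb s; rewrite (ger0_norm s0) ler_norml.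
    by move=> /andP[_ h]; rewrite subr_ge0.
  rewrite D10 subr0 mulr0 expR0 mulr1 => h.
  by rewrite -subr_ge0; apply: le_trans h.
move=> D0 hd hb t; have [t0|t0] := lerP 0 t; first exact: (main D d).
have := main (fun s => D (- s)) (fun s => - d (- s)); feed; first by rewrite oppr0.
feed.
  move=> s; have := @isd_scale_arg D (-1) s (d (- s)); rewrite mulN1r => /(_ (hd _)).
  by apply: is_derive_ext; [move=> u; rewrite mulN1r|rewrite mulN1r].
feed; first by move=> s; rewrite normrN; have := hb (- s); rewrite normrN.
by move=> /(_ (- t)); rewrite oppr_ge0 normrN opprK => /(_ (ltW t0)).
Qed.

(** The sequences a k - 2 c / 2^k and a k + 2 c / 2^k are nondecreasing and nonincreasing; the
    supremum of the lower one lies between them and gives the limit with its rate. *)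
Lemma geometric_cvg (a : nat -> R) (c : R) :
  (forall k, `|a k.+1 - a k| <= c / 2 ^+ k) ->
  exists l : R, forall k, `|a k - l| <= 2 * c / 2 ^+ k.
Proof.
move=> h.
have p2 k : (2 : R) ^+ k.+1 = 2 * 2 ^+ k by rewrite exprS.
have p0 k : (2 : R) ^+ k != 0 by rewrite expf_neq0.
pose b k := a k - 2 * c / 2 ^+ k; pose d k := a k + 2 * c / 2 ^+ k.
have c0 : 0 <= c by have := le_trans (normr_ge0 _) (h 0%N); rewrite expr0 divr1.
have e0 k : 0 <= 2 * c / 2 ^+ k by rewrite divr_ge0 ?mulr_ge0 // exprn_ge0.
have halve k : 2 * c / 2 ^+ k.+1 = c / 2 ^+ k by rewrite p2; field.
have bS k : b k <= b k.+1.
  have := h k; rewrite ler_norml => /andP[h1 _]; rewrite /b halve.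
  have -> : 2 * c / 2 ^+ k = c / 2 ^+ k + c / 2 ^+ k by field.
  by lra.
have dS k : d k.+1 <= d k.
  have := h k; rewrite ler_norml => /andP[_ h1]; rewrite /d halve.
  have -> : 2 * c / 2 ^+ k = c / 2 ^+ k + c / 2 ^+ k by field.
  by lra.
have bmono : {homo b : i j / (i <= j)%N >-> i <= j} by apply: homo_leq => //; exact: le_trans.
have dmono : {homo d : i j / (i <= j)%N >-> j <= i}.
  by apply: homo_leq => //; move=> x y z; exact: (fun h1 h2 => le_trans h2 h1).
have bd j k : b j <= d k.
  have e : b (maxn j k) <= d (maxn j k) by rewrite /b /d; have := e0 (maxn j k); lra.
  apply: (le_trans (bmono j (maxn j k) (leq_maxl _ _))); apply: (le_trans e).
  exact: (dmono k (maxn j k) (leq_maxr _ _)).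
have ub : has_ubound (range b) by exists (d 0%N) => _ [j _ <-]; exact: bd.
exists (sup (range b)) => k; rewrite ler_norml; apply/andP; split.
  rewrite -subr_ge0 opprK addrC addrA subr_ge0.
  have : sup (range b) <= d k by apply: ge_sup; [exists (b 0%N), 0%N|move=> _ [j _ <-]; exact: bd].
  by rewrite /d addrC.
rewrite lerBlDr -lerBlDl.
by apply: ub_le_sup => //; exists k.
Qed.

(** A globally Lipschitz field has solutions for all times: Picard iteration converges geometrically
    in the weighted norm of [exp_comparison]. *)
Lemma picard m (f : 'rV[R]_m -> 'rV[R]_m) (L : R) (z : 'rV[R]_m) : 1 <= L ->
  (forall x y, `|f x - f y| <= L * `|x - y|) ->
  exists2 Z : R -> 'rV[R]_m, Z 0 = z &
    forall (t : R) i, is_derive t (1 : R) (fun s : R => Z s 0 i) (f (Z t) 0 i).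
Proof.
move=> L1 fL.
have L0 : 0 < L by apply: lt_le_trans L1.
have cf (X : R -> 'rV[R]_m) : continuous X -> forall i, continuous (fun s : R => f (X s) 0 i).
  move=> cX i t; apply: (@continuous_comp _ _ _ X (fun v => f v 0 i)); first exact: cX.
  by apply: (@continuous_coord _ _ _ f); exact: (lipschitz_cont L0 fL).
(* An antiderivative operator vanishing at 0, specified on continuous functions only. *)
have /choice[P hP] : forall g : R -> R, exists G : R -> R, continuous g -> G 0 = 0 /\
    forall t : R, is_derive t (1 : R) G (g t).
  move=> g; have [cg|ncg] := pselect (continuous g); last by exists g.
  by have [G h1 h2] := exists_primitive cg; exists G.
pose step (X : R -> 'rV[R]_m) (t : R) : 'rV[R]_m := \row_i (z 0 i + P (fun s : R => f (X s) 0 i) t).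
pose X k := iter k step (fun=> z).
have dstep (Y : R -> 'rV[R]_m) (t : R) i : continuous Y -> is_derive t (1 : R) (fun s => step Y s 0 i) (f (Y t) 0 i).
  move=> cY; have [_ /(_ t) hd] := hP _ (cf Y cY i).
  apply: is_derive_ext (isdD (isd_cst (z 0 i) t 1) hd); rewrite ?add0r // => s.
  by rewrite mxE.
have step0 (Y : R -> 'rV[R]_m) : continuous Y -> step Y 0 = z.
  by move=> cY; apply/rowP => i; rewrite mxE; have [-> _] := hP _ (cf Y cY i); rewrite addr0.
have cX k : continuous (X k).
  elim: k => [|k IH] t; first exact: cst_continuous.
  apply: continuous_row => i; apply: is_derive1_cont; exact: dstep.
pose wt (t : R) : R := expR (2 * L * `|t|).
have wt0 (t : R) : 0 < wt t by exact: expR_gt0.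
(* The first iterate differs from the constant z by the integral of f z; [exp_comparison] applies to
   it with c = |f z| because 1 <= L. *)
pose C : R := 2 * `|f z|; have C0 : 0 <= C by rewrite mulr_ge0.
have p0 k : (2 : R) ^+ k != 0 by rewrite expf_neq0.
have pp k : 0 <= (2 : R) ^- k by rewrite invr_ge0 exprn_ge0.
have diffX k (t : R) : `|X k.+1 t - X k t| <= C / 2 ^+ k * wt t.
  elim: k t => [|k IH] t; (apply: norm_le_coord => [|i];
    first by rewrite mulr_ge0 ?divr_ge0 ?exprn_ge0 // ltW); rewrite !mxE.
    have := @exp_comparison (fun t => X 1%N t 0 i - X 0%N t 0 i) (fun t => f z 0 i) `|f z| L _ L0.
    feed; first by rewrite normr_ge0.
    feed; first by rewrite [X 1%N 0](step0 (X 0%N) (cX 0%N)) subrr.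
    feed.
      move=> s; apply: is_derive_ext (isdB (dstep (X 0%N) s i (cX 0%N)) (isd_cst (z 0 i) s 1)) => //.
      by rewrite subr0.
    feed.
      move=> s; apply: le_trans (coord_le_norm _ _) _; rewrite -mulrA ler_peMr //.
      rewrite -[1]mulr1; apply: ler_pM => //.
      by rewrite -expR0 ler_expR mulr_ge0 // mulr_ge0 // ltW.
    move=> /(_ t); rewrite !mxE => hh; apply: le_trans hh _; (apply: ler_wpM2r; first exact/ltW/expR_gt0).
    by rewrite expr0 divr1 /C; have := normr_ge0 (f z); lra.
  have := @exp_comparison (fun t => X k.+2 t 0 i - X k.+1 t 0 i)
    (fun t => f (X k.+1 t) 0 i - f (X k t) 0 i) (C / 2 ^+ k) L _ L0.
  feed; first by rewrite mulr_ge0.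
  feed; first by rewrite [X k.+2 0](step0 _ (cX k.+1)) [X k.+1 0](step0 _ (cX k)) subrr.
  feed; first by move=> s; exact: isdB (dstep (X k.+1) s i (cX _)) (dstep (X k) s i (cX _)).
  feed.
    move=> s; have -> : f (X k.+1 s) 0 i - f (X k s) 0 i = (f (X k.+1 s) - f (X k s)) 0 i.
      by rewrite !mxE.
    apply: le_trans (coord_le_norm _ _) _; apply: le_trans (fL _ _) _.
    rewrite [leRHS](_ : _ = L * (C / 2 ^+ k * wt s)); last by rewrite /wt; ring.
    by apply: ler_wpM2l (IH s); exact: ltW.
  move=> /(_ t); rewrite !mxE => hh; apply: le_trans hh _; (apply: ler_wpM2r; first exact/ltW/expR_gt0).
  by rewrite exprS invfM [2^-1 / _]mulrC mulrA.
have /choice[Z hZ] : forall t : R, exists l : 'rV[R]_m, forall k, `|X k t - l| <= 2 * (C * wt t) / 2 ^+ k.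
  move=> t; have /choice[l hl] : forall i, exists l : R, forall k, `|X k t 0 i - l| <= 2 * (C * wt t) / 2 ^+ k.
    move=> i; apply: geometric_cvg => k.
    have -> : X k.+1 t 0 i - X k t 0 i = (X k.+1 t - X k t) 0 i by rewrite !mxE.
    apply: le_trans (coord_le_norm _ _) _; apply: le_trans (diffX _ _) _.
    by rewrite mulrAC.
  exists (\row_i l i) => k; apply: norm_le_coord => [|i]; last by rewrite !mxE.
  by rewrite mulr_ge0 // mulr_ge0 // mulr_ge0 // ltW.
have small (c e : R) : 0 <= c -> 0 < e -> exists k, c / 2 ^+ k < e.
  move=> c0 e0; exists (Num.truncn (c / e)).+1.
  rewrite ltr_pdivrMr ?exprn_gt0 // mulrC -ltr_pdivrMr //.
  apply: lt_trans (truncnS_gt _) _; rewrite -natrX ltr_nat; exact: ltn_expl.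
have cZ : continuous Z.
  move=> t; apply: near_dist_cont => e e0.
  have cc : 0 <= 2 * (C * expR (2 * L * (`|t| + 1))).
    by rewrite mulr_ge0 // mulr_ge0 // ltW // expR_gt0.
  have e30 : 0 < e / 3 by rewrite divr_gt0.
  have [k hk] := small _ _ cc e30.
  have bnd (s : R) : `|s| <= `|t| + 1 -> `|X k s - Z s| <= e / 3.
    move=> st; apply: le_trans (hZ s k) _; apply: le_trans (ltW hk).
    rewrite ler_wpM2r // ler_pM2l // ler_wpM2l // ler_expR ler_pM2l //.
    by rewrite mulr_gt0.
  have hc : \forall s \near t, `|X k s - X k t| <= e / 3.
    have /cvgrPdist_le /(_ _ e30) : X k s @[s --> t] --> X k t by exact: cX.
    by apply: filterS => s; rewrite distrC.
  have : \forall s \near t, `|s| < `|t| + 1.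
    by have /cvgr_lt := @norm_continuous _ _ t; apply; rewrite ltrDl.
  move=> hn; apply: filterS2 hc hn => s h1 /ltW h2.
  have -> : Z s - Z t = - (X k s - Z s) + (X k s - X k t) + (X k t - Z t).
    by apply/rowP => i; rewrite !mxE; ring.
  have -> : e = e / 3 + e / 3 + e / 3 by field.
  apply: le_trans (ler_normD _ _) _; apply: lerD; last by apply: bnd; rewrite lerDl.
  by apply: le_trans (ler_normD _ _) _; apply: lerD => //; rewrite normrN; apply: bnd.
(* Z is a fixed point of the Picard operator: both sides are close to the iterate of index k + 1,
   the right side because the operator contracts. *)
have ZE (t : R) i : Z t 0 i = step Z t 0 i.
  apply/eqP; rewrite -subr_eq0 -normr_le0; apply/ler_addgt0Pr => e e0; rewrite add0r.
  have cc : 0 <= 2 * (2 * (C * wt t)) by rewrite !mulr_ge0 // ltW.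
  have [k hk] := small _ _ cc e0; apply: le_trans (ltW hk).
  have -> : Z t 0 i - step Z t 0 i = - (X k.+1 t - Z t) 0 i + (X k.+1 t 0 i - step Z t 0 i).
    by rewrite !mxE; ring.
  have -> : 2 * (2 * (C * wt t)) / 2 ^+ k = 2 * (C * wt t) / 2 ^+ k + 2 * (C * wt t) / 2 ^+ k by field.
  have half : 2 * (C * wt t) / 2 ^+ k.+1 <= 2 * (C * wt t) / 2 ^+ k.
    apply: ler_wpM2l; first by rewrite mulr_ge0 // mulr_ge0 // ltW.
    rewrite lef_pV2 ?posrE ?exprn_gt0 //.
    by rewrite exprS ler_peMl ?exprn_ge0 // ler1n.
  apply: le_trans (ler_normD _ _) _; apply: lerD.
    by rewrite normrN; apply: le_trans (coord_le_norm _ _) _; apply: le_trans (hZ _ _) _.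
  have := @exp_comparison (fun t => X k.+1 t 0 i - step Z t 0 i)
    (fun t => f (X k t) 0 i - f (Z t) 0 i) (2 * (C / 2 ^+ k)) L _ L0.
  feed; first by rewrite mulr_ge0 ?mulr_ge0.
  feed; first by rewrite [X k.+1 0](step0 _ (cX k)) (step0 _ cZ) subrr.
  feed; first by move=> s; exact: isdB (dstep _ s i (cX _)) (dstep _ s i cZ).
  feed.
    move=> s; have -> : f (X k s) 0 i - f (Z s) 0 i = (f (X k s) - f (Z s)) 0 i.
      by rewrite !mxE.
    apply: le_trans (coord_le_norm _ _) _; apply: le_trans (fL _ _) _.
    rewrite [leRHS](_ : _ = L * (2 * (C * wt s) / 2 ^+ k)); last by rewrite /wt; field.
    by apply: ler_wpM2l (hZ s k); exact: ltW.
  move=> /(_ t) hh; apply: le_trans hh _; rewrite -/(wt t).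
  have -> : 2 * (C * wt t) / 2 ^+ k = 2 * (2 * (C / 2 ^+ k) / 2 * wt t) by field.
  by rewrite ler_peMl ?ler1n // mulr_ge0 ?divr_ge0 ?mulr_ge0 // ltW.
exists Z.
  by apply/rowP => i; rewrite ZE (step0 _ cZ).
move=> t i; apply: is_derive_ext (dstep Z t i cZ) => // s; rewrite ZE //.
Qed.

Lemma sm_lipschitz_segment m (f : 'rV[R]_m -> R) (y z : 'rV[R]_m) (B : R) :
  (forall s : R, 0 <= s <= 1 -> sm f (z + s *: (y - z)) /\
     forall i : 'I_m, `|pd i f (z + s *: (y - z))| <= B) ->
  `|f y - f z| <= m%:R * B * `|y - z|.
Proof.
move=> h; pose l (s : R) : 'rV[R]_m := z + s *: (y - z).
have dl (s : R) : 0 <= s <= 1 -> is_derive s (1 : R) (fun s : R => f (l s)) (\sum_i (y - z) 0 i * pd i f (l s) : R).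
  move=> /h [h1 _]; apply: (@sm_comp_derive _ _ _ f l s (1:R) (y - z)) => //.
  move=> i; apply: is_derive_ext (isd_affine (z 0 i) ((y - z) 0 i) s) => // u.
  by rewrite !mxE.
have := MVT_bound (M := m%:R * B * `|y - z|) ler01 dl.
feed.
  move=> t /h[_ hb]; apply: le_trans (ler_norm_sum _ _ _) _.
  apply: (@le_trans _ _ (\sum_(i < m) B * `|y - z|)).
    apply: ler_sum => i _; rewrite normrM [B * _]mulrC.
    by apply: ler_pM => //; exact: coord_le_norm.
  by rewrite sumr_const card_ord -mulrA mulr_natl.
by rewrite /l scale0r addr0 scale1r subrKC subr0 mulr1.
Qed.

Definition box m (lo hi : 'rV[R]_m) : set 'rV[R]_m :=
  [set x | forall i, lo 0 i <= x 0 i <= hi 0 i].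

Lemma box_compact m (lo hi : 'rV[R]_m) : compact (box lo hi).
Proof.
have := @rV_compact R m (fun i => `[lo 0 i, hi 0 i]%classic).
feed; first by move=> i; exact: segment_compact.
congr (compact _); apply/seteqP; split => x /= h i; have := h i; rewrite ?in_itv //=.
Qed.

(** Near each point the partial derivatives are bounded by every large B; compactness of the box,
    used with the filter of large B, gives one B for all points. The box is convex, so the estimate
    along segments applies. *)
Lemma sm_lipschitz_box m (f : 'rV[R]_m -> R) (lo hi : 'rV[R]_m) :
  (forall x, box lo hi x -> sm f x) ->
  exists2 L : R, 0 <= L & forall y z, box lo hi y -> box lo hi z ->
    `|f y - f z| <= L * `|y - z|.
Proof.
move=> hf.
have [B hB] : exists B : R, forall x, box lo hi x -> forall i : 'I_m, `|pd i f x| <= B.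
  have /compact_near_coveringP hc := @box_compact m lo hi.
  have := hc R (pinfty_nbhs R) (fun B x => forall i : 'I_m, `|pd i f x| <= B) _.
  feed; first exact: _.
  feed.
    move=> x /hf fx.
    have h1 : \forall y \near x, forall i : 'I_m, `|pd i f y| <= `|pd i f x| + 1.
      apply: near_forall => i.
      apply: near_imp (cont_near_dist (sm_cont (sm_pd i fx)) ltr01) => y hy.
      by rewrite -lerBlDl; apply: le_trans (lerB_dist _ _) _.
    pose B0 : R := \sum_i (`|pd i f x| + 1).
    exists ([set y | forall i : 'I_m, `|pd i f y| <= `|pd i f x| + 1], [set B | B0 < B]).
      by split; [exact: h1|apply: nbhs_pinfty_gt; exact: num_real].
    move=> [y B] [/= hy hB] i; apply: le_trans (hy i) _; apply: le_trans (ltW hB).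
    rewrite /B0 (bigD1 i) //= lerDl; apply: sumr_ge0 => j _.
    by rewrite addr_ge0.
  move=> hn; have [B hB] := filter_ex hn.
  by exists B => x; exact: hB.
exists (m%:R * Num.max B 0); first by rewrite mulr_ge0 // le_max lexx orbT.
move=> y z hy hz; apply: sm_lipschitz_segment => s /andP[s0 s1].
have hb : box lo hi (z + s *: (y - z)).
  move=> i; rewrite !mxE; have /andP[y1 y2] := hy i; have /andP[z1 z2] := hz i.
  have -> : z 0 i + s * (y 0 i - z 0 i) = (1 - s) * z 0 i + s * y 0 i by ring.
  have s1' : 0 <= 1 - s by rewrite subr_ge0.
  apply/andP; split.
    have -> : lo 0 i = (1 - s) * lo 0 i + s * lo 0 i by ring.
    by apply: lerD; exact: ler_wpM2l.
  have -> : hi 0 i = (1 - s) * hi 0 i + s * hi 0 i by ring.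
  by apply: lerD; exact: ler_wpM2l.
split; first exact: hf.
by move=> i; apply: (le_trans (hB _ hb i)); rewrite le_max lexx.
Qed.

Definition clamp (a b x : R) : R := Num.max a (Num.min b x).

Lemma clamp_in (a b x : R) : a <= b -> a <= clamp a b x <= b.
Proof.
move=> ab; rewrite /clamp le_max lexx /= ge_max ab /= ge_min lexx //.
Qed.

Lemma clamp_id (a b x : R) : a <= x <= b -> clamp a b x = x.
Proof.
move=> /andP[ax xb]; rewrite /clamp.
have -> : Num.min b x = x by apply/min_idPr.
exact/max_idPr.
Qed.

Lemma clamp_lip (a b x y : R) : `|clamp a b x - clamp a b y| <= `|x - y|.
Proof.
rewrite /clamp /Order.max /Order.min.
by case: (ltP b x) => ?; case: (ltP b y) => ?; case: (ltP a b) => ?;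
  case: (ltP a x) => ?; case: (ltP a y) => ?; rewrite ler_norml;
  case: (lerP x y) => ?; apply/andP; split; lra.
Qed.

Definition clampv m (lo hi x : 'rV[R]_m) : 'rV[R]_m :=
  \row_i clamp (lo 0 i) (hi 0 i) (x 0 i).

(** Composition with the retraction [clampv] onto the box, which does not increase distances, makes
    the field globally Lipschitz. The solution exists for all times and solves the original equation
    for as long as it stays in the box. *)
Lemma ode_box m (f : 'rV[R]_m -> 'rV[R]_m) (lo hi z : 'rV[R]_m) :
  (forall i, lo 0 i <= hi 0 i) -> (forall x, box lo hi x -> smv f x) ->
  exists2 Z : R -> 'rV[R]_m, Z 0 = z &
    forall (t : R) i, is_derive t (1 : R) (fun s : R => Z s 0 i)
       (f (clampv lo hi (Z t)) 0 i).
Proof.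
move=> lohi hf.
have /choice[Li hLi] : forall i, exists L : R, 0 <= L /\ forall y z, box lo hi y -> box lo hi z ->
    `|f y 0 i - f z 0 i| <= L * `|y - z|.
  move=> i; have [L L0 hL] := @sm_lipschitz_box m (fun u => f u 0 i) lo hi (fun x hx => hf x hx i).
  by exists L.
pose L := 1 + \sum_i Li i.
have Ls0 : 0 <= \sum_i Li i by apply: sumr_ge0 => i _; have [] := hLi i.
have bc x : box lo hi (clampv lo hi x) by move=> i; rewrite mxE; exact: clamp_in.
apply: (@picard m (fun x => f (clampv lo hi x)) L); first by rewrite lerDl.
move=> x y; apply: norm_le_coord => [|i].
  by rewrite mulr_ge0 // addr_ge0.
rewrite !mxE; have [Li0 hl] := hLi i; apply: le_trans (hl _ _ (bc x) (bc y)) _.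
apply: ler_pM => //.
  rewrite /L (bigD1 i) //= addrCA lerDl addr_ge0 // sumr_ge0 // => j _.
  by have [] := hLi j.
apply: norm_le_coord => // j; rewrite !mxE; apply: le_trans (clamp_lip _ _ _ _) _.
by have := coord_le_norm (x - y) j; rewrite !mxE.
Qed.

Lemma smv_local_lipschitz m l (f : 'rV[R]_m -> 'rV[R]_l) (x : 'rV[R]_m) : smv f x ->
  exists2 r : R, 0 < r & exists2 L : R, 0 <= L &
    forall y z : 'rV[R]_m, `|y - x| < r -> `|z - x| < r -> `|f y - f z| <= L * `|y - z|.
Proof.
move=> hf.
have /choice[rL hrL] : forall i : 'I_l, exists rL : R * R, [/\ 0 < rL.1, 0 <= rL.2 &
    forall y z : 'rV[R]_m, `|y - x| < rL.1 -> `|z - x| < rL.1 ->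
      `|f y 0 i - f z 0 i| <= rL.2 * `|y - z|].
  by move=> i; have [r r0 [L L0 h]] := sm_local_lipschitz (hf i); exists (r, L).
have : \forall y \near x, forall i : 'I_l, `|y - x| < (rL i).1.
  by apply: near_forall => i; apply/near_normP; exists (rL i).1 => //; have [] := hrL i.
move=> /near_normP[r r0 hr]; exists r => //.
have L0 : 0 <= \sum_i (rL i).2 by apply: sumr_ge0 => i _; have [] := hrL i.
exists (\sum_i (rL i).2) => // y z yx zx.
apply: norm_le_coord => [|i]; first by rewrite mulr_ge0.
rewrite !mxE; have [_ _ h] := hrL i; apply: le_trans (h y z (hr y yx i) (hr z zx i)) _.
apply: ler_wpM2r => //; rewrite (bigD1 i) //= lerDl sumr_ge0 // => j _.
by have [] := hrL j.
Qed.

(** The squared Euclidean distance E of the two solutions satisfies E' <= K E near t0 and vanishes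
    at t0, so E expR (- K t), being nonincreasing, vanishes for t >= t0. *)
Lemma ode_unique_local m (f : 'rV[R]_m -> 'rV[R]_m) (x y : R -> 'rV[R]_m) (t0 : R) :
  smv f (x t0) -> x t0 = y t0 ->
  (\forall t \near t0, forall i, is_derive t (1 : R) (fun s : R => x s 0 i) (f (x t) 0 i)) ->
  (\forall t \near t0, forall i, is_derive t (1 : R) (fun s : R => y s 0 i) (f (y t) 0 i)) ->
  \forall t \near t0, t0 <= t -> x t = y t.
Proof.
move=> hf xy0 hx hy.
have [r r0 [L L0 hL]] := smv_local_lipschitz hf.
have cx : {for t0, continuous x}.
  by apply: continuous_row => i; apply: is_derive1_cont; exact: (nbhs_singleton hx).
have cy : {for t0, continuous y}.
  by apply: continuous_row => i; apply: is_derive1_cont; exact: (nbhs_singleton hy).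
have nx : \forall t \near t0, `|x t - x t0| < r.
  exact: cont_near_lt.
have ny : \forall t \near t0, `|y t - x t0| < r.
  by rewrite xy0; exact: cont_near_lt.
have := near_and (near_and hx hy) (near_and nx ny).
move=> /near_normP[e e0 he]; apply/near_normP; exists e => // t te t0t.
pose E (s : R) : R := \sum_i (x s 0 i - y s 0 i) * (x s 0 i - y s 0 i).
pose dE (s : R) : R := \sum_i ((f (x s) 0 i - f (y s) 0 i) * (x s 0 i - y s 0 i)
   + (x s 0 i - y s 0 i) * (f (x s) 0 i - f (y s) 0 i)).
pose K : R := 2 * (m%:R * L).
have near_s (s : R) : t0 <= s <= t -> `|s - t0| < e.
  move=> /andP[s1 s2]; apply: le_lt_trans te; rewrite !ger0_norm ?subr_ge0 //.
  by rewrite lerD2r.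
have dEP (s : R) : t0 <= s <= t -> is_derive s (1 : R) E (dE s).
  move=> /near_s /he [[h1 h2] _]; apply: isd_sum => i.
  by apply: isdM; exact: isdB.
have E0 s : 0 <= E s by apply: sumr_ge0 => i _; rewrite -expr2 sqr_ge0.
have nE (s : R) : `|x s - y s| * `|x s - y s| <= E s.
  suff h : `|x s - y s| <= Num.sqrt (E s).
    by rewrite -(sqr_sqrtr (E0 s)) expr2; apply: ler_pM.
  apply: norm_le_coord => [|i]; first exact: sqrtr_ge0.
  rewrite !mxE -sqrtr_sqr ler_wsqrtr // /E (bigD1 i) //= -expr2 lerDl.
  by apply: sumr_ge0 => j _; rewrite -expr2 sqr_ge0.
have dEb (s : R) : t0 <= s <= t -> dE s <= K * E s.
  move=> /near_s /he [_ [h1 h2]].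
  have hl := hL _ _ h1 h2.
  apply: (@le_trans _ _ (\sum_(i < m) 2 * (L * E s))).
    apply: ler_sum => i _.
    set a := f (x s) 0 i - _; set b := x s 0 i - _.
    have -> : a * b + b * a = 2 * (a * b) by ring.
    apply: ler_wpM2l => //.
    apply: le_trans (ler_norm _) _; rewrite normrM.
    apply: (@le_trans _ _ (L * `|x s - y s| * `|x s - y s|)).
      apply: ler_pM => //; last by have := coord_le_norm (x s - y s) i; rewrite !mxE.
      by apply: le_trans hl; have := coord_le_norm (f (x s) - f (y s)) i; rewrite !mxE.
    by rewrite -mulrA ler_wpM2l.
  by rewrite sumr_const card_ord /K -mulr_natl le_eqVlt; apply/orP; left; apply/eqP; ring.
pose h (s : R) : R := - (E s * expR (- K * s)).
have dh (s : R) : t0 <= s <= t -> is_derive s (1 : R) h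
    (- (dE s * expR (- K * s) + E s * (- K * expR (- K * s)))).
  move=> hs; apply: isdN; apply: isdM; first exact: dEP.
  exact: (isd_scale_arg (is_derive_expR (- K * s))).
have := MVT_ge0 t0t dh; feed.
  move=> s hs; set w := expR _.
  have -> : - (dE s * w + E s * (- K * w)) = (K * E s - dE s) * w by ring.
  by rewrite mulr_ge0 ?subr_ge0 ?dEb // ltW // expR_gt0.
rewrite /h lerN2 => hle.
have Et0 : E t0 = 0.
  by rewrite /E big1 // => i _; rewrite xy0 subrr mul0r.
move: hle; rewrite Et0 mul0r pmulr_lle0 ?expR_gt0 // => Et.
have Ez : E t = 0 by apply/eqP; rewrite eq_le Et E0.
apply/rowP => i; apply/eqP; rewrite -subr_eq0 -sqrf_eq0 expr2.
move/eqP: Ez; rewrite /E psumr_eq0 => [|j _]; last by rewrite -expr2 sqr_ge0.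
by move=> /allP /(_ i); rewrite mem_index_enum => /(_ isT).
Qed.

End ODE.

(** * Averaging *)

Section Oscillator.
Context {R : realType}.

Lemma MVT_gt0 (f df : R -> R) (a b : R) : a < b ->
  (forall t, a <= t <= b -> is_derive t (1 : R) f (df t)) ->
  (forall t, a <= t <= b -> 0 < df t) -> f a < f b.
Proof.
move=> ab h hM; rewrite -subr_gt0.
have [||c /andP[ac cb] ->] := @MVT_segment R f df a b (ltW ab).
- move=> x; rewrite in_itv /= => /andP[ax xb]; apply: h; rewrite !ltW //.
- apply: derivable_within_continuous => x; rewrite in_itv /= => /h [] //.
rewrite mulr_gt0 ?subr_gt0 //.
by apply: hM; apply/andP; split.
Qed.

Lemma sin_le_quarter (s t : R) : 0 <= s <= t -> t <= pi / 2 -> sin t <= 1 / 4 ->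
  sin s <= sin t /\ 1 / 2 <= cos s.
Proof.
move=> /andP[s0 st] tp hs.
have p0 : 0 < pi / 2 :> R by have /andP[] := @pihalf_02 R.
have hst : sin s <= sin t.
  rewrite leNgt ltr_sin; first by rewrite -leNgt.
    by rewrite in_itv /=; apply/andP; split => //; lra.
  by rewrite in_itv /=; apply/andP; split => //; lra.
split => //.
have c0 : 0 <= cos s by apply: cos_ge0_pihalf; apply/andP; split; lra.
have s1 : 0 <= sin s by apply: sin_ge0_pi; apply/andP; split; lra.
have := cos2Dsin2 s; set c := cos s in c0 *; set d := sin s in s1 hst *; nra.
Qed.

(** While sin stays below 1/4 the cosine is at least 1/2, so sin grows with slope at least 1/2. *)
Lemma sin_small (t : R) : `|t| <= pi / 2 -> `|sin t| <= 1 / 4 ->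
  `|t| <= 2 * `|sin t| /\ 1 / 2 <= cos t.
Proof.
wlog t0 : t / 0 <= t => [hw|].
  have [/hw//|t0] := lerP 0 t.
  have := hw (- t); rewrite normrN sinN cosN normrN; apply.
  by rewrite oppr_ge0 ltW.
rewrite (ger0_norm t0) => tp.
have s0 : 0 <= sin t.
  apply: sin_ge0_pi; rewrite t0 /=; have := @pihalf_02 R => /andP[h1 h2]; lra.
rewrite (ger0_norm s0) => hs.
split; last by have [] := @sin_le_quarter t t _ tp hs; rewrite ?t0 ?lexx.
have := @MVT_ge0 R (fun s => sin s - 2^-1 * s) _ 0 t t0
  (fun s _ => isdB (is_derive_sin s) (isdZ 2^-1 (isd_id s))).
feed.
  move=> s hst; have [_] := sin_le_quarter hst tp hs; lra.
by rewrite sin0 mulr0 subr0; lra.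
Qed.

Lemma sin_decr (u v : R) : pi / 2 <= u -> u <= v -> v <= 3 * (pi / 2) ->
  sin v <= sin u.
Proof.
move=> h1 h2 h3; have sin_shift (s : R) : sin s = - sin (s - pi).
  by rewrite sinB cospi sinpi; ring.
rewrite (sin_shift v) (sin_shift u) lerN2 leNgt ltr_sin ?in_itv /=.
- by rewrite -leNgt lerD2r.
- apply/andP; split; lra.
- apply/andP; split; lra.
Qed.

(** Variation of constants: A and B below, the pair (Y, V) rotated back, have derivatives bounded by
    e, so on [0, 6] they stay within 6 e of 0 and 1, and (Y, V) within 12 e of (sin, cos). The time
    6 exceeds 3 pi / 2, and e <= 1/48 makes 12 e <= 1/4. The bound 24 e on tau - pi is twice the
    bound 12 e on sin tau. *)
Lemma near_rotation (Y V q : R -> R) (e : R) : 0 <= e <= 1 / 48 ->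
  Y 0 = 0 -> V 0 = 1 ->
  (forall s : R, 0 <= s <= 6 -> [/\ is_derive s (1 : R) Y (V s),
     is_derive s (1 : R) V (- Y s + q s) & `|q s| <= e]) ->
  (forall s : R, 0 <= s <= 6 -> `|1 - V s * V s - Y s * Y s| <= 18 * e) /\
  exists tau : R, [/\ 0 < tau < 6, forall s : R, 0 < s < tau -> 0 < Y s,
    Y tau = 0, V tau < 0 & `|tau - pi| <= 24 * e].
Proof.
move=> /andP[e0 e48] Y0 V0 h.
pose A (s : R) : R := Y s * cos s - V s * sin s.
pose B (s : R) : R := Y s * sin s + V s * cos s.
have dA (s : R) : 0 <= s <= 6 -> is_derive s (1 : R) A (- (q s * sin s)).
  move=> /h[dY dV _]; apply: is_derive_ext (isdB (isdM dY (is_derive_cos s)) (isdM dV (is_derive_sin s))) => //.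
  by ring.
have dB (s : R) : 0 <= s <= 6 -> is_derive s (1 : R) B (q s * cos s).
  move=> /h[dY dV _]; apply: is_derive_ext (isdD (isdM dY (is_derive_sin s)) (isdM dV (is_derive_cos s))) => //.
  by ring.
have sub (s t : R) : 0 <= t <= 6 -> 0 <= s <= t -> 0 <= s <= 6.
  by move=> /andP[_ t6] /andP[-> st] /=; apply: le_trans t6.
have Ab (t : R) : 0 <= t <= 6 -> `|A t| <= 6 * e.
  move=> t6; have /andP[t0 tle] := t6.
  have := @MVT_bound R A _ 0 t e t0 (fun s hs => dA s (sub s t t6 hs)); feed.
    move=> s /(sub s t t6) /h[_ _ hq]; rewrite normrN normrM.
    rewrite -[leRHS]mulr1; apply: ler_pM => //; exact: sin_max.
  rewrite {2}/A Y0 sin0 mul0r mulr0 !subr0 => hA; apply: le_trans hA _.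
  by rewrite mulrC; apply: ler_wpM2r.
have Bb (t : R) : 0 <= t <= 6 -> `|B t - 1| <= 6 * e.
  move=> t6; have /andP[t0 tle] := t6.
  have := @MVT_bound R B _ 0 t e t0 (fun s hs => dB s (sub s t t6 hs)); feed.
    move=> s /(sub s t t6) /h[_ _ hq]; rewrite normrM.
    rewrite -[leRHS]mulr1; apply: ler_pM => //; exact: cos_max.
  rewrite {2}/B Y0 V0 cos0 mul0r mulr1 add0r !subr0 => hA; apply: le_trans hA _.
  by rewrite mulrC; apply: ler_wpM2r.
have YE (s : R) : Y s = A s * cos s + B s * sin s.
  by rewrite /A /B -[LHS]mulr1 -(cos2Dsin2 s); ring.
have VE (s : R) : V s = B s * cos s - A s * sin s.
  by rewrite /A /B -[LHS]mulr1 -(cos2Dsin2 s); ring.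
have Ys (s : R) : 0 <= s <= 6 -> `|Y s - sin s| <= 12 * e.
  move=> hs; have -> : Y s - sin s = A s * cos s + (B s - 1) * sin s by rewrite YE; ring.
  have -> : 12 * e = 6 * e * 1 + 6 * e * 1 by ring.
  apply: le_trans (ler_normD _ _) _; rewrite !normrM; apply: lerD; apply: ler_pM => //;
    [exact: Ab|exact: cos_max|exact: Bb|exact: sin_max].
have Vs (s : R) : 0 <= s <= 6 -> `|V s - cos s| <= 12 * e.
  move=> hs; have -> : V s - cos s = (B s - 1) * cos s - A s * sin s by rewrite VE; ring.
  have -> : 12 * e = 6 * e * 1 + 6 * e * 1 by ring.
  apply: le_trans (ler_normB _ _) _; rewrite !normrM; apply: lerD; apply: ler_pM => //;
    [exact: Bb|exact: cos_max|exact: Ab|exact: sin_max].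
split.
  move=> s hs.
  have -> : 1 - V s * V s - Y s * Y s = - (A s * A s + (B s - 1) * (2 + (B s - 1))).
    have -> : V s * V s = (B s * cos s - A s * sin s) * (B s * cos s - A s * sin s) by rewrite -VE.
    have -> : Y s * Y s = (A s * cos s + B s * sin s) * (A s * cos s + B s * sin s) by rewrite -YE.
    rewrite [LHS](_ : _ = 1 - (A s * A s + B s * B s) * (cos s ^+ 2 + sin s ^+ 2)); last by ring.
    by rewrite cos2Dsin2; ring.
  rewrite normrN; have := Ab s hs; have := Bb s hs.
  set a := A s; set b := B s - 1 => hb ha.
  apply: le_trans (ler_normD _ _) _; rewrite !normrM.
  have h2 : `|2 + b| <= 2 + `|b| by apply: le_trans (ler_normD _ _) _; rewrite ger0_norm.
  have := normr_ge0 a; have := normr_ge0 b; have := normr_ge0 (2 + b).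
  move: ha hb h2; set a' := `|a|; set b' := `|b|; set c' := `|2 + b| => *; nra.
have /andP[p0 p2] := @pihalf_02 R.
pose ph : R := pi / 2; have piE : pi = 2 * ph :> R by rewrite /ph; field.
rewrite -/ph in p0 p2.
have cY (s : R) : 0 <= s <= 6 -> {for s, continuous Y}.
  by move=> /h[dY _ _]; exact: (is_derive1_cont dY).
have Y1 : 0 < Y ph.
  have := Ys ph; feed; first by apply/andP; split; lra.
  by rewrite sin_pihalf ler_norml => /andP[h1 _]; lra.
have s3 : sin (3 * ph) = -1 :> R.
  have -> : 3 * ph = ph + pi by rewrite piE; ring.
  by rewrite sinDpi sin_pihalf.
have Y3 : Y (3 * ph) < 0.
  have := Ys (3 * ph); feed; first by apply/andP; split; lra.
  by rewrite s3 ler_norml => /andP[_ h1]; lra.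
have ph3 : ph <= 3 * ph by lra.
have cY3 : {within `[ph, 3 * ph], continuous Y}.
  apply: derivable_within_continuous => x; rewrite in_itv /= => /andP[x1 x2].
  have [] := h x; first by apply/andP; split; lra.
  by case.
have mm : Num.min (Y ph) (Y (3 * ph)) <= 0 <= Num.max (Y ph) (Y (3 * ph)).
  by rewrite ge_min le_max (ltW Y1) (ltW Y3) orbT.
(* Y is close to 1 at pi / 2 and to -1 at 3 pi / 2, so it has a zero in between. *)
have [tau] := @IVT R Y ph (3 * ph) 0 ph3 cY3 mm.
move=> /andP[]; rewrite !bnd_simp => t1 t2 Yt.
  have t06 : 0 <= tau <= 6 by apply/andP; split; lra.
  have sint : `|sin tau| <= 12 * e by have := Ys tau t06; rewrite Yt sub0r normrN.
  have tp : `|tau - pi| <= pi / 2.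
    by rewrite ler_norml piE; apply/andP; split; lra.
  have sin_shift (s : R) : sin (s - pi) = - sin s.
    by rewrite sinB cospi sinpi; ring.
  have cos_shift (s : R) : cos (s - pi) = - cos s.
    by rewrite cosB cospi sinpi; ring.
  have stq : `|sin (tau - pi)| <= 1 / 4 by rewrite sin_shift normrN; lra.
  have [tb tc] := sin_small tp stq.
  have V_mid (s : R) : ph <= s <= 3 * ph -> - (1 / 4) <= sin s -> sin s <= 1 / 4 -> V s < 0.
    move=> /andP[s1 s2] hs1 hs2.
    have [||_] := @sin_small (s - pi).
    - by rewrite ler_norml piE; apply/andP; split; lra.
    - by rewrite sin_shift ler_norml; apply/andP; split; lra.
    - rewrite cos_shift => hc; have := Vs s; feed; first by apply/andP; split; lra.
      by rewrite ler_norml => /andP[_ h1]; lra.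
  have sint' : - (1 / 4) <= sin tau by move: sint; rewrite ler_norml => /andP[h1 _]; lra.
  have sint2 : sin tau <= 1 / 4 by move: sint; rewrite ler_norml => /andP[_ h1]; lra.
  exists tau; split => //.
  + apply/andP; split; lra.
  (* If Y s <= 0, then sin s <= 1/4. For s <= pi / 2 this contradicts the growth of Y on [0, s],
     where V is close to cos >= 1/2; for s > pi / 2, V is negative on [s, tau], so Y s exceeds Y tau
     = 0. *)
  + move=> s /andP[s0 st]; rewrite ltNge; apply/negP => Ysle.
    have hs6 : 0 <= s <= 6 by apply/andP; split; lra.
    have sins : sin s <= 1 / 4.
      have := Ys s hs6; rewrite ler_norml => /andP[h1 _]; lra.
    have [sp|sp] := lerP s ph.
      have : Y 0 < Y s.
        apply: (@MVT_gt0 Y V 0 s s0).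
          by move=> u hu; have [] := h u (sub u s hs6 hu).
        move=> u hu; have [_ hc] := sin_le_quarter hu sp sins.
        have := Vs u (sub u s hs6 hu); rewrite ler_norml => /andP[h1 _]; lra.
      by rewrite Y0 ltNge Ysle.
    have : - Y s < - Y tau.
      apply: (@MVT_gt0 (fun u => - Y u) (fun u => - V u) s tau st).
        move=> u /andP[u1 u2]; apply: isdN; have [] // := h u.
        by apply/andP; split; lra.
      move=> u /andP[u1 u2]; rewrite oppr_gt0; apply: V_mid.
      - by apply/andP; split; lra.
      - by apply: le_trans sint' _; apply: sin_decr => //; exact: (le_trans (ltW sp)).
      - by apply: le_trans sins; apply: sin_decr => //; [exact: ltW|exact: le_trans t2].
    by rewrite Yt oppr0 oppr_lt0 ltNge Ysle.
  + by apply: V_mid => //; apply/andP; split.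
  + apply: le_trans tb _; rewrite sin_shift normrN; lra.
Qed.

End Oscillator.

Ltac posi := first [ assumption | exact: ltW | done | exact: sqr_ge0
  | apply: mulr_ge0; posi | apply: addr_ge0; posi | rewrite invr_ge0; posi ].

(** * The slow drift and the averaged motion over a half-period *)

Section Averaging.
Context {R : realType}.

Lemma MVT_bound_sym (f df : R -> R) (t c : R) :
  (forall s : R, `|s| <= `|t| -> is_derive s (1 : R) f (df s) /\ `|df s| <= c) ->
  `|f t - f 0| <= c * `|t|.
Proof.
move=> h; have [t0|t0] := lerP 0 t.
  rewrite (ger0_norm t0) in h *.
  have h' (s : R) : 0 <= s <= t -> is_derive s (1 : R) f (df s) /\ `|df s| <= c.
    by move=> /andP[s0 st]; apply: h; rewrite ger0_norm.
  by have := @MVT_bound R f df 0 t c t0 (fun s hs => (h' s hs).1) (fun s hs => (h' s hs).2);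
    rewrite subr0.
rewrite (ltr0_norm t0) in h *.
have h' (s : R) : t <= s <= 0 -> is_derive s (1 : R) f (df s) /\ `|df s| <= c.
  by move=> /andP[st s0]; apply: h; rewrite (ler0_norm s0) lerN2.
by have := @MVT_bound R f df t 0 c (ltW t0) (fun s hs => (h' s hs).1) (fun s hs => (h' s hs).2);
  rewrite sub0r distrC.
Qed.

Lemma box_ball m (x0 x : 'rV[R]_m) (r : R) : 0 <= r ->
  box (x0 - const_mx r) (x0 + const_mx r) x <-> `|x - x0| <= r.
Proof.
move=> r0; split => [h|h i].
  apply: norm_le_coord => // i; have := h i; rewrite !mxE ler_norml => /andP[h1 h2].
  by apply/andP; split; lra.
have := le_trans (coord_le_norm _ i) h; rewrite !mxE ler_norml => /andP[h1 h2].
by apply/andP; split; lra.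
Qed.

Lemma clampv_id m (lo hi x : 'rV[R]_m) : box lo hi x -> clampv lo hi x = x.
Proof. by move=> h; apply/rowP => i; rewrite mxE; apply: clamp_id. Qed.

Lemma clampv_in m (lo hi x : 'rV[R]_m) : (forall i, lo 0 i <= hi 0 i) ->
  box lo hi (clampv lo hi x).
Proof. by move=> h i; rewrite mxE; exact: clamp_in. Qed.

Lemma smv_bounds m l (F : 'rV[R]_m -> 'rV[R]_l) (x0 : 'rV[R]_m) : smv F x0 ->
  exists r L M : R, [/\ 0 < r, 0 <= L, 0 <= M,
    forall x, `|x - x0| <= r -> smv F x /\ `|F x| <= M &
    forall x y, `|x - x0| <= r -> `|y - x0| <= r -> `|F x - F y| <= L * `|x - y|].
Proof.
move=> hF; have [r1 r10 [L L0 hL]] := smv_local_lipschitz hF.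
have /near_normP[r2 r20 hr2] := smv_near hF.
have r0 : 0 < Num.min r1 r2 by rewrite lt_min r10.
have h12 (x : 'rV[R]_m) : `|x - x0| <= Num.min r1 r2 / 2 -> `|x - x0| < r1 /\ `|x - x0| < r2.
  move=> h; have : `|x - x0| < Num.min r1 r2.
    by apply: le_lt_trans h _; rewrite ltr_pdivrMr // ltr_pMr // ltr1n.
  by rewrite lt_min => /andP[].
exists (Num.min r1 r2 / 2), L, (`|F x0| + L * r1); split => //.
- by rewrite divr_gt0.
- by rewrite addr_ge0 // mulr_ge0 // ltW.
- move=> x /h12[hx1 hx2]; split; first exact: hr2.
  have -> : F x = F x0 + (F x - F x0) by rewrite subrKC.
  apply: le_trans (ler_normD _ _) _; rewrite lerD2l.
  apply: le_trans (hL x x0 hx1 _) _; first by rewrite subrr normr0.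
  by apply: ler_wpM2l => //; exact: ltW.
- by move=> x y /h12[hx _] /h12[hy _]; exact: hL.
Qed.

Lemma smv_bounds_le m l (F : 'rV[R]_m -> 'rV[R]_l) (x0 : 'rV[R]_m) (rho : R) : 0 < rho ->
  smv F x0 ->
  exists r L M : R, [/\ 0 < r < rho, 0 <= L, 0 <= M,
    forall x, `|x - x0| <= r -> smv F x /\ `|F x| <= M &
    forall x y, `|x - x0| <= r -> `|y - x0| <= r -> `|F x - F y| <= L * `|x - y|].
Proof.
move=> rho0 /smv_bounds[r [L [M [r0 L0 M0 h1 h2]]]].
have r'0 : 0 < Num.min r rho by rewrite lt_min r0.
have rr : Num.min r rho / 2 < Num.min r rho by rewrite ltr_pdivrMr // ltr_pMr // ltr1n.
exists (Num.min r rho / 2), L, M; split => //.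
- by rewrite divr_gt0 //=; apply: lt_le_trans rr _; rewrite ge_min lexx orbT.
- move=> x hx; apply: h1; apply: le_trans hx _; apply: (le_trans (ltW rr)).
  by rewrite ge_min lexx.
- move=> x y hx hy; apply: h2; (apply: le_trans _ (_ : Num.min r rho <= r); last by rewrite ge_min lexx);
    [apply: le_trans hx _|apply: le_trans hy _]; exact: ltW.
Qed.

(** Over a bounded time Z moves by O(d), so F0 along Z equals F0 x1 + O(d), and the displacement in
    time pi is d pi F0 x1 + O(d^2); F1 contributes only to the remainder. The interval ]-1, 4[
    contains [0, pi]. *)
Lemma slow_flow m (F0 F1 : 'rV[R]_m -> 'rV[R]_m) (x0 : 'rV[R]_m) (rho : R) : 0 < rho ->
  smv F0 x0 -> smv F1 x0 ->
  exists r K d0 : R, [/\ 0 < r, 0 <= K, 0 < d0 &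
    forall (x1 : 'rV[R]_m) (d : R), `|x1 - x0| < r -> 0 < d < d0 ->
    exists Z : R -> 'rV[R]_m, [/\ Z 0 = x1,
      forall t : R, -1 < t < 4 -> `|Z t - x0| < rho /\
        forall i, is_derive t (1 : R) (fun s : R => Z s 0 i)
          (d * (F0 (Z t) 0 i + d * F1 (Z t) 0 i)) &
      `|Z pi - x1 - (d * pi) *: F0 x1| <= K * d ^+ 2]].
Proof.
move=> rho0 s0 s1.
have [r1 [L0 [M0 [/andP[r10 r1rho] L00 M00 h01 h02]]]] := smv_bounds_le rho0 s0.
have [r [L1 [M1 [/andP[rp rr1] L10 M10 h11 h12]]]] := smv_bounds_le r10 s1.
have h01' x : `|x - x0| <= r -> smv F0 x /\ `|F0 x| <= M0.
  by move=> hx; apply: h01; apply: le_trans hx (ltW rr1).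
pose M := M0 + M1; have Mp : 0 <= M by rewrite addr_ge0.
(* The second bound keeps the displacement below r / 2 for |t| <= 4; d < 1 lets M bound F0 + d
   F1. *)
pose d0 : R := Num.min 1 (r / (16 * M + 1)).
have M16 : 0 < 16 * M + 1 by lra.
have d00 : 0 < d0 by rewrite lt_min ltr01 /= divr_gt0.
exists (r / 2), (4 * (8 * L0 * M + M1)), d0; split => //; first by rewrite divr_gt0.
  by rewrite !mulr_ge0 // addr_ge0 // mulr_ge0 // mulr_ge0.
move=> x1 d x1r /andP[dp]; rewrite lt_min => /andP[d1 dr].
have {}dr : d * (8 * M) < r / 2.
  by move: dr; rewrite ltr_pdivlMr // => dr; lra.
pose f x := d *: (F0 x + d *: F1 x).
pose lo := x0 - const_mx r; pose hi := x0 + const_mx r.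
have lohi i : lo 0 i <= hi 0 i by rewrite !mxE; lra.
have bb x : box lo hi x -> `|x - x0| <= r by move/(box_ball _ _ (ltW rp)).
have [|Z Z0 dZ] := @ode_box R m f lo hi x1 lohi.
  move=> x /bb hx; have [sF0 _] := h01' x hx; have [sF1 _] := h11 x hx.
  move=> j; apply: (sm_ext (f := fun u => d * (F0 u 0 j + d * F1 u 0 j))).
    by apply: near_all => u; rewrite !mxE.
  apply: sm_mul; first exact: sm_cst.
  apply: sm_add; first exact: sF0.
  by apply: sm_mul; [exact: sm_cst|exact: sF1].
have fb x i : `|x - x0| <= r -> `|f x 0 i| <= d * M.
  move=> hx; have [_ hF0] := h01' x hx; have [_ hF1] := h11 x hx.
  rewrite !mxE normrM (gtr0_norm dp); apply: ler_wpM2l; first exact: ltW.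
  apply: le_trans (ler_normD _ _) _; rewrite normrM (gtr0_norm dp); apply: lerD.
    by apply: le_trans (coord_le_norm _ _) hF0.
  apply: (@le_trans _ _ (1 * M1)); last by rewrite mul1r.
  apply: ler_pM => //; [exact: ltW|exact: ltW|].
  by apply: le_trans (coord_le_norm _ _) hF1.
have disp (t : R) : `|t| <= 4 -> `|Z t - x1| <= d * (8 * M).
  move=> t4; apply: norm_le_coord => [|i]; first by rewrite mulr_ge0 ?(ltW dp) // mulr_ge0.
  have := @MVT_bound_sym (fun s => Z s 0 i) (fun s => f (clampv lo hi (Z s)) 0 i) t (d * M).
  feed.
    move=> s _; split; first exact: dZ.
    by apply: fb; apply: bb; exact: clampv_in.
  rewrite Z0 !mxE => hh; apply: le_trans hh _.
  have := ler_wpM2l (mulr_ge0 (ltW dp) Mp) t4; have := mulr_ge0 (ltW dp) Mp; lra.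
have inb (t : R) : `|t| <= 4 -> `|Z t - x0| < r.
  move=> /disp hd; have -> : Z t - x0 = (Z t - x1) + (x1 - x0).
    by apply/rowP => i; rewrite !mxE; ring.
  apply: le_lt_trans (ler_normD _ _) _; lra.
have dZ' (t : R) i : `|t| <= 4 -> is_derive t (1 : R) (fun s : R => Z s 0 i)
          (d * (F0 (Z t) 0 i + d * F1 (Z t) 0 i)).
  move=> t4; have := dZ t i; rewrite clampv_id ?mxE // /f ?mxE //.
  by apply/(box_ball _ _ (ltW rp)); exact/ltW/inb.
exists Z; split => // [t /andP[t1 t4]|].
  have t4' : `|t| <= 4 by rewrite ler_norml; apply/andP; split; lra.
  split; first by apply: lt_trans (inb t t4') _; exact: lt_trans r1rho.
  by move=> i; exact: dZ'.
have pi4 : pi <= 4 :> R by have /andP[h1 h2] := @pihalf_02 R; lra.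
have pi0 : 0 <= pi :> R by exact: pi_ge0.
apply: norm_le_coord => [|i].
  by rewrite mulr_ge0 ?sqr_ge0 // mulr_ge0 // addr_ge0 // mulr_ge0 // mulr_ge0.
have in4 (s : R) : 0 <= s <= pi -> `|s| <= 4.
  by move=> /andP[s0' sp]; rewrite ger0_norm //; apply: le_trans sp pi4.
(* The deviation from uniform motion has a derivative of order d^2. *)
have := @MVT_bound R (fun s => Z s 0 i - (d * F0 x1 0 i) * s) _ 0 pi (d ^+ 2 * (8 * L0 * M + M1)) pi0
  (fun s hs => isdB (dZ' s i (in4 s hs)) (isdZ (d * F0 x1 0 i) (isd_id s))).
feed.
  move=> s /in4 s4; have hz := ltW (inb s s4).
  have [_ hF1] := h11 _ hz.
  have hx1 : `|x1 - x0| <= r1 by have := ltW x1r; lra.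
  have e0 : `|F0 (Z s) 0 i - F0 x1 0 i| <= L0 * (d * (8 * M)).
    have := coord_le_norm (F0 (Z s) - F0 x1) i; rewrite !mxE => /le_trans; apply.
    apply: le_trans (h02 _ _ _ hx1) _; first exact: le_trans hz (ltW rr1).
    by apply: ler_wpM2l => //; exact: disp.
  have e1 : `|F1 (Z s) 0 i| <= M1 by apply: le_trans (coord_le_norm _ _) hF1.
  have -> : d * (F0 (Z s) 0 i + d * F1 (Z s) 0 i) - d * F0 x1 0 i * 1
    = d * (F0 (Z s) 0 i - F0 x1 0 i) + d ^+ 2 * F1 (Z s) 0 i by ring.
  have -> : d ^+ 2 * (8 * L0 * M + M1) = d * (L0 * (d * (8 * M))) + d ^+ 2 * M1 by ring.
  apply: le_trans (ler_normD _ _) _; rewrite !normrM (gtr0_norm dp).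
  by apply: lerD; apply: ler_wpM2l => //; [exact: ltW|exact: sqr_ge0].
rewrite mulr0 !subr0 Z0 => hh.
rewrite !mxE [X in `|X|](_ : _ = Z pi 0 i - d * F0 x1 0 i * pi - x1 0 i); last by ring.
apply: le_trans hh _.
have -> : 4 * (8 * L0 * M + M1) * d ^+ 2 = d ^+ 2 * (8 * L0 * M + M1) * 4 by ring.
by apply: ler_wpM2l => //; rewrite mulr_ge0 ?sqr_ge0 // addr_ge0 // !mulr_ge0.
Qed.

(** N expR (- c t) is nonincreasing for t >= 0 and N expR (c t) nondecreasing for t <= 0. *)
Lemma gronwall_sym (N dN : R -> R) (t c : R) :
  (forall s : R, `|s| <= `|t| -> is_derive s (1 : R) N (dN s) /\ `|dN s| <= c * N s) ->
  N t <= N 0 * expR (c * `|t|).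
Proof.
move=> h.
have de (k s : R) : is_derive s (1 : R) (fun u => expR (k * u)) (k * expR (k * s)).
  exact: (isd_scale_arg (is_derive_expR (k * s))).
have [t0|t0] := lerP 0 t.
  rewrite (ger0_norm t0) in h *.
  have h' (s : R) : 0 <= s <= t -> is_derive s (1 : R) N (dN s) /\ `|dN s| <= c * N s.
    by move=> /andP[s0 st]; apply: h; rewrite ger0_norm.
  have := @MVT_ge0 R (fun s => - (N s * expR (- c * s))) _ 0 t t0
    (fun s hs => isdN (isdM (h' s hs).1 (de (- c) s))).
  feed.
    move=> s /h' [_]; rewrite ler_norml => /andP[_ hs]; set w := expR _.
    have -> : - (dN s * w + N s * (- c * w)) = (c * N s - dN s) * w by ring.
    by rewrite mulr_ge0 ?subr_ge0 // ltW // expR_gt0.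
  rewrite lerN2 mulr0 expR0 mulr1 mulNr expRN => hh.
  by rewrite -ler_pdivrMr ?expR_gt0.
rewrite (ltr0_norm t0) in h *.
have h' (s : R) : t <= s <= 0 -> is_derive s (1 : R) N (dN s) /\ `|dN s| <= c * N s.
  by move=> /andP[st s0]; apply: h; rewrite (ler0_norm s0) lerN2.
have := @MVT_ge0 R (fun s => N s * expR (c * s)) _ t 0 (ltW t0)
    (fun s hs => isdM (h' s hs).1 (de c s)).
feed.
  move=> s /h' [_]; rewrite ler_norml => /andP[hs _]; set w := expR _.
  have -> : dN s * w + N s * (c * w) = (dN s + c * N s) * w by ring.
  by rewrite mulr_ge0 -?lerBlDr ?sub0r // ltW // expR_gt0.
rewrite mulr0 expR0 mulr1 mulrN expRN => hh.
by rewrite ler_pdivlMr ?expR_gt0.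
Qed.

Lemma row_mx_norm_le m l (a : 'rV[R]_m) (b : 'rV[R]_l) (c : R) : 0 <= c ->
  `|a| <= c -> `|b| <= c -> `|row_mx a b| <= c.
Proof.
move=> c0 ha hb; apply: norm_le_coord => // i; case: (split_ordP i) => j ->.
  by rewrite row_mxEl; exact: le_trans (coord_le_norm _ _) ha.
by rewrite row_mxEr; exact: le_trans (coord_le_norm _ _) hb.
Qed.

Lemma const_norm_le l (c : R) : `|const_mx c : 'rV[R]_l| <= `|c|.
Proof. by apply: norm_le_coord => // i; rewrite mxE. Qed.

Lemma clamp_sym_le (b y : R) : 0 <= b -> `|clamp (- b) b y| <= `|y|.
Proof.
move=> b0; have := clamp_lip (- b) b y 0; rewrite (@clamp_id _ _ _ 0) ?subr0 //.
by rewrite oppr_le0 b0.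
Qed.

Section OscFlow.
Variables (m : nat) (G : 'rV[R]_(m + 1) -> 'rV[R]_m) (E : 'rV[R]_(m + 1) -> R).

(** The state is ((x, y), v) with slow x, and the system is x' = d y^2 G, y' = v, v' = - y E, where
    G and E are taken at (x, d y^2). In the application d = k^-2 and d y^2 is the coordinate s =
    sigma^2. *)
Definition osc_field (d : R) (s : 'rV[R]_(m + 1 + 1)) : 'rV[R]_(m + 1 + 1) :=
  let y := lsubmx s 0 (rshift m 0) in
  let z := row_mx (lsubmx (lsubmx s)) (const_mx (d * (y * y))) in
  row_mx (row_mx (d * (y * y) *: G z) (const_mx (rsubmx s 0 0)))
         (const_mx (- y * E z)).

Lemma osc_field_smv (d : R) (s : 'rV[R]_(m + 1 + 1)) :
  let y := lsubmx s 0 (rshift m 0) in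
  let z := row_mx (lsubmx (lsubmx s)) (const_mx (d * (y * y))) in
  smv G z -> sm E z -> smv (osc_field d) s.
Proof.
move=> y z hG hE.
have sy : sm (fun s : 'rV[R]_(m + 1 + 1) => lsubmx s 0 (rshift m 0)) s.
  by apply: sm_ext (sm_coord (lshift 1 (rshift m 0)) s); apply: near_all => u; rewrite mxE.
have syy : sm (fun s : 'rV[R]_(m + 1 + 1) => d * (lsubmx s 0 (rshift m 0) * lsubmx s 0 (rshift m 0))) s.
  by apply: sm_mul; [exact: sm_cst|exact: sm_mul].
have sz : smv (fun s : 'rV[R]_(m + 1 + 1) => row_mx (lsubmx (lsubmx s))
    (const_mx (d * (lsubmx s 0 (rshift m 0) * lsubmx s 0 (rshift m 0)))) : 'rV[R]_(m + 1)) s.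
  move=> j; case: (split_ordP j) => k ->.
    apply: sm_ext (sm_coord (lshift 1 (lshift 1 k)) s); apply: near_all => u.
    by rewrite row_mxEl !mxE.
  by apply: sm_ext syy; apply: near_all => u; rewrite row_mxEr !mxE.
move=> j; case: (split_ordP j) => k ->; last first.
  apply: (sm_ext (f := fun s : 'rV[R]_(m + 1 + 1) => - lsubmx s 0 (rshift m 0) * E (row_mx (lsubmx (lsubmx s))
    (const_mx (d * (lsubmx s 0 (rshift m 0) * lsubmx s 0 (rshift m 0))))))).
    by apply: near_all => u; rewrite /osc_field row_mxEr [RHS]mxE.
  by apply: sm_mul; [exact: sm_opp|exact: (sm_comp sz)].
case: (split_ordP k) => l ->.
  apply: (sm_ext (f := fun s : 'rV[R]_(m + 1 + 1) => d * (lsubmx s 0 (rshift m 0) * lsubmx s 0 (rshift m 0)) * G (row_mx (lsubmx (lsubmx s))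
    (const_mx (d * (lsubmx s 0 (rshift m 0) * lsubmx s 0 (rshift m 0))))) 0 l)).
    by apply: near_all => u; rewrite /osc_field row_mxEl row_mxEl [RHS]mxE.
  by apply: sm_mul => //; exact: (sm_comp (f := fun z => G z 0 l) sz).
apply: sm_ext (sm_coord (rshift (m + 1) 0) s); apply: near_all => u.
by rewrite /osc_field row_mxEl row_mxEr !mxE.
Qed.

(** In a bounded time x moves by O(d), so E is w^2 + O(d) along the motion, and in the time w t the
    pair (w y, v) is an O(d)-perturbation of a rotation: the next zero of y is at pi / w + O(d).
    Since 1 - v^2 = w^2 y^2 + O(d), the function t - y v has the derivative 2 w^2 y^2 + O(d); as y
    vanishes at both ends, the integral of y^2 is pi / (2 w^3) + O(d). *)
Lemma osc_flow (x0 : 'rV[R]_m) (rho : R) : 0 < rho ->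
  smv G (row_mx x0 0) -> sm E (row_mx x0 0) -> 0 < E (row_mx x0 0) ->
  exists r K d0 : R, [/\ 0 < r, 0 <= K, 0 < d0 &
    forall (x1 : 'rV[R]_m) (d : R), `|x1 - x0| < r -> 0 < d < d0 ->
    exists (x : R -> 'rV[R]_m) (y v : R -> R) (a b tau : R),
    let w := Num.sqrt (E (row_mx x1 0)) in
    [/\ [/\ a < 0, 0 < tau, tau < b, x 0 = x1 & (y 0 = 0 /\ v 0 = 1)],
      forall t : R, a < t < b ->
        [/\ `|x t - x0| < rho, d * (y t * y t) < rho,
          forall i, is_derive t (1 : R) (fun s : R => x s 0 i)
            (d * (y t * y t) * G (row_mx (x t) (const_mx (d * (y t * y t)))) 0 i),
          is_derive t (1 : R) y (v t) &
          is_derive t (1 : R) v (- y t * E (row_mx (x t) (const_mx (d * (y t * y t)))))],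
      forall t : R, 0 < t < tau -> 0 < y t,
      y tau = 0 /\ v tau < 0 &
      `|x tau - x1 - (d * (pi / (2 * w ^+ 3))) *: G (row_mx x1 0)| <= K * d ^+ 2]].
Proof.
move=> rho0 sG sE E0; set z0 := row_mx x0 0 in sG sE E0.
pose GE (z : 'rV[R]_(m + 1)) : 'rV[R]_(m + 1) := row_mx (G z) (const_mx (E z)).
have sGE : smv GE z0.
  move=> j; case: (split_ordP j) => k ->.
    by apply: sm_ext (sG k); apply: near_all => u; rewrite row_mxEl.
  by apply: sm_ext sE; apply: near_all => u; rewrite row_mxEr mxE.
have [r1 [L [M [r10 L0 M0 hb hl]]]] := smv_bounds sGE.
set w0 := E z0 in E0.
(* The last term makes L rr <= w0 / 2, hence E >= w0 / 2 = [kap] on the ball. *)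
pose rr : R := Num.min (Num.min r1 (rho / 2)) (w0 / (2 * (L + 1))).
have rr0 : 0 < rr by rewrite !lt_min r10 !divr_gt0 // mulr_gt0 // ltr_wpDl.
have rr_r1 : rr <= r1 by rewrite /rr !ge_min lexx.
have rr_rho : rr <= rho / 2 by rewrite /rr !ge_min lexx orbT.
have rr_rho1 : rr <= rho by lra.
have rr2_rho : rr / 2 < rho by lra.
have rr_w : rr * (2 * (L + 1)) <= w0.
  by rewrite -ler_pdivlMr ?mulr_gt0 ?ltr_wpDl // /rr ge_min lexx orbT.
have hG z : `|z - z0| <= rr -> [/\ smv G z, sm E z, `|G z| <= M & `|E z| <= M].
  move=> hz; have [sz bz] := hb z (le_trans hz rr_r1); split.
  - by move=> k; apply: sm_ext (sz (lshift 1 k)); apply: near_all => u; rewrite row_mxEl.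
  - by apply: sm_ext (sz (rshift m 0)); apply: near_all => u; rewrite row_mxEr mxE.
  - apply: norm_le_coord => // k; apply: le_trans bz.
    by have := coord_le_norm (GE z) (lshift 1 k); rewrite row_mxEl.
  - by apply: le_trans bz; have := coord_le_norm (GE z) (rshift m 0); rewrite row_mxEr mxE.
have lipG z z' i : `|z - z0| <= rr -> `|z' - z0| <= rr -> `|G z 0 i - G z' 0 i| <= L * `|z - z'|.
  move=> hz hz'; apply: le_trans (hl z z' (le_trans hz rr_r1) (le_trans hz' rr_r1)).
  have := coord_le_norm (GE z - GE z') (lshift 1 i).
  by rewrite [X in `|X| <= _]mxE [X in _ + X]mxE !row_mxEl.
have lipE z z' : `|z - z0| <= rr -> `|z' - z0| <= rr -> `|E z - E z'| <= L * `|z - z'|.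
  move=> hz hz'; apply: le_trans (hl z z' (le_trans hz rr_r1) (le_trans hz' rr_r1)).
  have := coord_le_norm (GE z - GE z') (rshift m 0).
  by rewrite [X in `|X| <= _]mxE [X in _ + X]mxE !row_mxEr !mxE.
pose kap : R := w0 / 2; have kap0 : 0 < kap by rewrite divr_gt0.
have Ekap z : `|z - z0| <= rr -> kap <= E z.
  move=> hz; have := lipE z z0 hz; feed; first by rewrite subrr normr0 ltW.
  rewrite ler_norml -/w0 => /andP[h1 _].
  have h2 : L * `|z - z0| <= L * rr by exact: ler_wpM2l.
  by rewrite /kap; lra.
pose k : R := Num.sqrt kap; have k0 : 0 < k by rewrite sqrtr_gt0.
have kk : k * k = kap by rewrite -expr2 sqr_sqrtr // ltW.
(* The rotation is controlled up to the rescaled time 6, that is up to t = 6 / w <= 6 / k; the extra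
   1 leaves room for an open interval. *)
pose T : R := 6 / k + 1.
have T1 : 1 <= T by rewrite /T lerDr divr_ge0 // ltW.
have T0 : 0 < T by apply: lt_le_trans T1.
(* Bound for |y| and |v| up to the time T: Gronwall for y^2 + v^2, which starts at 1 and grows at
   the rate 1 + M at most. *)
pose Rb : R := expR ((1 + M) * T).
have Rb1 : 1 <= Rb.
  rewrite -[leLHS]expR0 ler_expR; apply: mulr_ge0; last exact: ltW.
  exact: addr_ge0.
have Rb0 : 0 <= Rb by apply: le_trans Rb1.
pose Lc : R := L * (Rb * Rb * (1 + M * T)).
have RbT0 : 0 <= Rb * Rb * (1 + M * T).
  posi.
have Lc0 : 0 <= Lc by rewrite mulr_ge0.
pose C3 : R := Rb * Lc / k.
have C30 : 0 <= C3 by posi.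
(* For d D < 1 the second term keeps x and d y^2 in the ball, and the third gives d [C3] < 1/48,
   where d [C3] bounds the perturbation of the rotation. *)
pose D : R := 1 + 2 * (Rb * Rb * (1 + M * T)) / rr + 48 * C3.
have D1 : 0 < D.
  by rewrite /D -addrA ltr_pwDl //; posi.
(* [K1] bounds the error of the velocity after subtraction of the corrected mean drift; [K2] comes
   from replacing tau by pi / w. *)
pose K1 : R := Rb * Rb * Lc + M / (2 * kap) * (18 * C3 + Rb * Rb * Lc).
have K10 : 0 <= K1.
  by rewrite /K1; posi.
pose K2 : R := M * 24 * C3 / (2 * kap * k).
have K20 : 0 <= K2.
  by rewrite /K2; posi.
exists (rr / 2), (K1 * T + K2), D^-1; split.
- by rewrite divr_gt0.
- posi.
- by rewrite invr_gt0.
move=> x1 d x1r /andP[d0 dD].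
have {}dD : d * D < 1 by rewrite -ltr_pdivlMr // mul1r.
have dRb : d * (Rb * Rb * (1 + M * T)) < rr / 2.
  have : d * (2 * (Rb * Rb * (1 + M * T)) / rr) < 1.
    apply: le_lt_trans dD; apply: ler_wpM2l; first exact: ltW.
    by rewrite /D; lra.
  rewrite !mulrA ltr_pdivrMr // mul1r; lra.
have dC3 : d * C3 < 1 / 48.
  have : d * (48 * C3) < 1.
    apply: le_lt_trans dD; apply: ler_wpM2l; first exact: ltW.
    have : 0 <= 2 * (Rb * Rb * (1 + M * T)) / rr by posi.
    by rewrite /D; lra.
  lra.
have dRb1 : d * (Rb * Rb) <= rr / 2.
  apply: le_trans (ltW dRb); apply: ler_wpM2l; first exact: ltW.
  by rewrite ler_peMr ?mulr_ge0 // lerDl mulr_ge0 // ltW.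
pose lo : 'rV[R]_(m + 1 + 1) := row_mx (row_mx (x0 - const_mx rr) (const_mx (- Rb))) (const_mx (- Rb)).
pose hi : 'rV[R]_(m + 1 + 1) := row_mx (row_mx (x0 + const_mx rr) (const_mx Rb)) (const_mx Rb).
have lohi i : lo 0 i <= hi 0 i.
  case: (split_ordP i) => j ->; last by rewrite !row_mxEr !mxE; lra.
  rewrite !row_mxEl; case: (split_ordP j) => l ->; last by rewrite !row_mxEr !mxE; lra.
  by rewrite !row_mxEl !mxE; lra.
pose px (s : 'rV[R]_(m + 1 + 1)) : 'rV[R]_m := lsubmx (lsubmx s).
pose py (s : 'rV[R]_(m + 1 + 1)) : R := lsubmx s 0 (rshift m 0).
pose pv (s : 'rV[R]_(m + 1 + 1)) : R := rsubmx s 0 0.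
have boxE s : box lo hi s <-> [/\ `|px s - x0| <= rr, `|py s| <= Rb & `|pv s| <= Rb].
  split => [hs|[hx hy hv] i].
    split.
    - apply/(box_ball _ _ (ltW rr0)) => i; have := hs (lshift 1 (lshift 1 i)).
      by rewrite !row_mxEl /px !mxE.
    - have := hs (lshift 1 (rshift m 0)); rewrite !row_mxEl !row_mxEr !mxE => ?.
      by rewrite /py mxE ler_norml.
    - have := hs (rshift (m + 1) 0); rewrite !row_mxEr !mxE => ?.
      by rewrite /pv mxE ler_norml.
  case: (split_ordP i) => j ->.
    rewrite !row_mxEl; case: (split_ordP j) => l ->.
      rewrite !row_mxEl; have /(box_ball _ _ (ltW rr0)) := hx.
      by move=> /(_ l); rewrite /px [lsubmx (lsubmx s) 0 l]mxE [lsubmx s 0 _]mxE.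
    rewrite !row_mxEr !mxE -ler_norml; move: hy; rewrite /py mxE.
    by rewrite (ord1 l).
  by rewrite !row_mxEr !mxE -ler_norml; move: hv; rewrite /pv mxE (ord1 j).
have eta_b (y : R) : `|y| <= Rb -> 0 <= d * (y * y) <= rr / 2.
  move=> yb; apply/andP; split; first by rewrite mulr_ge0 ?(ltW d0) // -expr2 sqr_ge0.
  apply: le_trans dRb1; apply: ler_wpM2l; first exact: ltW.
  rewrite -expr2 -real_normK ?num_real // expr2.
  by apply: ler_pM.
have zin (x : 'rV[R]_m) (y : R) : `|x - x0| <= rr -> `|y| <= Rb ->
    `|row_mx x (const_mx (d * (y * y))) - z0| <= rr.
  move=> hx /eta_b /andP[h1 h2].
  rewrite /z0 opp_row_mx add_row_mx subr0; apply: row_mx_norm_le => //; first exact: ltW.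
  apply: le_trans (const_norm_le _ _) _; rewrite ger0_norm //; lra.
pose s1 : 'rV[R]_(m + 1 + 1) := row_mx (row_mx x1 0) 1.
(* The clamped system is solved for all times; the bounds below show that for |t| <= T the solution
   does not leave the box, so that clamping is the identity there. *)
have [|Z Z0 dZ] := @ode_box R _ (osc_field d) lo hi s1 lohi.
  move=> s /boxE[hx hy hv]; apply: osc_field_smv.
    by have [] := hG _ (zin _ _ hx hy).
  by have [] := hG _ (zin _ _ hx hy).
pose cl t := clampv lo hi (Z t).
have clb t : [/\ `|px (cl t) - x0| <= rr, `|py (cl t)| <= Rb & `|pv (cl t)| <= Rb].
  by apply/boxE; exact: clampv_in.
pose x (t : R) := px (Z t); pose y (t : R) := py (Z t); pose v (t : R) := pv (Z t).
have pycl t : `|py (cl t)| <= `|y t|.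
  have e1 : lo 0 (lshift 1 (rshift m 0)) = - Rb by rewrite row_mxEl row_mxEr mxE.
  have e2 : hi 0 (lshift 1 (rshift m 0)) = Rb by rewrite row_mxEl row_mxEr mxE.
  have -> : py (cl t) = clamp (- Rb) Rb (y t).
    by rewrite /py [LHS]mxE [LHS]mxE e1 e2 /y /py [in RHS]mxE.
  exact: clamp_sym_le.
have pvcl t : `|pv (cl t)| <= `|v t|.
  have e1 : lo 0 (rshift (m + 1) 0) = - Rb by rewrite row_mxEr mxE.
  have e2 : hi 0 (rshift (m + 1) 0) = Rb by rewrite row_mxEr mxE.
  have -> : pv (cl t) = clamp (- Rb) Rb (v t).
    by rewrite /pv [LHS]mxE [LHS]mxE e1 e2 /v /pv [in RHS]mxE.
  exact: clamp_sym_le.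
pose zc (t : R) : 'rV[R]_(m + 1) := row_mx (px (cl t)) (const_mx (d * (py (cl t) * py (cl t)))).
have dx (t : R) i : is_derive t (1 : R) (fun s : R => x s 0 i)
    (d * (py (cl t) * py (cl t)) * G (zc t) 0 i).
  have := dZ t (lshift 1 (lshift 1 i)); rewrite /osc_field !row_mxEl [_ 0 i in X in is_derive _ _ _ X]mxE.
  by apply: is_derive_ext => // s; rewrite /x /px !mxE.
have dy (t : R) : is_derive t (1 : R) y (pv (cl t)).
  have := dZ t (lshift 1 (rshift m 0)); rewrite /osc_field !row_mxEl !row_mxEr [_ 0 0 in X in is_derive _ _ _ X]mxE.
  by apply: is_derive_ext => // s; rewrite /y /py !mxE.
have dv (t : R) : is_derive t (1 : R) v (- py (cl t) * E (zc t)).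
  have := dZ t (rshift (m + 1) 0); rewrite /osc_field !row_mxEr [_ 0 0 in X in is_derive _ _ _ X]mxE.
  by apply: is_derive_ext => // s; rewrite /v /pv !mxE.
have zcb t : `|zc t - z0| <= rr by have [hx hy _] := clb t; exact: zin.
have yv_b (t : R) : `|t| <= T -> `|y t| <= Rb /\ `|v t| <= Rb.
  move=> tT.
  (* The estimate holds for the clamped system because clamping to a symmetric interval does not
     increase |y| and |v|. *)
  pose N (s : R) : R := y s * y s + v s * v s.
  have N0 : N 0 = 1.
    by rewrite /N /y /v /py /pv Z0 /s1 row_mxKl row_mxKr row_mxEr !mxE mul0r add0r mulr1.
  have NT : N t <= N 0 * expR ((1 + M) * `|t|).
    apply: (@gronwall_sym N (fun s => (pv (cl s) * y s + y s * pv (cl s)) +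
       (- py (cl s) * E (zc s) * v s + v s * (- py (cl s) * E (zc s))))) => s _.
    split; first by apply: isdD; exact: isdM.
    have [_ _ _ hE] := hG _ (zcb s).
    have e1 : `|pv (cl s) * y s| <= `|v s| * `|y s| by rewrite normrM ler_wpM2r.
    have e2 : `|py (cl s) * E (zc s) * v s| <= M * (`|v s| * `|y s|).
      rewrite !normrM.
      have -> : M * (`|v s| * `|y s|) = `|y s| * M * `|v s| by ring.
      by apply: ler_wpM2r => //; apply: ler_pM.
    have e3 : 2 * (`|v s| * `|y s|) <= N s.
      rewrite /N -[y s * y s]expr2 -[v s * v s]expr2.
      rewrite -(real_normK (num_real (y s))) -(real_normK (num_real (v s))).
      rewrite -subr_ge0 [X in 0 <= X](_ : _ = (`|y s| - `|v s|) ^+ 2); last by ring.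
      exact: sqr_ge0.
    rewrite [X in `|X|](_ : _ = 2 * (pv (cl s) * y s) - 2 * (py (cl s) * E (zc s) * v s)); last by ring.
    apply: le_trans (ler_normB _ _) _; rewrite !(normrM 2) (ger0_norm (ler0n _ 2)).
    apply: (@le_trans _ _ ((1 + M) * (2 * (`|v s| * `|y s|)))).
      rewrite [leRHS](_ : _ = 2 * (`|v s| * `|y s|) + 2 * (M * (`|v s| * `|y s|))); last by ring.
      by apply: lerD; apply: ler_wpM2l.
    by apply: ler_wpM2l => //; rewrite addr_ge0.
  have NR : N t <= Rb ^+ 2.
    apply: le_trans NT _; rewrite N0 mul1r.
    apply: (@le_trans _ _ Rb); last by rewrite expr2 ler_peMl.
    by rewrite ler_expR ler_wpM2l // addr_ge0.
  have y2 : 0 <= y t * y t by rewrite -expr2 sqr_ge0.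
  have v2 : 0 <= v t * v t by rewrite -expr2 sqr_ge0.
  split; rewrite -ler_sqr ?nnegrE // real_normK ?num_real // expr2;
    by apply: le_trans NR; rewrite /N ?lerDl ?lerDr.
have x_b (t : R) : `|t| <= T -> `|x t - x1| <= d * (Rb * Rb * (M * T)).
  move=> tT; apply: norm_le_coord => [|i].
    posi.
  have := @MVT_bound_sym (fun s => x s 0 i) (fun s => d * (py (cl s) * py (cl s)) * G (zc s) 0 i) t (d * (Rb * Rb) * M).
  feed.
    move=> s _; split; first exact: dx.
    have [hx hy _] := clb s; have [_ _ hGb _] := hG _ (zcb s).
    rewrite normrM; apply: ler_pM => //; last exact: le_trans (coord_le_norm _ _) hGb.
    rewrite !normrM (gtr0_norm d0); apply: ler_wpM2l; first exact: ltW.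
    by apply: ler_pM.
  have -> : x 0 = x1 by rewrite /x /px Z0 /s1 !row_mxKl.
  move=> hh; have -> : (x t - x1) 0 i = x t 0 i - x1 0 i by rewrite !mxE.
  apply: le_trans hh _.
  rewrite [leRHS](_ : _ = d * (Rb * Rb) * M * T); last by ring.
  by apply: ler_wpM2l => //; rewrite !mulr_ge0 // ltW.
have x_in (t : R) : `|t| <= T -> `|x t - x0| < rr.
  move=> tT; have -> : x t - x0 = (x t - x1) + (x1 - x0) by rewrite addrA subrK.
  apply: le_lt_trans (ler_normD _ _) _.
  have := x_b t tT; have : d * (Rb * Rb * (M * T)) <= d * (Rb * Rb * (1 + M * T)).
    apply: ler_wpM2l; [exact: ltW|apply: ler_wpM2l; [exact: mulr_ge0|by rewrite lerDr]].
  lra.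
have clE (t : R) : `|t| <= T -> cl t = Z t.
  move=> tT; apply: clampv_id; apply/boxE; have [h1 h2] := yv_b t tT.
  by split => //; exact/ltW/x_in.
pose zt (t : R) : 'rV[R]_(m + 1) := row_mx (x t) (const_mx (d * (y t * y t))).
have zcE (t : R) : `|t| <= T -> zc t = zt t by move=> /clE; rewrite /zc => ->.
pose z1 : 'rV[R]_(m + 1) := row_mx x1 0.
have z1b : `|z1 - z0| <= rr.
  rewrite /z1 /z0 opp_row_mx add_row_mx subr0; apply: row_mx_norm_le; first exact: ltW.
    by apply: (le_trans (ltW x1r)); lra.
  by rewrite normr0 ltW.
have ztb (t : R) : `|t| <= T -> `|zt t - z0| <= rr by move=> tT; rewrite -zcE.
have zdist (t : R) : `|t| <= T -> L * `|zt t - z1| <= d * Lc.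
  move=> tT; have -> : d * Lc = L * (d * (Rb * Rb * (1 + M * T))) by rewrite /Lc; ring.
  apply: ler_wpM2l => //; rewrite /zt /z1 opp_row_mx add_row_mx subr0.
  have [yb _] := yv_b t tT.
  apply: row_mx_norm_le; first posi.
    apply: le_trans (x_b t tT) _; apply: ler_wpM2l; first exact: ltW.
    by apply: ler_wpM2l; [exact: mulr_ge0|rewrite lerDr].
  apply: le_trans (const_norm_le _ _) _; have /andP[e0 _] := eta_b _ yb; rewrite ger0_norm //.
  apply: ler_wpM2l; first exact: ltW.
  have h1 : y t * y t <= Rb * Rb.
    by rewrite -expr2 -real_normK ?num_real // expr2; apply: ler_pM.
  apply: le_trans h1 _; rewrite ler_peMr ?mulr_ge0 // lerDl.
  posi.
have dx' (t : R) i : `|t| <= T -> is_derive t (1 : R) (fun s : R => x s 0 i)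
    (d * (y t * y t) * G (zt t) 0 i).
  by move=> tT; have := dx t i; rewrite zcE // clE.
have dy' (t : R) : `|t| <= T -> is_derive t (1 : R) y (v t).
  by move=> tT; have := dy t; rewrite clE.
have dv' (t : R) : `|t| <= T -> is_derive t (1 : R) v (- y t * E (zt t)).
  by move=> tT; have := dv t; rewrite zcE // clE.
have x00 : x 0 = x1 by rewrite /x /px Z0 /s1 !row_mxKl.
have y00 : y 0 = 0 by rewrite /y /py Z0 /s1 row_mxKl row_mxEr mxE.
have v00 : v 0 = 1 by rewrite /v /pv Z0 /s1 row_mxKr mxE.
clear dx dy dv dZ clb pycl pvcl zcb zcE clE.
set w := Num.sqrt (E (row_mx x1 0)).
have E1 : kap <= E z1 by exact: Ekap.
have ww : w * w = E z1.
  by rewrite -expr2 sqr_sqrtr // (le_trans _ E1) // ltW.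
have kw : k <= w by rewrite /k /w ler_wsqrtr.
have w_0 : 0 < w by apply: lt_le_trans kw.
have wi : w^-1 <= k^-1 by rewrite lef_pV2.
have iw0 : 0 <= w^-1 by rewrite invr_ge0 ltW.
have wn0 : w != 0 by rewrite gt_eqF.
have timeT (s : R) : 0 <= s <= 6 -> `|w^-1 * s| <= T.
  move=> /andP[s0 s6]; rewrite ger0_norm; last exact: mulr_ge0.
  apply: (@le_trans _ _ (6 / k)); last by rewrite /T lerDl.
  by rewrite mulrC; apply: ler_pM.
have dE (t : R) : `|t| <= T -> `|E (zt t) - E z1| <= d * Lc.
  by move=> tT; apply: le_trans (lipE _ _ (ztb t tT) z1b) (zdist t tT).
have dG (t : R) i : `|t| <= T -> `|G (zt t) 0 i - G z1 0 i| <= d * Lc.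
  by move=> tT; apply: le_trans (lipG _ _ i (ztb t tT) z1b) (zdist t tT).
have dLc0 : 0 <= d * Lc by posi.
have dC30 : 0 <= d * C3 by posi.
(* Time s = w t with Y = w y and V = v; the perturbation is y (w^2 - E) / w. *)
have [] := @near_rotation R (fun s => w * y (w^-1 * s)) (fun s => v (w^-1 * s))
  (fun s => y (w^-1 * s) * (E z1 - E (zt (w^-1 * s))) * w^-1) (d * C3).
- by rewrite dC30 /=; exact: ltW.
- by rewrite mulr0 y00 mulr0.
- by rewrite mulr0 v00.
- move=> s /timeT sT; split.
  + apply: is_derive_ext (isdZ w (isd_scale_arg (dy' _ sT))) => //.
    by rewrite mulVKf.
  + apply: is_derive_ext (isd_scale_arg (dv' _ sT)) => //.
    by rewrite -ww; field.
  + rewrite !normrM (ger0_norm iw0).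
    have -> : d * C3 = Rb * (d * Lc) * k^-1 by rewrite /C3; ring.
    apply: ler_pM; [by rewrite mulr_ge0|by []| |exact: wi].
    apply: ler_pM => //; first by have [] := yv_b _ sT.
    by rewrite distrC; exact: dE.
move=> hN [ts [/andP[ts0 ts6] tpos Yts Vts tspi]].
have tau0 : 0 < w^-1 * ts by rewrite mulr_gt0 // invr_gt0.
have tauT : w^-1 * ts < T.
  have := timeT ts; feed; first by rewrite !ltW.
  move=> _; apply: (@le_lt_trans _ _ (k^-1 * ts)).
    by apply: ler_wpM2r => //; exact: ltW.
  apply: (@lt_trans _ _ (6 / k)); last by rewrite /T ltrDl.
  by rewrite mulrC ltr_pM2r // invr_gt0.
have inT (t : R) : -1 < t < T -> `|t| <= T.
  by move=> /andP[h1 h2]; rewrite ler_norml (ltW h2) andbT (le_trans _ (ltW h1)) // lerN2.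
have ytau : y (w^-1 * ts) = 0.
  by move/eqP: Yts; rewrite mulf_eq0 (negbTE wn0) /= => /eqP.
exists x, y, v, (-1), T, (w^-1 * ts) => /=; split.
- by split.
- move=> t /inT tT; split.
  + exact: lt_le_trans (x_in t tT) rr_rho1.
  + have [yb _] := yv_b t tT; have /andP[_ h] := eta_b _ yb; exact: le_lt_trans h rr2_rho.
  + by move=> i; exact: dx'.
  + exact: dy'.
  + exact: dv'.
- move=> t /andP[t0 tt].
  have wt : 0 < w * t < ts by rewrite mulr_gt0 //= -ltr_pdivlMl.
  by have := tpos _ wt; rewrite mulKf // pmulr_rgt0.
- by split.
have KE : (K1 * T + K2) * d ^+ 2 = d ^+ 2 * K1 * T + d ^+ 2 * K2 by ring.
rewrite KE; apply: norm_le_coord => [|i]; first by posi.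
have g_b : `|G z1 0 i| <= M.
  by have [_ _ hg _] := hG _ z1b; apply: le_trans (coord_le_norm _ _) hg.
set g := G z1 0 i in g_b.
(* The mean drift per unit time: d g times the average 1 / (2 w^2) of y^2. Below, cf (t - y v) is
   subtracted from x, which cancels the oscillating part. *)
pose cf : R := d * g / (2 * (w * w)).
have kapw : kap <= w * w by rewrite ww.
have cfb : `|cf| <= d * (M / (2 * kap)).
  rewrite /cf !normrM (gtr0_norm d0) -mulrA; apply: ler_wpM2l; first exact: ltW.
  apply: ler_pM => //.
  rewrite ger0_norm; last by rewrite invr_ge0 mulr_ge0 // mulr_ge0 // ltW.
  by rewrite lef_pV2 ?posrE ?mulr_gt0 // ler_wpM2l.
have inT2 (t : R) : 0 <= t <= w^-1 * ts -> `|t| <= T.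
  by move=> /andP[h1 h2]; rewrite ger0_norm //; apply: le_trans h2 (ltW tauT).
have := @MVT_bound R (fun t => x t 0 i - cf * (t - y t * v t)) _ 0 (w^-1 * ts) (d ^+ 2 * K1) (ltW tau0)
  (fun t ht => isdB (dx' t i (inT2 t ht)) (isdZ cf (isdB (isd_id t) (isdM (dy' t (inT2 t ht)) (dv' t (inT2 t ht)))))).
feed.
  move=> t ht; have tT := inT2 t ht; have [yb _] := yv_b t tT.
  have hNt : `|1 - v t * v t - w * y t * (w * y t)| <= 18 * (d * C3).
    have := hN (w * t); rewrite mulKf //; apply.
    have /andP[h1 h2] := ht; rewrite mulr_ge0 ?(ltW w_0) //=.
    by apply: le_trans (ltW ts6); rewrite -ler_pdivlMl.
  have y2 : `|y t * y t| <= Rb * Rb by rewrite normrM; apply: ler_pM.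
  have -> : d * (y t * y t) * G (zt t) 0 i - cf * (1 - (v t * v t + y t * (- y t * E (zt t))))
    = d * (y t * y t * (G (zt t) 0 i - g)) - cf * ((1 - v t * v t - w * y t * (w * y t)) + y t * y t * (E (zt t) - E z1)).
    by rewrite -ww /cf; field.
  have -> : d ^+ 2 * K1 = d * (Rb * Rb * (d * Lc)) + d * (M / (2 * kap)) * (18 * (d * C3) + Rb * Rb * (d * Lc)).
    by rewrite /K1; ring.
  apply: le_trans (ler_normB _ _) _; apply: lerD.
    rewrite normrM (gtr0_norm d0); apply: ler_wpM2l; first exact: ltW.
    by rewrite normrM; apply: ler_pM => //; exact: dG.
  rewrite normrM; apply: ler_pM => //.
  apply: le_trans (ler_normD _ _) _; apply: lerD => //.
  by rewrite normrM; apply: ler_pM => //; exact: dE.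
rewrite ytau y00 !mul0r !subr0 mulr0 subr0 x00 => hh.
have -> : (x (w^-1 * ts) - x1 - (d * (pi / (2 * w ^+ 3))) *: G (row_mx x1 0)) 0 i
  = (x (w^-1 * ts) 0 i - cf * (w^-1 * ts) - x1 0 i) + cf * w^-1 * (ts - pi).
  rewrite !mxE -/z1 -/g /cf; field.
  by rewrite wn0.
apply: le_trans (ler_normD _ _) _; apply: lerD.
  apply: le_trans hh _; apply: ler_wpM2l; last exact: ltW.
  by posi.
have -> : d ^+ 2 * K2 = d * (M / (2 * kap)) * k^-1 * (24 * (d * C3)).
  by rewrite /K2; field; rewrite !gt_eqF.
rewrite normrM; apply: ler_pM => //.
by rewrite normrM (ger0_norm iw0); apply: ler_pM.
Qed.

End OscFlow.

End Averaging.

(** * Hamiltonian curves on a cotangent bundle *)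

Section GoodAtlas.
Context {R : realType} {T : topologicalType} {k : nat}.
Implicit Types (A : set (chart R T k)) (c d e : chart R T k) (x : T).

(** The local properties shared by the atlases of Gamma and of the double. T is the ambient space,
    so a chart domain is open only relative to the union of the domains; this is the premise inside
    [ga_dom]. *)
Record good_atlas A : Prop := {
  ga_inv : forall c x, A c -> chart_dom c x -> chart_from c (chart_to c x) = x;
  ga_near : forall c x, A c -> chart_dom c x -> \forall u \near chart_to c x,
    chart_dom c (chart_from c u) /\ chart_to c (chart_from c u) = u;
  ga_from : forall c x, A c -> chart_dom c x -> {for chart_to c x, continuous (chart_from c)};
  ga_dom : forall c x, A c -> chart_dom c x -> \forall y \near x,
    (exists2 d, A d & chart_dom d y) -> chart_dom c y;
  ga_smooth : forall c d x, A c -> A d -> chart_dom c x -> chart_dom d x ->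
    smv (fun u => chart_to d (chart_from c u)) (chart_to c x) }.

Definition trans c d (u : 'rV[R]_k) : 'rV[R]_k := chart_to d (chart_from c u).
Definition tj c d (u : 'rV[R]_k) : 'M[R]_k := 'J (trans c d) u.
Definition tjac c d x : 'M[R]_k := tj c d (chart_to c x).

Variable A : set (chart R T k).
Hypothesis gA : good_atlas A.

Lemma trans_dom c d x : A c -> A d -> chart_dom c x -> chart_dom d x ->
  \forall u \near chart_to c x, [/\ chart_dom c (chart_from c u),
    chart_to c (chart_from c u) = u & chart_dom d (chart_from c u)].
Proof.
move=> Ac Ad cx dx.
have h : \forall u \near chart_to c x, (exists2 e, A e & chart_dom e (chart_from c u)) ->
    chart_dom d (chart_from c u).
  apply: (near_cont_comp (P := fun y => (exists2 e, A e & chart_dom e y) -> chart_dom d y)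
    (ga_from gA Ac cx)).
  by rewrite (ga_inv gA Ac cx); exact: (ga_dom gA).
by apply: near_imp (near_and (ga_near gA Ac cx) h) => u [[h1 h2] h3]; split => //; apply: h3; exists c.
Qed.

Lemma tjE c d (u : 'rV[R]_k) i j : smv (trans c d) u ->
  tj c d u i j = pd i (fun v => trans c d v 0 j) u.
Proof. by move=> h; rewrite /tj (jacE i j h). Qed.

Lemma sm_tj c d (u : 'rV[R]_k) i j : smv (trans c d) u -> sm (fun v => tj c d v i j) u.
Proof. exact: sm_jac. Qed.

Lemma trans_at c d x : A c -> chart_dom c x -> trans c d (chart_to c x) = chart_to d x.
Proof. by move=> Ac cx; rewrite /trans (ga_inv gA). Qed.

Lemma trans_smv c d x : A c -> A d -> chart_dom c x -> chart_dom d x ->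
  smv (trans c d) (chart_to c x).
Proof. exact: (ga_smooth gA). Qed.

Lemma tjac_comp c d e x : A c -> A d -> A e ->
  chart_dom c x -> chart_dom d x -> chart_dom e x ->
  tjac c e x = tjac c d x *m tjac d e x.
Proof.
move=> Ac Ad Ae cx dx ex; rewrite /tjac /tj -(trans_at d Ac cx).
rewrite -jac_comp; [|exact: trans_smv|by rewrite trans_at //; exact: trans_smv].
apply: jac_near; last exact: trans_smv.
apply: near_imp (trans_dom Ac Ad cx dx) => u [_ _ du].
by rewrite /trans (ga_inv gA Ad du).
Qed.

Lemma tjac_id c x : A c -> chart_dom c x -> tjac c c x = 1%:M.
Proof.
move=> Ac cx; rewrite /tjac /tj -(@jac_id R k (chart_to c x)); apply/esym/jac_near.
  by apply: near_imp (ga_near gA Ac cx) => u [_ h]; rewrite /trans h.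
exact: smv_id.
Qed.

Lemma tjac_inv c d x : A c -> A d -> chart_dom c x -> chart_dom d x ->
  tjac c d x *m tjac d c x = 1%:M.
Proof. by move=> Ac Ad cx dx; rewrite -tjac_comp // tjac_id. Qed.

(** The coordinates in the other charts are filled in by the transformation law; the zeros match the
    last clause of [cotangent], so that a covector is determined by its coordinates in one chart
    ([cot_eq]). *)
Definition covlift c (u p : 'rV[R]_k) : covector R T k :=
  (chart_from c u, fun d => if pselect (A d /\ chart_dom d (chart_from c u))
     then p *m (tjac d c (chart_from c u))^T else 0).

Lemma lift_coord c d x p : A d -> chart_dom c x -> A c -> chart_dom d x ->
  (covlift c (chart_to c x) p).2 d = p *m (tjac d c x)^T.
Proof.
move=> Ad cx Ac dx; rewrite /covlift /= (ga_inv gA Ac cx); case: pselect => // h.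
by exfalso; apply: h.
Qed.

Lemma lift_cotangent c x p : A c -> chart_dom c x -> cotangent A (covlift c (chart_to c x) p).
Proof.
move=> Ac cx; have E : (covlift c (chart_to c x) p).1 = x by rewrite /= (ga_inv gA Ac cx).
split; first by exists c; rewrite ?E.
  move=> d e Ad Ae; rewrite E => dx ex.
  rewrite (lift_coord p Ad cx Ac dx) (lift_coord p Ae cx Ac ex) -[RHS]mulmxA -trmx_mul.
  by rewrite (tjac_comp Ad Ae Ac dx ex cx).
by move=> d; rewrite E => nd; rewrite /covlift /= (ga_inv gA Ac cx); case: pselect.
Qed.

Lemma cot_eq c z z' : A c -> chart_dom c z.1 -> cotangent A z -> cotangent A z' ->
  z.1 = z'.1 -> z.2 c = z'.2 c -> z = z'.
Proof.
move=> Ac cz [_ h1 h2] [_ h1' h2'] e1 e2.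
case: z z' e1 e2 cz h1 h2 h1' h2' => [x f] [x' f'] /= <- e2 cx h1 h2 h1' h2'.
congr pair; apply/funext => d; have [[Ad dx]|nd] := pselect (A d /\ chart_dom d x).
  by rewrite (h1 d c) // (h1' d c) // e2.
by rewrite h2 // h2'.
Qed.

Lemma cot_lift c z : A c -> chart_dom c z.1 -> cotangent A z ->
  z = covlift c (chart_to c z.1) (z.2 c).
Proof.
move=> Ac cz hz; apply: (@cot_eq c) => //; first exact: lift_cotangent.
  by rewrite /= (ga_inv gA Ac cz).
by rewrite lift_coord // tjac_id // trmx1 mulmx1.
Qed.

Variable F : chart R T k -> 'rV[R]_k -> 'rV[R]_k -> R.

(** A covector with coordinates P in d has the coordinates [P *m (tjac c d x)^T] in c; so this says
    that F is a well-defined function on the cotangent space at x. *)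
Definition fiber_invariant c x : Prop := forall d, A d -> chart_dom d x ->
  forall P, F c (chart_to c x) (P *m (tjac c d x)^T) = F d (chart_to d x) P.

Lemma fiber_evalE c z : A c -> chart_dom c z.1 -> cotangent A z ->
  fiber_invariant c z.1 -> fiber_eval A F z = F c (chart_to c z.1) (z.2 c).
Proof.
move=> Ac cz hz hF; rewrite /fiber_eval; case: xgetP => [r _ [d [Ad dz ->]]|].
  by have [_ h _] := hz; rewrite -(hF d Ad dz) (h c d Ac Ad cz dz).
by move=> h; case: (h (F c (chart_to c z.1) (z.2 c))); exists c.
Qed.

Definition joint (f : 'rV[R]_k -> 'rV[R]_k -> R) (s : 'rV[R]_(k + k)) : R :=
  f (lsubmx s) (rsubmx s).

Lemma pd_joint_l f (u p : 'rV[R]_k) (i : 'I_k) :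
  pd (lshift k i) (joint f) (row_mx u p) = pd i (fun v => f v p) u.
Proof.
have E : (fun h : R => h^-1 *: ((joint f \o shift (row_mx u p)) (h *: delta_mx 0 (lshift k i)) - joint f (row_mx u p)))
  = (fun h : R => h^-1 *: (((fun v => f v p) \o shift u) (h *: delta_mx 0 i) - f u p)).
  apply/funext => h; rewrite /joint /= delta_mx_lshift scale_row_mx add_row_mx scaler0 add0r.
  by rewrite !row_mxKl !row_mxKr.
by rewrite !pdE /derive E.
Qed.

Lemma pd_joint_r f (u p : 'rV[R]_k) (i : 'I_k) :
  pd (rshift k i) (joint f) (row_mx u p) = pd i (f u) p.
Proof.
have E : (fun h : R => h^-1 *: ((joint f \o shift (row_mx u p)) (h *: delta_mx 0 (rshift k i)) - joint f (row_mx u p)))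
  = (fun h : R => h^-1 *: ((f u \o shift p) (h *: delta_mx 0 i) - f u p)).
  apply/funext => h; rewrite /joint /= delta_mx_rshift scale_row_mx add_row_mx scaler0 add0r.
  by rewrite !row_mxKl !row_mxKr.
by rewrite !pdE /derive E.
Qed.

Lemma sm_joint_r f (u p : 'rV[R]_k) : sm (joint f) (row_mx u p) -> sm (f u) p.
Proof.
move=> h; apply: (sm_ext (f := fun q => joint f (row_mx u q))).
  by apply: near_all => q; rewrite /joint row_mxKl row_mxKr.
apply: (sm_comp (y := fun q => row_mx u q)) => // j; case: (split_ordP j) => l ->.
  by apply: sm_ext (sm_cst (u 0 l) p); apply: near_all => q; rewrite row_mxEl.
by apply: sm_ext (sm_coord l p); apply: near_all => q; rewrite row_mxEr.
Qed.

Lemma sm_joint_l f (u p : 'rV[R]_k) : sm (joint f) (row_mx u p) -> sm (fun v => f v p) u.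
Proof.
move=> h; apply: (sm_ext (f := fun v => joint f (row_mx v p))).
  by apply: near_all => q; rewrite /joint row_mxKl row_mxKr.
apply: (sm_comp (y := fun v => row_mx v p)) => // j; case: (split_ordP j) => l ->.
  by apply: sm_ext (sm_coord l u); apply: near_all => q; rewrite row_mxEl.
by apply: sm_ext (sm_cst (p 0 l) u); apply: near_all => q; rewrite row_mxEr.
Qed.

Lemma isd_mulmx m l (V : normedModType R) (y : V -> 'rV[R]_m) (M : 'M[R]_(m, l))
    (z v : V) (dy : 'rV[R]_m) (j : 'I_l) :
  (forall i, is_derive z v (fun s => y s 0 i) (dy 0 i)) ->
  is_derive z v (fun s => (y s *m M) 0 j) ((dy *m M) 0 j).
Proof.
move=> h; apply: (is_derive_ext (f := fun s => \sum_i y s 0 i * M i j)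
  (df := \sum_i (dy 0 i * M i j + y z 0 i * 0))); last first.
- by apply: isd_sum => i; exact: isdM (h i) (isd_cst (M i j) z v).
- by rewrite mxE; apply: eq_bigr => i _; rewrite mulr0 addr0.
- by move=> s; rewrite mxE.
Qed.

Lemma exists_eq (S : Type) (a : S) : exists b : S, b = a.
Proof. by exists a. Qed.

Lemma trE m l (M : 'M[R]_(m, l)) i j : M^T i j = M j i.
Proof. exact: mxE. Qed.

Lemma row_mul_trE m l (p : 'rV[R]_m) (M : 'M[R]_(l, m)) i :
  (p *m M^T) 0 i = \sum_j p 0 j * M i j.
Proof. by rewrite mxE; apply: eq_bigr => j _; rewrite trE. Qed.

Lemma isd_mulmx_delta l (M : 'M[R]_(k, l)) (P : 'rV[R]_k) (j : 'I_k) (i : 'I_l) :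
  is_derive P (delta_mx 0 j : 'rV[R]_k) (fun q : 'rV[R]_k => (q *m M) 0 i) (M j i).
Proof.
have h := isd_mulmx M i (derive_lin_coord P (delta_mx 0 j)).
have e : (delta_mx 0 j *m M : 'rV[R]_l) 0 i = M j i by rewrite -rowE mxE.
by rewrite -e.
Qed.

(* In the chart c the equations are u' = dF/dp, p' = - dF/du; the second
   derivatives of the transition map enter p' symmetrically and cancel. *)
Lemma hamiltonian_chart_change c d (u p : R -> 'rV[R]_k) (t : R) (x : T) :
  A c -> A d -> chart_dom c x -> chart_dom d x -> chart_to c x = u t ->
  (forall y, chart_dom c y -> fiber_invariant c y) ->
  sm (joint (F c)) (row_mx (u t) (p t)) ->
  (forall i, is_derive t (1 : R) (fun s : R => u s 0 i) (pd i (F c (u t)) (p t))) ->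
  (forall i, is_derive t (1 : R) (fun s : R => p s 0 i) (- pd i (fun v => F c v (p t)) (u t))) ->
  forall V P : R -> 'rV[R]_k, (forall s, V s = trans c d (u s)) ->
  (forall s, P s = p s *m (tj d c (V s))^T) ->
  forall i, is_derive t (1 : R) (fun s : R => V s 0 i) (pd i (F d (V t)) (P t)) /\
    is_derive t (1 : R) (fun s : R => P s 0 i) (- pd i (fun v => F d v (P t)) (V t)).
Proof.
move=> Ac Ad cx dx xE hF sF du dp V P VE PE.
have Vt : V t = chart_to d x by rewrite VE -xE trans_at.
have sV : smv (trans c d) (u t) by rewrite -xE; exact: trans_smv.
have sX : smv (trans d c) (V t) by rewrite Vt; exact: trans_smv.
have [J J0] := exists_eq (tj c d (u t)).
have [J' J0'] := exists_eq (tj d c (V t)).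
have JE : J = tjac c d x by rewrite J0 -xE; reflexivity.
have J'E : J' = tjac d c x by rewrite J0' Vt; reflexivity.
have JJ' : J *m J' = 1%:M by rewrite JE J'E tjac_inv.
have J'J : J' *m J = 1%:M by rewrite JE J'E tjac_inv.
have PJ : P t *m J^T = p t by rewrite PE -J0' -mulmxA -trmx_mul JJ' trmx1 mulmx1.
have dV j : is_derive t (1 : R) (fun s : R => V s 0 j) (\sum_l pd l (F c (u t)) (p t) * J l j).
  have := @sm_comp_derive R k R (fun v => trans c d v 0 j) u t 1 (\row_l pd l (F c (u t)) (p t)) (sV j).
  feed; first by move=> l; rewrite mxE; exact: du.
  move=> h; rewrite (_ : (fun s => V s 0 j) = fun s => trans c d (u s) 0 j); last first.
    by apply/funext => s; rewrite VE.
  apply: (is_derive_eq h); apply: eq_bigr => l _.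
  by rewrite mxE J0 (tjE l j sV).
have Fp j : pd j (F d (V t)) (P t) = \sum_l pd l (F c (u t)) (p t) * J l j.
  have -> : F d (V t) = (fun q => F c (u t) (q *m J^T)).
    by apply/funext => q; rewrite Vt -xE JE (hF x cx d Ad dx).
  have := @sm_comp_derive R k _ (F c (u t)) (fun q : 'rV[R]_k => q *m J^T) (P t) (delta_mx 0 j) (\row_l J l j).
  rewrite PJ; feed; first exact: sm_joint_r sF.
  feed.
    by move=> l; rewrite [X in is_derive _ _ _ X]mxE -(trE J j l); exact: isd_mulmx_delta.
  rewrite pdE => -[_ ->]; apply: eq_bigr => l _; by rewrite mxE mulrC.
have nt : \forall s \near t, [/\ chart_dom c (chart_from c (u s)),
    chart_to c (chart_from c (u s)) = u s & chart_dom d (chart_from c (u s))].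
  have cu : {for t, continuous u} by apply: continuous_row => i; exact: is_derive1_cont.
  apply: (near_cont_comp (P := fun v => [/\ chart_dom c (chart_from c v),
    chart_to c (chart_from c v) = v & chart_dom d (chart_from c v)]) cu).
  by rewrite -xE; exact: trans_dom.
(* P is differentiable as a product of differentiable factors; the value D of its derivative is not
   read off here but determined from the two relations below. *)
have /choice[D dP] : forall j, exists Dj : R, is_derive t (1 : R) (fun s : R => P s 0 j) Dj.
  move=> j; have dJ i : exists e : R, is_derive t (1 : R) (fun s : R => tj d c (V s) j i) e.
    have := @sm_comp_derive R k R (fun v => tj d c v j i) V t 1
      (\row_l \sum_l' pd l' (F c (u t)) (p t) * J l' l) (sm_tj j i sX).
    feed; first by move=> l; rewrite mxE; exact: dV.
    by move=> h; eexists; exact: h.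
  have /choice[e he] := dJ.
  exists (\sum_i (- pd i (fun v => F c v (p t)) (u t) * tj d c (V t) j i + p t 0 i * e i)).
  have h : is_derive t (1 : R) (fun s : R => \sum_i p s 0 i * tj d c (V s) j i)
     (\sum_i (- pd i (fun v => F c v (p t)) (u t) * tj d c (V t) j i + p t 0 i * e i)).
    by apply: isd_sum => i; exact: isdM (dp i) (he i).
  apply: (is_derive_ext _ erefl h).
  by move=> s; rewrite PE row_mul_trE.
have [q q0] := exists_eq (P t).
have qJ : q *m J^T = p t by rewrite q0.
(* Differentiation in time of p = P J^T. *)
have EQ1 i : - pd i (fun v => F c v (p t)) (u t)
  = \sum_j (D j * J i j + q 0 j * \sum_l pd l (F c (u t)) (p t) * pd l (fun v => tj c d v i j) (u t)).
  have [_ <-] := dp i.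
  suff : is_derive t (1 : R) (fun s : R => p s 0 i) (\sum_j (D j * J i j + q 0 j * \sum_l pd l (F c (u t)) (p t) * pd l (fun v => tj c d v i j) (u t))) by move=> [_ ->].
  apply: (is_derive_near (f := fun s => \sum_j P s 0 j * tj c d (u s) i j)).
    apply: near_imp nt => s [cs us ds].
    have inv : tj c d (u s) *m tj d c (V s) = 1%:M.
      have := tjac_inv Ac Ad cs ds; rewrite /tjac us.
      by rewrite VE /trans.
    have -> : p s = P s *m (tj c d (u s))^T.
      by rewrite PE -mulmxA -trmx_mul inv trmx1 mulmx1.
    by rewrite row_mul_trE.
  have h j : is_derive t (1 : R) (fun s : R => tj c d (u s) i j)
      (\sum_l pd l (F c (u t)) (p t) * pd l (fun v => tj c d v i j) (u t)).
    have := @sm_comp_derive R k R (fun v => tj c d v i j) u t 1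
      (\row_l pd l (F c (u t)) (p t)) (sm_tj i j sV).
    feed; first by move=> l; rewrite mxE; exact: du.
    by move=> h; apply: (is_derive_eq h); apply: eq_bigr => l _; rewrite mxE.
  rewrite q0 J0; apply: isd_sum => j; exact: isdM (dP j) (h j).
(* Differentiation in the base point of the invariance relation, with the coordinates q of the
   covector in d held fixed. *)
have EQ2 i : pd i (fun v => F c v (p t)) (u t)
    + \sum_l pd l (F c (u t)) (p t) * \sum_j q 0 j * pd i (fun v => tj c d v l j) (u t)
  = \sum_j J i j * pd j (fun v => F d v q) (V t).
  have dq l : is_derive (u t) (delta_mx 0 i : 'rV[R]_k) (fun v => (q *m (tj c d v)^T) 0 l)
      (\sum_j q 0 j * pd i (fun v => tj c d v l j) (u t)).
    have h : is_derive (u t) (delta_mx 0 i : 'rV[R]_k) (fun v => \sum_j q 0 j * tj c d v l j)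
        (\sum_j q 0 j * pd i (fun v => tj c d v l j) (u t)).
      by apply: isd_sum => j; apply: isdZ; exact: sm_derive (sm_tj l j sV).
    apply: (is_derive_ext _ erefl h).
    by move=> v; rewrite row_mul_trE.
  have h1 := @sm_comp_derive R (k + k) _ (joint (F c)) (fun v : 'rV[R]_k => row_mx v (q *m (tj c d v)^T))
    (u t) (delta_mx 0 i) (row_mx (delta_mx 0 i) (\row_l \sum_j q 0 j * pd i (fun v => tj c d v l j) (u t))).
  move: h1; rewrite -J0 qJ; feed; first exact: sF.
  feed.
    move=> l; case: (split_ordP l) => l' ->.
      rewrite row_mxEl; apply: (is_derive_ext _ erefl (derive_lin_coord (u t) (delta_mx 0 i) l')).
      by move=> v; rewrite row_mxEl.
    rewrite row_mxEr [X in is_derive _ _ _ X]mxE; apply: (is_derive_ext _ erefl (dq l')).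
    by move=> v; rewrite row_mxEr.
  rewrite big_split_ord /=.
  rewrite (eq_bigr (fun l : 'I_k => (delta_mx 0 i : 'rV[R]_k) 0 l * pd l (fun v => F c v (p t)) (u t))); last first.
    by move=> l _; rewrite row_mxEl pd_joint_l.
  rewrite (bigD1 i) //= [X in _ + X + _]big1 => [|l li]; last by rewrite !mxE (negbTE li) andbF mul0r.
  rewrite !mxE !eqxx mul1r addr0.
  rewrite (eq_bigr (fun l : 'I_k => pd l (F c (u t)) (p t) * \sum_j q 0 j * pd i (fun v => tj c d v l j) (u t))); last first.
    by move=> l _; rewrite row_mxEr pd_joint_r mxE mulrC.
  move=> h1.
  have sFd : sm (fun v => F d v q) (V t).
    rewrite Vt; apply: (sm_ext (f := fun v => joint (F c) (row_mx (trans d c v) (q *m (tj c d (trans d c v))^T)))).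
      apply: near_imp (trans_dom Ad Ac dx cx) => v [dv vE cv].
      rewrite /joint row_mxKl row_mxKr.
      by have := hF _ cv d Ad dv q; rewrite vE /tjac => <-.
    apply: (sm_comp (y := fun v => row_mx (trans d c v) (q *m (tj c d (trans d c v))^T))).
      move=> l; case: (split_ordP l) => l' ->.
        by apply: sm_ext (trans_smv Ad Ac dx cx l'); apply: near_all => v; rewrite row_mxEl.
      apply: (sm_ext (f := fun v => \sum_j q 0 j * tj c d (trans d c v) l' j)).
        by apply: near_all => v; rewrite row_mxEr row_mul_trE.
      apply: sm_sum => j _; apply: sm_mul; first exact: sm_cst.
      apply: (sm_comp (f := fun v => tj c d v l' j) (trans_smv Ad Ac dx cx)).
      by rewrite trans_at // xE; exact: sm_tj.
    by rewrite trans_at // xE -J0 qJ.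
  have sFd' : sm (fun v => F d v q) (trans c d (u t)) by rewrite -VE.
  have h2 := @sm_comp_derive R k _ (fun v => F d v q) (trans c d) (u t) (delta_mx 0 i)
    (\row_j J i j) sFd'.
  move: h2; feed.
    by move=> l; rewrite mxE J0 (tjE i l sV); exact: sm_derive.
  move=> h2.
  have E : \forall v \near u t, joint (F c) (row_mx v (q *m (tj c d v)^T)) = F d (trans c d v) q.
    rewrite -xE; apply: near_imp (trans_dom Ac Ad cx dx) => v [cv vE dv].
    rewrite /joint row_mxKl row_mxKr.
    by have := hF _ cv d Ad dv q; rewrite vE /tjac vE.
  have [_ e1] := is_derive_near E h1; have [_ e2] := h2.
  by rewrite -e1 e2 -VE; apply: eq_bigr => j _; rewrite mxE.
have Sch i j l : pd i (fun v => tj c d v l j) (u t) = pd l (fun v => tj c d v i j) (u t).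
  rewrite (pd_near (g := fun v => pd l (fun w => trans c d w 0 j) v)); last first.
    by apply: near_imp (smv_near sV) => v sv; rewrite tjE.
  rewrite [RHS](pd_near (g := fun v => pd i (fun w => trans c d w 0 j) v)); last first.
    by apply: near_imp (smv_near sV) => v sv; rewrite tjE.
  exact: sm_schwarz.
(* The defect of the momentum equation in the chart d. By the symmetry of second derivatives [EQ1]
   and [EQ2] combine to w J^T = 0, and J is invertible. *)
pose w : 'rV[R]_k := \row_j (D j + pd j (fun v => F d v q) (V t)).
have w0 : w *m J^T = 0.
  apply/rowP => i; rewrite !mxE.
  have E3 : \sum_l pd l (F c (u t)) (p t) * \sum_j q 0 j * pd i (fun v => tj c d v l j) (u t)
    = \sum_j q 0 j * \sum_l pd l (F c (u t)) (p t) * pd l (fun v => tj c d v i j) (u t).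
    under eq_bigr do rewrite mulr_sumr.
    rewrite exchange_big /=; apply: eq_bigr => j _; rewrite mulr_sumr; apply: eq_bigr => l _.
    by rewrite (Sch i j l) mulrCA.
  have := EQ1 i; have := EQ2 i; rewrite E3 big_split /=.
  set a := pd i _ _; set b := \sum_j q 0 j * _; set e1 := \sum_j J i j * _; set e2 := \sum_j D j * _.
  move=> h1 h2.
  rewrite (eq_bigr (fun j => D j * J i j + J i j * pd j (fun v => F d v q) (V t))); last first.
    by move=> j _; rewrite !mxE; ring.
  rewrite big_split /= -/e1 -/e2 -h1.
  by rewrite addrCA -h2 subrr.
have {}w0 : w = 0 by rewrite -[w]mulmx1 -trmx1 -J'J trmx_mul mulmxA w0 mul0mx.
move=> j; split; first by rewrite Fp; exact: dV.
apply: (is_derive_eq (dP j)).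
by rewrite -q0; have /rowP/(_ j) := w0; rewrite !mxE => /eqP; rewrite addr_eq0 => /eqP.
Qed.

End GoodAtlas.

(** Neighbourhoods of the two values always share a common value of f and g. This closes coincidence
    sets of curves and carries identities from sigma != 0 to sigma = 0. *)
Lemma hausdorff_cont_eq (R : realType) (T : topologicalType) (f g : R -> T) (t : R) :
  hausdorff_space T -> {for t, continuous f} -> {for t, continuous g} ->
  (forall e : R, 0 < e -> exists2 s : R, `|s - t| < e & f s = g s) -> f t = g t.
Proof.
move=> hT cf cg h; apply: hT => U V nU nV.
have n1 : \forall s \near t, U (f s) by exact: cf.
have n2 : \forall s \near t, V (g s) by exact: cg.
have /near_normP[r r0 hr] := near_and n1 n2.
have [s st e] := h r r0; have [h1 h2] := hr s st.
by exists (f s); split => //; rewrite e.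
Qed.

(** * Lifting and uniqueness of Hamiltonian curves *)

Section HamiltonianCurves.
Context {R : realType} {T : topologicalType} {k : nat}.
Implicit Types (c d e : chart R T k) (x : T).
Variable A : set (chart R T k).
Hypothesis gA : good_atlas A.
Variable F : chart R T k -> 'rV[R]_k -> 'rV[R]_k -> R.

Definition hfield c (s : 'rV[R]_(k + k)) : 'rV[R]_(k + k) :=
  row_mx (\row_i pd (rshift k i) (joint (F c)) s) (\row_i - pd (lshift k i) (joint (F c)) s).

Definition state c (z : covector R T k) : 'rV[R]_(k + k) := row_mx (chart_to c z.1) (z.2 c).

Lemma smv_hfield c s : sm (joint (F c)) s -> smv (hfield c) s.
Proof.
move=> h j; case: (split_ordP j) => l ->.
  by apply: sm_ext (sm_pd (rshift k l) h); apply: near_all => v; rewrite row_mxEl mxE.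
by apply: sm_ext (sm_opp (sm_pd (lshift k l) h)); apply: near_all => v; rewrite row_mxEr mxE.
Qed.

(** It suffices to solve the equations in one chart: invariance of F and [hamiltonian_chart_change]
    give them in every other chart around the point. *)
Lemma hamiltonian_lift c (I : set R) (u p : R -> 'rV[R]_k) (z : R -> covector R T k) : A c ->
  (forall t : R, z t = covlift A c (u t) (p t)) ->
  (forall y, chart_dom c y -> fiber_invariant A F c y) ->
  (forall t : R, I t -> [/\ chart_dom c (chart_from c (u t)), chart_to c (chart_from c (u t)) = u t,
    sm (joint (F c)) (row_mx (u t) (p t)) &
    forall i, is_derive t (1 : R) (fun s : R => row_mx (u s) (p s) 0 i)
      (hfield c (row_mx (u t) (p t)) 0 i)]) ->
  hamiltonian_curve A F I z.
Proof.
move=> Ac zE hF h t It; have [cx xE sF dup] := h t It.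
pose x := chart_from c (u t).
have du i : is_derive t (1 : R) (fun s : R => u s 0 i) (pd i (F c (u t)) (p t)).
  have := dup (lshift k i); rewrite /hfield row_mxEl mxE pd_joint_r => hh.
  by apply: (is_derive_ext _ erefl hh) => s; rewrite row_mxEl.
have dp i : is_derive t (1 : R) (fun s : R => p s 0 i) (- pd i (fun v => F c v (p t)) (u t)).
  have := dup (rshift k i); rewrite /hfield row_mxEr mxE pd_joint_l => hh.
  by apply: (is_derive_ext _ erefl hh) => s; rewrite row_mxEr.
have cu : {for t, continuous u} by apply: continuous_row => i; exact: is_derive1_cont.
split.
- by rewrite zE -xE; exact: lift_cotangent.
- rewrite (_ : (fun r => (z r).1) = fun r => chart_from c (u r)); last first.
    by apply/funext => s; rewrite zE.
  apply: (@continuous_comp _ _ _ u (chart_from c) t) => //.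
  by rewrite -xE; exact: (ga_from gA).
- move=> d Ad dx i; cbv zeta.
  have dx' : chart_dom d x by rewrite zE in dx.
  have [V VE] : exists V : R -> 'rV[R]_k, forall s, V s = trans c d (u s).
    by exists (fun s => trans c d (u s)).
  have [P PE] : exists P : R -> 'rV[R]_k, forall s, P s = p s *m (tj d c (V s))^T.
    by exists (fun s => p s *m (tj d c (V s))^T).
  have [h1 h2] := hamiltonian_chart_change gA Ac Ad cx dx' xE hF sF du dp VE PE i.
  have Vl (s : R) : chart_to d (z s).1 = V s by rewrite zE VE.
  have nt : \forall s \near t, (z s).2 d = P s.
    apply: (near_imp _ (near_cont_comp (P := fun v => [/\ chart_dom c (chart_from c v),
      chart_to c (chart_from c v) = v & chart_dom d (chart_from c v)]) cu _)).
      move=> s [h3 h4 h5]; rewrite zE -{1}h4 (lift_coord gA (p s) Ad h3 Ac h5) PE VE; reflexivity.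
    by rewrite -xE; exact: (trans_dom gA).
  have Pt : (z t).2 d = P t by exact: nbhs_singleton nt.
  rewrite Pt Vl; split; first by rewrite -pdE; apply: (is_derive_ext _ erefl h1) => s; rewrite Vl.
  rewrite -pdE; apply: is_derive_near h2.
  by apply: near_imp nt => s ->.
Qed.

Lemma hamiltonian_state c (I : set R) z t : A c -> hamiltonian_curve A F I z -> I t ->
  chart_dom c (z t).1 ->
  forall i, is_derive t (1 : R) (fun s : R => state c (z s) 0 i) (hfield c (state c (z t)) 0 i).
Proof.
move=> Ac hz It ct i; have [_ _ h] := hz t It.
case: (split_ordP i) => l ->.
  have [h1 _] := h c Ac ct l.
  rewrite /hfield row_mxEl mxE pd_joint_r pdE; apply: (is_derive_ext _ erefl h1).
  by move=> s; rewrite /state row_mxEl.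
have [_ h1] := h c Ac ct l.
rewrite /hfield row_mxEr mxE pd_joint_l pdE; apply: (is_derive_ext _ erefl h1).
by move=> s; rewrite /state row_mxEr.
Qed.

Lemma hamiltonian_dom c (I : set R) z t : open I -> A c -> hamiltonian_curve A F I z -> I t ->
  chart_dom c (z t).1 -> \forall s \near t, I s /\ chart_dom c (z s).1.
Proof.
move=> oI Ac hz It ct; have [_ h1 _] := hz t It.
have n1 := open_near oI It.
have n2 := near_cont_comp h1 (ga_dom gA Ac ct).
apply: near_imp (near_and n1 n2) => s [Is h]; split => //; apply: h.
by have [[]] := hz s Is.
Qed.

Lemma hamiltonian_unique_local c (I I' : set R) z z' t : open I -> open I' -> A c ->
  hamiltonian_curve A F I z -> hamiltonian_curve A F I' z' -> I t -> I' t ->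
  chart_dom c (z t).1 -> z t = z' t -> sm (joint (F c)) (state c (z t)) ->
  \forall s \near t, t <= s -> z s = z' s.
Proof.
move=> oI oI' Ac hz hz' It It' ct e sF.
have n1 := hamiltonian_dom oI Ac hz It ct.
have ct' : chart_dom c (z' t).1 by rewrite -e.
have n2 := hamiltonian_dom oI' Ac hz' It' ct'.
have := @ode_unique_local R (k + k) (hfield c) (fun s => state c (z s)) (fun s => state c (z' s)) t
  (smv_hfield sF).
feed; first by rewrite e.
feed; first by apply: near_imp n1 => s [Is cs]; exact: (hamiltonian_state Ac hz).
feed; first by apply: near_imp n2 => s [Is cs]; exact: (hamiltonian_state Ac hz').
move=> n3; apply: near_imp (near_and (near_and n1 n2) n3) => s [[[Is cs] [Is' cs']] h] ts.
have := h ts; rewrite /state => /eq_row_mx[e1 e2].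
have [h1 _ _] := hz s Is; have [h1' _ _] := hz' s Is'.
apply: (@cot_eq R T k A c) => //.
by rewrite -(ga_inv gA Ac cs) -(ga_inv gA Ac cs') e1.
Qed.

Hypothesis hT : hausdorff_space T.

(** Let m be the supremum of the times up to which the curves agree. They agree at m because the
    space is Hausdorff, and beyond m by local uniqueness, so m = b. The curve z is required to stay
    in one chart; z' is then in it wherever the two agree. *)
Lemma hamiltonian_unique c (I I' : set R) z z' (b : R) : open I -> open I' -> A c ->
  hamiltonian_curve A F I z -> hamiltonian_curve A F I' z' ->
  (forall t : R, 0 <= t <= b -> [/\ I t, I' t, chart_dom c (z t).1 & sm (joint (F c)) (state c (z t))]) ->
  z 0 = z' 0 -> forall t : R, 0 <= t <= b -> z t = z' t.
Proof.
move=> oI oI' Ac hz hz' h e0 t /andP[t0 tb].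
pose S := [set t : R | 0 <= t <= b /\ forall s : R, 0 <= s <= t -> z s = z' s].
have b0 : 0 <= b by exact: le_trans tb.
have S0 : S 0 by split; [rewrite lexx | move=> s /andP[s1 s2]; have -> : s = 0 by apply/eqP; rewrite eq_le s1 s2].
have hS : has_sup S by split; [exists 0 | exists b => s [/andP[]]].
have [m mE] := exists_eq (sup S).
have m0 : 0 <= m by rewrite mE; apply: sup_upper_bound.
have mb : m <= b by rewrite mE; apply: sup_le_ub; [exists 0 | move=> s [/andP[]]].
have lt_m (s : R) : 0 <= s < m -> z s = z' s.
  move=> /andP[s0 sm]; have [|r [_ hr] sr] := @sup_adherent R S (m - s) _ hS; first by rewrite subr_gt0.
  by apply: hr; rewrite s0 ltW //; move: sr; rewrite -mE subKr.
have [Im Im' cm sm] : [/\ I m, I' m, chart_dom c (z m).1 & sm (joint (F c)) (state c (z m))].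
  by apply: h; rewrite m0.
have zm : z m = z' m.
  move: m0; rewrite le_eqVlt => /orP[/eqP <- //|m0].
  have near_eq (e : R) : 0 < e -> exists2 s : R, `|s - m| < e & z s = z' s.
    move=> e0'; exists (Num.max 0 (m - e / 2)).
      by rewrite ltr_norml; apply/andP; split; rewrite ?ltrBlDr ?ltrBrDl ?lt_max ?gt_max; lra.
    by apply: lt_m; rewrite le_max lexx /= gt_max m0; lra.
  have [_ cz _] := hz m Im; have [cot' cz' _] := hz' m Im'.
  have e1 : (z m).1 = (z' m).1.
    apply: (hausdorff_cont_eq hT cz cz') => e e0'; have [s s1 s2] := near_eq e e0'.
    by exists s => //; rewrite s2.
  have cm' : chart_dom c (z' m).1 by rewrite -e1.
  have e2 : state c (z m) = state c (z' m).
    apply: (hausdorff_cont_eq (f := fun s => state c (z s)) (g := fun s => state c (z' s))).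
    - exact: norm_hausdorff.
    - by apply: continuous_row => i; apply: is_derive1_cont; exact: (hamiltonian_state Ac hz).
    - by apply: continuous_row => i; apply: is_derive1_cont; exact: (hamiltonian_state Ac hz').
    - move=> e e0'; have [s s1 s2] := near_eq e e0'.
      by exists s => //; rewrite s2.
  have [h1 _ _] := hz m Im.
  apply: (@cot_eq R T k A c) => //.
  by move: e2; rewrite /state => /eq_row_mx[].
have le_m (s : R) : 0 <= s <= m -> z s = z' s.
  by move=> /andP[s0]; rewrite le_eqVlt => /orP[/eqP -> //|s1]; apply: lt_m; rewrite s0.
have [tm|mt] := leP t m; first by apply: le_m; rewrite t0.
have /near_normP[r r0 hr] := hamiltonian_unique_local oI oI' Ac hz hz' Im Im' cm zm sm.
exfalso; pose s := Num.min b (m + r / 2).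
have ms : m < s by rewrite /s lt_min; apply/andP; split; lra.
have : S s.
  split; first by rewrite /s ge_min lexx /= andbT; apply: ltW; apply: le_lt_trans ms.
  move=> s' /andP[s'0 s's]; have [s'm|ms'] := leP s' m; first by apply: le_m; rewrite s'0.
  apply: hr; last exact: ltW.
  rewrite ger0_norm; last by rewrite subr_ge0 ltW.
  by move: s's; rewrite /s le_min => /andP[_]; lra.
by move/(sup_upper_bound hS); rewrite -mE leNgt ms.
Qed.

End HamiltonianCurves.

(** * Smooth maps and submanifolds *)

Section Jac.
Context {R : realType}.

Definition jac m l (f : 'rV[R]_m -> 'rV[R]_l) (x : 'rV[R]_m) : 'M[R]_(m, l) := 'J f x.

Lemma jac_pd m l (f : 'rV[R]_m -> 'rV[R]_l) x i j : smv f x ->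
  jac f x i j = pd i (fun u => f u 0 j) x.
Proof. by move=> h; rewrite /jac (jacE i j h). Qed.

Lemma jac_eqnear m l (f g : 'rV[R]_m -> 'rV[R]_l) x : (\forall y \near x, f y = g y) ->
  smv f x -> jac f x = jac g x.
Proof. exact: jac_near. Qed.

Lemma sm_jac_coef m l (f : 'rV[R]_m -> 'rV[R]_l) x i j : smv f x -> sm (fun u => jac f u i j) x.
Proof. exact: sm_jac. Qed.

Lemma jac_chain m l k (f : 'rV[R]_l -> 'rV[R]_k) (y : 'rV[R]_m -> 'rV[R]_l) x :
  smv y x -> smv f (y x) -> jac (fun u => f (y u)) x = jac y x *m jac f (y x).
Proof. exact: jac_comp. Qed.

Lemma jac_idE m (x : 'rV[R]_m) : jac id x = 1%:M.
Proof. exact: jac_id. Qed.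

End Jac.

Lemma within_near (T T' : topologicalType) (D : set T) (f : T -> T') (P : T' -> Prop) x :
  {within D, continuous f} -> D x -> (\forall y \near f x, P y) ->
  \forall y \near x, D y -> P (f y).
Proof. by move=> /subspace_continuousP h Dx nP; exact: (h x Dx P nP). Qed.

Lemma near_within_cont (T T' : topologicalType) (D : set T) (f : T -> T') :
  (forall x, D x -> forall P : set T', (\forall y \near f x, P y) -> \forall y \near x, D y -> P (f y)) ->
  {within D, continuous f}.
Proof. by move=> h; apply/subspace_continuousP => x Dx P nP; exact: (h x Dx P nP). Qed.

Lemma within_cont_open (T T' : topologicalType) (D : set T) (f : T -> T') x :
  open D -> {within D, continuous f} -> D x -> {for x, continuous f}.
Proof.
move=> oD hc Dx P nP; have := within_near hc Dx nP.
by move/(near_and (open_near oD Dx)); apply: near_imp => y [h1 h2]; exact: h2.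
Qed.

(** * Atlases in neighbourhood form, products, smooth maps in charts *)

Section Ambient.
Context {R : realType}.

(** The local properties of an atlas, stated with neighbourhoods; in this form they pass to products
    and so hold for M x R. *)
Record amb (T : topologicalType) k (A : set (chart R T k)) : Prop := {
  am_cover : forall x, exists2 a, A a & chart_dom a x;
  am_inv : forall a x, A a -> chart_dom a x -> chart_from a (chart_to a x) = x;
  am_open : forall a x, A a -> chart_dom a x -> \forall y \near x, chart_dom a y;
  am_img : forall a x, A a -> chart_dom a x -> \forall u \near chart_to a x,
    chart_dom a (chart_from a u) /\ chart_to a (chart_from a u) = u;
  am_to : forall a x, A a -> chart_dom a x -> {for x, continuous (chart_to a)};
  am_from : forall a x, A a -> chart_dom a x -> {for chart_to a x, continuous (chart_from a)};
  am_smooth : forall a b x, A a -> A b -> chart_dom a x -> chart_dom b x ->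
    smv (trans a b) (chart_to a x) }.

Lemma amb_manifold (T : topologicalType) k (A : set (chart R T k)) :
  smooth_manifold A -> amb A.
Proof.
move=> [_ _ cov ch sm0].
have img a x : A a -> chart_dom a x -> \forall u \near chart_to a x,
    chart_dom a (chart_from a u) /\ chart_to a (chart_from a u) = u.
  move=> Aa ax; have [_ oi inv _ _] := ch a Aa.
  have hi : chart_img a (chart_to a x) by exists x.
  by apply: near_imp (open_near oi hi) => _ [y ay <-]; rewrite inv.
have from a x : A a -> chart_dom a x -> {for chart_to a x, continuous (chart_from a)}.
  move=> Aa ax; have [_ oi _ _ cf] := ch a Aa.
  by apply: (within_cont_open oi cf); exists x.
split => //.
- by move=> a x Aa; have [_ _ + _ _] := ch a Aa; apply.
- by move=> a x Aa ax; have [od _ _ _ _] := ch a Aa; exact: open_near.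
- by move=> a x Aa ax; have [od _ _ ct _] := ch a Aa; exact: (within_cont_open od ct).
- move=> a b x Aa Ab ax bx j; apply: (smooth_on_sm (sm0 a b Aa Ab j)); first by exists x.
  have [od _ inv _ _] := ch b Ab; have [_ _ inva _ _] := ch a Aa.
  have nb : \forall u \near chart_to a x, chart_dom b (chart_from a u).
    by apply: (near_cont_comp (from a x Aa ax)); rewrite inva //; exact: open_near.
  apply: near_imp (near_and (img a x Aa ax) nb) => u [[h1 h2] h3].
  by exists (chart_from a u).
Qed.

Lemma amb_euclid k : amb (euclidean_atlas R k).
Proof.
split.
- by move=> x; exists (Chart setT id id).
- by move=> a x ->.
- by move=> a x -> _; apply: near_all.
- by move=> a x -> _; apply: near_all.
- by move=> a x -> _; exact: id.
- by move=> a x -> _; exact: id.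
- by move=> a b x -> -> _ _; exact: smv_id.
Qed.

Lemma amb_line : amb (line_atlas R).
Proof.
have ct (t : R) : {for t, continuous (fun t : R => const_mx t : 'rV[R]_1)}.
  apply: continuous_row => i; rewrite (_ : (fun s => _) = id); first exact: id.
  by apply/funext => s; rewrite mxE.
split.
- by move=> x; exists (Chart setT (fun t : R => const_mx t) (fun v : 'rV[R]_1 => v 0 0)).
- by move=> a x -> _ /=; rewrite mxE.
- by move=> a x -> _; apply: near_all.
- move=> a x -> _; apply: near_all => u /=; split => //.
  by apply/rowP => i; rewrite mxE ord1.
- by move=> a x -> _; exact: ct.
- by move=> a x -> _ /=; apply: continuous_coord; exact: id.
- move=> a b x -> -> _ _ j /=; apply: sm_ext (sm_coord j _).
  by apply: near_all => u; rewrite /trans /= mxE ord1.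
Qed.

Lemma near_pair (T T' : topologicalType) (P : T -> Prop) (Q : T' -> Prop) (x : T) (y : T') :
  (\forall x' \near x, P x') -> (\forall y' \near y, Q y') ->
  \forall z \near (x, y), P z.1 /\ Q z.2.
Proof. by move=> h1 h2; exists (P, Q). Qed.

Lemma cont_pair (S T T' : topologicalType) (f : S -> T) (g : S -> T') s :
  {for s, continuous f} -> {for s, continuous g} -> {for s, continuous (fun r => (f r, g r))}.
Proof. by move=> h1 h2; exact: cvg_pair h1 h2. Qed.

Lemma cont_row_mx (S : topologicalType) m l (f : S -> 'rV[R]_m) (g : S -> 'rV[R]_l) s :
  {for s, continuous f} -> {for s, continuous g} -> {for s, continuous (fun r => row_mx (f r) (g r))}.
Proof.
move=> h1 h2; apply: continuous_row => i; case: (split_ordP i) => k ->.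
  rewrite (_ : (fun r => _) = fun r => f r 0 k); first exact: continuous_coord.
  by apply/funext => r; rewrite row_mxEl.
rewrite (_ : (fun r => _) = fun r => g r 0 k); first exact: continuous_coord.
by apply/funext => r; rewrite row_mxEr.
Qed.

Lemma smv_row_mx k m l (f : 'rV[R]_k -> 'rV[R]_m) (g : 'rV[R]_k -> 'rV[R]_l) x :
  smv f x -> smv g x -> smv (fun u => row_mx (f u) (g u)) x.
Proof.
move=> h1 h2 i; case: (split_ordP i) => j ->.
  by apply: sm_ext (h1 j); apply: near_all => u; rewrite row_mxEl.
by apply: sm_ext (h2 j); apply: near_all => u; rewrite row_mxEr.
Qed.

Lemma smv_lsubmx m l (x : 'rV[R]_(m + l)) : smv (fun u : 'rV[R]_(m + l) => lsubmx u) x.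
Proof.
by move=> i; apply: sm_ext (sm_coord (lshift l i) x); apply: near_all => u; rewrite mxE.
Qed.

Lemma smv_rsubmx m l (x : 'rV[R]_(m + l)) : smv (fun u : 'rV[R]_(m + l) => rsubmx u) x.
Proof.
by move=> i; apply: sm_ext (sm_coord (rshift m i) x); apply: near_all => u; rewrite mxE.
Qed.

Lemma amb_prod (T T' : topologicalType) k l (A : set (chart R T k)) (B : set (chart R T' l)) :
  amb A -> amb B -> amb (prod_atlas A B).
Proof.
move=> hA hB; split.
- move=> [x y]; have [a Aa ax] := am_cover hA x; have [b Bb bx] := am_cover hB y.
  by exists (prod_chart a b) => //; exists a, b.
- move=> c [x y] [a [b [Aa Bb ->]]] [/= ax bx].
  by rewrite row_mxKl row_mxKr (am_inv hA) // (am_inv hB).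
- move=> c [x y] [a [b [Aa Bb ->]]] [/= ax bx].
  by apply: near_pair; [exact: (am_open hA)|exact: (am_open hB)].
- move=> c [x y] [a [b [Aa Bb ->]]] [/= ax bx].
  have c1 := smv_cont (smv_lsubmx (row_mx (chart_to a x) (chart_to b y))).
  have c2 := smv_cont (smv_rsubmx (row_mx (chart_to a x) (chart_to b y))).
  have n1 : \forall u \near row_mx (chart_to a x) (chart_to b y), chart_dom a (chart_from a (lsubmx u)) /\ chart_to a (chart_from a (lsubmx u)) = lsubmx u.
    by apply: (near_cont_comp c1 (P := fun v => chart_dom a (chart_from a v) /\ chart_to a (chart_from a v) = v)); rewrite row_mxKl; exact: (am_img hA).
  have n2 : \forall u \near row_mx (chart_to a x) (chart_to b y), chart_dom b (chart_from b (rsubmx u)) /\ chart_to b (chart_from b (rsubmx u)) = rsubmx u.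
    by apply: (near_cont_comp c2 (P := fun v => chart_dom b (chart_from b v) /\ chart_to b (chart_from b v) = v)); rewrite row_mxKr; exact: (am_img hB).
  apply: near_imp (near_and n1 n2) => u [[h1 h2] [h3 h4]] /=; split => //.
  by rewrite h2 h4 hsubmxK.
- move=> c [x y] [a [b [Aa Bb ->]]] [/= ax bx].
  apply: (@cont_row_mx (T * T')%type k l (fun z => chart_to a z.1) (fun z => chart_to b z.2)).
    by apply: (@continuous_comp _ _ _ fst (chart_to a)); [exact: cvg_fst|exact: (am_to hA)].
  by apply: (@continuous_comp _ _ _ snd (chart_to b)); [exact: cvg_snd|exact: (am_to hB)].
- move=> c [x y] [a [b [Aa Bb ->]]] [/= ax bx].
  have c1 := smv_cont (smv_lsubmx (row_mx (chart_to a x) (chart_to b y))).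
  have c2 := smv_cont (smv_rsubmx (row_mx (chart_to a x) (chart_to b y))).
  apply: cont_pair.
    apply: (@continuous_comp _ _ _ (fun u : 'rV[R]_(k + l) => lsubmx u) (chart_from a)) => //.
    by rewrite row_mxKl; exact: (am_from hA).
  apply: (@continuous_comp _ _ _ (fun u : 'rV[R]_(k + l) => rsubmx u) (chart_from b)) => //.
  by rewrite row_mxKr; exact: (am_from hB).
- move=> c c' [x y] [a [b [Aa Bb ->]]] [a' [b' [Aa' Bb' ->]]] [/= ax bx] [/= ax' bx'].
  apply: (smv_row_mx (f := fun u => trans a a' (lsubmx u)) (g := fun u => trans b b' (rsubmx u))).
    apply: smv_comp; first exact: smv_lsubmx.
    by rewrite row_mxKl; exact: (am_smooth hA).
  apply: smv_comp; first exact: smv_rsubmx.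
  by rewrite row_mxKr; exact: (am_smooth hB).
Qed.

Definition local_expr (T T' : topologicalType) k l (a : chart R T k) (a' : chart R T' l)
    (D : set T) (f : T -> T') (F : 'rV[R]_k -> 'rV[R]_l) (x : T) : Prop :=
  smv F (chart_to a x) /\ \forall y \near x, D y ->
    [/\ chart_dom a y, chart_dom a' (f y) & chart_to a' (f y) = F (chart_to a y)].

Section SmoothMap.
Variables (T T' : topologicalType) (k l : nat) (A : set (chart R T k)) (A' : set (chart R T' l)).
Hypotheses (hA : amb A) (hA' : amb A').

Lemma near_chart a x (P : T -> Prop) : A a -> chart_dom a x -> (\forall y \near x, P y) ->
  \forall u \near chart_to a x, P (chart_from a u).
Proof.
by move=> Aa ax h; apply: (near_cont_comp (am_from hA Aa ax)); rewrite (am_inv hA).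
Qed.

(** Around each point of an arbitrary D the coordinate expression of f is the restriction of a
    smooth F. Continuity of f on D keeps the images in the domain of a'. *)
Lemma smooth_map_local D f a a' x : smooth_map A D A' f -> D x -> A a -> chart_dom a x ->
  A' a' -> chart_dom a' (f x) -> exists F, local_expr a a' D f F x.
Proof.
move=> [cf sf] Dx Aa ax Aa' ax'.
have n1 : \forall y \near x, D y -> chart_dom a' (f y).
  by apply: (within_near cf Dx); exact: (am_open hA').
have /choice[F hF] : forall j : 'I_l, exists F, sm F (chart_to a x) /\ \forall u \near chart_to a x,
    (chart_to a @` (chart_dom a `&` D `&` (f @^-1` chart_dom a'))) u ->
    F u = chart_to a' (f (chart_from a u)) 0 j.
  move=> j; have [|F h1 h2] := smooth_on_ext (sf a a' Aa Aa' j) (x := chart_to a x); first by exists x.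
  by exists F.
exists (fun u => \row_j F j u); split.
  by move=> j; apply: sm_ext (proj1 (hF j)); apply: near_all => u; rewrite mxE.
have n2 : \forall y \near x, forall j, (chart_to a @` (chart_dom a `&` D `&` (f @^-1` chart_dom a'))) (chart_to a y) ->
    F j (chart_to a y) = chart_to a' (f (chart_from a (chart_to a y))) 0 j.
  by apply: near_forall => j; have := near_cont_comp (am_to hA Aa ax) (proj2 (hF j)).
apply: near_imp (near_and (near_and n1 (am_open hA Aa ax)) n2) => y [[h1 h2] h3] Dy.
split => //; first exact: h1.
apply/rowP => j; rewrite mxE h3 ?(am_inv hA) //.
by exists y => //; split; [split|exact: h1].
Qed.

(** One pair of charts around each point is enough: for any other pair the expression is obtained by
    composing F with transition maps on both sides. *)
Lemma local_expr_smooth_map D f :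
  (forall x, D x -> exists a a' F, [/\ A a, chart_dom a x, A' a' & chart_dom a' (f x)] /\
     local_expr a a' D f F x) -> smooth_map A D A' f.
Proof.
move=> h; have cf : {within D, continuous f}.
  apply: near_within_cont => x Dx P nP.
  have [a [a' [F [[Aa ax Aa' ax'] [sF nF]]]]] := h x Dx.
  have [_ _ e0] := nbhs_singleton nF Dx.
  have nP' : \forall v \near F (chart_to a x), P (chart_from a' v).
    by rewrite -e0; apply: (near_cont_comp (am_from hA' Aa' ax')); rewrite (am_inv hA').
  have n1 : \forall y \near x, P (chart_from a' (F (chart_to a y))).
    apply: (near_cont_comp (P := fun u => P (chart_from a' (F u))) (am_to hA Aa ax)).
    exact: (near_cont_comp (P := fun v => P (chart_from a' v)) (smv_cont sF)).
  apply: near_imp (near_and n1 nF) => y [h1 h2] Dy; have [h3 h4 h5] := h2 Dy.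
  by rewrite -(am_inv hA' Aa' h4) h5.
split => // b b' Ab Ab' j; apply: sm_smooth_on => _ [x [[bx Dx] bx'] <-].
have [a [a' [F [[Aa ax Aa' ax'] [sF nF]]]]] := h x Dx.
have [_ _ e0] := nbhs_singleton nF Dx.
have xE : trans b a (chart_to b x) = chart_to a x by rewrite /trans (am_inv hA).
exists (fun u => trans a' b' (F (trans b a u)) 0 j).
  apply: (sm_comp (f := fun v => trans a' b' v 0 j) (y := fun u => F (trans b a u))).
    by apply: smv_comp; [exact: (am_smooth hA)|rewrite xE].
  by rewrite xE -e0; exact: (am_smooth hA').
apply: near_imp (near_chart Ab bx nF) => u n1 [y [[h1 h2] h3] h4].
have [h5 h6 h7] : [/\ chart_dom a y, chart_dom a' (f y) & chart_to a' (f y) = F (chart_to a y)].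
  by move: n1; rewrite -h4 (am_inv hA) //; apply.
by rewrite -h4 /trans (am_inv hA) // -h7 (am_inv hA').
Qed.

End SmoothMap.
End Ambient.

(** * The implicit function theorem for one equation *)

Section ImplicitFunction.
Context {R : realType} {n : nat}.

Lemma is_derive_eps (V : normedModType R) (f : V -> R) (x v : V) (c : R) :
  (forall e : R, 0 < e -> exists2 r : R, 0 < r & forall h : R, `|h| < r ->
    `|f (x + h *: v) - f x - h * c| <= e * `|h|) -> is_derive x v f c.
Proof.
move=> H.
have cv : h^-1 *: ((f \o shift x) (h *: v) - f x) @[h --> (0 : R)^'] --> c.
  apply/cvgrPdist_le => e e0; have [r r0 hr] := H e e0.
  near=> h.
  have hn : h != 0 by near: h; exact: nbhs_dnbhs_neq.
  have hr' : `|h| < r.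
    by near: h; apply: dnbhs0_lt.
  have hh := hr h hr'.
  have -> : c - h^-1 *: (f (h *: v + x) - f x) = - (h^-1 * (f (x + h *: v) - f x - h * c)).
    by rewrite /GRing.scale /= [h *: v + x]addrC; field.
  rewrite normrN normrM normfV ler_pdivrMl ?normr_gt0 //.
  by rewrite [X in _ <= X]mulrC.
apply: DeriveDef; first by apply/cvg_ex; exists c.
by apply: cvg_lim => //; exact: cv.
Unshelve. all: by end_near. Qed.

Variable i : 'I_n.+1.

(** [insc] inserts t as the i-th coordinate and [delc] deletes that coordinate; together they split
    the space into the solved variable and the remaining ones. *)
Definition insc (v : 'rV[R]_n) (t : R) : 'rV[R]_n.+1 :=
  \row_j (if unlift i j is Some k then v 0 k else t).
Definition delc (u : 'rV[R]_n.+1) : 'rV[R]_n := \row_k u 0 (lift i k).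

Lemma insc_i v t : insc v t 0 i = t.
Proof. by rewrite mxE unlift_none. Qed.

Lemma insc_lift v t k : insc v t 0 (lift i k) = v 0 k.
Proof. by rewrite mxE liftK. Qed.

Lemma delcK u : insc (delc u) (u 0 i) = u.
Proof. by apply/rowP => j; case: (unliftP i j) => [k|] ->; rewrite ?insc_lift ?insc_i ?mxE. Qed.

Lemma insck v t : delc (insc v t) = v.
Proof. by apply/rowP => k; rewrite mxE insc_lift. Qed.

Lemma insc_norm_lt v t (u : 'rV[R]_n.+1) (r : R) : 0 < r -> `|v - delc u| < r -> `|t - u 0 i| < r ->
  `|insc v t - u| < r.
Proof.
move=> r0 h1 h2; apply: norm_lt_coord => // j.
case: (unliftP i j) => [k|] ->; rewrite !mxE ?liftK ?unlift_none //.
by apply: le_lt_trans h1; have := coord_le_norm (v - delc u) k; rewrite !mxE.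
Qed.

Lemma Ck_insc k (U : set 'rV[R]_n) (S : 'rV[R]_n -> R) j : Ck k U S ->
  open U -> Ck k U (fun v => insc v (S v) 0 j).
Proof.
move=> h oU; case: (unliftP i j) => [l|] ->.
  by apply: (Ck_ext oU _ (Ck_coord k U l)) => v _; rewrite insc_lift.
by apply: (Ck_ext oU _ h) => v _; rewrite insc_i.
Qed.

Lemma derive_insc_t (F : 'rV[R]_n.+1 -> R) v (t : R) : sm F (insc v t) ->
  is_derive t (1 : R) (fun s : R => F (insc v s)) (pd i F (insc v t)).
Proof.
move=> h; have := @sm_comp_derive R n.+1 R F (fun s : R => insc v s) t 1 (delta_mx 0 i) h.
feed.
  move=> j; case: (unliftP i j) => [l|] ->.
    apply: (is_derive_ext _ _ (isd_cst (v 0 l) t 1)); first by move=> s; rewrite insc_lift.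
    by rewrite mxE [lift i l == i]eq_sym (negbTE (neq_lift i l)) andbF.
  apply: (is_derive_ext _ _ (isd_id t)); first by move=> s; rewrite insc_i.
  by rewrite mxE !eqxx.
move=> hh; apply: (is_derive_eq hh).
rewrite (bigD1 i) //= mxE !eqxx mul1r big1 ?addr0 // => j ji.
by rewrite mxE (negbTE ji) andbF mul0r.
Qed.

Variables (F : 'rV[R]_n.+1 -> R) (u0 : 'rV[R]_n.+1).

(** F increases strictly in the i-th variable near u0, so the intermediate value theorem yields a
    unique zero S v. The sign change of F at S v - d and S v + d persists nearby, whence continuity;
    the linear expansion of F gives the partial derivatives of S; as these are quotients of
    derivatives of F at (v, S v), smoothness follows by induction. *)
Lemma implicit_pos : sm F u0 -> F u0 = 0 -> 0 < pd i F u0 ->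
  exists (r rho : R) (S : 'rV[R]_n -> R), [/\ 0 < r, 0 < rho,
    forall v, `|v - delc u0| < r -> [/\ `|S v - u0 0 i| < rho, F (insc v (S v)) = 0 & sm S v] &
    forall v t, `|v - delc u0| < r -> `|t - u0 0 i| < rho -> F (insc v t) = 0 -> t = S v].
Proof.
move=> sF F0 Fi.
have [U [oU Uu0 CU]] := sF.
have cF : {for u0, continuous (fun u => pd i F u)} := sm_cont (sm_pd i sF).
have n1 : \forall u \near u0, 0 < pd i F u.
  apply: near_imp (cont_near_lt cF Fi) => u; rewrite ltr_norml => /andP[h _].
  by rewrite -(ltrD2r (- pd i F u0)) add0r.
have /near_normP[r1 r10 hr1] := near_and (open_near oU Uu0) n1.
pose W : set 'rV[R]_n.+1 := [set u | `|u - u0| < r1].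
have oW : open W.
  rewrite (_ : W = ball u0 r1); first exact: ball_open.
  by apply/seteqP; split => u; rewrite /W -ball_normE /= distrC.
have WU : W `<=` U by move=> u /hr1[].
have Wpos u : W u -> 0 < pd i F u by move=> /hr1[].
have CW k : Ck k W F := Ck_sub WU (CU k).
have smW u : W u -> sm F u by move=> Wu; exists W.
pose v0 : 'rV[R]_n := delc u0; pose t0 : R := u0 0 i.
have inW (v : 'rV[R]_n) (t : R) : `|v - v0| < r1 -> `|t - t0| < r1 -> W (insc v t).
  by move=> h1 h2; exact: insc_norm_lt.
have mono (v : 'rV[R]_n) (t t' : R) : `|v - v0| < r1 -> `|t - t0| < r1 -> `|t' - t0| < r1 -> t < t' ->
    F (insc v t) < F (insc v t').
  move=> hv ht ht' tt'.
  have Ws (s : R) : t <= s <= t' -> W (insc v s).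
    move=> /andP[s1 s2]; apply: inW => //; move: ht ht'; rewrite !ltr_norml => /andP[a1 a2] /andP[a3 a4].
    by apply/andP; split; lra.
  apply: (@MVT_gt0 R (fun s => F (insc v s)) (fun s => pd i F (insc v s)) t t' tt') => s hs.
    exact: derive_insc_t (smW _ (Ws s hs)).
  exact: Wpos (Ws s hs).
pose rho : R := r1 / 2.
have rho0 : 0 < rho by rewrite divr_gt0.
have rhor1 : rho < r1 by rewrite /rho; lra.
have cont_v (t : R) v1 : W (insc v1 t) -> {for v1, continuous (fun v => F (insc v t))}.
  move=> Ww; apply: (@continuous_comp _ _ _ (fun v => insc v t) F); last exact: sm_cont (smW _ Ww).
  apply: continuous_row => j; case: (unliftP i j) => [l|] ->.
    rewrite (_ : (fun s => _) = fun s : 'rV[R]_n => s 0 l); first by apply: continuous_coord; exact: id.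
    by apply/funext => v; rewrite insc_lift.
  rewrite (_ : (fun s => _) = fun=> t); first exact: cst_continuous.
  by apply/funext => v; rewrite insc_i.
have pos_near (t : R) v1 : W (insc v1 t) -> 0 < F (insc v1 t) -> \forall v \near v1, 0 < F (insc v t).
  move=> h1 h2; apply: near_imp (cont_near_lt (cont_v t v1 h1) h2) => v.
  by rewrite ltr_norml => /andP[+ _]; lra.
have neg_near (t : R) v1 : W (insc v1 t) -> F (insc v1 t) < 0 -> \forall v \near v1, F (insc v t) < 0.
  move=> h1; rewrite -oppr_gt0 => h2; apply: near_imp (cont_near_lt (cont_v t v1 h1) h2) => v.
  by rewrite ltr_norml => /andP[_]; lra.
have v00 : `|v0 - v0| < r1 by rewrite subrr normr0.
have tp : `|t0 + rho - t0| < r1 by rewrite addrC addKr gtr0_norm.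
have tm : `|t0 - rho - t0| < r1 by rewrite addrC addKr normrN gtr0_norm.
have t00 : `|t0 - t0| < r1 by rewrite subrr normr0.
have F00 : F (insc v0 t0) = 0 by rewrite delcK.
have Fp : 0 < F (insc v0 (t0 + rho)) by rewrite -{1}F00; apply: mono => //; rewrite ltrDl.
have Fm : F (insc v0 (t0 - rho)) < 0 by rewrite -F00; apply: mono => //; rewrite ltrBlDr ltrDl.
have /near_normP[r2 r20 hr2] := near_and (pos_near _ _ (inW _ _ v00 tp) Fp) (neg_near _ _ (inW _ _ v00 tm) Fm).
pose r : R := Num.min r1 r2.
have r0 : 0 < r by rewrite lt_min r10.
have rr1 (v : 'rV[R]_n) : `|v - v0| < r -> `|v - v0| < r1 by rewrite lt_min => /andP[].
have ex (v : 'rV[R]_n) : `|v - v0| < r -> exists t : R, `|t - t0| < rho /\ F (insc v t) = 0.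
  move=> hv; have hv1 := rr1 v hv.
  have [hp hm] : 0 < F (insc v (t0 + rho)) /\ F (insc v (t0 - rho)) < 0.
    by apply: hr2; move: hv; rewrite lt_min => /andP[].
  have [|||t] := @IVT R (fun s => F (insc v s)) (t0 - rho) (t0 + rho) 0.
  - by rewrite lerD2l; lra.
  - apply: continuous_in_subspaceT => s; rewrite inE /= in_itv /= => /andP[s1 s2].
    apply: is_derive1_cont; apply: derive_insc_t; apply: smW; apply: inW => //.
    by rewrite ltr_norml; apply/andP; split; lra.
  - by rewrite ge_min le_max (ltW hp) (ltW hm) orbT.
  rewrite in_itv /= => /andP[t1 t2] Ft; exists t; split => //.
  have h1 : t0 - rho < t.
    by rewrite lt_neqAle t1 andbT; apply/eqP => e; move: hm; rewrite e Ft ltxx.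
  have h2 : t < t0 + rho.
    by rewrite lt_neqAle t2 andbT; apply/eqP => e; move: hp; rewrite -e Ft ltxx.
  by rewrite ltr_norml; apply/andP; split; lra.
have uni (v : 'rV[R]_n) (t t' : R) : `|v - v0| < r -> `|t - t0| < rho -> `|t' - t0| < rho ->
    F (insc v t) = 0 -> F (insc v t') = 0 -> t = t'.
  move=> hv ht ht' e e'; apply/eqP; rewrite eq_le !leNgt; apply/andP; split; apply/negP => tt.
    by have := mono v _ _ (rr1 v hv) (lt_trans ht' rhor1) (lt_trans ht rhor1) tt; rewrite e e' ltxx.
  by have := mono v _ _ (rr1 v hv) (lt_trans ht rhor1) (lt_trans ht' rhor1) tt; rewrite e e' ltxx.
pose S (v : 'rV[R]_n) : R := xget 0 [set t : R | `|t - t0| < rho /\ F (insc v t) = 0].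
have SP (v : 'rV[R]_n) : `|v - v0| < r -> `|S v - t0| < rho /\ F (insc v (S v)) = 0.
  by move=> hv; rewrite /S; case: xgetP => [t _ [] //|]; have [t ht] := ex v hv; move/(_ t ht).
pose B : set 'rV[R]_n := [set v | `|v - v0| < r].
have oB : open B.
  rewrite (_ : B = ball v0 r); first exact: ball_open.
  by apply/seteqP; split => u; rewrite /B -ball_normE /= distrC.
have cS v1 : B v1 -> {for v1, continuous S}.
  move=> Bv1; apply: near_dist_cont => e e0.
  have [S1 S2] := SP v1 Bv1.
  have [d [d0 dle dp dm]] : exists d : R, [/\ 0 < d, d <= e, `|S v1 + d - t0| < rho & `|S v1 - d - t0| < rho].
    move: S1; rewrite ltr_norml => /andP[a1 a2].
    exists (Num.min e (Num.min ((rho + (S v1 - t0)) / 2) ((rho - (S v1 - t0)) / 2))).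
    split; first by rewrite !lt_min e0; apply/andP; split; lra.
    - by rewrite ge_min lexx.
    - set d := Num.min _ _; have h1 : d <= (rho - (S v1 - t0)) / 2 by rewrite /d !ge_min lexx !orbT.
      have h2 : 0 < d by rewrite !lt_min e0; apply/andP; split; lra.
      by rewrite ltr_norml; apply/andP; split; lra.
    - set d := Num.min _ _; have h1 : d <= (rho + (S v1 - t0)) / 2 by rewrite /d !ge_min lexx !orbT.
      have h2 : 0 < d by rewrite !lt_min e0; apply/andP; split; lra.
      by rewrite ltr_norml; apply/andP; split; lra.
  have lt1 t : `|t - t0| < rho -> `|t - t0| < r1 by move=> h; exact: lt_trans rhor1.
  have n2 := pos_near _ _ (inW _ _ (rr1 _ Bv1) (lt1 _ dp)) _.
  have n3 := neg_near _ _ (inW _ _ (rr1 _ Bv1) (lt1 _ dm)) _.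
  move: n2; feed; first by rewrite -{1}S2; apply: mono; [exact: rr1|exact: lt1|exact: lt1|rewrite ltrDl].
  move: n3; feed; first by rewrite -S2; apply: mono; [exact: rr1|exact: lt1|exact: lt1|rewrite ltrBlDr ltrDl].
  move=> n3 n2; apply: near_imp (near_and (near_and n2 n3) (open_near oB Bv1)) => v [[h1 h2] Bv].
  have [S3 S4] := SP v Bv.
  have h3 : S v < S v1 + d.
    rewrite ltNge; apply/negP; rewrite le_eqVlt => /orP[/eqP e1|h].
      by move: h1; rewrite e1 S4 ltxx.
    by have := lt_trans h1 (mono v _ _ (rr1 v Bv) (lt1 _ dp) (lt1 _ S3) h); rewrite S4 ltxx.
  have h4 : S v1 - d < S v.
    rewrite ltNge; apply/negP; rewrite le_eqVlt => /orP[/eqP e1|h].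
      by move: h2; rewrite -e1 S4 ltxx.
    by have := lt_trans (mono v _ _ (rr1 v Bv) (lt1 _ S3) (lt1 _ dm) h) h2; rewrite S4 ltxx.
  by rewrite ler_norml; apply/andP; split; lra.
have WS v : B v -> W (insc v (S v)).
  by move=> Bv; have [h _] := SP v Bv; apply: inW; [exact: rr1|exact: lt_trans rhor1].
have dS v1 (k : 'I_n) : B v1 -> is_derive v1 (delta_mx 0 k : 'rV[R]_n) S
    (- (pd (lift i k) F (insc v1 (S v1)) * (pd i F (insc v1 (S v1)))^-1)).
  move=> Bv1; set p1 := insc v1 (S v1).
  pose a j := pd j F p1; have ai : 0 < a i by exact: Wpos (WS _ Bv1).
  (* L is an a priori bound for the slope of S: from |tau| a_i <= |h| |b| + (a_i / 2) (|h| + |tau|),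
     where tau is the increment of S, one gets |tau| <= L |h|. *)
  pose b := a (lift i k); pose L := (2 * `|b| + a i) / a i.
  have L0 : 0 <= L by rewrite divr_ge0 ?addr_ge0 ?mulr_ge0 // ltW.
  apply: is_derive_eps => e e0.
  (* The first bound on E gives the a priori estimate; the second makes the remainder E (1 + L) |h|
     / a_i at most e |h|. *)
  pose E := Num.min (a i / 2) (e * a i / (1 + L)).
  have E0 : 0 < E by rewrite lt_min !divr_gt0 ?mulr_gt0 ?ltr_wpDr.
  have E1 : E <= a i / 2 by rewrite ge_min lexx.
  have E2 : E * (1 + L) <= e * a i by rewrite -ler_pdivlMr ?ltr_wpDr // ge_min lexx orbT.
  have en : 0 <= E / n.+1%:R by rewrite divr_ge0 // ltW.
  have en0 : 0 < E / n.+1%:R by rewrite divr_gt0.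
  have n4 : \forall u \near p1, forall j, derivable F u (delta_mx 0 j) /\ `|pd j F u - a j| <= E / n.+1%:R.
    apply: near_forall => j; have sp := smW _ (WS _ Bv1).
    apply: near_imp (near_and (sm_near sp) (cont_near_dist (sm_cont (sm_pd j sp)) en0)) => u [h1 h2].
    split; last exact: h2.
    exact: (@ex_derive _ _ _ _ _ _ _ (sm_derive j h1)).
  have /near_normP[r3 r30 hr3] := n4.
  have inc := C1_increment en hr3.
  have n5 : \forall s \near (0 : R), `|S (v1 + s *: delta_mx 0 k) - S v1| < r3 /\ B (v1 + s *: delta_mx 0 k).
    have cl : {for (0 : R), continuous (fun s : R => v1 + s *: delta_mx 0 k)}.
      apply: continuous_row => j; rewrite (_ : (fun s => _) = fun s : R => v1 0 j + s * (delta_mx 0 k : 'rV[R]_n) 0 j).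
        exact: is_derive1_cont (isd_affine _ _ _).
      by apply/funext => s; rewrite !mxE.
    apply: (near_cont_comp (P := fun v => `|S v - S v1| < r3 /\ B v) cl).
    rewrite scale0r addr0; apply: near_and; last exact: open_near.
    exact: cont_near_lt (cS _ Bv1) r30.
  have /near_normP[r4 r40 hr4] := n5.
  exists (Num.min r3 r4) => [|h]; first by rewrite lt_min r30.
  rewrite lt_min => /andP[hh3 hh4].
  have [|s1 Bs] := hr4 h; first by rewrite subr0.
  set v := v1 + h *: delta_mx 0 k in s1 Bs *; pose tau := S v - S v1.
  pose w := insc (h *: delta_mx 0 k) tau.
  have wE : p1 + w = insc v (S v).
    apply/rowP => j; rewrite [LHS]mxE; case: (unliftP i j) => [l|] ->; rewrite ?insc_lift ?insc_i.
      by rewrite [RHS]mxE.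
    by rewrite /tau addrC subrK.
  have wn : `|w| <= `|h| + `|tau|.
    apply: norm_le_coord => [|j]; first by rewrite addr_ge0.
    case: (unliftP i j) => [l|] ->; rewrite ?insc_lift ?insc_i; last by rewrite lerDr.
    rewrite !mxE normrM; apply: (@le_trans _ _ `|h|); last by rewrite lerDl.
    by case: (_ && _); rewrite ?normr1 ?mulr1 ?normr0 ?mulr0.
  have wlt : `|w| < r3.
    apply: norm_lt_coord => // j; case: (unliftP i j) => [l|] ->; rewrite ?insc_lift ?insc_i //.
    rewrite !mxE normrM; apply: le_lt_trans hh3.
    by case: (_ && _); rewrite ?normr1 ?mulr1 ?normr0 ?mulr0.
  have sumE : \sum_j w 0 j * a j = tau * a i + h * b.
    rewrite (bigD1 i) //= insc_i; congr (_ + _).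
    rewrite (bigD1 (lift i k)) /=; last by rewrite eq_sym neq_lift.
    rewrite insc_lift !mxE !eqxx mulr1 big1 ?addr0 // => j /andP[j1 j2].
    case: (unliftP i j) j1 j2 => [l|] ->; last by rewrite eqxx.
    move=> _ lk; rewrite insc_lift !mxE.
    suff -> : (l == k) = false by rewrite andbF mulr0 mul0r.
    by apply/eqP => e1; move: lk; rewrite e1 eqxx.
  have := inc w wlt; rewrite wE (proj2 (SP _ Bs)) (proj2 (SP _ Bv1)) sumE subrr sub0r normrN.
  rewrite mulrCA mulfV ?pnatr_eq0 // mulr1 => inc1.
  have inc2 : `|tau * a i + h * b| <= E * (`|h| + `|tau|).
    by apply: le_trans inc1 _; rewrite ler_wpM2l // ltW.
  have taul : `|tau| <= L * `|h|.
    have : `|tau| * a i <= `|h| * `|b| + E * (`|h| + `|tau|).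
      have -> : `|tau| * a i = `|(tau * a i + h * b) - h * b| by rewrite addrK normrM (gtr0_norm ai).
      apply: le_trans (ler_normB _ _) _; rewrite normrM addrC lerD2l //.
    have : E * (`|h| + `|tau|) <= a i / 2 * (`|h| + `|tau|) by rewrite ler_wpM2r ?addr_ge0.
    move=> h1 h2; rewrite /L mulrAC ler_pdivlMr //; lra.
  have -> : S v - S v1 - h * - (b * (a i)^-1) = (tau * a i + h * b) * (a i)^-1.
    by rewrite -/tau mulrDl mulfK ?gt_eqF // mulrN opprK mulrA.
  rewrite normrM (gtr0_norm (_ : 0 < (a i)^-1)) ?invr_gt0 // ler_pdivrMr //.
  apply: le_trans inc2 _.
  apply: (@le_trans _ _ (E * (`|h| + L * `|h|))).
    by apply: ler_wpM2l; [exact: ltW|rewrite lerD2l].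
  have -> : E * (`|h| + L * `|h|) = E * (1 + L) * `|h| by ring.
  by rewrite [e * _ * _]mulrAC; apply: ler_wpM2r.
(* Bootstrap: if S is of class C^k, then so are its partial derivatives, being smooth functions of
   (v, S v). *)
have CS k : Ck k B S.
  elim: k => [|k IH]; first by split.
  split; first exact: cS.
  move=> l; split; first by move=> v Bv; have [] := dS v l Bv.
  apply: (Ck_ext oB (f := fun v => - (pd (lift i l) F (insc v (S v)) * (pd i F (insc v (S v)))^-1))).
    by move=> v Bv; have [_ <-] := dS v l Bv.
  apply: (@Ck_comp R n n.+1 k B W (fun u => - (pd (lift i l) F u * (pd i F u)^-1)) (fun v => insc v (S v)) oB oW WS).
    by move=> j; exact: Ck_insc.
  apply: (Ck_opp oW); apply: (Ck_mul oW); first exact: Ck_D (CW _).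
  apply: (Ck_inv oW); first by move=> u Wu; rewrite gt_eqF // Wpos.
  exact: Ck_D (CW _).
exists r, rho, S; split => //.
  by move=> v hv; have [h1 h2] := SP v hv; split => //; exists B.
by move=> v t hv ht Ft; have [h1 h2] := SP v hv; exact: (uni v).
Qed.

End ImplicitFunction.

Lemma implicit_function {R : realType} {n : nat} (i : 'I_n.+1) (F : 'rV[R]_n.+1 -> R) (u0 : 'rV[R]_n.+1) :
  sm F u0 -> F u0 = 0 -> pd i F u0 != 0 ->
  exists (r rho : R) (S : 'rV[R]_n -> R), [/\ 0 < r, 0 < rho,
    forall v, `|v - delc i u0| < r -> [/\ `|S v - u0 0 i| < rho, F (insc i v (S v)) = 0 & sm S v] &
    forall v t, `|v - delc i u0| < r -> `|t - u0 0 i| < rho -> F (insc i v t) = 0 -> t = S v].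
Proof.
move=> sF F0; rewrite neq_lt => /orP[h|h]; last exact: implicit_pos.
have [_ dN] := isdN (sm_derive i sF).
have [|||r [rho [S [r0 rho0 h1 h2]]]] := @implicit_pos R n i (fun u => - F u) u0.
- exact: sm_opp.
- by rewrite F0 oppr0.
- by rewrite pdE dN oppr_gt0.
exists r, rho, S; split => //.
  by move=> v hv; have [a1 a2 a3] := h1 v hv; split => //; rewrite -[LHS]opprK a2 oppr0.
by move=> v t hv ht Ft; apply: h2 => //; rewrite Ft oppr0.
Qed.

(** * Charts of an embedded submanifold *)

Section Submanifold.
Context {R : realType} {T : topologicalType} {m k : nat}.
Variables (A : set (chart R T m)) (hA : amb A) (S : set T).
Notation SA := (submanifold_atlas (k := k) A S).
Implicit Types (c d : chart R T k) (a : chart R T m).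

Lemma sub_in c x : SA c -> chart_dom c x -> S x.
Proof. by move=> [[V _ dE] _ _ _ _]; rewrite dE => -[]. Qed.

Lemma sub_near c x : SA c -> chart_dom c x -> \forall y \near x, S y -> chart_dom c y.
Proof.
move=> [[V oV dE] _ _ _ _]; rewrite dE => -[Vx _].
by apply: near_imp (open_near oV Vx) => y.
Qed.

Lemma sub_inv c x : SA c -> chart_dom c x -> chart_from c (chart_to c x) = x.
Proof. by move=> [_ _ h _ _]; exact: h. Qed.

Lemma sub_img c x : SA c -> chart_dom c x -> \forall u \near chart_to c x,
  chart_dom c (chart_from c u) /\ chart_to c (chart_from c u) = u.
Proof.
move=> [_ oi inv _ _] cx; have hi : chart_img c (chart_to c x) by exists x.
by apply: near_imp (open_near oi hi) => _ [y cy <-]; rewrite inv.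
Qed.

Lemma sub_from_cont c x : SA c -> chart_dom c x -> {for chart_to c x, continuous (chart_from c)}.
Proof.
move=> [_ oi _ [cf _] _] cx; apply: (within_cont_open oi cf).
by exists x.
Qed.

Lemma sub_from a c x : SA c -> chart_dom c x -> A a -> chart_dom a x ->
  smv (fun u => chart_to a (chart_from c u)) (chart_to c x).
Proof.
move=> SAc cx Aa ax; have [_ oi inv sf _] := SAc.
have hi : chart_img c (chart_to c x) by exists x.
have := @smooth_map_local R _ _ _ _ _ _ (amb_euclid k) hA (chart_img c) (chart_from c) (Chart setT id id) a (chart_to c x) sf hi erefl I Aa.
feed; first by rewrite inv.
move=> [F [sF nF]]; apply: smv_ext sF.
by apply: near_imp (near_and nF (open_near oi hi)) => u [h1 h2]; have [_ _ ->] := h1 h2.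
Qed.

Lemma sub_to a c x : SA c -> chart_dom c x -> A a -> chart_dom a x ->
  exists E : 'rV[R]_m -> 'rV[R]_k, smv E (chart_to a x) /\
    \forall y \near x, chart_dom c y -> chart_to c y = E (chart_to a y).
Proof.
move=> SAc cx Aa ax; have [_ _ _ _ st] := SAc.
have [F [sF nF]] := @smooth_map_local R _ _ _ _ _ _ hA (amb_euclid k) (chart_dom c) (chart_to c) a (Chart setT id id) x st cx Aa ax erefl I.
by exists F; split => //; apply: near_imp nF => y h cy; have [_ _ ] := h cy.
Qed.

(** A chart of the submanifold is locally the restriction of a smooth map E of ambient coordinates;
    composition with E turns smoothness in ambient coordinates into smoothness in the chart. *)
Lemma smv_into l (f : 'rV[R]_l -> T) a c (u : 'rV[R]_l) : SA c -> A a ->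
  chart_dom c (f u) -> chart_dom a (f u) -> {for u, continuous f} ->
  smv (fun v => chart_to a (f v)) u -> (\forall v \near u, S (f v)) ->
  smv (fun v => chart_to c (f v)) u.
Proof.
move=> SAc Aa cx ax cf sf nS; have [E [sE nE]] := sub_to SAc cx Aa ax.
apply: (smv_ext (f := fun v => E (chart_to a (f v)))); last exact: smv_comp.
apply: near_imp (near_and (near_and (near_cont_comp cf nE) (near_cont_comp cf (sub_near SAc cx))) nS) => v [[h1 h2] h3].
by rewrite h1 //; exact: h2.
Qed.

Lemma sub_good : good_atlas SA.
Proof.
split.
- by move=> c x; exact: sub_inv.
- by move=> c x; exact: sub_img.
- by move=> c x; exact: sub_from_cont.
- move=> c x SAc cx; apply: near_imp (sub_near SAc cx) => y h [d SAd dy].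
  by apply: h; exact: sub_in dy.
- move=> c d x SAc SAd cx dx; have [a Aa ax] := am_cover hA x.
  have e := sub_inv SAc cx.
  apply: (@smv_into k (chart_from c) a); rewrite ?e //.
    exact: sub_from_cont.
    exact: sub_from.
  by apply: near_imp (sub_img SAc cx) => u [h _]; exact: sub_in h.
Qed.

End Submanifold.

Section PullbackMetric.
Context {R : realType} {M : topologicalType} {m : nat}.
Variables (A : set (chart R M m)) (hA : amb A) (g : chart R M m -> M -> 'M[R]_m).

Definition metric_change : Prop := forall a b x, A a -> A b -> chart_dom a x -> chart_dom b x ->
  g a x = jac (trans a b) (chart_to a x) *m g b x *m (jac (trans a b) (chart_to a x))^T.

(** [pullback_metric] picks some chart around f u; by the transformation law of the metric every
    chart gives the same matrix. *)
Lemma pullback_metricE l (f : 'rV[R]_l -> M) u a : metric_change -> A a -> chart_dom a (f u) ->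
  {for u, continuous f} -> smv (fun v => chart_to a (f v)) u ->
  pullback_metric A g f u
  = jac (fun v => chart_to a (f v)) u *m g a (f u) *m (jac (fun v => chart_to a (f v)) u)^T.
Proof.
move=> hg Aa af cf sf; rewrite /pullback_metric.
case: xgetP => [S _ [b [Ab bf ->]]|]; last first.
  move=> /(_ (jac (fun v => chart_to a (f v)) u *m g a (f u) *m (jac (fun v => chart_to a (f v)) u)^T)) h.
  by exfalso; apply: h; exists a.
cbv zeta; rewrite -/(jac (fun v => chart_to b (f v)) u).
have -> : jac (fun v => chart_to b (f v)) u
    = jac (fun v => chart_to a (f v)) u *m jac (trans a b) (chart_to a (f u)).
  rewrite -(jac_chain sf (am_smooth hA Aa Ab af bf)).
  apply/esym/jac_eqnear; last exact: smv_comp sf (am_smooth hA Aa Ab af bf).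
  apply: near_imp (near_cont_comp cf (am_open hA Aa af)) => v h.
  by rewrite /trans (am_inv hA).
by rewrite (hg a b (f u)) // trmx_mul !mulmxA.
Qed.

End PullbackMetric.

(** * Gamma as a regular level set *)

Section LevelSet.
Context {R : realType} {n : nat} {M : topologicalType}.
Variables (A : set (chart R M n.+1)) (hA : amb A) (phi : M -> R).
Hypothesis hphi : smooth_map A setT (line_atlas R) phi.
Hypothesis hd : dphi_nonzero A phi.

Lemma sm_phi a x : A a -> chart_dom a x -> sm (fun u => phi (chart_from a u)) (chart_to a x).
Proof.
move=> Aa ax.
have [F [sF nF]] := @smooth_map_local R _ _ _ _ _ _ hA (@amb_line R) setT phi a (Chart setT (fun t : R => const_mx t) (fun v : 'rV[R]_1 => v 0 0)) x hphi I Aa ax erefl I.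
apply: (sm_ext (f := fun u => F u 0 0)) (sF 0).
apply: near_imp (near_and (near_chart hA Aa ax nF) (am_img hA Aa ax)) => u [h1 [_ h2]].
by have [_ _] := h1 I; rewrite /= h2 => <-; rewrite mxE.
Qed.

(** Where the i-th derivative of phi does not vanish, Gamma is the graph of the implicit function S
    over the other coordinates, and these serve as the chart. *)
Lemma level_set_chart y0 : Gamma phi y0 -> exists2 c, Gamma_atlas A phi c & chart_dom c y0.
Proof.
move=> G0; have [a Aa ay] := am_cover hA y0.
pose u0 := chart_to a y0; pose F u := phi (chart_from a u).
have [i Fi] := hd Aa ay G0.
have sF : sm F u0 := sm_phi Aa ay.
have F0 : F u0 = 0 by rewrite /F (am_inv hA).
have [r1 [rho [S [r10 rho0 hS uS]]]] := implicit_function (i := i) sF F0 Fi.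
have /near_normP[r2 r20 hr2] := near_and (am_img hA Aa ay) (sm_near sF).
pose v0 := delc i u0.
have cS : {for v0, continuous S}.
  by have [|_ _ /sm_cont] := hS v0; rewrite ?subrr ?normr0.
have S0 : S v0 = u0 0 i.
  by apply/esym/uS; rewrite ?subrr ?normr0 ?delcK.
have nS : \forall v \near v0, `|S v - u0 0 i| < r2 by rewrite -S0; exact: cont_near_lt.
have /near_normP[r3 r30 hr3] := nS.
pose r : R := Num.min (Num.min r1 r2) r3.
have r0 : 0 < r by rewrite !lt_min r10 r20.
have hr v : `|v - v0| < r -> [/\ `|v - v0| < r1, `|v - v0| < r2 & `|v - v0| < r3].
  by rewrite !lt_min => /andP[/andP[]].
pose E v := insc i v (S v).
have EP v : `|v - v0| < r -> [/\ chart_dom a (chart_from a (E v)), chart_to a (chart_from a (E v)) = E v & F (E v) = 0].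
  move=> hv; have [h1 h2 h3] := hr v hv.
  have [|[e1 e2] _] := hr2 (E v); first by apply: insc_norm_lt => //; exact: hr3.
  by have [_ ? _] := hS v h1.
have sE v : `|v - v0| < r -> smv E v.
  move=> hv j; have [h1 h2 h3] := hr v hv; have [_ _ sS] := hS v h1.
  rewrite /E; case: (unliftP i j) => [l|] ->.
    by apply: sm_ext (sm_coord l v); apply: near_all => w; rewrite insc_lift.
  by apply: sm_ext sS; apply: near_all => w; rewrite insc_i.
pose P y := [/\ chart_dom a y, `|delc i (chart_to a y) - v0| < r & `|chart_to a y 0 i - u0 0 i| < rho].
have oP : open P.
  rewrite openE => y [y1 y2 y3].
  have cd : {for y, continuous (fun z => delc i (chart_to a z))}.
    apply: continuous_row => j; rewrite (_ : (fun s => _) = fun s => chart_to a s 0 (lift i j)).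
      by apply: continuous_coord; exact: (am_to hA).
    by apply/funext => s; rewrite mxE.
  have ci : {for y, continuous (fun z => chart_to a z 0 i)}.
    by apply: continuous_coord; exact: (am_to hA).
  have lt_near (W : normedModType R) (f : M -> W) (b : W) (e : R) : {for y, continuous f} -> `|f y - b| < e ->
      \forall z \near y, `|f z - b| < e.
    move=> cf lt; have e0 : 0 < e - `|f y - b| by rewrite subr_gt0.
    apply: near_imp (cont_near_lt cf e0) => z; rewrite ltrBrDr; apply: le_lt_trans.
    by rewrite -[f z - b](subrKA (f y)); exact: ler_normD.
  apply: near_imp (near_and (near_and (am_open hA Aa y1) (lt_near _ _ _ _ cd y2)) (lt_near _ _ _ _ ci y3)).
  by move=> z [[h1 h2] h3]; split.
pose c : chart R M n := Chart (P `&` Gamma phi) (fun y => delc i (chart_to a y)) (fun v => chart_from a (E v)).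
have img v : chart_img c v <-> `|v - v0| < r.
  split; first by move=> [y [[_ h _] _] <-].
  move=> hv; have [e1 e2 e3] := EP v hv; have [h1 _ _] := hr v hv.
  exists (chart_from a (E v)); last by rewrite /= e2 insck.
  split => //; split; rewrite ?e2 ?insck //.
  by rewrite insc_i; have [] := hS v h1.
have inv y : chart_dom c y -> E (chart_to c y) = chart_to a y.
  move=> [[y1 y2 y3] Gy]; have [h1 _ _] := hr _ y2.
  rewrite /E /= -(uS _ (chart_to a y 0 i) h1 y3) ?delcK //.
  by rewrite -/(F _) /F (am_inv hA).
exists c; last first.
  by split => //; split => //; rewrite ?subrr ?normr0.
split.
- by exists P.
- rewrite (_ : chart_img c = ball v0 r); first exact: ball_open.
  by apply/seteqP; split => v; rewrite -ball_normE /= distrC => /img.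
- by move=> y cy; rewrite [chart_from c _]/= inv // (am_inv hA) //; case: cy => -[].
- apply: (local_expr_smooth_map (amb_euclid n) hA) => v /img hv; have [e1 e2 e3] := EP v hv.
  exists (Chart setT id id), a, E; split; first by split.
  split; first exact: sE.
  by apply: near_all => w /img hw; have [h1 h2 h3] := EP w hw; split.
- apply: (local_expr_smooth_map hA (amb_euclid n)) => y [[y1 y2 y3] Gy].
  exists a, (Chart setT id id), (delc i); split; first by split.
  split; last by apply: near_all => z [[z1 _ _] _].
  move=> j; apply: sm_ext (sm_coord (lift i j) _).
  by apply: near_all => w; rewrite mxE.
Qed.

(** Start at y and move the i-th coordinate with velocity D, the i-th derivative of phi at y:
    initially phi grows at the rate D^2 > 0, so points of Omega are met in every neighbourhood of
    y. *)
Lemma Gamma_closure y : Gamma phi y -> closure (Omega phi) y.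
Proof.
move=> G0; have [a Aa ay] := am_cover hA y.
have [i Fi] := hd Aa ay G0; move: (sm_phi Aa ay) Fi.
set F := fun u => _ => sF Fi B nB.
pose u0 := chart_to a y.
have F0 : F u0 = 0 by rewrite /F /u0 (am_inv hA).
pose D := pd i F u0.
have D0 : D != 0 by [].
have n0 : \forall v \near u0, sm F v /\ 0 < D * pd i F v.
  apply: near_and; first exact: sm_near.
  have DD : 0 < D * pd i F u0 by rewrite -expr2 exprn_even_gt0.
  apply: near_imp (cont_near_lt (sm_cont (sm_mul (sm_cst D u0) (sm_pd i sF))) DD) => v.
  by rewrite ltr_norml => /andP[h _]; rewrite -(ltrD2r (- (D * pd i F u0))) add0r.
have nB' : \forall s \near (0 : R), (sm F (u0 + s *: (D *: delta_mx 0 i)) /\ 0 < D * pd i F (u0 + s *: (D *: delta_mx 0 i))) /\ B (chart_from a (u0 + s *: (D *: delta_mx 0 i))).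
  have cl : {for (0 : R), continuous (fun s : R => u0 + s *: (D *: delta_mx 0 i))}.
    apply: continuous_row => j; rewrite (_ : (fun s => _) = fun s : R => u0 0 j + s * (D *: delta_mx 0 i : 'rV[R]_n.+1) 0 j).
      exact: is_derive1_cont (isd_affine _ _ _).
    by apply/funext => s; rewrite !mxE.
  apply: (near_cont_comp (P := fun v => (sm F v /\ 0 < D * pd i F v) /\ B (chart_from a v)) cl).
  by rewrite scale0r addr0; exact: near_and n0 (near_chart hA Aa ay nB).
have /near_normP[r r0 hr] := nB'.
pose s : R := r / 2.
have s0 : 0 < s by rewrite divr_gt0.
have sr : s < r by rewrite /s; lra.
have hs (t : R) : 0 <= t <= s -> `|t - 0| < r by move=> /andP[t0 ts]; rewrite subr0 ger0_norm //; apply: le_lt_trans sr.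
exists (chart_from a (u0 + s *: (D *: delta_mx 0 i))); split; last by apply: (proj2 (hr s _)); apply: hs; rewrite lexx ltW.
have := @MVT_gt0 R (fun s => F (u0 + s *: (D *: delta_mx 0 i)))
  (fun s => D * pd i F (u0 + s *: (D *: delta_mx 0 i))) 0 s s0.
rewrite scale0r addr0 F0; apply => t /hs/hr[[h1 h2] _] //.
have := @sm_comp_derive R n.+1 R F (fun s : R => u0 + s *: (D *: delta_mx 0 i)) t 1 (D *: delta_mx 0 i) h1.
feed.
  move=> j; apply: (is_derive_ext _ _ (isd_affine (u0 0 j) ((D *: delta_mx 0 i : 'rV[R]_n.+1) 0 j) t)).
    by move=> z; rewrite !mxE.
  by [].
move=> h; apply: (is_derive_eq h); rewrite (bigD1 i) //= big1 => [|j ji].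
  by rewrite !mxE !eqxx mulr1 addr0.
by rewrite !mxE (negbTE ji) andbF mulr0 mul0r.
Qed.

End LevelSet.

(** * Semigeodesic coordinates *)

Section Matrices.
Context {R : realType}.

Definition smm k m l (f : 'rV[R]_k -> 'M[R]_(m, l)) (x : 'rV[R]_k) : Prop :=
  forall i j, sm (fun u => f u i j) x.

Lemma smm_near k m l (f : 'rV[R]_k -> 'M[R]_(m, l)) x : smm f x -> \forall y \near x, smm f y.
Proof.
move=> h; apply: near_imp (near_forall (P := fun i y => forall j, sm (fun u => f u i j) y) _).
  by move=> y hy i j; exact: hy.
by move=> i; apply: near_forall => j; exact: sm_near.
Qed.

Lemma smm_mul k m l p (f : 'rV[R]_k -> 'M[R]_(m, l)) (h : 'rV[R]_k -> 'M[R]_(l, p)) x :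
  smm f x -> smm h x -> smm (fun u => f u *m h u) x.
Proof.
move=> h1 h2 i j; apply: (sm_ext (f := fun u => \sum_a f u i a * h u a j)).
  by apply: near_all => u; rewrite mxE.
by apply: sm_sum => a _; exact: sm_mul.
Qed.

Lemma smm_tr k m l (f : 'rV[R]_k -> 'M[R]_(m, l)) x : smm f x -> smm (fun u => (f u)^T) x.
Proof. by move=> h i j; apply: sm_ext (h j i); apply: near_all => u; rewrite mxE. Qed.

Lemma smm_jac m l (f : 'rV[R]_m -> 'rV[R]_l) x : smv f x -> smm (jac f) x.
Proof. by move=> h i j; exact: sm_jac_coef. Qed.

Lemma smm_ext k m l (f h : 'rV[R]_k -> 'M[R]_(m, l)) x : (\forall y \near x, f y = h y) ->
  smm f x -> smm h x.
Proof. by move=> e hf i j; apply: sm_ext (hf i j); apply: near_imp e => y ->. Qed.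

Lemma smm_comp k k' m l (f : 'rV[R]_k' -> 'M[R]_(m, l)) (y : 'rV[R]_k -> 'rV[R]_k') x :
  smv y x -> smm f (y x) -> smm (fun u => f (y u)) x.
Proof. by move=> h1 h2 i j; exact: (sm_comp (f := fun v => f v i j)). Qed.

Lemma sm_det k l (f : 'rV[R]_k -> 'M[R]_l) x : smm f x -> sm (fun u => \det (f u)) x.
Proof.
move=> h; apply: sm_sum => s _; apply: sm_mul; first exact: sm_cst.
by apply: sm_prod => i _; exact: h.
Qed.

(** Cramer's formula: determinant and cofactors are polynomials in the entries. *)
Lemma smm_inv k l (f : 'rV[R]_k -> 'M[R]_l) x : f x \in unitmx -> smm f x ->
  smm (fun u => invmx (f u)) x.
Proof.
move=> ux h; have dx : \det (f x) != 0 by rewrite -unitfE -unitmxE.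
have sd := sm_det h.
have nu : \forall u \near x, f u \in unitmx.
  have e0 : 0 < `|\det (f x)| by rewrite normr_gt0.
  apply: near_imp (cont_near_lt (sm_cont sd) e0) => u hu.
  rewrite unitmxE unitfE; apply/eqP => e1; move: hu.
  by rewrite e1 sub0r normrN ltxx.
apply: (smm_ext (f := fun u => (\det (f u))^-1 *: \adj (f u))).
  by apply: near_imp nu => u hu; rewrite /invmx hu.
move=> i j; apply: (sm_ext (f := fun u => (\det (f u))^-1 * cofactor (f u) j i)).
  by apply: near_all => u; rewrite !mxE.
apply: sm_mul; first exact: sm_inv.
apply: sm_mul; first exact: sm_cst.
apply: sm_det => a b; apply: sm_ext (h (lift j a) (lift i b)).
by apply: near_all => u; rewrite !mxE.
Qed.

Lemma near_dist_lt (V : normedModType R) (x0 x : V) (r : R) :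
  `|x - x0| < r -> \forall y \near x, `|y - x0| < r.
Proof.
move=> h; have e0 : 0 < r - `|x - x0| by rewrite subr_gt0.
apply/near_normP; exists (r - `|x - x0|) => // y; rewrite ltrBrDr; apply: le_lt_trans.
by rewrite -[y - x0](subrKA x); exact: ler_normD.
Qed.

Lemma row_mx_near m l (u0 : 'rV[R]_m) (v0 : 'rV[R]_l) (u : 'rV[R]_m) (v : 'rV[R]_l) (r : R) : 0 < r ->
  `|u - u0| < r -> `|v - v0| < r -> `|row_mx u v - row_mx u0 v0| < r.
Proof.
move=> r0 h1 h2; rewrite opp_row_mx add_row_mx; apply: norm_lt_coord => // i.
case: (split_ordP i) => j ->.
  by rewrite row_mxEl; apply: le_lt_trans h1; exact: coord_le_norm.
by rewrite row_mxEr; apply: le_lt_trans h2; exact: coord_le_norm.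
Qed.

Lemma row_mx_nearE m l (u0 : 'rV[R]_m) (v0 : 'rV[R]_l) (u : 'rV[R]_m) (v : 'rV[R]_l) (r : R) : 0 < r ->
  `|row_mx u v - row_mx u0 v0| < r -> `|u - u0| < r /\ `|v - v0| < r.
Proof.
move=> r0; rewrite opp_row_mx add_row_mx => h; split; apply: norm_lt_coord => // i.
  by apply: le_lt_trans h; rewrite -(row_mxEl (u - u0) (v - v0)); exact: coord_le_norm.
by apply: le_lt_trans h; rewrite -(row_mxEr (u - u0) (v - v0)); exact: coord_le_norm.
Qed.

Lemma const_mx1_norm (s : R) : `|const_mx s : 'rV[R]_1| = `|s|.
Proof.
apply/eqP; rewrite eq_le; apply/andP; split; first exact: const_norm_le.
by have := coord_le_norm (const_mx s : 'rV[R]_1) 0; rewrite mxE.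
Qed.

Lemma const_mx1_eq (v : 'rV[R]_1) : v = const_mx (v 0 0).
Proof. by apply/rowP => i; rewrite mxE ord1. Qed.

End Matrices.

(** * The metric in semigeodesic coordinates *)

Section Semigeodesic.
Context {R : realType} {n : nat} {M : topologicalType}.
Variables (A : set (chart R M n.+1)) (hA : amb A).
Variables (g : chart R M n.+1 -> M -> 'M[R]_n.+1) (hg : riemannian_metric A g).
Variables (phi : M -> R) (hphi : smooth_map A setT (line_atlas R) phi).
Variable hdphi : dphi_nonzero A phi.
Variables (W : set M) (eps0 : R) (q : M -> M) (X : M * R -> M)
  (B : chart R M n -> 'rV[R]_n -> R -> 'M[R]_n).
Variable hB : semigeodesic A g phi W eps0 q X B.
Local Notation GA := (Gamma_atlas A phi).
Implicit Types (c d : chart R M n) (a : chart R M n.+1).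

Lemma metric_change_g : metric_change A g.
Proof. by move=> a b x Aa Ab ax bx; have [_ _ h] := hg; exact: (h a b x Aa Ab ax bx). Qed.

Lemma metric_change_jacobi : metric_change A (jacobi_metric g phi).
Proof.
move=> a b x Aa Ab ax bx; rewrite /jacobi_metric {1}(metric_change_g Aa Ab ax bx).
by rewrite -scalemxAr -scalemxAl.
Qed.

Lemma smm_g a x : A a -> chart_dom a x -> smm (fun u => g a (chart_from a u)) (chart_to a x).
Proof.
move=> Aa ax i j; have [_ h _] := hg.
apply: (smooth_on_sm (h a Aa i j)); first by exists x.
by apply: near_imp (am_img hA Aa ax) => u [h1 h2]; exists (chart_from a u).
Qed.

Lemma GA_in c y : GA c -> chart_dom c y -> Gamma phi y.
Proof. exact: sub_in. Qed.

Lemma G_length_cst y : G_length A g phi (fun=> y) = 0%E.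
Proof.
have [a Aa ay] := am_cover hA y.
rewrite /G_length; apply: integral0_eq => t _; rewrite /G_speed.
have -> : pullback_metric A g (fun w : 'rV[R]_1 => (fun=> y) (w 0 0)) (const_mx t) = 0.
  rewrite (pullback_metricE hA (a := a) metric_change_g) //.
  - have -> : jac (fun v : 'rV[R]_1 => chart_to a ((fun=> y) (v 0 0))) (const_mx t) = 0.
      apply/matrixP => i j; rewrite jac_pd; last by move=> k; exact: sm_cst.
      by rewrite pdE mxE; have [_ ->] := isd_cst (chart_to a y 0 j) (const_mx t) (delta_mx 0 i : 'rV[R]_1).
    by rewrite !mul0mx.
  - exact: cst_continuous.
  - by move=> k; exact: sm_cst.
by rewrite mxE eqxx.
Qed.

(** The constant curve at y is admissible, as Gamma lies in the closure of Omega, and it has length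
    0 because zero vectors have zero length even on Gamma. *)
Lemma s_coord_Gamma y : Gamma phi y -> s_coord A g phi y = 0.
Proof.
move=> Gy; suff : rho A g phi y = 0%E by rewrite /s_coord => ->; rewrite expr0n mul0r.
apply/eqP; rewrite eq_le; apply/andP; split; last first.
  apply: le_ereal_inf_tmp => _ [gam _ <-]; apply: integral_ge0 => t _; rewrite /G_speed.
  by case: ifP => // _; case: ifP => // _; rewrite lee_fin sqrtr_ge0.
apply: ereal_inf_lbound; exists (fun=> y); last exact: G_length_cst.
have [a Aa ay] := am_cover hA y.
split=> //; last by move=> t _; exact: (Gamma_closure hA hphi hdphi).
apply: (local_expr_smooth_map (@amb_line R) hA) => t _.
exists (Chart setT (fun t : R => const_mx t) (fun v : 'rV[R]_1 => v 0 0)), a, (fun=> chart_to a y).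
split; first by split.
by split; [move=> k; exact: sm_cst|apply: near_all].
Qed.

Lemma Gamma_W y : Gamma phi y -> W y.
Proof.
move=> Gy; have [V [_ h1 h2]] := semigeodesic_nbhs hB.
by apply: h2; split; [exact: h1|exact: (Gamma_closure hA hphi hdphi)].
Qed.

Lemma X_Gamma y : Gamma phi y -> X (y, 0) = y.
Proof.
move=> Gy; have [_ _] := semigeodesic_to hB (Gamma_W Gy).
by rewrite (semigeodesic_Gamma hB Gy) s_coord_Gamma.
Qed.

(** X is smooth on Gamma x [0, eps0] as a subset of M x R; composition with a chart of Gamma gives
    an expression in (u, s), which at s = 0 is only the restriction of a smooth F. *)
Lemma X_expr c a u s : GA c -> A a -> chart_dom c (chart_from c u) -> chart_to c (chart_from c u) = u ->
  0 <= s <= eps0 -> chart_dom a (X (chart_from c u, s)) ->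
  exists F : 'rV[R]_(n + 1) -> 'rV[R]_n.+1, smv F (row_mx u (const_mx s)) /\
    \forall w \near row_mx u (const_mx s), 0 <= rsubmx w 0 0 <= eps0 ->
      chart_dom a (X (chart_from c (lsubmx w), rsubmx w 0 0)) /\
      chart_to a (X (chart_from c (lsubmx w), rsubmx w 0 0)) = F w.
Proof.
move=> Gc Aa cu uE hs aX; set y := chart_from c u in cu uE aX.
have [b Ab bz] := am_cover hA y.
pose l : chart R R 1 := Chart setT (fun t : R => const_mx t) (fun v : 'rV[R]_1 => v 0 0).
have Gy := GA_in Gc cu.
have D0 : (Gamma phi `*` `[0, eps0]) (y, s) by split => //=; rewrite in_itv.
have L0 : prod_atlas A (line_atlas R) (prod_chart b l) by exists b, l.
have d0 : chart_dom (prod_chart b l) (y, s) by [].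
have [F [sF nF]] := smooth_map_local (amb_prod hA (@amb_line R)) hA
  (semigeodesic_smooth_X hB) D0 L0 d0 Aa aX.
exists (fun w => F (row_mx (chart_to b (chart_from c (lsubmx w))) (rsubmx w))).
have cu' : {for row_mx u (const_mx s : 'rV[R]_1), continuous (fun w => chart_from c (lsubmx w))}.
  apply: (@continuous_comp _ _ _ (fun w : 'rV[R]_(n + 1) => lsubmx w) (chart_from c)).
    exact: smv_cont (smv_lsubmx _).
  by rewrite row_mxKl -uE; exact: (sub_from_cont Gc cu).
have cs : {for row_mx u (const_mx s : 'rV[R]_1), continuous (fun w : 'rV[R]_(n + 1) => rsubmx w 0 0)}.
  by apply: continuous_coord; exact: smv_cont (smv_rsubmx _).
split.
  apply: (smv_comp (f := F) (y := fun w => row_mx (chart_to b (chart_from c (lsubmx w))) (rsubmx w))).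
    apply: (smv_row_mx (f := fun w => chart_to b (chart_from c (lsubmx w)))); last exact: smv_rsubmx.
    apply: (smv_comp (f := fun v => chart_to b (chart_from c v))); first exact: smv_lsubmx.
    by rewrite row_mxKl -uE; exact: (sub_from hA Gc cu).
  by rewrite row_mxKl row_mxKr; exact: sF.
have cp : {for row_mx u (const_mx s : 'rV[R]_1), continuous (fun w : 'rV[R]_(n + 1) => (chart_from c (lsubmx w), rsubmx w 0 0))}.
  exact: cont_pair.
have e0 : (chart_from c (lsubmx (row_mx u (const_mx s : 'rV[R]_1))), rsubmx (row_mx u (const_mx s : 'rV[R]_1)) 0 0) = (y, s).
  by rewrite row_mxKl row_mxKr mxE.
have n1 : \forall w \near row_mx u (const_mx s : 'rV[R]_1), chart_dom c (chart_from c (lsubmx w)).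
  apply: (near_cont_comp (P := fun v => chart_dom c (chart_from c v)) (smv_cont (smv_lsubmx _))).
  by rewrite row_mxKl -uE; apply: near_imp (sub_img Gc cu) => v [].
rewrite -e0 in nF.
apply: near_imp (near_and n1 (near_cont_comp cp nF)) => w [h1 h2] hs'.
have [|_ h3 h4] := h2; first by split; [exact: GA_in Gc h1|rewrite /= in_itv].
split => //; rewrite h4 /=; congr (F (row_mx _ _)).
by rewrite -const_mx1_eq.
Qed.

Lemma q_expr c a x : GA c -> A a -> W x -> chart_dom c (q x) -> chart_dom a x ->
  exists Q : 'rV[R]_n.+1 -> 'rV[R]_n, smv Q (chart_to a x) /\
    \forall y \near x, W y -> chart_dom c (q y) /\ chart_to c (q y) = Q (chart_to a y).
Proof.
move=> Gc Aa Wx cq ax; have [b Ab bq] := am_cover hA (q x).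
have [F [sF nF]] := @smooth_map_local R _ _ _ _ _ _ hA hA W q a b x (semigeodesic_smooth_q hB) Wx Aa ax Ab bq.
have [E [sE nE]] := sub_to hA Gc cq Ab bq.
have [_ _ e0] := nbhs_singleton nF Wx.
exists (fun u => E (F u)); split; first by apply: smv_comp => //; rewrite -e0.
have cq' := proj1 (semigeodesic_smooth_q hB).
have n1 := within_near cq' Wx nE.
have n2 := within_near cq' Wx (sub_near Gc cq).
apply: near_imp (near_and (near_and n1 n2) nF) => y [[h1 h2] h3] Wy.
have [Gq _ _] := semigeodesic_to hB Wy.
have cqy := h2 Wy Gq; split => //.
by rewrite h1 //; have [_ _ ->] := h3 Wy.
Qed.

Lemma s_expr a x : A a -> W x -> chart_dom a x ->
  exists S : 'rV[R]_n.+1 -> R, sm S (chart_to a x) /\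
    \forall y \near x, W y -> s_coord A g phi y = S (chart_to a y).
Proof.
move=> Aa Wx ax.
have [F [sF nF]] := @smooth_map_local R _ _ _ _ _ _ hA (@amb_line R) W (s_coord A g phi) a
  (Chart setT (fun t : R => const_mx t) (fun v : 'rV[R]_1 => v 0 0)) x (semigeodesic_smooth_s hB) Wx Aa ax erefl I.
exists (fun u => F u 0 0); split; first exact: sF.
by apply: near_imp nF => y h Wy; have [_ _ <-] := h Wy; rewrite mxE.
Qed.

Lemma B_ext c u : GA c -> chart_img c u ->
  exists Bt : 'rV[R]_(n + 1) -> 'M[R]_n, smm Bt (row_mx u 0) /\
    \forall w \near row_mx u 0, chart_img c (lsubmx w) /\ 0 <= rsubmx w 0 0 <= eps0 ->
      B c (lsubmx w) (rsubmx w 0 0) = Bt w.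
Proof.
move=> Gc iu; have e0 := ltW (semigeodesic_eps0 hB).
have h : forall i j : 'I_n, exists F : 'rV[R]_(n + 1) -> R, sm F (row_mx u 0) /\
    \forall w \near row_mx u 0, chart_img c (lsubmx w) /\ 0 <= rsubmx w 0 0 <= eps0 ->
      F w = B c (lsubmx w) (rsubmx w 0 0) i j.
  move=> i j; have [|F h1 h2] := smooth_on_ext (semigeodesic_B_smooth hB Gc i j) (x := row_mx u 0).
    by rewrite /= row_mxKl row_mxKr mxE lexx.
  by exists F.
have /choice[F /= hF] : forall ij : 'I_n * 'I_n, exists F : 'rV[R]_(n + 1) -> R, sm F (row_mx u 0) /\
    \forall w \near row_mx u 0, chart_img c (lsubmx w) /\ 0 <= rsubmx w 0 0 <= eps0 ->
      F w = B c (lsubmx w) (rsubmx w 0 0) ij.1 ij.2 by move=> [i j]; exact: h.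
exists (fun w => \matrix_(i, j) F (i, j) w); split.
  by move=> i j; apply: sm_ext (proj1 (hF (i, j))); apply: near_all => w; rewrite mxE.
apply: near_imp (near_forall (P := fun i w => forall j, chart_img c (lsubmx w) /\ 0 <= rsubmx w 0 0 <= eps0 ->
      F (i, j) w = B c (lsubmx w) (rsubmx w 0 0) i j) _).
  by move=> w hw hh; apply/matrixP => i j; rewrite mxE hw.
by move=> i; apply: near_forall => j; have [_] := hF (i, j).
Qed.

Lemma diag_quad m l (J : 'M[R]_(m, l)) (S : 'M[R]_l) i :
  (J *m S *m J^T) i i = (row i J *m S *m (row i J)^T) 0 0.
Proof.
rewrite -row_mul [LHS]mxE [RHS]mxE; apply: eq_bigr => k _; congr (_ * _); last by rewrite !mxE.
by rewrite [RHS]mxE.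
Qed.

Lemma sym_posdef_unit l (S : 'M[R]_l) : sym_posdef S -> S \in unitmx.
Proof.
move=> [_ h]; rewrite -row_free_unit -kermx_eq0; apply/eqP/row_matrixP => i.
rewrite row0; apply/eqP; apply/negPn/negP => /h.
by rewrite -row_mul mulmx_ker row0 mul0mx mxE ltxx.
Qed.

(* Xt and Ct are smooth extensions, in the chart a, of X and of C across s = 0,
   and phi = s h. *)
Record normal_chart (c : chart R M n) (a : chart R M n.+1) (u0 : 'rV[R]_n) (Xt : 'rV[R]_(n + 1) -> 'rV[R]_n.+1)
  (h : 'rV[R]_(n + 1) -> R) (Ct : 'rV[R]_(n + 1) -> 'M[R]_n) (r : R) : Prop := {
  nc_r : 0 < r < eps0;
  nc_c : GA c;
  nc_a : A a;
  nc_img : forall u, `|u - u0| < r -> chart_dom c (chart_from c u) /\ chart_to c (chart_from c u) = u;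
  nc_sm : forall w, `|w - row_mx u0 0| < r -> [/\ smv Xt w, sm h w, 0 < h w & smm Ct w];
  nc_from : forall w, `|w - row_mx u0 0| < r ->
    chart_dom a (chart_from a (Xt w)) /\ chart_to a (chart_from a (Xt w)) = Xt w;
  nc_X : forall u (s : R), `|u - u0| < r -> 0 <= s < r ->
    [/\ X (chart_from c u, s) = chart_from a (Xt (row_mx u (const_mx s))),
        phi (X (chart_from c u, s)) = s * h (row_mx u (const_mx s)) &
        C_mx B c u s = Ct (row_mx u (const_mx s))];
  nc_metric : forall u (s : R), `|u - u0| < r -> 0 < s < r ->
    let w := row_mx u (const_mx s) in
    jac Xt w *m g a (chart_from a (Xt w)) *m (jac Xt w)^T = h w *: block_mx (B c u s) 0 0 1%:M }.

(** With G = g / phi the semigeodesic form says that the pull-back of g is phi / s times the block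
    matrix of B and 1. Its (s, s) entry h is defined from the extension of X, hence smooth across s
    = 0, and phi = s h. What has to be proved is h > 0 on Gamma, that is, that the s-derivative of X
    does not vanish there. *)
Lemma normal_chart_exists c y0 : GA c -> chart_dom c y0 ->
  exists a Xt h Ct r, chart_dom a y0 /\ normal_chart c a (chart_to c y0) Xt h Ct r.
Proof.
move=> Gc cy; have [a Aa ay] := am_cover hA y0.
have e00 := semigeodesic_eps0 hB; have e0 := ltW e00.
have Gy := GA_in Gc cy; have inv := sub_inv Gc cy.
have [u0 u0E] := exists_eq (chart_to c y0); rewrite -u0E.
have [w0 w0E] : exists w0 : 'rV[R]_(n + 1), w0 = row_mx u0 0 by exists (row_mx u0 0).
have yE : chart_from c u0 = y0 by rewrite u0E inv.
have c0 : const_mx 0 = 0 :> 'rV[R]_1 by apply/rowP => i; rewrite !mxE.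
have [||||Xt] := @X_expr c a u0 0 Gc Aa.
- by rewrite yE.
- by rewrite yE.
- by rewrite lexx.
- by rewrite yE X_Gamma.
rewrite c0 -w0E => -[sX nX].
have lw0 : lsubmx w0 = u0 by rewrite w0E row_mxKl.
have rw0 : rsubmx w0 = 0 by rewrite w0E row_mxKr.
have X0 : Xt w0 = chart_to a y0.
  have [|_ <-] := nbhs_singleton nX; first by rewrite rw0 mxE lexx.
  by rewrite rw0 lw0 mxE yE X_Gamma.
have [|Bt [sB nB]] := @B_ext c u0 Gc; first by exists y0.
have B0 : Bt w0 \in unitmx.
  rewrite -w0E in nB; rewrite -(nbhs_singleton nB); last first.
    by rewrite rw0 lw0 mxE lexx; split => //; exists y0.
  rewrite rw0 mxE; apply/sym_posdef_unit/(semigeodesic_B_posdef hB Gc); last by rewrite lexx.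
  by rewrite lw0; exists y0.
have sC : smm (fun w => invmx (Bt w)) w0 by apply: smm_inv => //; rewrite w0E.
have sg : smm (fun w => g a (chart_from a (Xt w))) w0.
  by apply: (smm_comp (f := fun v => g a (chart_from a v)) sX); rewrite X0; exact: smm_g.
pose N w := jac Xt w *m g a (chart_from a (Xt w)) *m (jac Xt w)^T.
have sN : smm N w0 by apply: smm_mul; [apply: smm_mul => //; exact: smm_jac|exact/smm_tr/smm_jac].
(* The squared g-length of the s-derivative of X. *)
pose h w := N w (rshift n 0) (rshift n 0).
have sh : sm h w0 by exact: sN.
have n4 : \forall w \near w0, chart_dom c (chart_from c (lsubmx w)) /\ chart_to c (chart_from c (lsubmx w)) = lsubmx w.
  apply: (near_cont_comp (P := fun v => chart_dom c (chart_from c v) /\ chart_to c (chart_from c v) = v) (smv_cont (smv_lsubmx _))).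
  by rewrite lw0 u0E; exact: sub_img Gc cy.
have h0 : 0 < h w0.
  have -> : h w0 = (row (rshift n 0) (jac Xt w0) *m g a y0 *m (row (rshift n 0) (jac Xt w0))^T) 0 0.
    by rewrite /h /N X0 (am_inv hA Aa ay) diag_quad.
  have [hpos _ _] := hg; have [_ hp] := hpos a y0 Aa ay; apply: hp.
  (* If the s-derivative of the extension of X vanished at w0, then so would that of the smooth
     expression of [s_coord] along it, which would stay below 1 nearby; but for s > 0 this
     expression is s itself, with derivative 1. *)
  apply/eqP => v0.
  have [S [sS nS]] := s_expr Aa (Gamma_W Gy) ay.
  have sSX : sm (fun w => S (Xt w)) w0 by apply: sm_comp => //; rewrite X0.
  have D0 : pd (rshift n 0) (fun w => S (Xt w)) w0 = 0.
    have := @sm_comp_derive R n.+1 _ S Xt w0 (delta_mx 0 (rshift n 0)) 0.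
    feed; first by rewrite X0.
    feed.
      move=> j; have hj := sm_derive (rshift n 0) (sX j); apply: (is_derive_eq hj).
      have /rowP/(_ j) := v0; rewrite [LHS]mxE (jac_pd _ _ sX) => ->; reflexivity.
    move=> [_ e1]; rewrite pdE e1; apply: big1 => j _; by rewrite mxE mul0r.
  have nS' : \forall w \near w0, W (chart_from a (Xt w)) ->
      s_coord A g phi (chart_from a (Xt w)) = S (chart_to a (chart_from a (Xt w))).
    have cX : {for w0, continuous (fun w => chart_from a (Xt w))}.
      apply: (@continuous_comp _ _ _ Xt (chart_from a)); first exact: smv_cont.
      by rewrite X0; exact: (am_from hA).
    apply: (near_cont_comp (P := fun y => W y -> s_coord A g phi y = S (chart_to a y)) cX).
    by rewrite X0 (am_inv hA).
  have nD : \forall w \near w0, `|pd (rshift n 0) (fun w => S (Xt w)) w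
      - pd (rshift n 0) (fun w => S (Xt w)) w0| < 1.
    by apply: cont_near_lt; [exact: sm_cont (sm_pd _ sSX)|].
  have /near_normP[r1 r10 hr1] := near_and (near_and n4 nX) (near_and nS' nD).
  pose t : R := Num.min r1 eps0 / 2.
  have m0 : 0 < Num.min r1 eps0 by rewrite lt_min r10.
  have t0 : 0 < t by rewrite divr_gt0.
  have [tr te] : t < r1 /\ t < eps0.
    have : t < Num.min r1 eps0 by rewrite /t; lra.
    by rewrite lt_min => /andP.
  have [w wE] : exists w : 'rV[R]_(n + 1), w = row_mx u0 (const_mx t) by exists (row_mx u0 (const_mx t)).
  have wr : `|w - w0| < r1.
    by rewrite wE w0E; apply: row_mx_near => //; rewrite ?subr0 ?const_mx1_norm ?gtr0_norm // subrr normr0.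
  have SX w' : `|w' - w0| < r1 -> 0 <= rsubmx w' 0 0 <= eps0 -> S (Xt w') = rsubmx w' 0 0.
    move=> hw hs'; have [[[c1 c2] h2] [h3 _]] := hr1 w' hw.
    have [ax e1] := h2 hs'.
    have e2 : X (chart_from c (lsubmx w'), rsubmx w' 0 0) = chart_from a (Xt w').
      by rewrite -e1 (am_inv hA).
    have [w1 _ w3] := semigeodesic_from hB (GA_in Gc c1) hs'.
    by rewrite -w3 e2 h3 -?e2 // e1.
  have rw : rsubmx w 0 0 = t by rewrite wE row_mxKr mxE.
  have nw : \forall w' \near w, S (Xt w') = rsubmx w' 0 0.
    have cr : {for w, continuous (fun w' : 'rV[R]_(n + 1) => rsubmx w' 0 0)}.
      by apply: continuous_coord; exact: smv_cont (smv_rsubmx _).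
    have h1 : \forall w' \near w, `|w' - w0| < r1.
      exact: near_dist_lt.
    have h2 : \forall w' \near w, 0 < rsubmx w' 0 0 /\ rsubmx w' 0 0 < eps0.
      apply: (near_cont_comp (P := fun z : R => 0 < z /\ z < eps0) cr); rewrite rw.
      apply: near_and; [exact: lt_nbhsr|exact: lt_nbhsl].
    apply: near_imp (near_and h1 h2) => w' [h3 [h4 h5]]; apply: SX => //.
    by rewrite !ltW.
  have [_ [_ hD]] := hr1 w wr.
  move: hD; rewrite D0 subr0 (pd_near (rshift n 0) nw).
  have -> : pd (rshift n 0) (fun w' : 'rV[R]_(n + 1) => rsubmx w' 0 0) w = 1.
    have hh := derive_lin_coord w (delta_mx 0 (rshift n 0)) (rshift n 0).
    have hh2 : is_derive w (delta_mx 0 (rshift n 0) : 'rV[R]_(n + 1)) (fun w' : 'rV[R]_(n + 1) => rsubmx w' 0 0) 1.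
      apply: (is_derive_ext _ _ hh); first by move=> w'; rewrite mxE.
      by rewrite mxE !eqxx.
    by rewrite pdE; have [_ ->] := hh2.
  by rewrite normr1 ltxx.
have n1 : \forall w \near w0, [/\ smv Xt w, sm h w, 0 < h w & smm (fun w => invmx (Bt w)) w].
  have nh : \forall w \near w0, 0 < h w.
    apply: near_imp (cont_near_lt (sm_cont sh) h0) => w.
    by rewrite ltr_norml => /andP[hh _]; rewrite -(ltrD2r (- h w0)) add0r.
  apply: near_imp (near_and (near_and (smv_near sX) (sm_near sh)) (near_and nh (smm_near sC))).
  by move=> w [[h1 h2] [h3 h4]].
have n2 : \forall w \near w0, chart_dom a (chart_from a (Xt w)) /\ chart_to a (chart_from a (Xt w)) = Xt w.
  apply: (near_cont_comp (P := fun v => chart_dom a (chart_from a v) /\ chart_to a (chart_from a v) = v) (smv_cont sX)).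
  by rewrite X0; exact: (am_img hA).
rewrite -w0E in nB.
have /near_normP[r1 r10 hr1] := near_and (near_and n1 n2) (near_and (near_and n4 nX) nB).
pose r : R := Num.min r1 (eps0 / 2).
have r0 : 0 < r by rewrite lt_min r10 divr_gt0.
have re : r < eps0 by rewrite gt_min; apply/orP; right; lra.
have rr1 (z : R) : z < r -> z < r1 by rewrite lt_min => /andP[].
have near_w u (s : R) : `|u - u0| < r -> 0 <= s < r -> `|row_mx u (const_mx s) - w0| < r.
  move=> hu /andP[s0 sr]; rewrite w0E; apply: row_mx_near => //.
  by rewrite subr0 const_mx1_norm ger0_norm.
have s_eps (s : R) : 0 <= s < r -> 0 <= s <= eps0 by move=> /andP[-> /ltW sr]; apply: le_trans (ltW re).
have XE u (s : R) : `|u - u0| < r -> 0 <= s < r ->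
    [/\ chart_dom c (chart_from c u), chart_to c (chart_from c u) = u,
     chart_dom a (X (chart_from c u, s)), chart_to a (X (chart_from c u, s)) = Xt (row_mx u (const_mx s)) &
     X (chart_from c u, s) = chart_from a (Xt (row_mx u (const_mx s)))].
  move=> hu hs; have [_ [[h1 h2] _]] := hr1 _ (rr1 _ (near_w u s hu hs)).
  move: h1 h2; rewrite row_mxKl row_mxKr mxE => -[c1 c2] /(_ (s_eps s hs))[h3 h4].
  by split => //; rewrite -h4 (am_inv hA).
have met u (s : R) : `|u - u0| < r -> 0 < s < r ->
    phi (X (chart_from c u, s)) = s * h (row_mx u (const_mx s)) /\
    N (row_mx u (const_mx s)) = h (row_mx u (const_mx s)) *: block_mx (B c u s) 0 0 1%:M.
  move=> hu /andP[s0 sr].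
  have hs : 0 <= s < r by rewrite ltW.
  have [c1 c2 ax _ e1] := XE u s hu hs.
  have := @semigeodesic_metric _ _ _ _ _ _ _ _ _ _ _ hB c u s Gc.
  feed; first by exists (chart_from c u).
  feed; first by rewrite s0 (lt_trans sr).
  have [w wE] := exists_eq (row_mx u (const_mx s : 'rV[R]_1)); rewrite -wE.
  have rw : rsubmx w 0 0 = s by rewrite wE row_mxKr mxE.
  have lw : lsubmx w = u by rewrite wE row_mxKl.
  have nw : \forall w' \near w, [/\ X (chart_from c (lsubmx w'), rsubmx w' 0 0) = chart_from a (Xt w')
      & chart_to a (X (chart_from c (lsubmx w'), rsubmx w' 0 0)) = Xt w'].
    have cr : {for w, continuous (fun w' : 'rV[R]_(n + 1) => rsubmx w' 0 0)}.
      by apply: continuous_coord; exact: smv_cont (smv_rsubmx _).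
    have h1 : \forall w' \near w, `|w' - w0| < r.
      by apply: near_dist_lt; rewrite wE; exact: near_w.
    have h2 : \forall w' \near w, 0 < rsubmx w' 0 0.
      by apply: (near_cont_comp (P := fun z : R => 0 < z) cr); rewrite rw; exact: lt_nbhsr.
    apply: near_imp (near_and h1 h2) => w' [h3 h4].
    move: (h3); rewrite -(hsubmxK w') w0E => /(row_mx_nearE r0)[h5].
    rewrite subr0 (const_mx1_eq (rsubmx w')) const_mx1_norm => h6.
    have hs' : 0 <= rsubmx w' 0 0 < r by rewrite ltW //=; rewrite gtr0_norm in h6.
    have [_ _ _ h7 h8] := XE _ _ h5 hs'.
    by move: h7 h8; rewrite -(const_mx1_eq (rsubmx w')) hsubmxK.
  have [sXw _ _ _] := (proj1 (proj1 (hr1 _ (rr1 _ (near_w u s hu hs))))); rewrite -wE in sXw.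
  rewrite (pullback_metricE hA (a := a) metric_change_jacobi) //; last first.
  - by apply: smv_ext sXw; apply: near_imp nw => w' [_ ->].
  - apply: (near_cont (f := fun w' => chart_from a (Xt w'))); first by apply: near_imp nw => w' [->].
    apply: (@continuous_comp _ _ _ Xt (chart_from a)); first exact: smv_cont.
    have [_ <-] := nbhs_singleton nw; apply: (am_from hA) => //.
    by rewrite lw rw.
  - by rewrite lw rw.
  rewrite (jac_eqnear (g := Xt)); last first.
  - by apply: smv_ext sXw; apply: near_imp nw => w' [_ ->].
  - by apply: near_imp nw => w' [_ ->].
  have gE : g a (X (chart_from c u, s)) = g a (chart_from a (Xt w)) by rewrite e1 -wE.
  rewrite lw rw /jacobi_metric gE -scalemxAr -scalemxAl -/(N w).
  set ph := phi _ => hm.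
  have sn0 : s != 0 by rewrite gt_eqF.
  (* The (s, s) entry of the metric identity; it also shows that phi does not vanish here, as s^-1
     != 0. *)
  have e2 : ph^-1 * h w = s^-1.
    have /matrixP/(_ (rshift n 0) (rshift n 0)) := hm.
    have -> : (ph^-1 *: N w) (rshift n 0) (rshift n 0) = ph^-1 * h w by rewrite mxE.
    move=> ->; rewrite mxE block_mxEdr.
    by rewrite mxE eqxx mulr1.
  have ph0 : ph != 0.
    apply/eqP => p0; move: e2; rewrite p0 invr0 mul0r => /esym/eqP.
    by rewrite invr_eq0 (negbTE sn0).
  have e3 : ph = s * h w.
    have e4 : h w = ph * s^-1 by rewrite -e2 mulrA mulfV // mul1r.
    by rewrite e4 mulrCA mulfV // mulr1.
  split => //; apply: (scalerI (a := ph^-1)); first by rewrite invr_eq0.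
  by rewrite hm scalerA e2.
exists a, Xt, h, (fun w => invmx (Bt w)), r; split; first exact: ay.
split.
- by rewrite r0 re.
- exact: Gc.
- exact: Aa.
- by move=> u hu; have [|c1 c2 _ _ _] := XE u 0 hu; first by rewrite lexx.
- rewrite -w0E => w hw; exact: (proj1 (proj1 (hr1 w (rr1 _ hw)))).
- rewrite -w0E => w hw; exact: (proj2 (proj1 (hr1 w (rr1 _ hw)))).
- move=> u s hu hs; have [c1 c2 _ _ e1] := XE u s hu hs; split; first exact: e1.
    case: (eqVneq s 0) => [->|sn].
      by rewrite mul0r X_Gamma; exact: GA_in Gc c1.
    by have [|] := met u s hu => //; move: hs => /andP[s0 ->]; rewrite lt_neqAle eq_sym sn s0.
  have [_ [_ hb]] := hr1 _ (rr1 _ (near_w u s hu hs)).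
  move: hb; rewrite row_mxKl row_mxKr mxE /C_mx => ->//.
  by split; [exists (chart_from c u)|exact: s_eps].
- move=> u s hu hs; cbv zeta.
  by have [_] := met u s hu hs.
Qed.

End Semigeodesic.

(** * The double of Omega *)

Lemma rel_open (T : topologicalType) (S D : set T) : D `<=` S ->
  (forall z, D z -> \forall z' \near z, S z' -> D z') -> exists2 V : set T, open V & D = V `&` S.
Proof.
move=> DS h; exists ([set z | S z -> D z]°); first exact: open_interior.
apply/seteqP; split => z; first by move=> Dz; split; [exact: h|exact: DS].
by move=> [/interior_subset h1 Sz]; exact: h1.
Qed.

Section DoubleChart.
Context {R : realType} {n : nat} {M : topologicalType}.
Variables (A : set (chart R M n.+1)) (hA : amb A).
Variables (g : chart R M n.+1 -> M -> 'M[R]_n.+1) (hg : riemannian_metric A g).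
Variables (phi : M -> R) (hphi : smooth_map A setT (line_atlas R) phi).
Variable hdphi : dphi_nonzero A phi.
Variables (W : set M) (eps0 : R) (q : M -> M) (X : M * R -> M)
  (B : chart R M n -> 'rV[R]_n -> R -> 'M[R]_n).
Variable hB : semigeodesic A g phi W eps0 q X B.
Local Notation GA := (Gamma_atlas A phi).
Local Notation HA := (Omega_hat_atlas A phi).
Local Notation AR := (prod_atlas A (line_atlas R)).
Local Notation line := (Chart setT (fun t : R => const_mx t) (fun v : 'rV[R]_1 => v 0 0)).
Variables (c : chart R M n) (a : chart R M n.+1) (u0 : 'rV[R]_n) (Xt : 'rV[R]_(n + 1) -> 'rV[R]_n.+1)
  (h : 'rV[R]_(n + 1) -> R) (Ct : 'rV[R]_(n + 1) -> 'M[R]_n) (r : R).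
Hypothesis hN : normal_chart A g phi eps0 X B c a u0 Xt h Ct r.
Variables (V : set M) (e : R).
Hypotheses (oV : open V) (VW : V `&` closure (Omega phi) `<=` W).
Hypotheses (e0 : 0 < e) (er : e <= r) (e1 : e <= 1).
Hypothesis XV : forall u (s : R), `|u - u0| < e -> 0 <= s < e -> V (X (chart_from c u, s)).

Definition sig (w : 'rV[R]_(1 + n)) : R := lsubmx w 0 0.
(** The map (sigma, u) -> (u, sigma^2), which folds the double onto a collar of Gamma. *)
Definition fold (w : 'rV[R]_(1 + n)) : 'rV[R]_(n + 1) := row_mx (rsubmx w) (const_mx (sig w * sig w)).
(** The ratio xi / sigma: from xi^2 = 2 phi = 2 s h with s = sigma^2 it follows that xi = sigma sqrt
    (2 h) up to sign. *)
Definition kap (v : 'rV[R]_(n + 1)) : R := Num.sqrt (2 * h v).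

(** The coordinates are sigma = xi / [kap] and u. As [kap] is positive, sigma keeps the sign of xi
    and so distinguishes the two sheets. The bound e * e on s is |sigma| < e, and V keeps the points
    where q and s are defined. *)
Definition double_chart : chart R (M * R)%type n.+1 :=
  Chart [set z | [/\ Omega_hat phi z, V z.1, chart_dom c (q z.1),
                     `|chart_to c (q z.1) - u0| < e & s_coord A g phi z.1 < e * e]]
    (fun z => row_mx (const_mx (z.2 / kap (row_mx (chart_to c (q z.1)) (const_mx (s_coord A g phi z.1)))))
                     (chart_to c (q z.1)) : 'rV[R]_(1 + n))
    (fun w => (X (chart_from c (rsubmx (w : 'rV[R]_(1 + n))), sig w * sig w), sig w * kap (fold w))).

Local Notation w00 := (row_mx 0 u0 : 'rV[R]_(1 + n)).

Lemma sqr_lt (s : R) : `|s| < e -> [/\ 0 <= s * s, s * s < e * e & e * e <= e].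
Proof.
move=> se; split; first by rewrite -expr2 sqr_ge0.
  by rewrite -[s * s]ger0_norm -?expr2 ?sqr_ge0 // normrX expr2; apply: ltr_pM.
by rewrite ler_piMr // ltW.
Qed.

Lemma double_box (w : 'rV[R]_(1 + n)) : `|w - w00| < e ->
  [/\ `|sig w| < e, `|rsubmx w - u0| < e, `|rsubmx w - u0| < r & 0 <= sig w * sig w < r].
Proof.
rewrite -{1}(hsubmxK w) => /(row_mx_nearE e0)[h1 h2].
have h3 : `|sig w| < e by move: h1; rewrite subr0 (const_mx1_eq (lsubmx w)) const_mx1_norm.
have [s1 s2 s3] := sqr_lt h3.
split => //; first exact: lt_le_trans er.
by rewrite s1 /=; apply: lt_le_trans er; apply: lt_le_trans s3.
Qed.

Lemma fold_near (w : 'rV[R]_(1 + n)) : `|w - w00| < e -> `|fold w - row_mx u0 0| < r.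
Proof.
move=> /double_box[_ _ h1 /andP[h2 h3]]; have [/andP[r0 _] _ _ _ _ _ _ _] := hN.
by apply: row_mx_near => //; rewrite subr0 const_mx1_norm ger0_norm.
Qed.

Lemma kap_gt0 v : `|v - row_mx u0 0| < r -> 0 < kap v /\ kap v * kap v = 2 * h v.
Proof.
move=> hv; have [_ _ hp _] := nc_sm hN hv.
have h2 : 0 < 2 * h v by rewrite mulr_gt0.
by rewrite /kap sqrtr_gt0 -expr2 sqr_sqrtr // ltW.
Qed.

Lemma double_from (w : 'rV[R]_(1 + n)) : `|w - w00| < e ->
  chart_dom double_chart (chart_from double_chart w) /\
  chart_to double_chart (chart_from double_chart w) = w.
Proof.
move=> hw; have [h1 h2 h3 h4] := double_box hw; have hf := fold_near hw.
have [k0 k2] := kap_gt0 hf; have [s1 s2 s3] := sqr_lt h1.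
have [c1 c2] := nc_img hN h3; have [x1 x2 x3] := nc_X hN h3 h4.
have hs : 0 <= sig w * sig w <= eps0.
  by rewrite s1 /=; have [/andP[_ re] _ _ _ _ _ _ _] := hN; move: h4 => /andP[_ /ltW h4]; apply: le_trans h4 (ltW re).
have [w1 w2 w3] := semigeodesic_from hB (GA_in (nc_c hN) c1) hs.
split => /=.
  split; rewrite /= ?w2 ?c2 ?w3 //.
    split; first exact: (semigeodesic_sub hB).
    rewrite /= x2 expr2 mulrACA k2 /fold; ring.
  by apply: XV => //; rewrite s1 /=; apply: lt_le_trans s3.
rewrite w2 w3 c2 -/(fold w) mulfK ?gt_eqF //.
have -> : const_mx (sig w) = lsubmx w by rewrite [RHS]const_mx1_eq.
exact: (@hsubmxK R 1 1 n w).
Qed.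

Lemma double_dom z : chart_dom double_chart z ->
  exists2 w : 'rV[R]_(1 + n), `|w - w00| < e & z = chart_from double_chart w.
Proof.
move=> [[z1 z2] Vz cz uz sz]; have Wz : W z.1 by exact: VW.
have [Gq /andP[s0 _] Xq] := semigeodesic_to hB Wz.
have ur : `|chart_to c (q z.1) - u0| < r by exact: lt_le_trans er.
have se : e * e <= e by rewrite ler_piMr // ltW.
have sr : 0 <= s_coord A g phi z.1 < r by rewrite s0 /=; apply: lt_le_trans (le_trans se er).
have cinv := sub_inv (nc_c hN) cz.
have [_ x2 _] := nc_X hN ur sr; rewrite cinv Xq in x2.
have [v vE] := exists_eq (row_mx (chart_to c (q z.1)) (const_mx (s_coord A g phi z.1) : 'rV[R]_1)).
have hv : `|v - row_mx u0 0| < r.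
  have [/andP[r0 _] _ _ _ _ _ _ _] := hN.
  by rewrite vE; apply: row_mx_near => //; rewrite subr0 const_mx1_norm ger0_norm //; case/andP: sr.
have [k0 k2] := kap_gt0 hv; rewrite -vE in x2.
have [s sE] := exists_eq (z.2 / kap v).
have ss : s * s = s_coord A g phi z.1.
  have hv0 : 2 * h v != 0 by rewrite -k2 mulf_neq0 // gt_eqF.
  rewrite sE mulrACA -invfM k2 -expr2 z2 x2 mulrCA mulfK //.
have hs : `|s| < e.
  by rewrite -(ltr_pXn2r (n := 2)) // ?nnegrE ?ltW // !expr2 -normrM ss ger0_norm.
exists (row_mx (const_mx s) (chart_to c (q z.1))).
  by apply: row_mx_near => //; rewrite subr0 const_mx1_norm.
have sg : sig (row_mx (const_mx s) (chart_to c (q z.1))) = s by rewrite /sig row_mxKl mxE.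
rewrite /= /fold sg row_mxKr cinv ss Xq -vE sE divfK ?gt_eqF //.
by case: (z).
Qed.

Lemma double_to z : chart_dom double_chart z -> `|chart_to double_chart z - w00| < e /\
  chart_from double_chart (chart_to double_chart z) = z.
Proof. by move=> /double_dom[w hw ->]; have [_ ->] := double_from hw. Qed.

Lemma double_imgE : chart_img double_chart = [set w | `|w - w00| < e].
Proof.
apply/seteqP; split => w; first by move=> [z /double_to[h1 _] <-].
by move=> hw; have [h1 h2] := double_from hw; exists (chart_from double_chart w).
Qed.

Lemma double_a w : `|w - w00| < e ->
  [/\ chart_dom a (chart_from double_chart w).1, chart_to a (chart_from double_chart w).1 = Xt (fold w) &
      chart_from double_chart w = (chart_from a (Xt (fold w)), sig w * kap (fold w))].
Proof.
move=> hw; have [_ _ h3 h4] := double_box hw.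
have [a1 a2] := nc_from hN (fold_near hw); have [x1 _ _] := nc_X hN h3 h4.
by rewrite /= x1.
Qed.

Lemma sm_sig (w : 'rV[R]_(1 + n)) : sm sig w.
Proof. by apply: sm_ext (sm_coord (lshift n 0) w); apply: near_all => v; rewrite /sig mxE. Qed.

Lemma smv_fold (w : 'rV[R]_(1 + n)) : smv fold w.
Proof.
apply: (smv_row_mx (f := fun w => rsubmx w)); first exact: smv_rsubmx.
move=> j; apply: sm_ext (sm_mul (sm_sig w) (sm_sig w)).
by apply: near_all => v; rewrite mxE.
Qed.

Lemma sm_kap v : `|v - row_mx u0 0| < r -> sm kap v.
Proof.
move=> hv; have [_ sh hp _] := nc_sm hN hv.
by apply: sm_sqrt; [rewrite mulr_gt0|exact: sm_mul (sm_cst 2 v) sh].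
Qed.

Lemma smv_const_mx1 k (f : 'rV[R]_k -> R) x : sm f x -> smv (fun u => const_mx (f u) : 'rV[R]_1) x.
Proof. by move=> hf j; apply: sm_ext hf; apply: near_all => u; rewrite mxE. Qed.

Lemma double_V_near z : chart_dom double_chart z -> \forall z' \near z, Omega_hat phi z' -> chart_dom double_chart z'.
Proof.
move=> dz; have [w hw zE] := double_dom dz; have [ax _ _] := double_a hw; rewrite -zE in ax.
have [[z1 z2] Vz cz uz sz] := dz; have Wz : W z.1 by exact: VW.
have [Q [sQ nQ]] := q_expr hA hB (nc_c hN) (nc_a hN) Wz cz ax.
have [S [sS nS]] := s_expr hA hB (nc_a hN) Wz ax.
have cto := am_to hA (nc_a hN) ax.
have [_ qE] := nbhs_singleton nQ Wz; have sE := nbhs_singleton nS Wz.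
have n1 : \forall x \near z.1, `|Q (chart_to a x) - u0| < e.
  apply: (near_cont_comp (P := fun v : 'rV[R]_n.+1 => `|Q v - u0| < e) cto).
  apply: (near_cont_comp (f := Q) (P := fun v : 'rV[R]_n => `|v - u0| < e) (smv_cont sQ)).
  by apply: near_dist_lt; rewrite -qE.
have n2 : \forall x \near z.1, S (chart_to a x) < e * e.
  apply: (near_cont_comp (P := fun v : 'rV[R]_n.+1 => S v < e * e) cto).
  apply: (near_cont_comp (f := S) (P := fun v : R => v < e * e) (sm_cont sS)).
  by rewrite -sE; exact: lt_nbhsl.
have n3 := near_and (near_and nQ nS) (near_and (near_and n1 n2) (open_near oV Vz)).
have cf : {for z, continuous (fst : M * R -> M)} by exact: cvg_fst.
apply: near_imp (near_cont_comp cf n3) => z' [[h1 h2] [[h3 h4] h5]] Oz'.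
have Wz' : W z'.1 by apply: VW; split => //; case: Oz'.
have [h6 h7] := h1 Wz'.
by split => //; rewrite ?h7 ?h2.
Qed.

Lemma AR_chart : AR (prod_chart a line).
Proof. by exists a, line; split => //; exact: (nc_a hN). Qed.

Lemma double_atlas : HA double_chart.
Proof.
have hAR : amb AR := amb_prod hA (@amb_line R).
split.
- by apply: rel_open; [move=> z []|exact: double_V_near].
- rewrite double_imgE (_ : [set w | _] = ball w00 e); first exact: ball_open.
  by apply/seteqP; split => v; rewrite -ball_normE /= distrC.
- by move=> z /double_to[].
- apply: (local_expr_smooth_map (amb_euclid n.+1) hAR) => w; rewrite double_imgE => hw.
  exists (Chart setT id id), (prod_chart a line), (fun w => row_mx (Xt (fold w)) (const_mx (sig w * kap (fold w)))).
  have [a1 a2 a3] := double_a hw.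
  split; first by split; [reflexivity| |exact: AR_chart|split].
  have hf := fold_near hw; have [sX sh hp _] := nc_sm hN hf.
  split.
    apply: smv_row_mx; first exact: smv_comp (smv_fold w) sX.
    apply: smv_const_mx1; apply: sm_mul; first exact: sm_sig.
    exact: sm_comp (smv_fold w) (sm_kap hf).
  apply: near_all => w' hw'; have [b1 b2 b3] := double_a hw'.
  split; [exact: I|exact: (conj b1 I)|].
  by rewrite [LHS]/= b2.
- apply: (local_expr_smooth_map hAR (amb_euclid n.+1)) => z dz.
  have [w hw zE] := double_dom dz; have [ax _ _] := double_a hw; rewrite -zE in ax.
  have [[z1 z2] Vz cz uz sz] := dz; have Wz : W z.1 by exact: VW.
  have [Q [sQ nQ]] := q_expr hA hB (nc_c hN) (nc_a hN) Wz cz ax.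
  have [S [sS nS]] := s_expr hA hB (nc_a hN) Wz ax.
  have [_ qE] := nbhs_singleton nQ Wz; have sE := nbhs_singleton nS Wz.
  pose Qv (v : 'rV[R]_(n.+1 + 1)) := row_mx (Q (lsubmx v)) (const_mx (S (lsubmx v)) : 'rV[R]_1).
  exists (prod_chart a line), (Chart setT id id),
    (fun v => row_mx (const_mx (rsubmx v 0 0 / kap (Qv v))) (Q (lsubmx v)) : 'rV[R]_(1 + n)).
  split; first by split; [exact: AR_chart|split|reflexivity|].
  have [v vE] := exists_eq (chart_to (prod_chart a line) z).
  have lv : lsubmx v = chart_to a z.1 by rewrite vE row_mxKl.
  have hv : `|Qv v - row_mx u0 0| < r.
    have [_ /andP[s0 _] _] := semigeodesic_to hB Wz.
    have [/andP[r0 _] _ _ _ _ _ _ _] := hN.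
    apply: row_mx_near => //; rewrite lv -?qE -?sE; first exact: lt_le_trans er.
    rewrite subr0 const_mx1_norm ger0_norm //; apply: lt_le_trans er; apply: lt_le_trans sz _.
    by rewrite ler_piMr // ltW.
  split.
    rewrite -vE; apply: (@smv_row_mx R (n.+1 + 1) 1 n (fun v => const_mx (rsubmx v 0 0 / kap (Qv v))) (fun v => Q (lsubmx v))); last first.
      by apply: smv_comp; [exact: smv_lsubmx|rewrite lv].
    apply: smv_const_mx1; apply: sm_mul; first exact: (smv_rsubmx (m := n.+1) v 0).
    apply: sm_inv; first by have [k0 _] := kap_gt0 hv; rewrite gt_eqF.
    apply: (sm_comp (f := kap) (y := Qv)); last exact: sm_kap.
    apply: smv_row_mx; first by apply: smv_comp; [exact: smv_lsubmx|rewrite lv].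
    apply: smv_const_mx1; apply: sm_comp; first exact: smv_lsubmx.
    by rewrite lv.
  have cf : {for z, continuous (fst : M * R -> M)} by exact: cvg_fst.
  apply: near_imp (near_cont_comp cf (near_and nQ nS)) => z' [h1 h2] dz'.
  have [w' hw' z'E] := double_dom dz'; have [ax' _ _] := double_a hw'; rewrite -z'E in ax'.
  have [[z1' z2'] Vz' cz' uz' sz'] := dz'; have Wz' : W z'.1 by exact: VW.
  have [_ h3] := h1 Wz'; have h4 := h2 Wz'.
  split; [exact: (conj ax' I)|exact: I|].
  have [v' v'E] := exists_eq (chart_to (prod_chart a line) z'); rewrite -v'E.
  have lv' : lsubmx v' = chart_to a z'.1 by rewrite v'E row_mxKl.
  have rv' : rsubmx v' 0 0 = z'.2 by rewrite v'E row_mxKr mxE.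
  by rewrite /Qv lv' rv' -h3 -h4.
Qed.

Variable Hh : chart R (M * R)%type n.+1 -> 'rV[R]_n.+1 -> 'rV[R]_n.+1 -> R.
Hypothesis hH : regularized_hamiltonian A g phi Hh.
Local Notation d0 := double_chart.

Definition hamf (w p : 'rV[R]_(1 + n)) : R :=
  lsubmx p 0 0 ^+ 2 / 4 + sig w * sig w * (rsubmx p *m Ct (fold w) *m (rsubmx p)^T) 0 0.

Lemma pd_is_derive k (f : 'rV[R]_k -> R) x i (d : R) :
  is_derive x (delta_mx 0 i : 'rV[R]_k) f d -> pd i f x = d.
Proof. by move=> [_ <-]; rewrite pdE. Qed.

Lemma jac_fold (w : 'rV[R]_(1 + n)) :
  jac fold w = block_mx 0 (const_mx (2 * sig w)) 1%:M 0 :> 'M[R]_(1 + n, n + 1).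
Proof.
have dr (i : 'I_(1 + n)) (j : 'I_n) : pd i (fun v : 'rV[R]_(1 + n) => fold v 0 (lshift 1 j)) w
    = (delta_mx 0 i : 'rV[R]_(1 + n)) 0 (rshift 1 j).
  have hh := derive_lin_coord w (delta_mx 0 i) (rshift 1 j).
  apply: pd_is_derive; apply: (is_derive_ext _ erefl hh) => v.
  by rewrite row_mxEl mxE.
have ds (i : 'I_(1 + n)) : pd i (fun v : 'rV[R]_(1 + n) => fold v 0 (rshift n 0)) w
    = 2 * sig w * (delta_mx 0 i : 'rV[R]_(1 + n)) 0 (lshift n 0).
  have hh := derive_lin_coord w (delta_mx 0 i) (lshift n 0).
  have h2 := isdM hh hh.
  apply: pd_is_derive; apply: (is_derive_ext _ _ h2) => [v|]; first by rewrite row_mxEr mxE /sig mxE.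
  by rewrite /sig [lsubmx w _ _]mxE; ring.
apply/matrixP => i j; rewrite jac_pd; last exact: smv_fold.
case: (split_ordP j) => j' ->; case: (split_ordP i) => i' ->.
- by rewrite dr block_mxEul !mxE eq_rlshift.
- by rewrite dr block_mxEdl !mxE eq_rshift eqxx eq_sym.
- by rewrite (ord1 j') ds block_mxEur !mxE (ord1 i') !eqxx mulr1.
- by rewrite (ord1 j') ds block_mxEdr !mxE eq_lrshift mulr0.
Qed.

Lemma double_jac w : `|w - w00| < e ->
  jac (fun v => chart_to a (chart_from d0 v).1) w = jac fold w *m jac Xt (fold w).
Proof.
move=> hw; have [sX _ _ _] := nc_sm hN (fold_near hw).
rewrite -(jac_chain (smv_fold w) sX); apply/esym/jac_eqnear; last exact: smv_comp (smv_fold w) sX.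
by apply: near_imp (near_dist_lt hw) => v hv; have [_ ->] := double_a hv.
Qed.

Lemma mulmx_tr_inj k (x y : 'rV[R]_k) (T S : 'M[R]_k) : S *m T = 1%:M -> x *m T^T = y *m T^T -> x = y.
Proof.
move=> ST /(congr1 (fun v => v *m S^T)).
by rewrite -!mulmxA -trmx_mul ST trmx1 !mulmx1.
Qed.

Lemma quad_block (C : 'M[R]_n) (b : 'rV[R]_n) (s k : R) :
  (row_mx b (const_mx s : 'rV[R]_1) *m (k *: block_mx C 0 0 1%:M) *m (row_mx b (const_mx s : 'rV[R]_1))^T) 0 0
  = k * ((b *m C *m b^T) 0 0 + s ^+ 2).
Proof.
rewrite -scalemxAr -scalemxAl mxE mul_row_block !mulmx0 mulmx1 addr0 add0r tr_row_mx mul_row_col mxE.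
by congr (_ * (_ + _)); rewrite !mxE big_ord1 !mxE expr2.
Qed.

(** The Gram matrix of g in (u, s) is h times the block matrix of B and 1, so phi |P|^2 = s (p_s^2 +
    C(p_u, p_u)); with s = sigma^2 and p_s = p_sigma / (2 sigma) this is [hamf]. The latter relation
    is where sigma != 0 enters. *)
Lemma Hh_regular w (p : 'rV[R]_(1 + n)) : `|w - w00| < e -> sig w != 0 ->
  exists P : 'rV[R]_n.+1, P *m (jac (fun v => chart_to a (chart_from d0 v).1) w)^T = p /\
    H_ham g phi a (chart_from d0 w).1 P = hamf w p.
Proof.
move=> hw sw; have hf := fold_near hw.
have [_ _ h3 h4] := double_box hw.
have s0 : 0 < sig w * sig w < r.
  by case/andP: h4 => _ ->; rewrite andbT -expr2 exprn_even_gt0.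
have KD := nc_metric hN h3 s0; cbv zeta in KD; rewrite -/(fold w) in KD.
have [x1 x2 x3] := nc_X hN h3 h4; rewrite -/(fold w) in x1 x2 x3.
have [sX sh hp sC] := nc_sm hN hf; have [a1 a2] := nc_from hN hf.
rewrite (double_jac hw) [(chart_from d0 w).1]/=.
have [xx xxE] := exists_eq (X (chart_from c (rsubmx (w : 'rV[R]_(1 + n))), sig w * sig w)).
rewrite -xxE; rewrite -x1 -xxE in KD a1; rewrite -xxE in x2.
have [K KE] := exists_eq (jac Xt (fold w)); rewrite -KE in KD *.
have [G GE] := exists_eq (g a xx); rewrite -GE in KD.
have [Gs Gp] : sym_posdef G by rewrite GE; have [hp' _ _] := hg; exact: hp' (nc_a hN) a1.
have Gu : G \in unitmx by apply: sym_posdef_unit.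
have [hn0 sn0] : h (fold w) != 0 /\ 2 * sig w != 0 by rewrite gt_eqF // mulf_neq0.
have hs : 0 <= sig w * sig w <= eps0.
  case/andP: h4 => -> /ltW h4 /=; have [/andP[_ re] _ _ _ _ _ _ _] := hN.
  exact: le_trans h4 (ltW re).
have Bu : B c (rsubmx w) (sig w * sig w) \in unitmx.
  apply/sym_posdef_unit/(semigeodesic_B_posdef hB (nc_c hN)) => //.
  by have [c1 c2] := nc_img hN h3; exists (chart_from c (rsubmx w)).
(* The inverse of the Gram matrix in the coordinates (u, s); it makes the covector P with given
   pull-back explicit, as [rr *m E *m K *m G]. *)
pose E := (h (fold w))^-1 *: block_mx (Ct (fold w)) 0 0 1%:M : 'M[R]_(n + 1).
have ED : E *m (K *m G *m K^T) = 1%:M.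
  rewrite KD /E -x3 -scalemxAl -scalemxAr scalerA mulVf // scale1r mulmx_block !mulmx0 !mul0mx !addr0 !add0r mulmx1.
  by rewrite /C_mx mulVmx // -scalar_mx_block.
(* The covector p rewritten in the coordinates (u, s). *)
pose rr : 'rV[R]_(n + 1) := row_mx (rsubmx p) (const_mx (lsubmx p 0 0 / (2 * sig w))).
have rE : rr *m (jac fold w)^T = p.
  rewrite jac_fold tr_block_mx mul_row_block !trmx0 trmx1 !mulmx0 mulmx1 addr0 add0r.
  rewrite -[RHS](@hsubmxK R 1 1 n p); congr (row_mx _ _).
  by apply/rowP => i; rewrite !mxE big_ord1 !mxE divfK // ord1.
have ED' : rr *m E *m K *m G *m K^T = rr by rewrite -[RHS]mulmx1 -ED !mulmxA.
exists (rr *m E *m K *m G); split.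
  by rewrite trmx_mul mulmxA ED' rE.
rewrite /H_ham -GE mulmxK //.
have -> : rr *m E *m K *m (rr *m E *m K *m G)^T = (rr *m E *m rr^T)^T.
  by rewrite !trmx_mul trmxK Gs !mulmxA ED'.
rewrite mxE quad_block x2 /hamf.
move: hn0 sn0; rewrite mulf_eq0 negb_or => hn0 /andP[_ sn0]; field.
by rewrite hn0 sn0.
Qed.

Lemma Hh_off w (p : 'rV[R]_(1 + n)) : `|w - w00| < e -> sig w != 0 ->
  exists P : 'rV[R]_n.+1, [/\ P *m (jac (fun v => chart_to a (chart_from d0 v).1) w)^T = p,
    H_ham g phi a (chart_from d0 w).1 P = hamf w p & Hh d0 w p = hamf w p].
Proof.
move=> hw sw; have [P [P1 P2]] := Hh_regular p hw sw; exists P; split => //.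
have [_ h2] := hH double_atlas; have [a1 _ _] := double_a hw.
have iw : chart_img d0 w by rewrite double_imgE.
have [k0 _] := kap_gt0 (fold_near hw).
have f2 : (chart_from d0 w).2 != 0 by rewrite mulf_neq0 // gt_eqF.
have e2 : Hh d0 w (P *m (jac (fun v => chart_to a (chart_from d0 v).1) w)^T) = H_ham g phi a (chart_from d0 w).1 P.
  exact: (h2 w iw f2 a (nc_a hN) a1 P).
by rewrite -P2 -e2 P1.
Qed.

Lemma sm_hat_joint d z (P : 'rV[R]_n.+1) : HA d -> chart_dom d z ->
  sm (joint (Hh d)) (row_mx (chart_to d z) P).
Proof.
move=> Hd dz; have [h1 _] := hH Hd; apply: (smooth_on_sm h1).
  by rewrite /= row_mxKl; exists z.
apply: (near_cont_comp (f := fun w : 'rV[R]_(n.+1 + n.+1) => lsubmx w) (P := fun v => chart_img d v)).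
  exact: smv_cont (smv_lsubmx _).
by rewrite row_mxKl; apply: near_imp (sub_img Hd dz) => u [h2 h3]; exists (chart_from d u).
Qed.

Lemma sm_hamf w p : `|w - w00| < e -> sm (fun v => hamf v p) w.
Proof.
move=> hw; have [_ _ _ sC] := nc_sm hN (fold_near hw).
apply: sm_add; first exact: sm_cst.
apply: sm_mul; first by apply: sm_mul; exact: sm_sig.
have sCf : smm (fun v => Ct (fold v)) w := smm_comp (smv_fold w) sC.
apply: (smm_mul (f := fun v => rsubmx p *m Ct (fold v)) (h := fun=> (rsubmx p)^T)).
  by apply: (smm_mul (f := fun=> rsubmx p)) => // i j; exact: sm_cst.
by move=> i j; exact: sm_cst.
Qed.

Definition at_sig (t : R) (w : 'rV[R]_(1 + n)) : 'rV[R]_(1 + n) := row_mx (const_mx t) (rsubmx w).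

Lemma at_sig_cont (w : 'rV[R]_(1 + n)) : {for (0 : R), continuous (fun t : R => at_sig t w)}.
Proof.
apply: (@cont_row_mx R R 1 n (fun t => const_mx t) (fun=> rsubmx w)); last exact: cst_continuous.
apply: continuous_row => i; rewrite (_ : (fun s => _) = id); first exact: id.
by apply/funext => s; rewrite mxE.
Qed.

Lemma at_sig0 w : sig w = 0 -> at_sig 0 w = w.
Proof. by move=> h0; rewrite /at_sig -h0 /sig -const_mx1_eq; exact: (@hsubmxK R 1 1 n w). Qed.

Lemma at_sig_near (P : 'rV[R]_(1 + n) -> Prop) w : sig w = 0 -> (\forall v \near w, P v) ->
  \forall t \near (0 : R), P (at_sig t w).
Proof.
move=> s0 nP; have n1 : \forall v \near at_sig 0 w, P v by rewrite at_sig0.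
exact: (@at_sig_cont w P n1).
Qed.

Lemma sig_at t w : sig (at_sig t w) = t.
Proof. by rewrite /sig row_mxKl mxE. Qed.

(** On sigma = 0 the differential of the projection is singular and the defining relation is silent;
    both sides are continuous along the line of varying sigma ([at_sig]), so the formula extends. *)
Lemma Hh_formula w p : `|w - w00| < e -> Hh d0 w p = hamf w p.
Proof.
move=> hw; have [s0|sn] := eqVneq (sig w) 0; last by have [P []] := Hh_off p hw sn.
have [dz zE] := double_from hw.
have c1 : {for (0 : R), continuous (fun t : R => Hh d0 (at_sig t w) p)}.
  apply: (@continuous_comp _ _ _ (fun t : R => at_sig t w) (fun v => Hh d0 v p)); first exact: at_sig_cont.
  rewrite at_sig0 //; apply: sm_cont; apply: sm_joint_l.
  by rewrite -[X in row_mx X]zE; exact: sm_hat_joint double_atlas dz.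
have c2 : {for (0 : R), continuous (fun t : R => hamf (at_sig t w) p)}.
  apply: (@continuous_comp _ _ _ (fun t : R => at_sig t w) (fun v => hamf v p)); first exact: at_sig_cont.
  by rewrite at_sig0 //; apply: sm_cont; exact: sm_hamf.
have nw : \forall t \near (0 : R), `|at_sig t w - w00| < e.
  exact: (at_sig_near (P := fun v => `|v - w00| < e) s0 (near_dist_lt hw)).
have /near_normP[r1 r10 hr1] := nw.
suff : Hh d0 (at_sig 0 w) p = hamf (at_sig 0 w) p by rewrite at_sig0.
apply: (hausdorff_cont_eq (@norm_hausdorff R _) c1 c2) => k k0.
pose t : R := Num.min r1 k / 2.
have m0 : 0 < Num.min r1 k by rewrite lt_min r10.
have t0 : 0 < t by rewrite divr_gt0.
have [tr tk] : t < r1 /\ t < k.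
  have : t < Num.min r1 k by rewrite /t; lra.
  by rewrite lt_min => /andP.
exists t; first by rewrite subr0 gtr0_norm.
have ht : `|at_sig t w - w00| < e by apply: hr1; rewrite subr0 gtr0_norm.
have st : sig (at_sig t w) != 0 by rewrite sig_at gt_eqF.
by have [P []] := Hh_off p ht st.
Qed.

Lemma hat_good : good_atlas HA.
Proof. exact: (sub_good (amb_prod hA (@amb_line R))). Qed.

(** Off Gamma_hat the covector is the pull-back of a covector P' on M through either chart, and both
    sides equal H at P'. *)
Lemma Hh_invariant_off z d : chart_dom d0 z -> HA d -> chart_dom d z -> sig (chart_to d0 z) != 0 ->
  forall P, Hh d0 (chart_to d0 z) (P *m (tjac d0 d z)^T) = Hh d (chart_to d z) P.
Proof.
move=> dz Hd dz' sn P; have [hw zE] := double_to dz.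
have hAR : amb AR := amb_prod hA (@amb_line R).
have [P' [P1 P2 ->]] := Hh_off (P *m (tjac d0 d z)^T) hw sn.
have [a1 _ _] := double_a hw; rewrite zE in a1.
have sd : smv (fun v => chart_to a (chart_from d v).1) (chart_to d z).
  have s1 := sub_from hAR Hd dz' AR_chart (conj a1 I).
  have s2 := smv_comp s1 (smv_lsubmx (m := n.+1) _).
  by apply: smv_ext s2; apply: near_all => v; rewrite /= row_mxKl.
have J0 : jac (fun v => chart_to a (chart_from d0 v).1) (chart_to d0 z)
    = tjac d0 d z *m jac (fun v => chart_to a (chart_from d v).1) (chart_to d z).
  have tE := trans_at hat_good d double_atlas dz.
  have s1 := trans_smv hat_good double_atlas Hd dz dz'.
  rewrite -{1}tE in sd; have := jac_chain s1 sd; rewrite tE => <-.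
  apply/esym/jac_eqnear; last exact: smv_comp s1 sd.
  apply: near_imp (trans_dom hat_good double_atlas Hd dz dz') => v [_ _ h3].
  by rewrite /trans (ga_inv hat_good Hd h3).
have PE : P' *m (jac (fun v => chart_to a (chart_from d v).1) (chart_to d z))^T = P.
  rewrite J0 trmx_mul mulmxA in P1.
  exact: (mulmx_tr_inj (tjac_inv hat_good Hd double_atlas dz' dz) P1).
have [_ h2] := hH Hd.
have iw : chart_img d (chart_to d z) by exists z.
have [k0 _] := kap_gt0 (fold_near hw).
have f2 : (chart_from d (chart_to d z)).2 != 0.
  have f0 : sig (chart_to d0 z) * kap (fold (chart_to d0 z)) != 0 := mulf_neq0 sn (lt0r_neq0 k0).
  have [_ _ /(congr1 snd) e3] := double_a hw; rewrite zE in e3.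
  by rewrite (ga_inv hat_good Hd dz') e3.
have a1' : chart_dom a (chart_from d (chart_to d z)).1 by rewrite (ga_inv hat_good Hd dz').
have e2 : Hh d (chart_to d z) (P' *m (jac (fun v => chart_to a (chart_from d v).1) (chart_to d z))^T)
   = H_ham g phi a (chart_from d (chart_to d z)).1 P'.
  exact: (h2 _ iw f2 a (nc_a hN) a1' P').
by rewrite -P2 -{1}PE e2 (ga_inv hat_good Hd dz') zE.
Qed.

Lemma Hh_invariant z : chart_dom d0 z -> fiber_invariant HA Hh d0 z.
Proof.
move=> dz d Hd dz' P; have [hw zE] := double_to dz.
have [s0|sn] := eqVneq (sig (chart_to d0 z)) 0; last exact: Hh_invariant_off.
have [w wE] := exists_eq (chart_to d0 z); rewrite -wE in s0 hw zE.
have st : smv (trans d0 d) w by rewrite wE; exact: (trans_smv hat_good double_atlas Hd dz dz').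
have tE : trans d0 d w = chart_to d z by rewrite wE; exact: (trans_at hat_good d double_atlas dz).
have c1 : {for (0 : R), continuous (fun t : R => Hh d0 (at_sig t w) (P *m (tj d0 d (at_sig t w))^T))}.
  apply: (@continuous_comp _ _ _ (fun t : R => at_sig t w) (fun v => Hh d0 v (P *m (tj d0 d v)^T))); first exact: at_sig_cont.
  rewrite at_sig0 //; apply: sm_cont.
  apply: (sm_ext (f := fun v => joint (Hh d0) (row_mx v (P *m (tj d0 d v)^T)))).
    by apply: near_all => v; rewrite /joint row_mxKl row_mxKr.
  apply: (sm_comp (f := joint (Hh d0))); last by rewrite wE; exact: sm_hat_joint double_atlas dz.
  apply: smv_row_mx; first exact: smv_id.
  move=> j; apply: (sm_ext (f := fun v => \sum_i P 0 i * tj d0 d v j i)).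
    by apply: near_all => v; rewrite row_mul_trE.
  by apply: sm_sum => i _; apply: sm_mul; [exact: sm_cst|exact: sm_tj].
have c2 : {for (0 : R), continuous (fun t : R => Hh d (trans d0 d (at_sig t w)) P)}.
  apply: (@continuous_comp _ _ _ (fun t : R => at_sig t w) (fun v => Hh d (trans d0 d v) P)); first exact: at_sig_cont.
  rewrite at_sig0 //; apply: sm_cont; apply: (sm_comp (f := fun v => Hh d v P) st).
  by rewrite tE; apply: sm_joint_l; exact: sm_hat_joint Hd dz'.
have nw : \forall t \near (0 : R), [/\ chart_dom d0 (chart_from d0 (at_sig t w)),
    chart_to d0 (chart_from d0 (at_sig t w)) = at_sig t w & chart_dom d (chart_from d0 (at_sig t w))].
  apply: (at_sig_near (P := fun v => [/\ chart_dom d0 (chart_from d0 v),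
    chart_to d0 (chart_from d0 v) = v & chart_dom d (chart_from d0 v)]) s0).
  by rewrite wE; exact: (trans_dom hat_good double_atlas Hd dz dz').
have /near_normP[r1 r10 hr1] := nw.
suff : Hh d0 (at_sig 0 w) (P *m (tj d0 d (at_sig 0 w))^T) = Hh d (trans d0 d (at_sig 0 w)) P.
  by rewrite at_sig0 // tE wE.
apply: (hausdorff_cont_eq (@norm_hausdorff R _) c1 c2) => k k0.
pose t : R := Num.min r1 k / 2.
have m0 : 0 < Num.min r1 k by rewrite lt_min r10.
have t0 : 0 < t by rewrite divr_gt0.
have [tr tk] : t < r1 /\ t < k.
  have : t < Num.min r1 k by rewrite /t; lra.
  by rewrite lt_min => /andP.
exists t; first by rewrite subr0 gtr0_norm.
have [h1 h2 h3] : [/\ chart_dom d0 (chart_from d0 (at_sig t w)),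
    chart_to d0 (chart_from d0 (at_sig t w)) = at_sig t w & chart_dom d (chart_from d0 (at_sig t w))].
  by apply: hr1; rewrite subr0 gtr0_norm.
have snt : sig (chart_to d0 (chart_from d0 (at_sig t w))) != 0 by rewrite h2 sig_at gt_eqF.
by have := Hh_invariant_off h1 Hd h3 snt P; rewrite /tjac h2.
Qed.

End DoubleChart.

(** * The double near a point of Gamma_hat *)

Section HatChart.
Context {R : realType} {n : nat} {M : topologicalType}.
Variables (A : set (chart R M n.+1)) (hA : amb A).
Variables (g : chart R M n.+1 -> M -> 'M[R]_n.+1) (hg : riemannian_metric A g).
Variables (phi : M -> R) (hphi : smooth_map A setT (line_atlas R) phi).
Variable hdphi : dphi_nonzero A phi.
Local Notation GA := (Gamma_atlas A phi).
Local Notation HA := (Omega_hat_atlas A phi).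
Local Notation AR := (prod_atlas A (line_atlas R)).
Local Notation line := (Chart setT (fun t : R => const_mx t) (fun v : 'rV[R]_1 => v 0 0)).
Variable Hh : chart R (M * R)%type n.+1 -> 'rV[R]_n.+1 -> 'rV[R]_n.+1 -> R.
Hypothesis hH : regularized_hamiltonian A g phi Hh.

(* In the coordinates (sigma, u) of d, where s = sigma^2, the regularized
   Hamiltonian is p_sigma^2 / 4 + sigma^2 <C(u, sigma^2) p_u, p_u>. *)
Record hat_chart (c : chart R M n) (u0 : 'rV[R]_n) (Ct : 'rV[R]_(n + 1) -> 'M[R]_n) (e : R)
    (d : chart R (M * R)%type n.+1) (kp : 'rV[R]_(1 + n) -> R) : Prop := {
  hc_e : 0 < e;
  hc_c : GA c;
  hc_d : HA d;
  hc_img : forall u, `|u - u0| < e -> chart_dom c (chart_from c u) /\ chart_to c (chart_from c u) = u;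
  hc_from : forall w : 'rV[R]_(1 + n), `|w - (row_mx 0 u0 : 'rV[R]_(1 + n))| < e ->
    chart_dom d (chart_from d w) /\ chart_to d (chart_from d w) = w;
  hc_dom : forall z, chart_dom d z -> `|chart_to d z - (row_mx 0 u0 : 'rV[R]_(1 + n))| < e;
  hc_Gamma : forall w : 'rV[R]_(1 + n), `|w - (row_mx 0 u0 : 'rV[R]_(1 + n))| < e ->
    Gamma phi (chart_from d w).1 <-> sig w = 0;
  hc_zero : forall u, `|u - u0| < e -> chart_from d (row_mx 0 u : 'rV[R]_(1 + n)) = (chart_from c u, 0);
  hc_xi : forall w : 'rV[R]_(1 + n), `|w - (row_mx 0 u0 : 'rV[R]_(1 + n))| < e ->
    [/\ (chart_from d w).2 = sig w * kp w, 0 < kp w & sm kp w];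
  hc_ham : forall w p : 'rV[R]_(1 + n), `|w - (row_mx 0 u0 : 'rV[R]_(1 + n))| < e -> Hh d w p = hamf Ct w p;
  hc_inv : forall z, chart_dom d z -> fiber_invariant HA Hh d z }.

Lemma hat_chart_exists (W : set M) (eps0 : R) (q : M -> M) (X : M * R -> M)
    (B : chart R M n -> 'rV[R]_n -> R -> 'M[R]_n) (hB : semigeodesic A g phi W eps0 q X B)
    c a y0 Xt h Ct r (e' : R) : 0 < e' -> chart_dom c y0 ->
  normal_chart A g phi eps0 X B c a (chart_to c y0) Xt h Ct r ->
  exists e d kp, [/\ e <= r, e <= e' & hat_chart c (chart_to c y0) Ct e d kp].
Proof.
move=> e'0 cy hN; have [/andP[r0 re] Gc Aa _ _ _ _ _] := hN.
have [V [oV GV VW]] := semigeodesic_nbhs hB.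
have [u0 u0E] := exists_eq (chart_to c y0); rewrite -u0E in hN *.
have Gy := GA_in Gc cy.
have [w0 w0E] : exists w0 : 'rV[R]_(n + 1), w0 = row_mx u0 0 by exists (row_mx u0 0).
have c0 : const_mx 0 = 0 :> 'rV[R]_1 by apply/rowP => i; rewrite !mxE.
have uu : `|u0 - u0| < r by rewrite subrr normr0.
have [|x1 _ _] := nc_X hN uu (s := 0); first by rewrite lexx.
have y0E : chart_from c u0 = y0 by rewrite u0E (sub_inv Gc cy).
rewrite c0 -w0E y0E (X_Gamma hA hg hphi hdphi hB Gy) in x1.
have hw0 : `|w0 - row_mx u0 0| < r by rewrite w0E subrr normr0.
have [sX _ _ _] := nc_sm hN hw0; have [a1 a2] := nc_from hN hw0.
have nV : \forall w \near w0, V (chart_from a (Xt w)).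
  apply: (near_cont_comp (P := fun v => V (chart_from a v)) (smv_cont sX)).
  apply: (near_cont_comp (P := V) (f := chart_from a)).
    by rewrite -a2; exact: (am_from hA).
  by rewrite -x1; apply: open_near oV _; exact: GV.
have /near_normP[r1 r10 hr1] := nV.
(* The radius [r1] guarantees that the chart stays in V, where points of the closure of Omega belong
   to W. *)
pose e : R := Num.min (Num.min r 1) (Num.min r1 e').
have e0 : 0 < e by rewrite !lt_min r0 r10 e'0 ltr01.
have er : e <= r by rewrite !ge_min lexx.
have e1 : e <= 1 by rewrite !ge_min lexx orbT.
have er1 : e <= r1 by rewrite !ge_min lexx !orbT.
have ee' : e <= e' by rewrite !ge_min lexx !orbT.
have XV u (s : R) : `|u - u0| < e -> 0 <= s < e -> V (X (chart_from c u, s)).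
  move=> hu /andP[s0 se].
  have hu' : `|u - u0| < r by exact: lt_le_trans er.
  have hs' : 0 <= s < r by rewrite s0 (lt_le_trans se).
  have [-> _ _] := nc_X hN hu' hs'; apply: hr1; rewrite w0E; apply: row_mx_near => //.
    exact: lt_le_trans er1.
  by rewrite subr0 const_mx1_norm ger0_norm // (lt_le_trans se).
exists e, (double_chart A g phi q X c u0 h V e), (fun w => kap h (fold w)); split => //.
have dform w : (chart_from (double_chart A g phi q X c u0 h V e) w).1 = X (chart_from c (rsubmx (w : 'rV[R]_(1 + n))), sig w * sig w) by [].
split.
- exact: e0.
- exact: Gc.
- exact: (double_atlas hA hB hN oV VW e0 er e1 XV).
- by move=> u hu; apply: (nc_img hN); exact: lt_le_trans er.
- by move=> w; exact: (double_from hB hN e0 er e1 XV).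
- by move=> z dz; have [] := double_to hB hN VW e0 er e1 XV dz.
- move=> w hw; have [_ _ h3 h4] := double_box e0 er e1 hw; rewrite dform.
  have hf := fold_near hN e0 er e1 hw.
  have [_ x2 _] := nc_X hN h3 h4; rewrite /Gamma /= x2 -/(fold w).
  have [_ _ hp _] := nc_sm hN hf.
  split=> [/eqP|->]; last by rewrite !mul0r.
  by rewrite !mulf_eq0 (gt_eqF hp) orbF orbb => /eqP.
- move=> u hu; have hw : `|(row_mx 0 u : 'rV[R]_(1 + n)) - row_mx 0 u0| < e.
    by apply: row_mx_near => //; rewrite subrr normr0.
  have s0 : sig (row_mx 0 u : 'rV[R]_(1 + n)) = 0 by rewrite /sig row_mxKl mxE.
  have [c1 _] : chart_dom c (chart_from c u) /\ chart_to c (chart_from c u) = u.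
    by apply: (nc_img hN); exact: lt_le_trans er.
  rewrite /= s0 !mul0r row_mxKr; congr pair.
  exact: (X_Gamma hA hg hphi hdphi hB (GA_in Gc c1)).
- move=> w hw; have hf := fold_near hN e0 er e1 hw.
  have [k0 _] := kap_gt0 hN hf; split => //.
  exact: sm_comp (smv_fold w) (sm_kap hN hf).
- by move=> w p hw; exact: (Hh_formula hA hg hB hN oV VW e0 er e1 XV hH).
- by move=> z; exact: (Hh_invariant hA hg hB hN oV VW e0 er e1 XV hH).
Qed.

Variables (c : chart R M n) (u0 : 'rV[R]_n) (Ct : 'rV[R]_(n + 1) -> 'M[R]_n) (e : R)
  (d : chart R (M * R)%type n.+1) (kp : 'rV[R]_(1 + n) -> R).
Hypothesis hC : hat_chart c u0 Ct e d kp.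
Local Notation w00 := (row_mx 0 u0 : 'rV[R]_(1 + n)).

Lemma hat_atlas_good : good_atlas HA.
Proof. exact: (sub_good (amb_prod hA (@amb_line R))). Qed.

Lemma pd_mul_trmx k (f : 'rV[R]_k -> R) (P : 'rV[R]_k) (T : 'M[R]_k) j : sm f (P *m T^T) ->
  pd j (fun q : 'rV[R]_k => f (q *m T^T)) P = \sum_l pd l f (P *m T^T) * T l j.
Proof.
move=> sf; have := @sm_comp_derive R k _ f (fun q : 'rV[R]_k => q *m T^T) P (delta_mx 0 j) (\row_l T l j) sf.
feed; first by move=> l; rewrite [X in is_derive _ _ _ X]mxE -(trE T j l); exact: isd_mulmx_delta.
by move=> hh; apply: pd_is_derive; apply: (is_derive_eq hh); apply: eq_bigr => l _; rewrite mxE mulrC.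
Qed.

Lemma sm_xi d' z : HA d' -> chart_dom d' z -> sm (fun v => (chart_from d' v).2) (chart_to d' z).
Proof.
move=> Hd dz; have [a Aa az] := am_cover hA z.1.
have AL : AR (prod_chart a line) by exists a, line.
have s1 := sub_from (amb_prod hA (@amb_line R)) Hd dz AL (conj az I).
apply: (sm_ext (f := fun v => chart_to (prod_chart a line) (chart_from d' v) 0 (rshift n.+1 0))); last exact: s1.
by apply: near_all => v; rewrite row_mxEr mxE.
Qed.

(** The momentum derivatives of the Hamiltonian transform as a vector and d xi as a covector, so
    their pairing does not depend on the chart. *)
Lemma xi_dot_invariant z : chart_dom d z -> fiber_invariant HA (xi_dot Hh) d z.
Proof.
move=> dz d' Hd' dz' P; have Hd := hc_d hC.
have [T TE] := exists_eq (tjac d d' z); rewrite -TE.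
have sH : sm (Hh d (chart_to d z)) (P *m T^T) := sm_joint_r (sm_hat_joint hH (P *m T^T) Hd dz).
have e1 i : pd i (Hh d' (chart_to d' z)) P = \sum_l pd l (Hh d (chart_to d z)) (P *m T^T) * T l i.
  rewrite -pd_mul_trmx //; congr pd; apply/funext => p; rewrite TE.
  by rewrite (hc_inv hC dz Hd' dz').
have st := trans_smv hat_atlas_good Hd Hd' dz dz'.
have tE := trans_at hat_atlas_good d' Hd dz.
have e2 l : pd l (fun v => (chart_from d v).2) (chart_to d z)
    = \sum_i T l i * pd i (fun v => (chart_from d' v).2) (chart_to d' z).
  have sx : sm (fun v => (chart_from d' v).2) (trans d d' (chart_to d z)) by rewrite tE; exact: sm_xi.
  have := @sm_comp_derive R n.+1 _ _ (trans d d') (chart_to d z) (delta_mx 0 l) (\row_i T l i) sx.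
  feed; first by move=> i; rewrite [X in is_derive _ _ _ X]mxE TE (tjE l i st); exact: sm_derive.
  rewrite tE => hh; apply: pd_is_derive.
  apply: (is_derive_near (f := fun v => (chart_from d' (trans d d' v)).2)).
    apply: near_imp (trans_dom hat_atlas_good Hd Hd' dz dz') => v [_ _ h3].
    by rewrite /trans (ga_inv hat_atlas_good Hd' h3).
  by apply: (is_derive_eq hh); apply: eq_bigr => i _; rewrite mxE.
have xE d1 u p : xi_dot Hh d1 u p = \sum_(i < n.+1) pd i (Hh d1 u) p * pd i (fun v => (chart_from d1 v).2) u by [].
rewrite !xE; under eq_bigr do rewrite e2 mulr_sumr.
rewrite exchange_big /=; apply: eq_bigr => i _; rewrite e1 mulr_suml.
by apply: eq_bigr => l _; rewrite mulrA.
Qed.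

(** On sigma = 0 the only velocity component is sigma' = p_sigma / 2, and the sigma-derivative of xi
    = sigma [kp] reduces to [kp]. *)
Lemma xi_dot_zero u (p : 'rV[R]_(1 + n)) : `|u - u0| < e ->
  xi_dot Hh d (row_mx 0 u : 'rV[R]_(1 + n)) p = lsubmx p 0 0 / 2 * kp (row_mx 0 u).
Proof.
move=> hu; have [w wE] := exists_eq (row_mx 0 u : 'rV[R]_(1 + n)); rewrite -wE.
have hw : `|w - w00| < e by rewrite wE; apply: row_mx_near; [exact: hc_e hC|rewrite subrr normr0; exact: hc_e hC|].
have s0 : sig w = 0 by rewrite wE /sig row_mxKl mxE.
have [f2 k0 sk] := hc_xi hC hw.
have ep i : pd i (Hh d w) p = 2 * lsubmx p 0 0 / 4 * (delta_mx 0 i : 'rV[R]_(1 + n)) 0 (lshift n 0).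
  rewrite (pd_near (g := fun q : 'rV[R]_(1 + n) => q 0 (lshift n 0) * q 0 (lshift n 0) * 4^-1)); last first.
    by apply: near_all => q; rewrite (hc_ham hC q hw) /hamf s0 mulr0 mul0r addr0 mxE expr2.
  have hh := derive_lin_coord p (delta_mx 0 i) (lshift n 0).
  apply: pd_is_derive; apply: (is_derive_eq (isdM (isdM hh hh) (isd_cst 4^-1 p (delta_mx 0 i)))).
  by rewrite [lsubmx p _ _]mxE; ring.
have ex : pd (lshift n 0 : 'I_(1 + n)) (fun v : 'rV[R]_(1 + n) => (chart_from d v).2) w = kp w.
  rewrite (pd_near (g := fun v : 'rV[R]_(1 + n) => v 0 (lshift n 0) * kp v)); last first.
    apply: near_imp (near_dist_lt hw) => v hv; have [-> _ _] := hc_xi hC hv.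
    by rewrite /sig mxE.
  have hh := derive_lin_coord w (delta_mx 0 (lshift n 0)) (lshift n 0).
  apply: pd_is_derive; apply: (is_derive_eq (isdM hh (sm_derive (lshift n 0) sk))).
  have -> : w 0 (lshift n 0) = 0 by rewrite -s0 /sig mxE.
  by rewrite mul0r addr0 mxE !eqxx mul1r.
have xE : xi_dot Hh d w p = \sum_(i < 1 + n) pd i (Hh d w) p * pd i (fun v => (chart_from d v).2) w by [].
rewrite xE (bigD1 (lshift n 0)) //= ex big1 => [|i ni].
  rewrite addr0 ep (_ : (delta_mx 0 (lshift n 0) : 'rV[R]_(1 + n)) 0 (lshift n 0) = 1); last by rewrite mxE !eqxx.
  by field.
have -> : pd i (Hh d w) p = 0 by rewrite ep [X in _ * X]mxE eq_sym (negbTE ni) andbF mulr0.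
by rewrite mul0r.
Qed.

(** The embedding of Gamma onto Gamma_hat; it takes values in the double because Gamma lies in the
    closure of Omega. *)
Lemma iota_smv c' d' y : GA c' -> HA d' -> chart_dom c' y -> chart_dom d' (y, 0) ->
  smv (fun u => chart_to d' (chart_from c' u, 0)) (chart_to c' y).
Proof.
move=> Gc Hd cy dy; have [a Aa ay] := am_cover hA y; have inv := sub_inv Gc cy.
have AL : AR (prod_chart a line) by exists a, line.
apply: (@smv_into R _ _ _ AR (amb_prod hA (@amb_line R)) (Omega_hat phi) n (fun u => (chart_from c' u, 0)) (prod_chart a line)) => //.
- by rewrite inv.
- by rewrite inv.
- by apply: cont_pair; [exact: (sub_from_cont Gc cy)|exact: cst_continuous].
- apply: smv_row_mx; first exact: (sub_from hA Gc cy).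
  exact: (smv_const_mx1 (sm_cst 0 _)).
- apply: near_imp (sub_img Gc cy) => u [h1 _]; have Gu := GA_in Gc h1.
  split; first exact: (Gamma_closure hA hphi hdphi).
  by rewrite /= Gu mulr0 expr0n.
Qed.

Lemma hat_at_Gamma y : chart_dom c y -> `|chart_to c y - u0| < e ->
  [/\ chart_dom d (y, 0), chart_to d (y, 0) = row_mx 0 (chart_to c y) :> 'rV[R]_(1 + n) &
      jac (fun u => chart_to d (chart_from c u, 0)) (chart_to c y) = row_mx 0 1%:M :> 'M[R]_(n, 1 + n)].
Proof.
move=> cy hu; have e0 := hc_e hC.
have hw u : `|u - u0| < e -> `|(row_mx 0 u : 'rV[R]_(1 + n)) - w00| < e.
  by move=> h; apply: row_mx_near => //; rewrite subrr normr0.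
have [h1 h2] := hc_from hC (hw _ hu).
rewrite (hc_zero hC hu) (sub_inv (hc_c hC) cy) in h1 h2; split => //.
have si := iota_smv (hc_c hC) (hc_d hC) cy h1.
apply/matrixP => i j; rewrite (jac_pd _ _ si).
rewrite (pd_near (g := fun u => (row_mx 0 u : 'rV[R]_(1 + n)) 0 j)); last first.
  apply: near_imp (near_dist_lt hu) => u hu'; have [_ h3] := hc_from hC (hw _ hu').
  by rewrite (hc_zero hC hu') in h3; rewrite h3.
apply: pd_is_derive; case: (@split_ordP 1 n j) => k ->.
  rewrite row_mxEl mxE; apply: (is_derive_ext _ erefl (isd_cst 0 _ _)).
  by move=> u; rewrite row_mxEl mxE.
rewrite row_mxEr; apply: (is_derive_ext _ _ (derive_lin_coord _ _ k)).
  by move=> u; rewrite row_mxEr.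
by rewrite !mxE eqxx eq_sym.
Qed.

Lemma mul_row_select (v : 'rV[R]_(1 + n)) : v *m (row_mx 0 1%:M : 'M[R]_(n, 1 + n))^T = rsubmx v.
Proof. by rewrite -{1}(hsubmxK v) tr_row_mx mul_row_col trmx0 mulmx0 trmx1 mulmx1 add0r. Qed.

(** [restricts_to] asks for the relation in all pairs of charts; one pair is enough, since the
    Jacobian of the embedding in the charts (c', d) factors through d' and also through c ([J1],
    [J2]). *)
Lemma hat_restrict z w : cotangent HA z -> cotangent GA w -> z.1 = (w.1, 0) ->
  chart_dom c w.1 -> `|chart_to c w.1 - u0| < e ->
  restricts_to A phi z w <-> w.2 c = rsubmx (z.2 d : 'rV[R]_(1 + n)).
Proof.
move=> hz hw e1 cy hu; have [dz tE JE] := hat_at_Gamma cy hu.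
have Gc := hc_c hC; have Hd := hc_d hC.
have rE : z.2 d *m (jac (fun u => chart_to d (chart_from c u, 0)) (chart_to c w.1))^T = rsubmx (z.2 d : 'rV[R]_(1 + n)).
  by rewrite JE; exact: mul_row_select.
split.
  by move=> [_ _ h3]; rewrite -rE (h3 c d Gc Hd cy) // e1.
move=> h; split => // c' d' Gc' Hd' cy' dz'.
rewrite e1 in dz'.
have dd : chart_dom d z.1 by rewrite e1.
have dd' : chart_dom d' z.1 by rewrite e1.
have [_ h1 _] := hz; have [_ h2 _] := hw.
have z1 : z.2 d' = z.2 d *m (tjac d' d z.1)^T := h1 d' d Hd' Hd dd' dd.
have w1 : w.2 c' = w.2 c *m (tjac c' c w.1)^T := h2 c' c Gc' Gc cy' cy.
have Gg : good_atlas GA by exact: (sub_good hA).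
pose f u := chart_to d (chart_from c' u, 0).
have s1 := iota_smv Gc' Hd' cy' dz'.
have J1 : jac f (chart_to c' w.1) = jac (fun u => chart_to d' (chart_from c' u, 0)) (chart_to c' w.1) *m tjac d' d z.1.
  have tE' : chart_to d' (chart_from c' (chart_to c' w.1), 0) = chart_to d' z.1 by rewrite (sub_inv Gc' cy') e1.
  have s2 : smv (trans d' d) (chart_to d' (chart_from c' (chart_to c' w.1), 0)).
    by rewrite tE'; exact: (trans_smv hat_atlas_good Hd' Hd dd' dd).
  have := jac_chain s1 s2; rewrite tE' => <-; apply/jac_eqnear; last exact: (iota_smv Gc' Hd cy').
  have cf : {for chart_to c' w.1, continuous (fun u => (chart_from c' u, 0 : R))}.
    by apply: cont_pair; [exact: (sub_from_cont Gc' cy')|exact: cst_continuous].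
  have n1 : \forall u \near chart_to c' w.1, Omega_hat phi (chart_from c' u, 0) -> chart_dom d' (chart_from c' u, 0).
    apply: (near_cont_comp (P := fun y => Omega_hat phi y -> chart_dom d' y) cf).
    by rewrite (sub_inv Gc' cy'); exact: (sub_near Hd' dz').
  apply: near_imp (near_and n1 (sub_img Gc' cy')) => u [h3 [h4 _]].
  have Gu := GA_in Gc' h4.
  have : chart_dom d' (chart_from c' u, 0).
    apply: h3; split; first exact: (Gamma_closure hA hphi hdphi).
    by rewrite /= Gu mulr0 expr0n.
  by move=> h5; rewrite /f /trans (sub_inv Hd' h5).
have J2 : jac f (chart_to c' w.1) = tjac c' c w.1 *m jac (fun u => chart_to d (chart_from c u, 0)) (chart_to c w.1).
  have s3 := trans_smv Gg Gc' Gc cy' cy.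
  have tE' := trans_at Gg c Gc' cy'.
  have s4 : smv (fun u => chart_to d (chart_from c u, 0)) (trans c' c (chart_to c' w.1)).
    by rewrite tE'; exact: (iota_smv Gc Hd cy).
  have := jac_chain s3 s4; rewrite tE' => <-; apply/jac_eqnear; last exact: (iota_smv Gc' Hd cy').
  apply: near_imp (trans_dom Gg Gc' Gc cy' cy) => u [_ _ h5].
  by rewrite /f /trans (sub_inv Gc h5).
rewrite w1 h -rE -mulmxA -trmx_mul -J2 J1 trmx_mul mulmxA -z1; reflexivity.
Qed.

End HatChart.

(** * Equations of motion in local coordinates *)

Section Scaling.
Context {R : realType}.

Definition dscale m (mu z : 'rV[R]_m) : 'rV[R]_m := \row_l (mu 0 l * z 0 l).

(** Differentiation of the homogeneity relation; with weights 1 on u and k on p it yields the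
    degrees of homogeneity of the partial derivatives. *)
Lemma pd_dscale m (f : 'rV[R]_m -> R) (mu z : 'rV[R]_m) (k : R) l :
  (forall z', f (dscale mu z') = k * f z') -> sm f (dscale mu z) -> sm f z ->
  mu 0 l * pd l f (dscale mu z) = k * pd l f z.
Proof.
move=> hf s1 s2.
have := @sm_comp_derive R m _ f (dscale mu) z (delta_mx 0 l) (\row_i (mu 0 i * (delta_mx 0 l : 'rV[R]_m) 0 i)) s1.
feed.
  move=> i; apply: (is_derive_ext _ _ (isdZ (mu 0 i) (derive_lin_coord z (delta_mx 0 l) i))).
    by move=> u; rewrite [RHS]mxE.
  by rewrite [RHS]mxE.
move=> h1; have h2 := isdZ k (sm_derive l s2).
have h3 := is_derive_ext (f := fun u => k * f u) (g := fun u => f (dscale mu u)) (fun u => esym (hf u)) erefl h2.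
have [_ <-] := h3; have [_ ->] := h1.
rewrite (bigD1 l) //= big1 => [|i il]; first by rewrite !mxE !eqxx mulr1 addr0.
by rewrite !mxE (negbTE il) andbF mulr0 mul0r.
Qed.

End Scaling.

(** * The quadratic form K and the oscillator equations *)

Section QuadraticForm.
Context {R : realType} {n : nat}.
Variables (u0 : 'rV[R]_n) (Ct : 'rV[R]_(n + 1) -> 'M[R]_n) (r : R).
Hypothesis sC : forall w, `|w - row_mx u0 0| < r -> smm Ct w.

(* z = ((u, P), eta) *)
Definition base (z : 'rV[R]_(n + n + 1)) : 'rV[R]_(n + 1) := row_mx (lsubmx (lsubmx z)) (rsubmx z).
Definition Kq (z : 'rV[R]_(n + n + 1)) : R :=
  (rsubmx (lsubmx z) *m Ct (base z) *m (rsubmx (lsubmx z))^T) 0 0.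

Definition iu (j : 'I_n) : 'I_(n + n + 1) := lshift 1 (lshift n j).
Definition ip (j : 'I_n) : 'I_(n + n + 1) := lshift 1 (rshift n j).
Definition ie : 'I_(n + n + 1) := rshift (n + n) 0.

Lemma smv_base z : smv base z.
Proof.
apply: (smv_row_mx (f := fun z : 'rV[R]_(n + n + 1) => lsubmx (lsubmx z))); last exact: smv_rsubmx.
by apply: (smv_comp (f := fun v : 'rV[R]_(n + n) => lsubmx v)); exact: smv_lsubmx.
Qed.

Lemma sm_Kq z : `|base z - row_mx u0 0| < r -> sm Kq z.
Proof.
move=> hz.
have sP : smm (fun z : 'rV[R]_(n + n + 1) => rsubmx (lsubmx z)) z.
  move=> i j; rewrite (ord1 i).
  exact: (smv_comp (f := fun v : 'rV[R]_(n + n) => rsubmx v) (smv_lsubmx _) (smv_rsubmx _) j).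
have sCb : smm (fun z => Ct (base z)) z := smm_comp (smv_base z) (sC hz).
exact: (smm_mul (smm_mul sP sCb) (smm_tr sP)).
Qed.

Definition mul_p (k : R) : 'rV[R]_(n + n + 1) := row_mx (row_mx (const_mx 1) (const_mx k)) (const_mx 1).

Lemma dscale_p k (u P : 'rV[R]_n) (eta : 'rV[R]_1) :
  dscale (mul_p k) (row_mx (row_mx u P) eta) = row_mx (row_mx u (k *: P)) eta.
Proof.
apply/rowP => l; rewrite mxE /mul_p; case: (split_ordP l) => l' ->; last by rewrite !row_mxEr mxE mul1r.
rewrite !row_mxEl; case: (split_ordP l') => l'' ->; first by rewrite !row_mxEl mxE mul1r.
by rewrite !row_mxEr !mxE.
Qed.

Lemma KqE (u P : 'rV[R]_n) (eta : 'rV[R]_1) :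
  Kq (row_mx (row_mx u P) eta) = (P *m Ct (row_mx u eta) *m P^T) 0 0.
Proof. by rewrite /Kq /base !row_mxKl !row_mxKr. Qed.

Lemma baseE (u P : 'rV[R]_n) (eta : 'rV[R]_1) : base (row_mx (row_mx u P) eta) = row_mx u eta.
Proof. by rewrite /base !row_mxKl row_mxKr. Qed.

Lemma Kq_scale k z : Kq (dscale (mul_p k) z) = k ^+ 2 * Kq z.
Proof.
rewrite -[z]hsubmxK -[lsubmx z]hsubmxK dscale_p !KqE.
by rewrite linearZ /= -scalemxAr -!scalemxAl scalerA mxE expr2.
Qed.

Lemma pd_Kq_scale k (u P : 'rV[R]_n) (eta : 'rV[R]_1) : `|row_mx u eta - row_mx u0 0| < r -> k != 0 ->
  [/\ forall j, pd (iu j) Kq (row_mx (row_mx u (k *: P)) eta) = k ^+ 2 * pd (iu j) Kq (row_mx (row_mx u P) eta),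
      forall j, pd (ip j) Kq (row_mx (row_mx u (k *: P)) eta) = k * pd (ip j) Kq (row_mx (row_mx u P) eta) &
      pd ie Kq (row_mx (row_mx u (k *: P)) eta) = k ^+ 2 * pd ie Kq (row_mx (row_mx u P) eta)].
Proof.
move=> hz k0; have s1 : sm Kq (row_mx (row_mx u P) eta) by apply: sm_Kq; rewrite baseE.
have s2 : sm Kq (dscale (mul_p k) (row_mx (row_mx u P) eta)) by rewrite dscale_p; apply: sm_Kq; rewrite baseE.
have h l := pd_dscale l (Kq_scale k) s2 s1; rewrite dscale_p in h.
split=> [j|j|].
- by rewrite -h /mul_p /iu row_mxEl row_mxEl mxE mul1r.
- by apply: (mulfI k0); have := h (ip j); rewrite {1}/mul_p /ip row_mxEl row_mxEr mxE mulrA -expr2.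
- by rewrite -h /mul_p /ie row_mxEr mxE mul1r.
Qed.

Definition Gq (z : 'rV[R]_(n + n + 1)) : 'rV[R]_(n + n) :=
  row_mx (\row_j pd (ip j) Kq z) (\row_j - pd (iu j) Kq z).
(** The derivative of eta K in eta. It appears because the sigma-derivative of sigma^2 K(u, P,
    sigma^2) is 2 sigma times it. [Gq] is the Hamiltonian vector field of K in (u, P) with eta
    fixed. *)
Definition Eq (z : 'rV[R]_(n + n + 1)) : R := Kq z + rsubmx z 0 0 * pd ie Kq z.

Lemma smv_Gq z : `|base z - row_mx u0 0| < r -> smv Gq z.
Proof.
move=> hz; have s1 := sm_Kq hz; apply: smv_row_mx => j.
  by apply: sm_ext (sm_pd (ip j) s1); apply: near_all => v; rewrite mxE.
by apply: sm_ext (sm_opp (sm_pd (iu j) s1)); apply: near_all => v; rewrite mxE.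
Qed.

Lemma sm_Eq z : `|base z - row_mx u0 0| < r -> sm Eq z.
Proof.
move=> hz; have s1 := sm_Kq hz; apply: sm_add => //; apply: sm_mul; last exact: sm_pd.
exact: (smv_rsubmx (m := n + n) z 0).
Qed.

Lemma sum_coords (al be : 'I_n -> R) (ga : R) (F : 'I_(n + n + 1) -> R) :
  \sum_i (row_mx (row_mx (\row_j al j) (\row_j be j)) (const_mx ga) : 'rV[R]_(n + n + 1)) 0 i * F i
  = \sum_j al j * F (iu j) + \sum_j be j * F (ip j) + ga * F ie.
Proof.
rewrite big_split_ord big_split_ord /= big_ord1; congr (_ + _ + _).
- by apply: eq_bigr => j _; rewrite row_mxEl row_mxEl mxE.
- by apply: eq_bigr => j _; rewrite row_mxEl row_mxEr mxE.
- by rewrite row_mxEr mxE.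
Qed.

(** A Hamiltonian vector field annihilates its own Hamiltonian, so only the motion of eta changes
    K. *)
Lemma symplectic_cancel (k ga : R) (F : 'I_(n + n + 1) -> R) :
  \sum_i (row_mx (k *: row_mx (\row_j F (ip j)) (\row_j - F (iu j))) (const_mx ga) : 'rV[R]_(n + n + 1)) 0 i * F i
  = ga * F ie.
Proof.
rewrite (_ : k *: _ = row_mx (\row_j (k * F (ip j))) (\row_j - (k * F (iu j)))); last first.
  by rewrite scale_row_mx; congr row_mx; apply/rowP => j; rewrite !mxE // mulrN.
rewrite sum_coords (eq_bigr (fun j => k * (F (ip j) * F (iu j)))) => [|j _]; last by rewrite mulrA.
rewrite [X in _ + X + _](eq_bigr (fun j => - (k * (F (ip j) * F (iu j))))) => [|j _]; last by ring.
by rewrite sumrN subrr add0r.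
Qed.

Lemma hamfE (w p : 'rV[R]_(1 + n)) : hamf Ct w p = sig p ^+ 2 / 4
  + sig w * sig w * Kq (row_mx (row_mx (rsubmx w) (rsubmx p)) (const_mx (sig w * sig w))).
Proof. by rewrite KqE. Qed.

Definition js : 'I_((1 + n) + (1 + n)) := lshift (1 + n) (lshift n 0).
Definition ju (j : 'I_n) : 'I_((1 + n) + (1 + n)) := lshift (1 + n) (rshift 1 j).
Definition jps : 'I_((1 + n) + (1 + n)) := rshift (1 + n) (lshift n 0).
Definition jp (j : 'I_n) : 'I_((1 + n) + (1 + n)) := rshift (1 + n) (rshift 1 j).

(** The direction is left general so that one computation yields all four kinds of partial
    derivatives, by inserting basis vectors. *)
Lemma isd_hamf (w p : 'rV[R]_(1 + n)) (z : 'rV[R]_(n + n + 1)) (dv : 'rV[R]_((1 + n) + (1 + n)))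
    (a b : R) (al be : 'I_n -> R) :
  z = row_mx (row_mx (rsubmx w) (rsubmx p)) (const_mx (sig w * sig w)) ->
  `|base z - row_mx u0 0| < r ->
  dv 0 js = a -> dv 0 jps = b -> (forall j, dv 0 (ju j) = al j) -> (forall j, dv 0 (jp j) = be j) ->
  is_derive (row_mx w p) dv (fun s : 'rV[R]_((1 + n) + (1 + n)) => hamf Ct (lsubmx s) (rsubmx s))
    ((sig p * b / 2 + 2 * sig w * a * Kq z + sig w * sig w *
      (\sum_j al j * pd (iu j) Kq z + \sum_j be j * pd (ip j) Kq z + 2 * sig w * a * pd ie Kq z)) : R).
Proof.
move=> z_E hz da db dal dbe; have [s0 s0E] := exists_eq (row_mx w p).
have co := derive_lin_coord s0 dv.
pose zz (s : 'rV[R]_((1 + n) + (1 + n))) : 'rV[R]_(n + n + 1) :=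
  row_mx (row_mx (rsubmx (lsubmx s)) (rsubmx (rsubmx s))) (const_mx (sig (lsubmx s) * sig (lsubmx s))).
have zE : zz s0 = z by rewrite /zz s0E row_mxKl row_mxKr z_E.
have sgE (s : 'rV[R]_((1 + n) + (1 + n))) : sig (lsubmx s) = s 0 js by rewrite /sig !mxE.
have sgpE (s : 'rV[R]_((1 + n) + (1 + n))) : sig (rsubmx s) = s 0 jps by rewrite /sig !mxE.
have wE : s0 0 js = sig w by rewrite -sgE s0E row_mxKl.
have pE : s0 0 jps = sig p by rewrite -sgpE s0E row_mxKr.
pose dz : 'rV[R]_(n + n + 1) := row_mx (row_mx (\row_j al j) (\row_j be j)) (const_mx (2 * sig w * a)).
have := @sm_comp_derive R _ _ Kq zz s0 dv dz.
feed; first by rewrite zE; exact: sm_Kq.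
feed.
  move=> l; case: (split_ordP l) => l' ->.
    case: (split_ordP l') => j ->; rewrite /dz row_mxEl.
      rewrite row_mxEl [X in is_derive _ _ _ X]mxE -dal; apply: (is_derive_ext _ erefl (co (ju j))) => s.
      by rewrite /zz !row_mxEl !mxE.
    rewrite row_mxEr [X in is_derive _ _ _ X]mxE -dbe; apply: (is_derive_ext _ erefl (co (jp j))) => s.
    by rewrite /zz row_mxEl row_mxEr !mxE.
  rewrite /dz row_mxEr [X in is_derive _ _ _ X]mxE -da.
  apply: (is_derive_ext _ _ (isdM (co js) (co js))); first by move=> s; rewrite /zz row_mxEr mxE sgE.
  by rewrite wE; ring.
rewrite zE => hK; have hh := isdD (isdM (isdM (co jps) (co jps)) (isd_cst 4^-1 s0 dv)) (isdM (isdM (co js) (co js)) hK).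
rewrite -s0E; apply: (is_derive_ext _ _ hh).
  by move=> s; rewrite /zz hamfE sgE sgpE expr2.
rewrite zE wE pE /dz (sum_coords al be _ (fun l => pd l Kq z)) da db.
have key (S1 S2 D K1 P1 W1 : R) : (b * P1 + P1 * b) / 4 + P1 * P1 * 0 + ((a * W1 + W1 * a) * K1 + W1 * W1 * (S1 + S2 + 2 * W1 * a * D))
  = P1 * b / 2 + 2 * W1 * a * K1 + W1 * W1 * (S1 + S2 + 2 * W1 * a * D) by field.
exact: key.
Qed.

Lemma delta_coord m (i j : 'I_m) : (delta_mx 0 i : 'rV[R]_m) 0 j = (j == i)%:R.
Proof. by rewrite mxE eqxx. Qed.

Lemma sum_delta m (i : 'I_m) (f : 'I_m -> R) : \sum_j (j == i)%:R * f j = f i.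
Proof.
rewrite (bigD1 i) //= eqxx mul1r big1 ?addr0 // => j ji.
by rewrite (negbTE ji) mul0r.
Qed.

Lemma delta_js : [/\ (delta_mx 0 js : 'rV[R]_(_ + _)) 0 js = 1, (delta_mx 0 js : 'rV[R]_(_ + _)) 0 jps = 0,
  forall j, (delta_mx 0 js : 'rV[R]_(_ + _)) 0 (ju j) = 0 & forall j, (delta_mx 0 js : 'rV[R]_(_ + _)) 0 (jp j) = 0].
Proof.
split=> [||j|j]; rewrite delta_coord ?eqxx // ?eq_lshift ?eq_rshift ?eq_lrshift ?eq_rlshift //.
Qed.

Lemma delta_jps : [/\ (delta_mx 0 jps : 'rV[R]_(_ + _)) 0 js = 0, (delta_mx 0 jps : 'rV[R]_(_ + _)) 0 jps = 1,
  forall j, (delta_mx 0 jps : 'rV[R]_(_ + _)) 0 (ju j) = 0 & forall j, (delta_mx 0 jps : 'rV[R]_(_ + _)) 0 (jp j) = 0].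
Proof.
split=> [||j|j]; rewrite delta_coord ?eqxx // ?eq_lshift ?eq_rshift ?eq_lrshift ?eq_rlshift //.
Qed.

Lemma delta_ju k : [/\ (delta_mx 0 (ju k) : 'rV[R]_(_ + _)) 0 js = 0, (delta_mx 0 (ju k) : 'rV[R]_(_ + _)) 0 jps = 0,
  forall j, (delta_mx 0 (ju k) : 'rV[R]_(_ + _)) 0 (ju j) = (j == k)%:R &
  forall j, (delta_mx 0 (ju k) : 'rV[R]_(_ + _)) 0 (jp j) = 0].
Proof.
split=> [||j|j]; rewrite delta_coord ?eqxx // ?eq_lshift ?eq_rshift ?eq_lrshift ?eq_rlshift //.
Qed.

Lemma delta_jp k : [/\ (delta_mx 0 (jp k) : 'rV[R]_(_ + _)) 0 js = 0, (delta_mx 0 (jp k) : 'rV[R]_(_ + _)) 0 jps = 0,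
  forall j, (delta_mx 0 (jp k) : 'rV[R]_(_ + _)) 0 (ju j) = 0 &
  forall j, (delta_mx 0 (jp k) : 'rV[R]_(_ + _)) 0 (jp j) = (j == k)%:R].
Proof.
split=> [||j|j]; rewrite delta_coord ?eqxx // ?eq_lshift ?eq_rshift ?eq_lrshift ?eq_rlshift //.
Qed.

Lemma sum_zero (F : 'I_n -> R) : \sum_j 0 * F j = 0.
Proof. by apply: big1 => j _; rewrite mul0r. Qed.

Lemma pd_hamf (w p : 'rV[R]_(1 + n)) (z : 'rV[R]_(n + n + 1)) :
  z = row_mx (row_mx (rsubmx w) (rsubmx p)) (const_mx (sig w * sig w)) ->
  `|base z - row_mx u0 0| < r ->
  [/\ pd jps (fun s : 'rV[R]_((1 + n) + (1 + n)) => hamf Ct (lsubmx s) (rsubmx s)) (row_mx w p) = sig p / 2,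
      forall j, pd (jp j) (fun s : 'rV[R]_((1 + n) + (1 + n)) => hamf Ct (lsubmx s) (rsubmx s)) (row_mx w p)
        = sig w * sig w * Gq z 0 (lshift n j),
      pd js (fun s : 'rV[R]_((1 + n) + (1 + n)) => hamf Ct (lsubmx s) (rsubmx s)) (row_mx w p) = 2 * sig w * Eq z &
      forall j, pd (ju j) (fun s : 'rV[R]_((1 + n) + (1 + n)) => hamf Ct (lsubmx s) (rsubmx s)) (row_mx w p)
        = - (sig w * sig w * Gq z 0 (rshift n j))].
Proof.
move=> zE hz.
have ez : rsubmx z 0 0 = sig w * sig w by rewrite zE row_mxKr mxE.
have zu : \sum_j (0 : R) * pd (iu j) Kq z = 0 by exact: sum_zero.
have zp : \sum_j (0 : R) * pd (ip j) Kq z = 0 by exact: sum_zero.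
have gen (S1 S2 S1' S2' D K0 P0 W0 a b c0 : R) : S1 = S1' -> S2 = S2' ->
    P0 * b / 2 + 2 * W0 * a * K0 + W0 * W0 * (S1' + S2' + 2 * W0 * a * D) = c0 ->
    P0 * b / 2 + 2 * W0 * a * K0 + W0 * W0 * (S1 + S2 + 2 * W0 * a * D) = c0 by move=> -> ->.
split=> [|k||k].
- have [h1 h2 h3 h4] := delta_jps; have h5 := pd_is_derive (isd_hamf zE hz h1 h2 h3 h4).
  apply: (etrans h5); apply: (gen _ _ _ _ _ _ _ _ _ _ _ zu zp).
  by move: (pd ie Kq z) (Kq z) (sig p) (sig w) => D K0 P0 W0; ring.
- have [h1 h2 h3 h4] := delta_jp k; have h5 := pd_is_derive (isd_hamf zE hz h1 h2 h3 h4).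
  apply: (etrans h5); apply: (gen _ _ _ _ _ _ _ _ _ _ _ zu (sum_delta k (fun j => pd (ip j) Kq z))).
  rewrite /Gq row_mxEl mxE.
  by move: (pd (ip k) Kq z) (pd ie Kq z) (Kq z) (sig p) (sig w) => D' D K0 P0 W0; ring.
- have [h1 h2 h3 h4] := delta_js; have h5 := pd_is_derive (isd_hamf zE hz h1 h2 h3 h4).
  apply: (etrans h5); apply: (gen _ _ _ _ _ _ _ _ _ _ _ zu zp); rewrite /Eq ez.
  by move: (pd ie Kq z) (Kq z) (sig p) (sig w) => D K0 P0 W0; ring.
- have [h1 h2 h3 h4] := delta_ju k; have h5 := pd_is_derive (isd_hamf zE hz h1 h2 h3 h4).
  apply: (etrans h5); apply: (gen _ _ _ _ _ _ _ _ _ _ _ (sum_delta k (fun j => pd (iu j) Kq z)) zp).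
  rewrite /Gq row_mxEr mxE.
  by move: (pd (iu k) Kq z) (pd ie Kq z) (Kq z) (sig p) (sig w) => D' D K0 P0 W0; ring.
Qed.

(* Conservation of p_sigma^2 / 4 + sigma^2 <C p_u, p_u> = v^2 + y^2 K. *)
Lemma osc_energy (x : R -> 'rV[R]_(n + n)) (y v : R -> R) (d tau : R) : 0 < tau ->
  (forall t : R, 0 <= t <= tau ->
    let z := row_mx (x t) (const_mx (d * (y t * y t))) in
    [/\ `|base z - row_mx u0 0| < r,
      forall i, is_derive t (1 : R) (fun s : R => x s 0 i) (d * (y t * y t) * Gq z 0 i),
      is_derive t (1 : R) y (v t) & is_derive t (1 : R) v (- y t * Eq z)]) ->
  y 0 = 0 -> v 0 = 1 -> y tau = 0 -> v tau ^+ 2 = 1.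
Proof.
move=> tau0 h y0 v0 yt.
pose F (t : R) : R := v t * v t + y t * y t * Kq (row_mx (x t) (const_mx (d * (y t * y t)))).
have dF (t : R) : 0 <= t <= tau -> is_derive t (1 : R) F 0.
  move=> ht; have [] := h t ht; have [z zE] := exists_eq (row_mx (x t) (const_mx (d * (y t * y t)) : 'rV[R]_1)).
  rewrite -zE => hz dx dy dv; have ez : rsubmx z 0 0 = d * (y t * y t) by rewrite zE row_mxKr mxE.
  have [k kE] := exists_eq (d * (y t * y t)); have [k' k'E] := exists_eq (2 * d * y t * v t).
  rewrite -kE in dx.
  have hdz : forall l, is_derive t (1 : R) (fun s : R => row_mx (x s) (const_mx (d * (y s * y s)) : 'rV[R]_1) 0 l)
     ((row_mx (k *: Gq z) (const_mx k') : 'rV[R]_(n + n + 1)) 0 l).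
    move=> l; case: (split_ordP l) => i ->.
      rewrite row_mxEl [X in is_derive _ _ _ X]mxE; apply: (is_derive_ext _ erefl (dx i)) => s.
      by rewrite row_mxEl.
    rewrite row_mxEr [X in is_derive _ _ _ X]mxE; apply: (is_derive_ext _ _ (isdZ d (isdM dy dy))).
      by move=> s; rewrite row_mxEr mxE.
    by rewrite k'E; ring.
  have hK0 : sm Kq (row_mx (x t) (const_mx (d * (y t * y t)))) by rewrite -zE; exact: sm_Kq.
  have := @sm_comp_derive R _ R Kq (fun s : R => row_mx (x s) (const_mx (d * (y s * y s)))) t 1 _ hK0 hdz.
  rewrite -zE.
  rewrite (symplectic_cancel k k' (fun l => pd l Kq z)).
  move=> hK; have hh := isdD (isdM dv dv) (isdM (isdM dy dy) hK).
  apply: (is_derive_eq hh); rewrite -zE k'E /Eq ez.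
  by move: (pd ie Kq z) (Kq z) => D K0; ring.
have := @MVT_bound R F (fun=> 0) 0 tau 0 (ltW tau0) dF.
feed; first by move=> t _; rewrite normr0.
rewrite mul0r normr_le0 subr_eq0 /F yt y0 v0 !mul0r !addr0 mulr1 -expr2 => /eqP //.
Qed.

End QuadraticForm.

(** * The averaged Hamiltonian and its homogeneity *)

Section AveragedField.
Context {R : realType} {n : nat}.
Variables (u0 : 'rV[R]_n) (Ct : 'rV[R]_(n + 1) -> 'M[R]_n) (r : R).
Hypothesis sC : forall w, `|w - row_mx u0 0| < r -> smm Ct w.
Local Notation Kq := (Kq Ct).

Definition sgrad (f : 'rV[R]_(n + n) -> R) (x : 'rV[R]_(n + n)) : 'rV[R]_(n + n) :=
  row_mx (\row_j pd (rshift n j) f x) (\row_j - pd (lshift n j) f x).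

Lemma smv_sgrad f x : sm f x -> smv (sgrad f) x.
Proof.
move=> h; apply: smv_row_mx => j.
  by apply: sm_ext (sm_pd (rshift n j) h); apply: near_all => v; rewrite mxE.
by apply: sm_ext (sm_opp (sm_pd (lshift n j) h)); apply: near_all => v; rewrite mxE.
Qed.

(** [k0] and [k1] are K_0 and K_1 as functions of x = (u, p), see [K0_link] and [K1_link]; [N0] and
    [N1] are the two terms of N, with the powers of K_0 written through the square root, whose
    smoothness is at hand. *)
Definition k0 (x : 'rV[R]_(n + n)) : R := Kq (row_mx x 0).
Definition k1 (x : 'rV[R]_(n + n)) : R := pd ie Kq (row_mx x 0).
Definition N0 (x : 'rV[R]_(n + n)) : R := - (Num.sqrt (k0 x))^-1.
Definition N1 (x : 'rV[R]_(n + n)) : R := 3 / 8 * (k1 x * (k0 x * k0 x * Num.sqrt (k0 x))^-1).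

Definition in_base (x : 'rV[R]_(n + n)) : Prop := `|(row_mx (lsubmx x) 0 : 'rV[R]_(n + 1)) - row_mx u0 0| < r.

Lemma in_baseE x : in_base x -> `|base (row_mx x 0 : 'rV[R]_(n + n + 1)) - row_mx u0 0| < r.
Proof. by rewrite /base row_mxKl row_mxKr. Qed.

Lemma smv_row0 (x : 'rV[R]_(n + n)) : smv (fun x : 'rV[R]_(n + n) => row_mx x 0 : 'rV[R]_(n + n + 1)) x.
Proof. by apply: smv_row_mx; [exact: smv_id|move=> j; exact: sm_cst]. Qed.

Lemma sm_k0 x : in_base x -> sm k0 x.
Proof. move=> h; exact: (sm_comp (smv_row0 x) (sm_Kq sC (in_baseE h))). Qed.

Lemma sm_k1 x : in_base x -> sm k1 x.
Proof. move=> h; exact: (sm_comp (smv_row0 x) (sm_pd ie (sm_Kq sC (in_baseE h)))). Qed.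

Lemma sm_N0 x : in_base x -> 0 < k0 x -> sm N0 x.
Proof.
move=> h k0p; apply: sm_opp; apply: sm_inv; first by rewrite gt_eqF // sqrtr_gt0.
exact: sm_sqrt (sm_k0 h).
Qed.

Lemma sm_N1 x : in_base x -> 0 < k0 x -> sm N1 x.
Proof.
move=> h k0p; apply: sm_mul; first exact: sm_cst.
have s0 := sm_k0 h; apply: sm_mul; first exact: sm_k1.
apply: sm_inv; first by rewrite gt_eqF // !mulr_gt0 // sqrtr_gt0.
by apply: sm_mul; [exact: sm_mul|exact: sm_sqrt].
Qed.

Lemma pd_k0 x l : in_base x -> pd l k0 x = pd (lshift 1 l) Kq (row_mx x 0).
Proof.
move=> h; have := @sm_comp_derive R _ _ Kq (fun x : 'rV[R]_(n + n) => row_mx x 0 : 'rV[R]_(n + n + 1)) x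
  (delta_mx 0 l) (delta_mx 0 (lshift 1 l)) (sm_Kq sC (in_baseE h)).
feed.
  move=> i; case: (split_ordP i) => i' ->.
    apply: (is_derive_ext _ _ (derive_lin_coord x (delta_mx 0 l) i')); first by move=> s; rewrite row_mxEl.
    by rewrite delta_mx_lshift row_mxEl.
  apply: (is_derive_ext _ _ (isd_cst 0 x (delta_mx 0 l))); first by move=> s; rewrite row_mxEr mxE.
  by rewrite delta_mx_lshift row_mxEr mxE.
move=> hd; apply: (etrans (pd_is_derive hd)).
apply: etrans (sum_delta (lshift 1 l) (fun i => pd i Kq (row_mx x 0))).
by apply: eq_bigr => i _; rewrite delta_coord.
Qed.

Lemma sgrad_N0 x : in_base x -> 0 < k0 x ->
  sgrad N0 x = (2 * Num.sqrt (k0 x) ^+ 3)^-1 *: Gq Ct (row_mx x 0).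
Proof.
move=> h kp; have s0 := sm_k0 h.
have w0 : 0 < Num.sqrt (k0 x) by rewrite sqrtr_gt0.
have key (w d : R) : w != 0 -> - (- (2^-1 * w^-1 * d) * (w^-1 * w^-1)) = (2 * w ^+ 3)^-1 * d.
  by move=> wn; field.
have E l : pd l N0 x = (2 * Num.sqrt (k0 x) ^+ 3)^-1 * pd (lshift 1 l) Kq (row_mx x 0).
  rewrite -(pd_k0 l h); have hd := isdN (@isdV R _ (fun y => Num.sqrt (k0 y)) x _ _ (lt0r_neq0 w0) (isd_sqrt kp (sm_derive l s0))).
  apply: (etrans (pd_is_derive hd)); exact: key (lt0r_neq0 w0).
apply/rowP => j; rewrite [RHS]mxE; case: (split_ordP j) => i ->.
  by rewrite /sgrad /Gq !row_mxEl [LHS]mxE [X in _ * X]mxE E.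
by rewrite /sgrad /Gq !row_mxEr [LHS]mxE [X in _ * X]mxE E mulrN.
Qed.

Definition mul_p2 (k : R) : 'rV[R]_(n + n) := row_mx (const_mx 1) (const_mx k).

Lemma dscale_p2 k (u P : 'rV[R]_n) : dscale (mul_p2 k) (row_mx u P) = row_mx u (k *: P).
Proof.
apply/rowP => l; rewrite mxE /mul_p2; case: (split_ordP l) => j ->.
  by rewrite !row_mxEl mxE mul1r.
by rewrite !row_mxEr !mxE.
Qed.

Lemma k0_scale k x : k0 (dscale (mul_p2 k) x) = k ^+ 2 * k0 x.
Proof.
rewrite /k0 -Kq_scale; congr Kq; rewrite -[x]hsubmxK dscale_p2.
by rewrite dscale_p.
Qed.

Lemma k1_scale k x : in_base x -> k != 0 -> k1 (dscale (mul_p2 k) x) = k ^+ 2 * k1 x.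
Proof.
move=> h kn; rewrite /k1 -[x]hsubmxK dscale_p2.
by have [_ _ ->] := pd_Kq_scale sC (rsubmx x) h kn.
Qed.

Lemma N0_scale k x : 0 < k -> N0 (dscale (mul_p2 k) x) = k^-1 * N0 x.
Proof.
move=> kp; rewrite /N0 k0_scale sqrtrM ?sqr_ge0 // sqrtr_sqr gtr0_norm //.
by rewrite invfM mulrN.
Qed.

Lemma in_base_scale k x : in_base (dscale (mul_p2 k) x) <-> in_base x.
Proof. by rewrite /in_base -{1}[x]hsubmxK dscale_p2 row_mxKl. Qed.

Lemma pd_N0_scale k x l : in_base x -> 0 < k0 x -> 0 < k ->
  mul_p2 k 0 l * pd l N0 (dscale (mul_p2 k) x) = k^-1 * pd l N0 x.
Proof.
move=> h kp k_0; apply: pd_dscale; last exact: sm_N0.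
  by move=> z; exact: N0_scale.
by apply: sm_N0; [exact/in_base_scale|rewrite k0_scale mulr_gt0 // exprn_gt0].
Qed.

Lemma N1_scale k x : in_base x -> 0 < k -> N1 (dscale (mul_p2 k) x) = k ^- 3 * N1 x.
Proof.
move=> h kp; rewrite /N1 k1_scale ?gt_eqF // k0_scale sqrtrM ?sqr_ge0 // sqrtr_sqr gtr0_norm //.
have kn : k != 0 by rewrite gt_eqF.
move: (k1 x) (k0 x) (Num.sqrt _) => a b c.
have [->|bn] := eqVneq b 0; first by rewrite !(mulr0, mul0r, invr0).
have [->|cn] := eqVneq c 0; first by rewrite !(mulr0, mul0r, invr0).
by field; rewrite kn bn cn.
Qed.

Lemma in_base_near x : in_base x -> \forall y \near x, in_base y.
Proof.
move=> h; have s1 : smv (fun x : 'rV[R]_(n + n) => row_mx (lsubmx x) 0 : 'rV[R]_(n + 1)) x.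
  by apply: smv_row_mx; [exact: smv_lsubmx|move=> j; exact: sm_cst].
exact: (near_cont_comp (P := fun v : 'rV[R]_(n + 1) => `|v - row_mx u0 0| < r) (smv_cont s1) (near_dist_lt h)).
Qed.

(** [k1] contains a derivative of C, so the homogeneity of [N1] is known over the ball around u0
    only and is differentiated as an identity of germs. *)
Lemma pd_N1_scale k x l : in_base x -> 0 < k0 x -> 0 < k ->
  mul_p2 k 0 l * pd l N1 (dscale (mul_p2 k) x) = k ^- 3 * pd l N1 x.
Proof.
move=> h kp k_0.
have s2 : sm N1 (dscale (mul_p2 k) x).
  by apply: sm_N1; [exact/in_base_scale|rewrite k0_scale mulr_gt0 // exprn_gt0].
have := @sm_comp_derive R _ _ N1 (dscale (mul_p2 k)) x (delta_mx 0 l)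
  (\row_i (mul_p2 k 0 i * (delta_mx 0 l : 'rV[R]_(n + n)) 0 i)) s2.
feed.
  move=> i; apply: (is_derive_ext _ _ (isdZ (mul_p2 k 0 i) (derive_lin_coord x (delta_mx 0 l) i))).
    by move=> u; rewrite [RHS]mxE.
  by rewrite [RHS]mxE.
move=> h1; have h2 := isdZ (k ^- 3) (sm_derive l (sm_N1 h kp)).
have h3 : is_derive x (delta_mx 0 l : 'rV[R]_(n + n)) (fun u => N1 (dscale (mul_p2 k) u)) (k ^- 3 * pd l N1 x).
  by apply: is_derive_near h2; apply: near_imp (in_base_near h) => u hu; rewrite N1_scale.
have e1 := pd_is_derive h1; have e3 := pd_is_derive h3.
apply: etrans (etrans (esym e1) e3); apply: esym.
apply: etrans (sum_delta l (fun i => mul_p2 k 0 i * pd i N1 (dscale (mul_p2 k) x))).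
by apply: eq_bigr => i _; rewrite [(\row_j _) 0 i]mxE delta_coord; ring.
Qed.

Definition Nf x : R := N0 x + N1 x.

Lemma pd_Nf x l : in_base x -> 0 < k0 x -> pd l Nf x = pd l N0 x + pd l N1 x.
Proof.
move=> h kp; exact: (pd_is_derive (isdD (sm_derive l (sm_N0 h kp)) (sm_derive l (sm_N1 h kp)))).
Qed.

(* With p = k P and time unchanged, the Hamilton equations of N become
   x' = d (F0 + d F1) for x = (u, P) and d = k^-2. *)
Lemma N_curve (k : R) (Z : R -> 'rV[R]_(n + n)) (t : R) : 0 < k -> in_base (Z t) -> 0 < k0 (Z t) ->
  (forall i, is_derive t (1 : R) (fun s : R => Z s 0 i) (k ^- 2 * (sgrad N0 (Z t) 0 i + k ^- 2 * sgrad N1 (Z t) 0 i))) ->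
  forall i, is_derive t (1 : R) (fun s : R => dscale (mul_p2 k) (Z s) 0 i) (sgrad Nf (dscale (mul_p2 k) (Z t)) 0 i).
Proof.
move=> kp h hk hZ i; have kn : k != 0 by rewrite gt_eqF.
have hs : in_base (dscale (mul_p2 k) (Z t)) by exact/in_base_scale.
have hks : 0 < k0 (dscale (mul_p2 k) (Z t)) by rewrite k0_scale mulr_gt0 // exprn_gt0.
have c1 (a b : R) : k ^- 2 * (a + k ^- 2 * b) = k^-1 * (k^-1 * a) + k^-1 * (k ^- 3 * b) by field.
have c2 (a b : R) : k * (k ^- 2 * (- a + k ^- 2 * - b)) = - (k^-1 * a + k ^- 3 * b) by field.
apply: (is_derive_ext _ _ (isdZ (mul_p2 k 0 i) (hZ i))); first by move=> s; rewrite [RHS]mxE.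
rewrite /sgrad; case: (split_ordP i) => j ->.
  have -> : mul_p2 k 0 (lshift n j) = 1 by rewrite /mul_p2 row_mxEl mxE.
  have m2 : mul_p2 k 0 (rshift n j) = k by rewrite /mul_p2 row_mxEr mxE.
  have h0 := pd_N0_scale (rshift n j) h hk kp; have h1 := pd_N1_scale (rshift n j) h hk kp.
  rewrite m2 in h0 h1; rewrite mul1r !row_mxEl [in LHS]mxE [in X in _ * (_ + _ * X)]mxE [RHS]mxE.
  apply: (etrans (c1 _ _)); rewrite -h0 -h1 (mulKf kn) (mulKf kn); apply: esym; exact: (pd_Nf _ hs hks).
have m1 : mul_p2 k 0 (lshift n j) = 1 by rewrite /mul_p2 row_mxEl mxE.
have -> : mul_p2 k 0 (rshift n j) = k by rewrite /mul_p2 row_mxEr mxE.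
have h0 := pd_N0_scale (lshift n j) h hk kp; have h1 := pd_N1_scale (lshift n j) h hk kp.
rewrite m1 !mul1r in h0 h1; rewrite !row_mxEr [in LHS]mxE [in X in _ * (_ * (_ + _ * X))]mxE [RHS]mxE.
apply: (etrans (c2 _ _)); rewrite -h0 -h1; congr (- _); exact: esym (pd_Nf _ hs hks).
Qed.

End AveragedField.

(** * Dual quadratic forms *)

Section InverseForms.
Context {R : realType}.

(** The inverse matrix transforms by the inverse Jacobian on both sides, which cancels the factors
    J^T acting on the covector. *)
Lemma inv_form_change n (Sc Sd J J' : 'M[R]_n) (P : 'rV[R]_n) : Sd \in unitmx ->
  J *m J' = 1%:M -> J' *m J = 1%:M -> Sc = J *m Sd *m J^T ->
  P *m J^T *m invmx Sc *m (P *m J^T)^T = P *m invmx Sd *m P^T.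
Proof.
move=> Su JJ' J'J ->.
have JT : J'^T *m J^T = 1%:M by rewrite -trmx_mul JJ' trmx1.
have JT' : J^T *m J'^T = 1%:M by rewrite -trmx_mul J'J trmx1.
have inv : (J *m Sd *m J^T) *m (J'^T *m invmx Sd *m J') = 1%:M.
  by rewrite !mulmxA -(mulmxA _ J^T) JT' mulmx1 mulmxK.
have -> : invmx (J *m Sd *m J^T) = J'^T *m invmx Sd *m J'.
  have [u1 _] := mulmx1_unit inv.
  by rewrite -[RHS](mulKmx u1) inv mulmx1.
rewrite trmx_mul trmxK !mulmxA -(mulmxA P) JT' mulmx1.
by rewrite -(mulmxA _ J') J'J mulmx1.
Qed.

Lemma sym_posdef_inv n (S : 'M[R]_n) (p : 'rV[R]_n) : sym_posdef S -> p != 0 ->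
  0 < (p *m invmx S *m p^T) 0 0.
Proof.
move=> hS p0; have Su := sym_posdef_unit hS; have [Ss Sp] := hS.
have -> : p *m invmx S *m p^T = (p *m invmx S) *m S *m (p *m invmx S)^T.
  by rewrite trmx_mul trmx_inv Ss mulmxKV // mulmxA.
apply: Sp; apply/eqP => h; move/eqP: p0; apply.
by rewrite -(mulmxKV Su p) h mul0mx.
Qed.

(* Cauchy-Schwarz for the pairing of S with its inverse. *)
Lemma coord_sqr_le n (S : 'M[R]_n) (p : 'rV[R]_n) i : sym_posdef S ->
  p 0 i ^+ 2 <= (p *m invmx S *m p^T) 0 0 * S i i.
Proof.
move=> hS; have Su := sym_posdef_unit hS; have [Ss Sp] := hS.
have [w wE] := exists_eq (p *m invmx S).
have pE : p = w *m S by rewrite wE mulmxKV.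
have qE : (p *m invmx S *m p^T) 0 0 = (w *m S *m w^T) 0 0 by rewrite -wE {1}pE trmx_mul Ss mulmxA.
pose v : 'rV[R]_n := delta_mx 0 i.
have v0 : v != 0.
  by apply/eqP => /rowP/(_ i); rewrite !mxE !eqxx => /eqP; rewrite oner_eq0.
have Sii : (v *m S *m v^T) 0 0 = S i i by rewrite -rowE trmx_delta -colE !mxE.
have Spos : 0 < S i i by rewrite -Sii; exact: Sp.
have pi : (w *m S *m v^T) 0 0 = p 0 i by rewrite -pE trmx_delta -colE mxE.
have ip : (v *m S *m w^T) 0 0 = p 0 i.
  by rewrite -pi -[v *m S *m w^T]trmxK mxE !trmx_mul trmxK Ss mulmxA.
pose t := p 0 i / S i i.
have ge0 : 0 <= ((w - t *: v) *m S *m (w - t *: v)^T) 0 0.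
  have [->|h] := eqVneq (w - t *: v) 0; first by rewrite !mul0mx mxE.
  exact: ltW (Sp _ h).
have ex : ((w - t *: v) *m S *m (w - t *: v)^T) 0 0
    = (w *m S *m w^T) 0 0 - t * p 0 i - t * p 0 i + t * t * S i i.
  have -> : (w - t *: v)^T = w^T - t *: v^T by apply/matrixP => k l; rewrite !mxE.
  rewrite !mulmxBl !mulmxBr -!scalemxAl -!scalemxAr.
  move: pi ip Sii; move: (w *m S *m v^T) (v *m S *m w^T) (v *m S *m v^T) (w *m S *m w^T) => M1 M2 M3 M4 h1 h2 h3.
  by rewrite !mxE h1 h2 h3; ring.
rewrite qE -subr_ge0; rewrite ex /t in ge0.
have -> : (w *m S *m w^T) 0 0 * S i i - p 0 i ^+ 2 = S i i *
   ((w *m S *m w^T) 0 0 - p 0 i / S i i * p 0 i - p 0 i / S i i * p 0 i + p 0 i / S i i * (p 0 i / S i i) * S i i).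
  by have Sn := lt0r_neq0 Spos; field.
by rewrite mulr_ge0 // ltW.
Qed.

Lemma quad_le n (D : 'M[R]_n) (p : 'rV[R]_n) (b : R) : (forall i j, `|D i j| <= b) ->
  `|(p *m D *m p^T) 0 0| <= n%:R * (n%:R * b) * `|p| ^+ 2.
Proof.
move=> hD; rewrite mxE; apply: le_trans (ler_norm_sum _ _ _) _.
apply: (@le_trans _ _ (\sum_(i < n) n%:R * b * `|p| ^+ 2)).
  apply: ler_sum => j _; rewrite normrM mxE [p^T _ _]mxE expr2 mulrA.
  apply: ler_pM => //; last exact: coord_le_norm.
  apply: le_trans (ler_norm_sum _ _ _) _.
  apply: (@le_trans _ _ (\sum_(i < n) b * `|p|)); last by rewrite sumr_const card_ord -mulrA mulr_natl.
  by apply: ler_sum => i _; rewrite normrM mulrC; apply: ler_pM => //; exact: coord_le_norm.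
have -> : n%:R * (n%:R * b) * `|p| ^+ 2 = (n%:R * b * `|p| ^+ 2) *+ n.
  by rewrite -(mulrA n%:R (n%:R * b)) mulr_natl.
by rewrite sumr_const card_ord.
Qed.

End InverseForms.

(** * Chart independence of K_0, K_1, N and the norm *)

Section Invariance.
Context {R : realType} {n : nat} {M : topologicalType}.
Variables (A : set (chart R M n.+1)) (hA : amb A).
Variables (g : chart R M n.+1 -> M -> 'M[R]_n.+1) (hg : riemannian_metric A g).
Variables (phi : M -> R) (hphi : smooth_map A setT (line_atlas R) phi).
Variable hdphi : dphi_nonzero A phi.
Variables (W : set M) (eps0 : R) (q : M -> M) (X : M * R -> M)
  (B : chart R M n -> 'rV[R]_n -> R -> 'M[R]_n).
Variable hB : semigeodesic A g phi W eps0 q X B.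
Local Notation GA := (Gamma_atlas A phi).
Implicit Types (c d : chart R M n).

Lemma Gamma_good : good_atlas GA.
Proof. exact: (sub_good hA). Qed.

Lemma X_interior c a u s : GA c -> A a -> chart_dom c (chart_from c u) -> chart_to c (chart_from c u) = u ->
  0 < s < eps0 -> chart_dom a (X (chart_from c u, s)) ->
  let f (w : 'rV[R]_(n + 1)) := X (chart_from c (lsubmx w), rsubmx w 0 0) in
  {for row_mx u (const_mx s), continuous f} /\ smv (fun w => chart_to a (f w)) (row_mx u (const_mx s)).
Proof.
move=> Gc Aa cu uE /andP[s0 s1] ax f; have hs : 0 <= s <= eps0 by rewrite !ltW.
have [F [sF nF]] := X_expr hA hB Gc Aa cu uE hs ax.
have [w wE] := exists_eq (row_mx u (const_mx s : 'rV[R]_1)); rewrite -wE in sF nF *.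
have rw : rsubmx w 0 0 = s by rewrite wE row_mxKr mxE.
have lw : lsubmx w = u by rewrite wE row_mxKl.
have n1 : \forall w' \near w, 0 < rsubmx w' 0 0 /\ rsubmx w' 0 0 < eps0.
  have cr : {for w, continuous (fun w' : 'rV[R]_(n + 1) => rsubmx w' 0 0)}.
    by apply: continuous_coord; exact: smv_cont (smv_rsubmx _).
  apply: (near_cont_comp (P := fun z : R => 0 < z /\ z < eps0) cr); rewrite rw.
  by apply: near_and; [exact: lt_nbhsr|exact: lt_nbhsl].
have n2 : \forall w' \near w, chart_dom a (f w') /\ chart_to a (f w') = F w'.
  by apply: near_imp (near_and nF n1) => w' [h1 [h2 h3]]; apply: h1; rewrite !ltW.
split; last by apply: smv_ext sF; apply: near_imp n2 => w' [_ ->].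
apply: (near_cont (f := fun w' => chart_from a (F w'))).
  by apply: near_imp n2 => w' [h1 <-]; rewrite (am_inv hA).
apply: (@continuous_comp _ _ _ F (chart_from a)); first exact: smv_cont.
have [h1 <-] := nbhs_singleton n2; exact: (am_from hA).
Qed.

(** Both matrices come from one metric at the point X(y, s). The change of coordinates is the
    transition map on Gamma times the identity in s, so its Jacobian is block diagonal and the upper
    left blocks give the law for B. *)
Lemma B_change_pos c d y s : GA c -> GA d -> chart_dom c y -> chart_dom d y -> 0 < s < eps0 ->
  B c (chart_to c y) s = tjac c d y *m B d (chart_to d y) s *m (tjac c d y)^T.
Proof.
move=> Gc Gd cy dy hs; have invc := sub_inv Gc cy; have invd := sub_inv Gd dy.
have [a Aa ax] := am_cover hA (X (y, s)).
have [w wE] := exists_eq (row_mx (chart_to c y) (const_mx s : 'rV[R]_1)).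
have [w' w'E] := exists_eq (row_mx (chart_to d y) (const_mx s : 'rV[R]_1)).
pose f e (w : 'rV[R]_(n + 1)) := X (chart_from e (lsubmx w), rsubmx w 0 0).
have fc : f c w = X (y, s) by rewrite /f wE row_mxKl row_mxKr mxE invc.
have fd : f d w' = X (y, s) by rewrite /f w'E row_mxKl row_mxKr mxE invd.
have [|||c1 c2] := X_interior Gc Aa _ _ hs (u := chart_to c y); rewrite ?invc //.
have [|||d1 d2] := X_interior Gd Aa _ _ hs (u := chart_to d y); rewrite ?invd //.
rewrite -wE in c1 c2; rewrite -w'E in d1 d2.
have pc := semigeodesic_metric hB Gc (ex_intro2 _ _ y cy erefl) hs.
have pd' := semigeodesic_metric hB Gd (ex_intro2 _ _ y dy erefl) hs.
rewrite -wE in pc; rewrite -w'E in pd'.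
have ac : chart_dom a (f c w) by rewrite fc.
have ad : chart_dom a (f d w') by rewrite fd.
rewrite (pullback_metricE hA (metric_change_jacobi hg phi) Aa ac c1 c2) in pc.
rewrite (pullback_metricE hA (metric_change_jacobi hg phi) Aa ad d1 d2) in pd'.
pose tr (w : 'rV[R]_(n + 1)) : 'rV[R]_(n + 1) := row_mx (trans c d (lsubmx w)) (rsubmx w).
have st : smv (trans c d) (chart_to c y) := trans_smv Gamma_good Gc Gd cy dy.
have str : smv tr w.
  apply: (smv_row_mx (f := fun w => trans c d (lsubmx w))); last exact: smv_rsubmx.
  by apply: (smv_comp (f := trans c d)); [exact: smv_lsubmx|rewrite wE row_mxKl].
have trE : tr w = w' by rewrite /tr wE row_mxKl row_mxKr (trans_at Gamma_good d Gc cy) -w'E.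
have jt : jac tr w = block_mx (tjac c d y) 0 0 1%:M.
  apply/matrixP => i j; rewrite (jac_pd _ _ str).
  have sl : smv (fun v : 'rV[R]_(n + 1) => lsubmx v) w := smv_lsubmx w.
  case: (split_ordP j) => j' ->.
    rewrite (pd_near (g := fun v => trans c d (lsubmx v) 0 j')); last by apply: near_all => v; rewrite row_mxEl.
    have s1 : sm (fun v => trans c d v 0 j') (lsubmx w) by rewrite wE row_mxKl.
    have := @sm_comp_derive R _ _ (fun v => trans c d v 0 j') (fun v : 'rV[R]_(n + 1) => lsubmx v) w (delta_mx 0 i)
      (lsubmx (delta_mx 0 i : 'rV[R]_(n + 1))) s1.
    feed.
      move=> l; rewrite [X in is_derive _ _ _ X]mxE; apply: (is_derive_ext _ erefl (derive_lin_coord w (delta_mx 0 i) (lshift 1 l))).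
      by move=> v; rewrite mxE.
    move=> hd; apply: (etrans (pd_is_derive hd)).
    have -> : lsubmx w = chart_to c y by rewrite wE row_mxKl.
    case: (split_ordP i) => i' ->.
      rewrite block_mxEul /tjac (tjE _ _ st).
      apply: etrans (sum_delta i' (fun l => pd l (fun v => trans c d v 0 j') (chart_to c y))).
      by apply: eq_bigr => l _; rewrite mxE delta_coord eq_lshift.
    rewrite block_mxEdl mxE; apply: big1 => l _.
    by rewrite mxE delta_coord eq_lrshift mul0r.
  rewrite (pd_near (g := fun v : 'rV[R]_(n + 1) => v 0 (rshift n j'))); last by apply: near_all => v; rewrite row_mxEr mxE.
  apply: (etrans (pd_is_derive (derive_lin_coord w (delta_mx 0 i) (rshift n j')))).
  rewrite delta_coord (ord1 j'); case: (split_ordP i) => i' ->.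
    by rewrite block_mxEur mxE eq_rlshift.
  by rewrite block_mxEdr (ord1 i') mxE !eqxx.
have nf : \forall v \near w, f d (tr v) = f c v.
  have n1 : \forall v \near w, [/\ chart_dom c (chart_from c (lsubmx v)), chart_to c (chart_from c (lsubmx v)) = lsubmx v
      & chart_dom d (chart_from c (lsubmx v))].
    apply: (near_cont_comp (P := fun u => [/\ chart_dom c (chart_from c u), chart_to c (chart_from c u) = u
      & chart_dom d (chart_from c u)]) (smv_cont (smv_lsubmx w))).
    by rewrite wE row_mxKl; exact: (trans_dom Gamma_good).
  by apply: near_imp n1 => v [_ _ h]; rewrite /f /tr row_mxKl row_mxKr /trans (sub_inv Gd h).
have jc : jac (fun v => chart_to a (f c v)) w = jac tr w *m jac (fun v => chart_to a (f d v)) w'.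
  have d2' : smv (fun v => chart_to a (f d v)) (tr w) by rewrite trE.
  have := jac_chain str d2'; rewrite trE => <-; apply: esym; apply: jac_eqnear.
    by apply: near_imp nf => v ->.
  exact: (smv_comp str d2').
rewrite -/(f c) jc -/(f c w) fc -fd in pc.
rewrite trmx_mul -!mulmxA (mulmxA (jac _ w')) (mulmxA _ _ (jac tr w)^T) pd' in pc.
move: pc; rewrite -scalemxAl -scalemxAr => /(scalerI (a := s^-1)) pc.
have sn : s^-1 != 0 by rewrite invr_eq0 gt_eqF //; case/andP: hs.
have := pc sn; rewrite jt tr_block_mx !mulmx_block !trmx0 !(mul0mx, mulmx0, addr0, add0r).
by move=> /eq_block_mx[<- _ _ _]; rewrite mulmxA.
Qed.

Lemma B_right_cont c y : GA c -> chart_dom c y ->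
  exists2 Bt : R -> 'M[R]_n, (forall i j, {for (0 : R), continuous (fun s => Bt s i j)}) &
    \forall s \near (0 : R), 0 <= s -> B c (chart_to c y) s = Bt s.
Proof.
move=> Gc cy; have [|Bt [sB nB]] := B_ext hB Gc (u := chart_to c y); first by exists y.
have cw : {for (0 : R), continuous (fun s : R => row_mx (chart_to c y) (const_mx s) : 'rV[R]_(n + 1))}.
  apply: cont_row_mx; first exact: cst_continuous.
  apply: continuous_row => i; rewrite (_ : (fun s => _) = id); first exact: id.
  by apply/funext => s; rewrite mxE.
have c0 : const_mx 0 = 0 :> 'rV[R]_1 by apply/rowP => i; rewrite !mxE.
exists (fun s => Bt (row_mx (chart_to c y) (const_mx s))).
  move=> i j; apply: (@continuous_comp _ _ _ (fun s : R => row_mx (chart_to c y) (const_mx s) : 'rV[R]_(n + 1)) (fun w => Bt w i j)) => //.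
  by rewrite c0; exact: sm_cont (sB i j).
rewrite -c0 in nB.
have n1 : \forall s \near (0 : R), s < eps0 by exact: lt_nbhsl (semigeodesic_eps0 hB).
apply: near_imp (near_and (near_cont_comp cw nB) n1) => s [h1 h2] s0.
by move: h1; rewrite row_mxKl row_mxKr mxE => <- //; split; [exists y|rewrite s0 ltW].
Qed.

(** The metric identity is available for s > 0 only; s = 0 is reached by right continuity of B in
    both charts. *)
Lemma B_change c d y s : GA c -> GA d -> chart_dom c y -> chart_dom d y -> 0 <= s < eps0 ->
  B c (chart_to c y) s = tjac c d y *m B d (chart_to d y) s *m (tjac c d y)^T.
Proof.
move=> Gc Gd cy dy /andP[]; rewrite le_eqVlt => /orP[/eqP <-|s0] se; last by apply: B_change_pos => //; rewrite s0.
have [Bc cc nc] := B_right_cont Gc cy; have [Bd cd nd] := B_right_cont Gd dy.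
have e00 := semigeodesic_eps0 hB.
have [T TE] := exists_eq (tjac c d y); rewrite -TE.
apply/matrixP => i j.
rewrite (nbhs_singleton nc (lexx 0)) (nbhs_singleton nd (lexx 0)).
have cr : {for (0 : R), continuous (fun s : R => (T *m Bd s *m T^T) i j)}.
  rewrite (_ : (fun s : R => _) = fun s => \sum_k (\sum_l T i l * Bd s l k) * T j k).
    apply: continuous_sumf => k; apply: continuousM; last exact: cst_continuous.
    by apply: continuous_sumf => l; apply: continuousM; [exact: cst_continuous|exact: cd].
  by apply/funext => s'; rewrite mxE; apply: eq_bigr => k _; rewrite mxE trE.
have /near_normP[r1 r10 hr1] := near_and nc nd.
apply: (hausdorff_cont_eq (f := fun s : R => Bc s i j) (g := fun s : R => (T *m Bd s *m T^T) i j) (@norm_hausdorff R _) (cc i j) cr).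
move=> k k0; pose t : R := Num.min (Num.min r1 k) eps0 / 2.
have m0 : 0 < Num.min (Num.min r1 k) eps0 by rewrite !lt_min r10 k0.
have t0 : 0 < t by rewrite divr_gt0.
have [tr tk te] : [/\ t < r1, t < k & t < eps0].
  have : t < Num.min (Num.min r1 k) eps0 by rewrite /t; lra.
  by rewrite !lt_min => /andP[/andP[]].
exists t; first by rewrite subr0 gtr0_norm.
have [|h1 h2] := hr1 t; first by rewrite subr0 gtr0_norm.
have ht : 0 < t < eps0 by rewrite t0.
by rewrite -(h1 (ltW t0)) -(h2 (ltW t0)) (B_change_pos Gc Gd cy dy ht) TE.
Qed.

Definition Cq c (u : 'rV[R]_n) (s : R) (p : 'rV[R]_n) : R := (p *m C_mx B c u s *m p^T) 0 0.

Lemma Cq_change c d y s P : GA c -> GA d -> chart_dom c y -> chart_dom d y -> 0 <= s < eps0 ->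
  Cq c (chart_to c y) s (P *m (tjac c d y)^T) = Cq d (chart_to d y) s P.
Proof.
move=> Gc Gd cy dy hs; rewrite /Cq /C_mx.
rewrite (inv_form_change P _ (tjac_inv Gamma_good Gc Gd cy dy) (tjac_inv Gamma_good Gd Gc dy cy) (B_change Gc Gd cy dy hs)) //.
apply/sym_posdef_unit/(semigeodesic_B_posdef hB Gd); first by exists y.
by case/andP: hs => -> /ltW.
Qed.

Lemma K0_invariant c y : GA c -> chart_dom c y -> fiber_invariant GA (K0 B) c y.
Proof.
move=> Gc cy d Gd dy P; apply: (Cq_change P Gc Gd cy dy).
by rewrite lexx (semigeodesic_eps0 hB).
Qed.

(** The right difference quotient, in terms of which K_1 is defined, has as limit the ordinary
    derivative of any differentiable extension to s < 0. *)
Lemma is_derive_right_lim (f h : R -> R) (df : R) : is_derive (0 : R) (1 : R) f df ->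
  (\forall s \near (0 : R), 0 <= s -> h s = f s) -> s^-1 * (h s - h 0) @[s --> 0^'+] --> df.
Proof.
move=> hf nh; apply/cvgrPdist_le => e e0.
have cv : s^-1 *: ((f \o shift 0) (s *: (1 : R)) - f 0) @[s --> (0 : R)^'] --> df.
  by have [h1 h2] := hf; rewrite -h2 /derive; exact: h1.
have /cvgrPdist_le/(_ e e0) := cv; rewrite !near_withinE => n1.
have h0 := nbhs_singleton nh (lexx 0).
apply: near_imp (near_and n1 nh) => s [h1 h2] s0.
have := h1 (lt0r_neq0 s0); rewrite /= addr0 /GRing.scale /= mulr1.
by rewrite (h2 (ltW s0)) h0.
Qed.

(** [dC_mx] is a [lim], meaningful only once the quotient is known to converge; convergence comes
    from inverting a smooth extension of B across s = 0. *)
Lemma C_right_derive c y : GA c -> chart_dom c y ->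
  exists D : 'M[R]_n, forall i j, s^-1 * (C_mx B c (chart_to c y) s i j - C_mx B c (chart_to c y) 0 i j) @[s --> 0^'+] --> D i j.
Proof.
move=> Gc cy; have [|Bt [sB nB]] := B_ext hB Gc (u := chart_to c y); first by exists y.
have c0 : const_mx 0 = 0 :> 'rV[R]_1 by apply/rowP => i; rewrite !mxE.
have e00 := semigeodesic_eps0 hB.
have B0 : Bt (row_mx (chart_to c y) 0) \in unitmx.
  rewrite -(nbhs_singleton nB); last by rewrite row_mxKl row_mxKr mxE lexx ltW //; split => //; exists y.
  rewrite row_mxKl row_mxKr mxE; apply/sym_posdef_unit/(semigeodesic_B_posdef hB Gc); first by exists y.
  by rewrite lexx ltW.
have sC := smm_inv B0 sB.
exists (\matrix_(i, j) pd (rshift n 0) (fun w => invmx (Bt w) i j) (row_mx (chart_to c y) 0)) => i j.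
rewrite [X in _ --> X]mxE.
pose f (s : R) := invmx (Bt (row_mx (chart_to c y) (const_mx s))) i j.
apply: (@is_derive_right_lim f (fun s => C_mx B c (chart_to c y) s i j)).
  have := @sm_comp_derive R _ R (fun w => invmx (Bt w) i j) (fun s : R => row_mx (chart_to c y) (const_mx s) : 'rV[R]_(n + 1)) 0 1 (delta_mx 0 (rshift n 0)).
  rewrite c0; feed; first exact: sC.
  feed.
    move=> l; rewrite delta_coord; case: (split_ordP l) => l' ->.
      rewrite eq_lrshift; apply: (is_derive_ext _ erefl (isd_cst (chart_to c y 0 l') (0 : R) 1)) => s.
      by rewrite row_mxEl.
    rewrite (ord1 l') eqxx; apply: (is_derive_ext _ erefl (isd_id 0)) => s.
    by rewrite row_mxEr mxE.
  move=> hd; apply: (is_derive_eq hd).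
  apply: etrans (sum_delta (rshift n 0) (fun l => pd l (fun w => invmx (Bt w) i j) (row_mx (chart_to c y) 0))).
  by apply: eq_bigr => l _; rewrite delta_coord.
have cw : {for (0 : R), continuous (fun s : R => row_mx (chart_to c y) (const_mx s) : 'rV[R]_(n + 1))}.
  apply: cont_row_mx; first exact: cst_continuous.
  apply: continuous_row => l; rewrite (_ : (fun s => _) = id); first exact: id.
  by apply/funext => s; rewrite mxE.
rewrite -c0 in nB.
have n1 : \forall s \near (0 : R), s < eps0 by exact: lt_nbhsl.
apply: near_imp (near_and (near_cont_comp cw nB) n1) => s [h1 h2] s0.
move: h1; rewrite row_mxKl row_mxKr mxE /C_mx /f => -> //.
by split; [exists y|rewrite s0 ltW].
Qed.

Lemma quadE (p : 'rV[R]_n) (D : 'M[R]_n) : (p *m D *m p^T) 0 0 = \sum_j (\sum_i p 0 i * D i j) * p 0 j.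
Proof. by rewrite row_mul_trE; apply: eq_bigr => j _; rewrite mxE. Qed.

Lemma cvg_sumf (F : set_system R) (FF : Filter F) k (f : 'I_k -> R -> R) (l : 'I_k -> R) :
  (forall i, f i s @[s --> F] --> l i) -> \sum_i f i s @[s --> F] --> \sum_i l i.
Proof.
elim: k f l => [|k IH] f l h.
  rewrite (_ : (fun s => _) = fun=> 0); last by apply/funext => s; rewrite big_ord0.
  by rewrite big_ord0; exact: cvg_cst.
rewrite (_ : (fun s => _) = fun s => f ord0 s + \sum_i f (lift ord0 i) s); last first.
  by apply/funext => s; rewrite big_ord_recl.
by rewrite big_ord_recl; apply: cvgD; [exact: h|apply: IH => i; exact: h].
Qed.

Lemma K1_right_lim c y p : GA c -> chart_dom c y ->
  s^-1 * (Cq c (chart_to c y) s p - Cq c (chart_to c y) 0 p) @[s --> 0^'+] --> K1 B c (chart_to c y) p.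
Proof.
move=> Gc cy; have [D hD] := C_right_derive Gc cy.
have DE i j : dC_mx B c (chart_to c y) i j = D i j.
  by rewrite mxE; apply: cvg_lim => //; exact: hD.
have -> : K1 B c (chart_to c y) p = \sum_j (\sum_i p 0 i * D i j) * p 0 j.
  by rewrite /K1 quadE; apply: eq_bigr => j _; congr (_ * _); apply: eq_bigr => i _; rewrite DE.
have -> : (fun s : R => s^-1 * (Cq c (chart_to c y) s p - Cq c (chart_to c y) 0 p))
   = fun s : R => \sum_j (\sum_i p 0 i * (s^-1 * (C_mx B c (chart_to c y) s i j - C_mx B c (chart_to c y) 0 i j))) * p 0 j.
  apply/funext => s; rewrite /Cq !quadE -sumrB mulr_sumr; apply: eq_bigr => j _.
  rewrite -mulrBl -sumrB mulrA mulr_sumr; congr (_ * _); apply: eq_bigr => i _.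
  by rewrite -mulrBr mulrCA.
apply: cvg_sumf => j; apply: cvgM; last exact: cvg_cst.
by apply: cvg_sumf => i; apply: cvgM; [exact: cvg_cst|exact: hD].
Qed.

(** The form [Cq] is invariant for every small s >= 0 under a transformation of P that does not
    depend on s; so are its difference quotients and their limit. *)
Lemma K1_invariant c y : GA c -> chart_dom c y -> fiber_invariant GA (K1 B) c y.
Proof.
move=> Gc cy d Gd dy P.
have l1 := @K1_right_lim c y (P *m (tjac c d y)^T) Gc cy; have l2 := @K1_right_lim d y P Gd dy.
have e00 := semigeodesic_eps0 hB.
have l3 : s^-1 * (Cq c (chart_to c y) s (P *m (tjac c d y)^T) - Cq c (chart_to c y) 0 (P *m (tjac c d y)^T)) @[s --> 0^'+] --> K1 B d (chart_to d y) P.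
  apply: cvg_trans l2; apply: near_eq_cvg; rewrite near_withinE.
  have n1 : \forall s \near (0 : R), s < eps0 by exact: lt_nbhsl.
  apply: near_imp n1 => s se s0.
  by rewrite !(Cq_change P Gc Gd cy dy) // ?lexx // ltW.
exact: (cvg_unique (@norm_hausdorff R _) l1 l3).
Qed.

Lemma N_invariant c y : GA c -> chart_dom c y -> fiber_invariant GA (N_ham B) c y.
Proof.
move=> Gc cy d Gd dy P; rewrite /N_ham.
by rewrite (K0_invariant Gc cy Gd dy) (K1_invariant Gc cy Gd dy).
Qed.

(** The chart of Gamma extends to a smooth map E of ambient coordinates, so J has a right inverse;
    hence v J != 0 for v != 0 and positivity is inherited from g. *)
Lemma induced_metric c a y : GA c -> chart_dom c y -> A a -> chart_dom a y ->
  let J := jac (fun u => chart_to a (chart_from c u)) (chart_to c y) in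
  pullback_metric A g (chart_from c) (chart_to c y) = J *m g a y *m J^T /\ sym_posdef (J *m g a y *m J^T).
Proof.
move=> Gc cy Aa ay J; have inv := sub_inv Gc cy.
have sJ := sub_from hA Gc cy Aa ay.
have ay' : chart_dom a (chart_from c (chart_to c y)) by rewrite inv.
split.
  by rewrite (pullback_metricE hA (metric_change_g hg) Aa ay' (sub_from_cont Gc cy) sJ) inv.
have [hp _ _] := hg; have [gs gp] := hp a y Aa ay.
have [E [sE nE]] := sub_to hA Gc cy Aa ay.
have JE : J *m jac E (chart_to a y) = 1%:M.
  have sE' : smv E (chart_to a (chart_from c (chart_to c y))) by rewrite inv.
  have := jac_chain sJ sE'; rewrite inv => <-; rewrite -(jac_idE (chart_to c y)).
  apply: esym; apply: jac_eqnear; last exact: smv_id.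
  have n1 : \forall u \near chart_to c y, chart_dom c (chart_from c u) -> chart_to c (chart_from c u) = E (chart_to a (chart_from c u)).
    apply: (near_cont_comp (P := fun z => chart_dom c z -> chart_to c z = E (chart_to a z)) (sub_from_cont Gc cy)).
    by rewrite inv.
  by apply: near_imp (near_and n1 (sub_img Gc cy)) => u [h1 [h2 h3]]; rewrite -h1 // h3.
split; first by rewrite !trmx_mul trmxK gs mulmxA.
move=> v v0; have -> : v *m (J *m g a y *m J^T) *m v^T = (v *m J) *m g a y *m (v *m J)^T.
  by rewrite trmx_mul !mulmxA.
apply: gp; apply/eqP => h; move/eqP: v0; apply.
by rewrite -[v]mulmx1 -JE mulmxA h mul0mx.
Qed.

Lemma dual_norm_invariant c y : GA c -> chart_dom c y -> fiber_invariant GA (dual_norm A g) c y.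
Proof.
move=> Gc cy d Gd dy P; rewrite /dual_norm.
have [a Aa ay] := am_cover hA y.
have [e1 _] := induced_metric Gc cy Aa ay; have [e2 p2] := induced_metric Gd dy Aa ay.
rewrite e1 e2; set Jc := jac _ _; set Jd := jac _ _ in p2 *.
have JE : Jc = tjac c d y *m Jd.
  have st := trans_smv Gamma_good Gc Gd cy dy; have tE := trans_at Gamma_good d Gc cy.
  have sd : smv (fun u => chart_to a (chart_from d u)) (trans c d (chart_to c y)).
    by rewrite tE; exact: (sub_from hA Gd dy Aa ay).
  have := jac_chain st sd; rewrite tE => <-.
  apply: jac_eqnear; last exact: (sub_from hA Gc cy Aa ay).
  by apply: near_imp (trans_dom Gamma_good Gc Gd cy dy) => u [_ _ h]; rewrite /trans (sub_inv Gd h).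
have SE : Jc *m g a y *m Jc^T = tjac c d y *m (Jd *m g a y *m Jd^T) *m (tjac c d y)^T.
  by rewrite JE trmx_mul !mulmxA.
have h := inv_form_change P (sym_posdef_unit p2) (tjac_inv Gamma_good Gc Gd cy dy) (tjac_inv Gamma_good Gd Gc dy cy) SE.
exact: (congr1 (fun S : 'M[R]_1 => Num.sqrt (S 0 0)) h).
Qed.

(** Near the point the entries of the Gram matrix S and of its inverse are bounded. The bound on the
    inverse gives the upper estimate; the bound on S gives the lower one, through p_i^2 <= S_ii
    times the dual square ([coord_sqr_le]). *)
Lemma dual_norm_bounds c y0 : GA c -> chart_dom c y0 ->
  exists a b : R, [/\ 0 < a, 0 < b &
    \forall u \near chart_to c y0, forall p, a * `|p| <= dual_norm A g c u p <= b * `|p|].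
Proof.
move=> Gc cy; have [a Aa ay] := am_cover hA y0; have inv := sub_inv Gc cy.
pose J u := jac (fun u => chart_to a (chart_from c u)) u.
pose S u := J u *m g a (chart_from c u) *m (J u)^T.
have sJ := sub_from hA Gc cy Aa ay.
have sgc : smm (fun u => g a (chart_from c u)) (chart_to c y0).
  apply: (smm_ext (f := fun u => g a (chart_from a (chart_to a (chart_from c u))))).
    have n1 : \forall u \near chart_to c y0, chart_dom a (chart_from c u).
      by apply: (near_cont_comp (sub_from_cont Gc cy)); rewrite inv; exact: (am_open hA).
    by apply: near_imp n1 => u h; rewrite (am_inv hA).
  apply: (smm_comp (f := fun v => g a (chart_from a v)) sJ).
  by rewrite inv; exact: (smm_g hA hg Aa ay).
have sS : smm S (chart_to c y0).
  by apply: smm_mul; [apply: smm_mul => //; exact: smm_jac|exact/smm_tr/smm_jac].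
have [e0 p0] := induced_metric Gc cy Aa ay.
have S0 : S (chart_to c y0) \in unitmx by rewrite /S inv; exact: sym_posdef_unit.
have sD := smm_inv S0 sS.
have bnd (f : 'rV[R]_n -> 'M[R]_n) : smm f (chart_to c y0) ->
    exists2 b : R, 0 < b & \forall u \near chart_to c y0, forall i j, `|f u i j| <= b.
  move=> sf; exists (1 + \sum_i \sum_j `|f (chart_to c y0) i j|).
    by rewrite ltr_pwDl // sumr_ge0 // => i _; rewrite sumr_ge0.
  apply: near_forall => i; apply: near_forall => j.
  apply: near_imp (cont_near_dist (sm_cont (sf i j)) ltr01) => u h.
  rewrite -[f u i j](subrK (f (chart_to c y0) i j)); apply: le_trans (ler_normD _ _) _.
  apply: lerD => //; rewrite (bigD1 i) //= (bigD1 j) //= -addrA lerDl addr_ge0 //.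
    by rewrite sumr_ge0.
  by rewrite sumr_ge0 // => k _; rewrite sumr_ge0.
have [bS bS0 nS] := bnd _ sS; have [bD bD0 nD] := bnd _ sD.
have n1 : \forall u \near chart_to c y0, [/\ chart_dom c (chart_from c u), chart_to c (chart_from c u) = u & chart_dom a (chart_from c u)].
  have n2 : \forall u \near chart_to c y0, chart_dom a (chart_from c u).
    by apply: (near_cont_comp (sub_from_cont Gc cy)); rewrite inv; exact: (am_open hA).
  by apply: near_imp (near_and (sub_img Gc cy) n2) => u [[h1 h2] h3].
(* The added 1 keeps the upper constant positive also when n = 0. *)
exists (Num.sqrt bS)^-1, (Num.sqrt (n%:R * (n%:R * bD)) + 1); split.
- by rewrite invr_gt0 sqrtr_gt0.
- by rewrite ltr_pwDr // sqrtr_ge0.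
apply: near_imp (near_and n1 (near_and nS nD)) => u [[cu uE au] [hS hD]] p.
have [e1 p1] := induced_metric Gc cu Aa au; rewrite uE in e1 p1.
rewrite /dual_norm e1 -/(J u) -/(S u) in p1 *.
have q0 : 0 <= (p *m invmx (S u) *m p^T) 0 0.
  have [->|pn] := eqVneq p 0; first by rewrite !mul0mx mxE.
  exact: ltW (sym_posdef_inv p1 pn).
apply/andP; split.
  rewrite ler_pdivrMl ?sqrtr_gt0 // -sqrtrM; last exact: ltW.
  apply: norm_le_coord => [|i]; first exact: sqrtr_ge0.
  rewrite -sqrtr_sqr; apply: ler_wsqrtr; apply: le_trans (coord_sqr_le p i p1) _.
  by rewrite mulrC ler_wpM2r //; apply: le_trans (ler_norm _) (hS i i).
apply: (@le_trans _ _ (Num.sqrt (n%:R * (n%:R * bD)) * `|p|)).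
  rewrite -[X in _ * X]normr_id -sqrtr_sqr -sqrtrM; last by rewrite !mulr_ge0 // ltW.
  by apply: ler_wsqrtr; apply: le_trans (ler_norm _) (quad_le p hD).
by rewrite ler_wpM2r // lerDl.
Qed.

End Invariance.

(** * N in a normal chart *)

Section Links.
Context {R : realType} {n : nat} {M : topologicalType}.
Variables (A : set (chart R M n.+1)) (hA : amb A).
Variables (g : chart R M n.+1 -> M -> 'M[R]_n.+1) (hg : riemannian_metric A g).
Variables (phi : M -> R) (hphi : smooth_map A setT (line_atlas R) phi).
Variable hdphi : dphi_nonzero A phi.
Variables (W : set M) (eps0 : R) (q : M -> M) (X : M * R -> M)
  (B : chart R M n -> 'rV[R]_n -> R -> 'M[R]_n).
Variable hB : semigeodesic A g phi W eps0 q X B.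
Local Notation GA := (Gamma_atlas A phi).
Variables (c : chart R M n) (a : chart R M n.+1) (u0 : 'rV[R]_n) (Xt : 'rV[R]_(n + 1) -> 'rV[R]_n.+1)
  (h : 'rV[R]_(n + 1) -> R) (Ct : 'rV[R]_(n + 1) -> 'M[R]_n) (r : R).
Hypothesis hN : normal_chart A g phi eps0 X B c a u0 Xt h Ct r.

Lemma nc_pos : 0 < r. Proof. by have /andP[] := nc_r hN. Qed.

Lemma nc_smC w : `|w - row_mx u0 0| < r -> smm Ct w.
Proof. by move=> hw; have [] := nc_sm hN hw. Qed.

Lemma in_base_row u p : `|u - u0| < r -> in_base u0 r (row_mx u p).
Proof.
move=> hu; rewrite /in_base row_mxKl; apply: row_mx_near; [exact: nc_pos|exact: hu|].
by rewrite subrr normr0 nc_pos.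
Qed.

Lemma const_mx1_0 : const_mx 0 = 0 :> 'rV[R]_1.
Proof. by apply/rowP => i; rewrite !mxE. Qed.

Lemma K0_link u p : `|u - u0| < r -> K0 B c u p = k0 Ct (row_mx u p).
Proof.
move=> hu; have [|_ _ e] := nc_X hN hu (s := 0); first by rewrite lexx nc_pos.
by rewrite /K0 e const_mx1_0 /k0 KqE.
Qed.

Lemma k0_pos u p : `|u - u0| < r -> p != 0 -> 0 < k0 Ct (row_mx u p).
Proof.
move=> hu p0; rewrite -K0_link //; apply: sym_posdef_inv => //.
have [h1 h2] := nc_img hN hu.
apply: (semigeodesic_B_posdef hB (nc_c hN)); first by exists (chart_from c u).
by rewrite lexx ltW // (semigeodesic_eps0 hB).
Qed.

(** The one-sided derivative defining K_1 coincides with the two-sided eta-derivative of the form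
    built from the extension of C. *)
Lemma K1_link u p : `|u - u0| < r -> K1 B c u p = k1 Ct (row_mx u p).
Proof.
move=> hu; have [h1 h2] := nc_img hN hu.
have l1 := K1_right_lim hB (p := p) (nc_c hN) h1; rewrite h2 in l1.
apply: (cvg_unique (@norm_hausdorff R _) l1).
pose f (s : R) := Kq Ct (row_mx (row_mx u p) (const_mx s)).
apply: (@is_derive_right_lim R f (fun s => Cq B c u s p)).
  have := @sm_comp_derive R _ R (Kq Ct) (fun s : R => row_mx (row_mx u p) (const_mx s) : 'rV[R]_(n + n + 1)) 0 1
    (delta_mx 0 (ie (n := n))).
  rewrite const_mx1_0; feed.
    by apply: (sm_Kq nc_smC); apply: in_baseE; exact: in_base_row.
  feed.
    move=> l; rewrite delta_coord; case: (split_ordP l) => l' ->.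
      rewrite eq_lrshift; apply: (is_derive_ext _ erefl (isd_cst (row_mx u p 0 l') (0 : R) 1)) => s.
      by rewrite row_mxEl.
    rewrite (ord1 l') eqxx; apply: (is_derive_ext _ erefl (isd_id 0)) => s.
    by rewrite row_mxEr mxE.
  move=> hd; apply: (is_derive_eq hd).
  apply: etrans (sum_delta (ie (n := n)) (fun l => pd l (Kq Ct) (row_mx (row_mx u p) 0))).
  by apply: eq_bigr => l _; rewrite delta_coord.
have n1 : \forall s \near (0 : R), s < r by exact: lt_nbhsl nc_pos.
apply: near_imp n1 => s sr s0.
have [|_ _ e] := nc_X hN hu (s := s); first by rewrite s0.
by rewrite /Cq e /f KqE.
Qed.

Lemma N_link u p : `|u - u0| < r -> p != 0 -> N_ham B c u p = Nf Ct (row_mx u p).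
Proof.
move=> hu p0; have kp := k0_pos hu p0.
rewrite /N_ham K0_link // K1_link // /Nf /N0 /N1.
move: (k0 Ct _) (k1 Ct _) kp => K L kp.
have e1 : K `^ (1 / 2) = Num.sqrt K by rewrite div1r powR12_sqrt // ltW.
have e2 : K `^ (5 / 2) = K * K * Num.sqrt K.
  have -> : 5 / 2 = 2%:R + 1 / 2 :> R by field.
  rewrite powRD; last by apply/implyP => _; rewrite gt_eqF.
  by rewrite powR_mulrn ?ltW // e1 expr2.
by rewrite powRN e1 e2.
Qed.

Lemma near_open_u (u p : 'rV[R]_n) : `|u - u0| < r -> p != 0 ->
  \forall s \near (row_mx u p : 'rV[R]_(n + n)), `|lsubmx s - u0| < r /\ rsubmx s != 0.
Proof.
move=> hu p0; apply: near_and.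
  apply: (near_cont_comp (f := fun s : 'rV[R]_(n + n) => lsubmx s) (P := fun v => `|v - u0| < r) (smv_cont (smv_lsubmx _))).
  by rewrite row_mxKl; exact: near_dist_lt.
have pp : 0 < `|p| by rewrite normr_gt0.
apply: (near_cont_comp (f := fun s : 'rV[R]_(n + n) => rsubmx s) (P := fun v : 'rV[R]_n => v != 0) (smv_cont (smv_rsubmx _))).
rewrite row_mxKr; have hpp : `|p - p| < `|p| by rewrite subrr normr0.
apply: near_imp (near_dist_lt hpp) => v; apply: contraTneq => ->.
by rewrite sub0r normrN ltxx.
Qed.

Lemma N_joint_near u p : `|u - u0| < r -> p != 0 ->
  \forall s \near (row_mx u p : 'rV[R]_(n + n)), Nf Ct s = joint (N_ham B c) s.
Proof.
move=> hu p0; apply: near_imp (near_open_u hu p0) => s [h1 h2].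
by rewrite /joint N_link // hsubmxK.
Qed.

Lemma sm_Nf u p : `|u - u0| < r -> p != 0 -> sm (Nf Ct) (row_mx u p).
Proof.
move=> hu p0; have hb := in_base_row p hu; have kp := k0_pos hu p0.
by apply: sm_add; [exact: (sm_N0 nc_smC)|exact: (sm_N1 nc_smC)].
Qed.

Lemma sm_N_joint u p : `|u - u0| < r -> p != 0 -> sm (joint (N_ham B c)) (row_mx u p).
Proof. by move=> hu p0; apply: sm_ext (N_joint_near hu p0) (sm_Nf hu p0). Qed.

Lemma hfield_N u p : `|u - u0| < r -> p != 0 -> hfield (N_ham B) c (row_mx u p) = sgrad (Nf Ct) (row_mx u p).
Proof.
move=> hu p0.
have e l : pd l (joint (N_ham B c)) (row_mx u p) = pd l (Nf Ct) (row_mx u p).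
  by apply: pd_near; apply: near_imp (N_joint_near hu p0) => s ->.
by rewrite /hfield /sgrad; congr row_mx; apply/rowP => j; rewrite [LHS]mxE [RHS]mxE e.
Qed.

End Links.

(** * The two maps near a point of Gamma *)

Section LocalAveragedFlow.
Context {R : realType} {n : nat} {M : topologicalType}.
Variables (A : set (chart R M n.+1)) (hA : amb A) (hM : hausdorff_space M).
Variables (g : chart R M n.+1 -> M -> 'M[R]_n.+1) (hg : riemannian_metric A g).
Variables (phi : M -> R) (hphi : smooth_map A setT (line_atlas R) phi).
Variable hdphi : dphi_nonzero A phi.
Variables (W : set M) (eps0 : R) (q : M -> M) (X : M * R -> M)
  (B : chart R M n -> 'rV[R]_n -> R -> 'M[R]_n).
Variable hB : semigeodesic A g phi W eps0 q X B.
Local Notation GA := (Gamma_atlas A phi).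
Variables (c : chart R M n) (a : chart R M n.+1) (u0 : 'rV[R]_n) (Xt : 'rV[R]_(n + 1) -> 'rV[R]_n.+1)
  (h : 'rV[R]_(n + 1) -> R) (Ct : 'rV[R]_(n + 1) -> 'M[R]_n) (r : R).
Hypothesis hN : normal_chart A g phi eps0 X B c a u0 Xt h Ct r.

Lemma near_sphere (P0 : 'rV[R]_n) (u P : 'rV[R]_n) (e : R) : `|P0| = 1 -> 0 < e -> e <= 1 ->
  `|row_mx u P - row_mx u0 P0| < e -> `|u - u0| < e /\ P != 0.
Proof.
move=> n1 e0 e1 hx; have [h1 h2] := row_mx_nearE e0 hx; split => //.
by apply: contraTneq h2 => ->; rewrite sub0r normrN n1 -leNgt.
Qed.

Lemma covlift_dom u p : `|u - u0| < r ->
  [/\ chart_dom c (covlift GA c u p).1, chart_to c (covlift GA c u p).1 = u,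
      cotangent GA (covlift GA c u p) & (covlift GA c u p).2 c = p].
Proof.
move=> hu; have [h1 h2] := nc_img hN hu; have Gc := nc_c hN.
have gG : good_atlas GA by exact: (sub_good hA).
have e : covlift GA c u p = covlift GA c (chart_to c (chart_from c u)) p by rewrite h2.
split; [exact: h1|exact: h2| |].
  rewrite e; exact: (lift_cotangent gG).
apply: (etrans (congr1 (fun z => z.2 c) e)); apply: (etrans (lift_coord gG p Gc h1 Gc h1)).
by rewrite (tjac_id gG Gc h1) trmx1 mulmx1.
Qed.

(** With p = k P the flow of N becomes the system of [slow_flow] with d = k^-2 and time unchanged.
    The solution stays in the domain of the chart, the lower bound of the norm keeps it off the zero
    section, and every other curve with the same initial point coincides with it up to the time
    pi. *)
Lemma N_flow_local (P0 : 'rV[R]_n) (e al : R) : `|P0| = 1 -> 0 < e -> e <= r -> e <= 1 -> 0 < al ->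
  (forall u, `|u - u0| < e -> forall p, al * `|p| <= dual_norm A g c u p) ->
  exists r1 K d0 : R, [/\ 0 < r1, 0 <= K, 0 < d0 & forall u P (k : R),
    `|row_mx u P - row_mx u0 P0| < r1 -> 0 < k -> k ^- 2 < d0 ->
    exists x2 : 'rV[R]_(n + n), let z2 := covlift GA c (lsubmx x2) (k *: rsubmx x2) in
    [/\ `|lsubmx x2 - u0| < e, N_flow_pi A g phi B (covlift GA c u (k *: P)) z2,
        forall z', N_flow_pi A g phi B (covlift GA c u (k *: P)) z' -> z2 = z' &
        `|x2 - row_mx u P - (k ^- 2 * pi) *: sgrad (N0 Ct) (row_mx u P)| <= K * k ^- 2 ^+ 2]].
Proof.
move=> n1 e0 er e1 al0 hD; have Gc := nc_c hN; have sC := nc_smC hN.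
have gG : good_atlas GA by exact: (sub_good hA).
have [x0 x0E] := exists_eq (row_mx u0 P0).
have hx0 : `|x0 - row_mx u0 P0| < e by rewrite x0E subrr normr0.
have inx x : `|x - row_mx u0 P0| < e -> [/\ `|lsubmx x - u0| < e, rsubmx x != 0, in_base u0 r x & 0 < k0 Ct x].
  rewrite -{1}(hsubmxK x) => hx; have [h1 h2] := near_sphere n1 e0 e1 hx.
  have h3 := lt_le_trans h1 er; split => //.
    by rewrite -(hsubmxK x); exact: (in_base_row hN).
  by rewrite -(hsubmxK x); exact: (k0_pos hB hN).
have [_ _ b0 kp0] := inx x0 hx0.
have [r1 [K [d0 [r10 K0 d00 hZ]]]] := slow_flow e0 (smv_sgrad (sm_N0 sC b0 kp0)) (smv_sgrad (sm_N1 sC b0 kp0)).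
exists r1, K, d0; split => // u P k hx k_0 kd.
have d1 : 0 < k ^- 2 < d0 by rewrite kd invr_gt0 exprn_gt0.
rewrite -x0E in hx inx; have [Z [Z0 dZ Zpi]] := hZ (row_mx u P) (k ^- 2) hx d1.
have pi4 : (pi : R) < 4 by have /andP[h1 h2] := @pihalf_02 R; lra.
have pi0 : 0 < (pi : R) := pi_gt0 R.
have kz (v : 'rV[R]_n) : v != 0 -> k *: v != 0 by move=> v0; rewrite scaler_eq0 negb_or v0 andbT (lt0r_neq0 k_0).
have kz' (v : 'rV[R]_n) : v != 0 -> 0 < al * `|k *: v| by move=> v0; rewrite mulr_gt0 // normr_gt0 kz.
pose zz (t : R) := covlift GA c (lsubmx (Z t)) (k *: rsubmx (Z t)).
have hc : hamiltonian_curve GA (N_ham B) `](-1 : R), 4[ zz.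
  apply: (hamiltonian_lift gG (u := fun t => lsubmx (Z t)) (p := fun t => k *: rsubmx (Z t)) Gc) => //.
    by move=> y cy; exact: (N_invariant hA hg hB).
  move=> t; rewrite /= in_itv /= => ht; have [h1 h2] := dZ t ht.
  have [i1 i2 i3 i4] := inx _ h1; have i1' := lt_le_trans i1 er.
  have [j1 j2] := nc_img hN i1'.
  have kn := kz _ i2.
  split => //; first exact: (sm_N_joint hB hN).
  rewrite (hfield_N hB hN i1' kn) => i.
  have dE s : dscale (mul_p2 k) (Z s) = row_mx (lsubmx (Z s)) (k *: rsubmx (Z s)).
    by rewrite -dscale_p2 hsubmxK.
  have := N_curve sC k_0 i3 i4 h2 i.
  rewrite dE; apply: is_derive_ext; last reflexivity.
  by move=> s; rewrite dE.
have Ipi : -1 < (pi : R) < 4 by rewrite pi4 andbT; lra.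
have zd (t : R) : -1 < t < 4 -> [/\ chart_dom c (zz t).1, chart_to c (zz t).1 = lsubmx (Z t),
    cotangent GA (zz t) & (zz t).2 c = k *: rsubmx (Z t)].
  move=> ht; have [h1 _] := dZ t ht; have [i1 _ _ _] := inx _ h1.
  exact: (covlift_dom _ (lt_le_trans i1 er)).
have zz0 : zz 0 = covlift GA c u (k *: P) by rewrite /zz Z0 row_mxKl row_mxKr.
exists (Z pi); split.
- by have [h1 _] := dZ pi Ipi; have [] := inx _ h1.
- exists zz, (-1), 4; split; [by split; lra|exact: hc| |exact: zz0|reflexivity].
  move=> t ht; have [h1 _] := dZ t ht; have [i1 i2 _ _] := inx _ h1.
  have [j1 j2 j3 j4] := zd t ht.
  rewrite /norm_cov (fiber_evalE Gc j1 j3 (dual_norm_invariant hA hg Gc j1)) j2 j4.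
  by apply: lt0r_neq0; apply: lt_le_trans (kz' _ i2) (hD _ i1 _).
- move=> z' [Z' [a' [b' [[a0 b0'] hZ' nZ' Z'0 <-]]]].
  apply: (hamiltonian_unique gG hM _ _ Gc hc hZ' (b := pi)).
  + exact: interval_open.
  + exact: interval_open.
  + move=> t /andP[t0 tp].
    have ht : -1 < t < 4 by apply/andP; split; lra.
    have [h1 _] := dZ t ht; have [i1 i2 _ _] := inx _ h1; have [j1 j2 j3 j4] := zd t ht.
    split; [by rewrite /= in_itv|by rewrite /= in_itv /=; apply/andP; split; lra|exact: j1|].
    by rewrite /state j2 j4; exact: (sm_N_joint hB hN (lt_le_trans i1 er) (kz _ i2)).
  + exact: (etrans zz0 (esym Z'0)).
  + by apply/andP; split; [exact: ltW|exact: lexx].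
- exact: Zpi.
Qed.

End LocalAveragedFlow.

Lemma hfield_l {R : realType} {T : topologicalType} k (F : chart R T k -> 'rV[R]_k -> 'rV[R]_k -> R) c s i :
  hfield F c s 0 (lshift k i) = pd (rshift k i) (joint (F c)) s.
Proof. by rewrite /hfield row_mxEl mxE. Qed.

Lemma hfield_r {R : realType} {T : topologicalType} k (F : chart R T k -> 'rV[R]_k -> 'rV[R]_k -> R) c s i :
  hfield F c s 0 (rshift k i) = - pd (lshift k i) (joint (F c)) s.
Proof. by rewrite /hfield row_mxEr mxE. Qed.

(** * The section and the rescaled flow in the chart of the double *)

Section HatSection.
Context {R : realType} {n : nat} {M : topologicalType}.
Variables (A : set (chart R M n.+1)) (hA : amb A).
Variables (g : chart R M n.+1 -> M -> 'M[R]_n.+1).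
Variables (phi : M -> R) (hphi : smooth_map A setT (line_atlas R) phi).
Variable hdphi : dphi_nonzero A phi.
Local Notation GA := (Gamma_atlas A phi).
Local Notation HA := (Omega_hat_atlas A phi).
Variable Hh : chart R (M * R)%type n.+1 -> 'rV[R]_n.+1 -> 'rV[R]_n.+1 -> R.
Hypothesis hH : regularized_hamiltonian A g phi Hh.
Variables (c : chart R M n) (u0 : 'rV[R]_n) (Ct : 'rV[R]_(n + 1) -> 'M[R]_n) (e : R)
  (d : chart R (M * R)%type n.+1) (kp : 'rV[R]_(1 + n) -> R).
Hypothesis hC : hat_chart A phi Hh c u0 Ct e d kp.
Local Notation w00 := (row_mx 0 u0 : 'rV[R]_(1 + n)).

Lemma hat_lift_dom (w p : 'rV[R]_(1 + n)) : `|w - w00| < e ->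
  [/\ chart_dom d (covlift HA d w p).1, chart_to d (covlift HA d w p).1 = w,
      cotangent HA (covlift HA d w p) & (covlift HA d w p).2 d = p].
Proof.
move=> hw; have [h1 h2] := hc_from hC hw; have Hd := hc_d hC.
have gH : good_atlas HA by exact: (hat_atlas_good hA).
have E : covlift HA d w p = covlift HA d (chart_to d (chart_from d w)) p by rewrite h2.
split; [exact: h1|exact: h2| |].
  rewrite E; exact: (lift_cotangent gH).
apply: (etrans (congr1 (fun z => z.2 d) E)); apply: (etrans (lift_coord gH p Hd h1 Hd h1)).
by rewrite (tjac_id gH Hd h1) trmx1 mulmx1.
Qed.

Lemma zero_near u : `|u - u0| < e -> `|(row_mx 0 u : 'rV[R]_(1 + n)) - w00| < e.
Proof. by move=> hu; apply: row_mx_near; [exact: hc_e hC|rewrite subrr normr0; exact: hc_e hC|]. Qed.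

(** On sigma = 0 the Hamiltonian is p_sigma^2 / 4, so the energy level 1 fixes p_sigma up to sign
    and leaves u and p_u free. *)
Lemma hat_section (w p : 'rV[R]_(1 + n)) : `|w - w00| < e ->
  section_S A phi Hh (covlift HA d w p) <-> sig w = 0 /\ sig p ^+ 2 = 4.
Proof.
move=> hw; have [h1 h2 h3 h4] := hat_lift_dom p hw; have Hd := hc_d hC.
have ev : fiber_eval HA Hh (covlift HA d w p) = hamf Ct w p.
  by rewrite (fiber_evalE Hd h1 h3 (hc_inv hC h1)) h2 h4 (hc_ham hC _ hw).
have hG : Gamma phi (covlift HA d w p).1.1 <-> sig w = 0 := hc_Gamma hC hw.
have hamE : sig w = 0 -> hamf Ct w p = sig p ^+ 2 / 4.
  by move=> s0; rewrite hamfE s0 !mul0r addr0.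
split.
  move=> [_ /hG s0]; rewrite ev hamE // => hE; split => //.
  by have -> : sig p ^+ 2 = sig p ^+ 2 / 4 * 4 by [field]; rewrite hE mul1r.
move=> [s0 sp]; split => //; first exact/hG.
by rewrite ev hamE // sp divff // pnatr_eq0.
Qed.

(** There xi' is p_sigma / 2 times a positive factor, so the halves are p_sigma = 2 and p_sigma = -
    2. *)
Lemma hat_half (minus : bool) u (p : 'rV[R]_(1 + n)) : `|u - u0| < e ->
  section_half A phi Hh minus (covlift HA d (row_mx 0 u : 'rV[R]_(1 + n)) p) <-> sig p = 2 * (-1) ^+ minus.
Proof.
move=> hu; have hw := zero_near hu; have [h1 h2 h3 h4] := hat_lift_dom p hw; have Hd := hc_d hC.
have ev : fiber_eval HA (xi_dot Hh) (covlift HA d (row_mx 0 u : 'rV[R]_(1 + n)) p) = sig p / 2 * kp (row_mx 0 u).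
  rewrite (fiber_evalE Hd h1 h3 (xi_dot_invariant hA hH hC h1)) h2 h4.
  exact: (xi_dot_zero hC).
have [_ k0 _] := hc_xi hC hw.
have s0 : sig (row_mx 0 u : 'rV[R]_(1 + n)) = 0 by rewrite /sig row_mxKl mxE.
have m2 : (-1) ^+ minus * (-1) ^+ minus = 1 :> R by case: minus; rewrite ?expr0 ?expr1 ?mulrNN mulr1.
rewrite /section_half /= ev; split.
  move=> [/(hat_section p hw)[_ sp] hpos].
  have : (sig p - 2) * (sig p + 2) = 0 by rewrite -subr_sqr sp -natrX subrr.
  move/eqP; rewrite mulf_eq0 => /orP[]/eqP hs.
    have e2 : sig p = 2 by lra.
    case: minus hpos m2 => //; rewrite ?expr0 ?expr1 e2 ?mulr1 //.
    by rewrite divff ?pnatr_eq0 // mul1r mulN1r oppr_gt0 ltNge (ltW k0).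
  have e2 : sig p = - 2 by lra.
  case: minus hpos m2 => //; rewrite ?expr0 ?expr1 e2 ?mulrN1 //.
  by rewrite mulNr divff ?pnatr_eq0 // mul1r mulN1r oppr_gt0 ltNge (ltW k0).
move=> sp; split.
  by apply/(hat_section p hw); split => //; rewrite sp exprMn [X in _ * X]expr2 m2 mulr1 -natrX.
rewrite sp; have -> : (-1) ^+ minus * (2 * (-1) ^+ minus / 2 * kp (row_mx 0 u)) = ((-1) ^+ minus * (-1) ^+ minus) * kp (row_mx 0 u) :> R.
  by move: ((-1) ^+ minus) (kp _) => E K; field.
by rewrite m2 mul1r.
Qed.

Lemma hat_restrict_lift u (p : 'rV[R]_(1 + n)) (P : 'rV[R]_n) : `|u - u0| < e ->
  restricts_to A phi (covlift HA d (row_mx 0 u : 'rV[R]_(1 + n)) p) (covlift GA c u P) <-> P = rsubmx p.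
Proof.
move=> hu; have hw := zero_near hu; have [h1 h2 h3 h4] := hat_lift_dom p hw.
have [c1 c2] := hc_img hC hu; have Gc := hc_c hC.
have gG : good_atlas GA by exact: (sub_good hA).
have E : covlift GA c u P = covlift GA c (chart_to c (chart_from c u)) P by rewrite c2.
have ct : cotangent GA (covlift GA c u P) by rewrite E; exact: (lift_cotangent gG).
have cP : (covlift GA c u P).2 c = P.
  apply: (etrans (congr1 (fun z => z.2 c) E)); apply: (etrans (lift_coord gG P Gc c1 Gc c1)).
  by rewrite (tjac_id gG Gc c1) trmx1 mulmx1.
have e1 : (covlift HA d (row_mx 0 u : 'rV[R]_(1 + n)) p).1 = ((covlift GA c u P).1, 0) := hc_zero hC hu.
have hu' : `|chart_to c (covlift GA c u P).1 - u0| < e by rewrite /= c2.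
have := hat_restrict hA hphi hdphi hC h3 ct e1 c1 hu'.
by rewrite cP h4.
Qed.

Variable r : R.
Hypothesis sC : forall w, `|w - row_mx u0 0| < r -> smm Ct w.

(* The canonical rescaling p_u = k P, t = s / k, sigma = y / k, with k^-2 the small parameter. *)
Lemma hat_field_curve (x : R -> 'rV[R]_(n + n)) (y v : R -> R) (k ep t : R) : 0 < k ->
  let z := row_mx (x (k * t)) (const_mx (k ^- 2 * (y (k * t) * y (k * t)))) in
  let ww s : 'rV[R]_(1 + n) := row_mx (const_mx (ep * y (k * s) / k)) (lsubmx (x (k * s))) in
  let pp s : 'rV[R]_(1 + n) := row_mx (const_mx (2 * ep * v (k * s))) (k *: rsubmx (x (k * s))) in
  ep * ep = 1 -> `|base z - row_mx u0 0| < r -> `|ww t - w00| < e ->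
  (forall i, is_derive (k * t) (1 : R) (fun s : R => x s 0 i) (k ^- 2 * (y (k * t) * y (k * t)) * Gq Ct z 0 i)) ->
  is_derive (k * t) (1 : R) y (v (k * t)) -> is_derive (k * t) (1 : R) v (- y (k * t) * Eq Ct z) ->
  forall i, is_derive t (1 : R) (fun s : R => (row_mx (ww s) (pp s) : 'rV[R]_((1 + n) + (1 + n))) 0 i)
    (hfield Hh d (row_mx (ww t) (pp t) : 'rV[R]_((1 + n) + (1 + n))) 0 i).
Proof.
move=> k_0 z ww pp ep2 hz hw dx dy dv i; have kn := lt0r_neq0 k_0.
have [w wE] := exists_eq (ww t); have [p pE] := exists_eq (pp t).
have sgw : sig w = ep * y (k * t) / k by rewrite wE /sig /ww row_mxKl mxE.
have rsw : rsubmx w = lsubmx (x (k * t)) by rewrite wE /ww row_mxKr.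
have sgp : sig p = 2 * ep * v (k * t) by rewrite pE /sig /pp row_mxKl mxE.
have rsp : rsubmx p = k *: rsubmx (x (k * t)) by rewrite pE /pp row_mxKr.
have s2 : sig w * sig w = k ^- 2 * (y (k * t) * y (k * t)).
  rewrite sgw; have -> : ep * y (k * t) / k * (ep * y (k * t) / k) = (ep * ep) * (k ^- 2 * (y (k * t) * y (k * t))).
    by move: (y _) => Y; field.
  by rewrite ep2 mul1r.
have [eta etaE] := exists_eq (const_mx (k ^- 2 * (y (k * t) * y (k * t))) : 'rV[R]_1).
have [u uE] := exists_eq (lsubmx (x (k * t))); have [P PE] := exists_eq (rsubmx (x (k * t))).
have zE : z = row_mx (row_mx u P) eta by rewrite /z uE PE etaE hsubmxK.
have hb : `|row_mx u eta - row_mx u0 0| < r by move: hz; rewrite zE baseE.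
have [z' z'E] := exists_eq (row_mx (row_mx u (k *: P)) eta).
have z'E' : z' = row_mx (row_mx (rsubmx w) (rsubmx p)) (const_mx (sig w * sig w)).
  by rewrite s2 rsw rsp -uE -PE -etaE z'E.
have hz' : `|base z' - row_mx u0 0| < r by rewrite z'E baseE.
have [q1 q2 q3] := pd_Kq_scale sC P hb kn; rewrite -z'E -zE in q1 q2 q3.
have Gl j : Gq Ct z' 0 (lshift n j) = k * Gq Ct z 0 (lshift n j).
  by rewrite /Gq !row_mxEl [LHS]mxE [X in _ * X]mxE; exact: q2.
have Gr j : Gq Ct z' 0 (rshift n j) = k ^+ 2 * Gq Ct z 0 (rshift n j).
  by rewrite /Gq !row_mxEr [LHS]mxE [X in _ * X]mxE q1 mulrN.
have EE : Eq Ct z' = k ^+ 2 * Eq Ct z.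
  have KE : Kq Ct z' = k ^+ 2 * Kq Ct z by rewrite z'E zE -dscale_p Kq_scale.
  have rE : rsubmx z' 0 0 = rsubmx z 0 0 by rewrite z'E zE !row_mxKr.
  by rewrite /Eq KE q3 rE; ring.
have [p1 p2 p3 p4] := pd_hamf sC z'E' hz'.
have nj l : pd l (joint (Hh d)) (row_mx w p : 'rV[R]_((1 + n) + (1 + n)))
    = pd l (fun s : 'rV[R]_((1 + n) + (1 + n)) => hamf Ct (lsubmx s) (rsubmx s)) (row_mx w p).
  apply: pd_near.
  have hw' : `|w - w00| < e by rewrite wE.
  have n1 : \forall s \near (row_mx w p : 'rV[R]_((1 + n) + (1 + n))), `|lsubmx s - w00| < e.
    apply: (near_cont_comp (f := fun s : 'rV[R]_((1 + n) + (1 + n)) => lsubmx s) (P := fun v => `|v - w00| < e) (smv_cont (smv_lsubmx _))).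
    by rewrite row_mxKl; exact: near_dist_lt.
  by apply: near_imp n1 => s hs; exact: (hc_ham hC).
rewrite -wE -pE.
case: (@split_ordP (1 + n) (1 + n) i) => i' ->.
  apply: (is_derive_eq (f' := pd (rshift (1 + n) i') (joint (Hh d)) (row_mx w p : 'rV[R]_((1 + n) + (1 + n))))); last first.
    by apply: esym; exact: (hfield_l (k := n.+1)).
  rewrite nj; case: (@split_ordP 1 n i') => j ->.
    rewrite (ord1 j); apply: (is_derive_eq (f' := sig p / 2)); last by apply: esym; exact: p1.
    apply: (is_derive_ext _ _ (isdZ (ep / k) (isd_scale_arg dy))).
      by move=> s; rewrite row_mxEl /ww row_mxEl mxE; move: (y _) => Y; field.
    by rewrite sgp; move: (v _) => V; field.
  apply: (is_derive_eq (f' := sig w * sig w * Gq Ct z' 0 (lshift n j))); last by apply: esym; exact: p2.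
  apply: (is_derive_ext _ _ (isd_scale_arg (dx (lshift n j)))).
    by move=> s; rewrite row_mxEl /ww row_mxEr mxE.
  by rewrite Gl s2; ring.
apply: (is_derive_eq (f' := - pd (lshift (1 + n) i') (joint (Hh d)) (row_mx w p : 'rV[R]_((1 + n) + (1 + n))))); last first.
  by apply: esym; exact: (hfield_r (k := n.+1)).
rewrite nj; case: (@split_ordP 1 n i') => j ->.
  rewrite (ord1 j); apply: (is_derive_eq (f' := - (2 * sig w * Eq Ct z'))); last by apply: esym; congr (- _); exact: p3.
  apply: (is_derive_ext _ _ (isdZ (2 * ep) (isd_scale_arg dv))).
    by move=> s; rewrite row_mxEr /pp row_mxEl mxE.
  by rewrite sgw EE; move: (y _) (Eq _ _) => Y E; field.
apply: (is_derive_eq (f' := - - (sig w * sig w * Gq Ct z' 0 (rshift n j)))); last by apply: esym; congr (- _); exact: p4.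
apply: (is_derive_ext _ _ (isdZ k (isd_scale_arg (dx (rshift n j))))).
  by move=> s; rewrite row_mxEr /pp row_mxEr !mxE.
by rewrite Gr s2; ring.
Qed.

End HatSection.

(** * The first return near a point of Gamma *)

Section LocalBilliard.
Context {R : realType} {n : nat} {M : topologicalType}.
Variables (A : set (chart R M n.+1)) (hA : amb A) (hM : hausdorff_space M).
Variables (g : chart R M n.+1 -> M -> 'M[R]_n.+1).
Variables (phi : M -> R) (hphi : smooth_map A setT (line_atlas R) phi).
Variable hdphi : dphi_nonzero A phi.
Variables (W : set M) (eps0 : R) (q : M -> M) (X : M * R -> M)
  (B : chart R M n -> 'rV[R]_n -> R -> 'M[R]_n).
Variable hB : semigeodesic A g phi W eps0 q X B.
Local Notation GA := (Gamma_atlas A phi).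
Local Notation HA := (Omega_hat_atlas A phi).
Variable Hh : chart R (M * R)%type n.+1 -> 'rV[R]_n.+1 -> 'rV[R]_n.+1 -> R.
Hypothesis hH : regularized_hamiltonian A g phi Hh.
Variables (c : chart R M n) (a : chart R M n.+1) (u0 : 'rV[R]_n) (Xt : 'rV[R]_(n + 1) -> 'rV[R]_n.+1)
  (h : 'rV[R]_(n + 1) -> R) (Ct : 'rV[R]_(n + 1) -> 'M[R]_n) (r : R).
Hypothesis hN : normal_chart A g phi eps0 X B c a u0 Xt h Ct r.
Variables (e : R) (d : chart R (M * R)%type n.+1) (kp : 'rV[R]_(1 + n) -> R).
Hypothesis hC : hat_chart A phi Hh c u0 Ct e d kp.
Local Notation w00 := (row_mx 0 u0 : 'rV[R]_(1 + n)).

Lemma prod_hausdorff : hausdorff_space (M * R)%type.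
Proof.
move=> p1 p2 hc.
have pr (T : topologicalType) (f : M * R -> T) : hausdorff_space T -> continuous f -> f p1 = f p2.
  move=> hT cf; apply: hT => U V nU nV.
  have [z [z1 z2]] := hc (f @^-1` U) (f @^-1` V) (cf _ _ nU) (cf _ _ nV).
  by exists (f z).
rewrite [p1]surjective_pairing [p2]surjective_pairing; congr pair.
  by apply: pr => // z; exact: cvg_fst.
by apply: (pr R) => [|z]; [exact: norm_hausdorff|exact: cvg_snd].
Qed.

(** The sign ep is 1 or - 1 and selects the half-section of departure. The oscillator is invariant
    under (y, v) -> (- y, - v), so both signs lead to the same end point in (u, P). *)
Definition hat_w (x : R -> 'rV[R]_(n + n)) (y : R -> R) (k ep s : R) : 'rV[R]_(1 + n) :=
  row_mx (const_mx (ep * y (k * s) / k)) (lsubmx (x (k * s))).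
Definition hat_p (x : R -> 'rV[R]_(n + n)) (v : R -> R) (k ep s : R) : 'rV[R]_(1 + n) :=
  row_mx (const_mx (2 * ep * v (k * s))) (k *: rsubmx (x (k * s))).
Definition hat_z x y v k ep s : covector R (M * R)%type n.+1 := covlift HA d (hat_w x y k ep s) (hat_p x v k ep s).

Section Orbit.
Variables (x : R -> 'rV[R]_(n + n)) (y v : R -> R) (al be tau k : R).
Hypotheses (er : e <= r) (k_0 : 0 < k).
Hypotheses (al0 : al < 0) (tau0 : 0 < tau) (taub : tau < be).
Hypotheses (y0 : y 0 = 0) (v0 : v 0 = 1) (yt : y tau = 0) (vt : v tau < 0).
Hypothesis hx : forall t, al < t < be -> [/\ `|lsubmx (x t) - u0| < e, k ^- 2 * (y t * y t) < e * e & k ^- 2 * (y t * y t) < e].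
Hypothesis dx : forall t, al < t < be -> let z := row_mx (x t) (const_mx (k ^- 2 * (y t * y t))) in
  [/\ forall i, is_derive t (1 : R) (fun s : R => x s 0 i) (k ^- 2 * (y t * y t) * Gq Ct z 0 i),
      is_derive t (1 : R) y (v t) & is_derive t (1 : R) v (- y t * Eq Ct z)].
Hypothesis ypos : forall t, 0 < t < tau -> 0 < y t.

Lemma small_ge0 (s : R) : 0 <= k ^- 2 * (s * s).
Proof.
apply: mulr_ge0; last by rewrite -expr2; exact: sqr_ge0.
by rewrite invr_ge0; exact/exprn_ge0/ltW.
Qed.

(** The section prescribes p_sigma exactly, whereas the comparison with a rotation yields only v < 0
    at the return; conservation of energy supplies v^2 = 1. *)
Lemma orbit_v_tau : v tau = -1.
Proof.
have h1 : v tau ^+ 2 = 1.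
  apply: (osc_energy (nc_smC hN) (x := x) (y := y) (d := k ^- 2) tau0) => //.
  move=> t /andP[t0 tt]; have ht : al < t < be by rewrite (lt_le_trans al0 t0) (le_lt_trans tt taub).
  have [i1 i2 i3] := hx ht; have [j1 j2 j3] := dx ht; move=> z; split => //.
  rewrite /z /base row_mxKl row_mxKr; apply: row_mx_near; first exact: (nc_pos hN).
    exact: lt_le_trans er.
  rewrite subr0 const_mx1_norm ger0_norm; first exact: lt_le_trans er.
  exact: small_ge0.
have h0 : (v tau - 1) * (v tau + 1) = v tau ^+ 2 - 1 by ring.
move/eqP: h0; rewrite h1 subrr mulf_eq0 => /orP[]/eqP h2; last by lra.
by move: vt; have -> : v tau = 1 by [lra]; rewrite ltNge ler01.
Qed.

Lemma hat_w_near ep t : ep * ep = 1 -> al < k * t < be -> `|hat_w x y k ep t - w00| < e.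
Proof.
move=> ep2 ht; have [i1 i2 _] := hx ht; have e0 := hc_e hC; have kn := lt0r_neq0 k_0.
apply: row_mx_near => //; rewrite subr0 const_mx1_norm.
rewrite -(@ltr_pXn2r R 2) ?nnegrE ?normr_ge0 ?ltW // real_normK ?num_real //.
have -> : (ep * y (k * t) / k) ^+ 2 = (ep * ep) * (k ^- 2 * (y (k * t) * y (k * t))).
  by move: (y _) => Y; field.
by rewrite ep2 mul1r [e ^+ 2]expr2.
Qed.

Lemma hat_orbit ep : ep * ep = 1 -> hamiltonian_curve HA Hh `](al / k), (be / k)[ (hat_z x y v k ep).
Proof.
move=> ep2; have gH : good_atlas HA by exact: (hat_atlas_good hA).
have Hd := hc_d hC; have e0 := hc_e hC.
apply: (hamiltonian_lift gH (u := hat_w x y k ep) (p := hat_p x v k ep) Hd).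
- by move=> t; reflexivity.
- exact: (hc_inv hC).
move=> t; rewrite /= in_itv /= => ht.
have ht' : al < k * t < be by move: ht; rewrite ltr_pdivrMr // ltr_pdivlMr // mulrC.
have hw := hat_w_near ep2 ht'; have [h1 h2] := hc_from hC hw.
have [i1 i2 i3] := hx ht'; have [j1 j2 j3] := dx ht'.
split; [exact: h1|exact: h2| |].
  by rewrite -h2; exact: (sm_hat_joint hH _ Hd h1).
apply: (hat_field_curve hC (nc_smC hN) k_0 ep2) => //.
rewrite /base row_mxKl row_mxKr; apply: row_mx_near; first exact: (nc_pos hN).
  exact: lt_le_trans er.
rewrite subr0 const_mx1_norm ger0_norm; first exact: lt_le_trans er.
exact: small_ge0.
Qed.

Lemma hat_z_at (ep s t : R) : k * t = s -> y s = 0 ->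
  hat_z x y v k ep t = covlift HA d (row_mx 0 (lsubmx (x s)) : 'rV[R]_(1 + n))
    (row_mx (const_mx (2 * ep * v s)) (k *: rsubmx (x s)) : 'rV[R]_(1 + n)).
Proof.
move=> <- ys; rewrite /hat_z /hat_w /hat_p ys mulr0 mul0r; congr covlift.
Qed.

Let al0be : al < 0 < be. Proof. by rewrite al0 (lt_trans tau0). Qed.
Let alt : al < tau < be. Proof. by rewrite taub (lt_trans al0). Qed.

Lemma sgn_sqr (minus : bool) : (-1) ^+ minus * (-1) ^+ minus = 1 :> R.
Proof. by case: minus; rewrite ?expr0 ?expr1 ?mulrNN mulr1. Qed.

Lemma sgn_neg (minus : bool) : (-1) ^+ (~~ minus) = - (-1) ^+ minus :> R.
Proof. by case: minus; rewrite ?expr0 ?expr1 ?opprK. Qed.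

Lemma no_return (minus : bool) (t : R) : 0 < t < tau / k ->
  ~ section_S A phi Hh (hat_z x y v k ((-1) ^+ minus) t).
Proof.
move=> /andP[t0]; rewrite ltr_pdivlMr // mulrC => tt.
have kt0 : 0 < k * t by rewrite mulr_gt0.
have ht : al < k * t < be by rewrite (lt_trans al0 kt0) (lt_trans tt taub).
move/(hat_section hA hC _ (hat_w_near (sgn_sqr minus) ht)) => [].
rewrite /sig /hat_w row_mxKl mxE => /eqP.
rewrite mulf_eq0 invr_eq0 (gt_eqF k_0) orbF mulf_eq0 signr_eq0 /=.
have yp : 0 < y (k * t) by apply: ypos; rewrite kt0.
by rewrite gt_eqF.
Qed.

Lemma orbit_half0 (minus : bool) : section_half A phi Hh minus (hat_z x y v k ((-1) ^+ minus) 0).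
Proof.
rewrite (hat_z_at _ (mulr0 k) y0); apply/(hat_half hA hH hC minus); first by have [] := hx al0be.
by rewrite /sig row_mxKl mxE v0 mulr1.
Qed.

Lemma k_tau : k * (tau / k) = tau.
Proof. by rewrite mulrC divfK // gt_eqF. Qed.

Lemma orbit_half_tau (minus : bool) : section_half A phi Hh (~~ minus) (hat_z x y v k ((-1) ^+ minus) (tau / k)).
Proof.
rewrite (hat_z_at _ k_tau yt); apply/(hat_half hA hH hC (~~ minus)); first by have [] := hx alt.
by rewrite /sig row_mxKl mxE orbit_v_tau sgn_neg mulrN1 mulrN.
Qed.

Lemma orbit_first_return (minus : bool) :
  first_return A phi Hh minus (covlift GA c (lsubmx (x 0)) (k *: rsubmx (x 0)))
    (covlift GA c (lsubmx (x tau)) (k *: rsubmx (x tau))).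
Proof.
exists (hat_z x y v k ((-1) ^+ minus)), (al / k), (be / k), (tau / k); split.
- by split; rewrite ?ltr_pdivrMr ?ltr_pdivlMr ?mul0r ?divfK ?gt_eqF.
- exact: hat_orbit (sgn_sqr minus).
- by split; [exact: orbit_half0|exact: orbit_half_tau].
- exact: no_return.
- split.
    rewrite (hat_z_at _ (mulr0 k) y0); apply/(hat_restrict_lift hA hphi hdphi hC); first by have [] := hx al0be.
    by rewrite row_mxKr.
  rewrite (hat_z_at _ k_tau yt); apply/(hat_restrict_lift hA hphi hdphi hC); first by have [] := hx alt.
  by rewrite row_mxKr.
Qed.

(** A point of S^+ over a given covector of Gamma has p_sigma = 2 and the prescribed p_u, so any
    competing curve starts at the same point and coincides with the constructed one up to the
    smaller of the two return times. One half-section is enough to identify the end point. *)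
Lemma orbit_unique w' :
  first_return A phi Hh false (covlift GA c (lsubmx (x 0)) (k *: rsubmx (x 0))) w' ->
  covlift GA c (lsubmx (x tau)) (k *: rsubmx (x tau)) = w'.
Proof.
move=> [Z [a' [b' [tau' [[a0 t0 tb] hZ [hf0 hft] nr [r0 rt]]]]]].
have gG : good_atlas GA by exact: (sub_good hA).
have gH : good_atlas HA by exact: (hat_atlas_good hA).
have [hu0 _ _] := hx al0be; have [hut _ _] := hx alt.
have [c1 c2] := hc_img hC hu0; have [c1' c2'] := hc_img hC hut.
have Gc := hc_c hC; have Hd := hc_d hC.
have [z Zz] := exists_eq (Z 0); rewrite -Zz in hf0 r0.
have [[ctz _ _] _] := hf0.
have z1 : z.1 = (chart_from c (lsubmx (x 0)), 0) by have [-> _ _] := r0.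
have [D1 D2 _] : [/\ chart_dom d (chart_from c (lsubmx (x 0)), 0),
    chart_to d (chart_from c (lsubmx (x 0)), 0) = row_mx 0 (chart_to c (chart_from c (lsubmx (x 0)))) :> 'rV[R]_(1 + n) &
    jac (fun u => chart_to d (chart_from c u, 0)) (chart_to c (chart_from c (lsubmx (x 0)))) = row_mx 0 1%:M :> 'M[R]_(n, 1 + n)].
  by apply: (hat_at_Gamma hA hphi hdphi hC c1); rewrite c2.
rewrite c2 in D2.
have [p pE] := exists_eq (z.2 d : 'rV[R]_(1 + n)).
have zE : z = covlift HA d (row_mx 0 (lsubmx (x 0)) : 'rV[R]_(1 + n)) p.
  have dz : chart_dom d z.1 by rewrite z1.
  by apply: (etrans (cot_lift gH Hd dz ctz)); rewrite z1 D2 pE.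
rewrite zE in hf0 r0.
have sp := (hat_half hA hH hC false p hu0).1 hf0.
have rp := (hat_restrict_lift hA hphi hdphi hC p (k *: rsubmx (x 0)) hu0).1 r0.
have e0 : hat_z x y v k ((-1) ^+ false) 0 = Z 0.
  rewrite (hat_z_at _ (mulr0 k) y0) -Zz zE v0 mulr1; congr covlift.
  apply: etrans (@hsubmxK R 1 1 n p); rewrite -rp.
  apply: (congr1 (fun z : 'rV[R]_1 => row_mx z (k *: rsubmx (x 0)) : 'rV[R]_(1 + n))).
  by apply/rowP => i; rewrite (ord1 i) mxE -sp.
(* The common time interval of the two orbits, up to the earlier return. *)
have [m mE] := exists_eq (Num.min (tau / k) tau').
have tk0 : 0 < tau / k by rewrite divr_gt0.
have m0 : 0 < m by rewrite mE lt_min tk0.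
have mt : m <= tau / k by rewrite mE ge_min lexx.
have mt' : m <= tau' by rewrite mE ge_min lexx orbT.
have hq : forall t : R, 0 <= t <= m -> hat_z x y v k ((-1) ^+ false) t = Z t.
  apply: (hamiltonian_unique gH prod_hausdorff _ _ Hd (hat_orbit (sgn_sqr false)) hZ _ e0).
  - exact: interval_open.
  - exact: interval_open.
  move=> t /andP[t0' tm].
  have kt : al < k * t < be.
    rewrite (lt_le_trans al0) ?mulr_ge0 ?(ltW k_0) //=; apply: le_lt_trans taub.
    by rewrite -k_tau ler_pM2l //; exact: le_trans mt.
  have hw := hat_w_near (sgn_sqr false) kt.
  have [j1 j2 j3 j4] := hat_lift_dom hA hC (hat_p x v k ((-1) ^+ false) t) hw.
  split; [|by rewrite /= in_itv /= (lt_le_trans a0 t0') (le_lt_trans (le_trans tm mt') tb)|exact: j1|].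
    by rewrite /= in_itv /= ltr_pdivrMr // ltr_pdivlMr // ![t * k]mulrC.
  exact: (sm_hat_joint hH _ Hd j1).
(* If the times differed, the later-returning curve would meet the section before its own first
   return. *)
have mm : tau / k = tau'.
  apply/eqP; rewrite eq_le; apply/andP; split; rewrite leNgt; apply/negP => hlt.
    have mE' : m = tau' by rewrite mE; apply/min_idPr; exact: ltW.
    apply: (@no_return false tau'); first by rewrite t0.
    by rewrite hq; [have [] := hft|rewrite mE' lexx ltW].
  have mE' : m = tau / k by rewrite mE; apply/min_idPl; exact: ltW.
  apply: (nr (tau / k)); first by rewrite tk0.
  by rewrite -hq; [have [] := orbit_half_tau false|rewrite mE' lexx ltW].
have Zt : Z tau' = covlift HA d (row_mx 0 (lsubmx (x tau)) : 'rV[R]_(1 + n))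
    (row_mx (const_mx (2 * (-1) ^+ false * v tau)) (k *: rsubmx (x tau)) : 'rV[R]_(1 + n)).
  have hm : 0 <= tau' <= m by rewrite mE mm minxx lexx ltW.
  apply: (etrans (esym (hq tau' hm))); rewrite -mm; exact: (hat_z_at _ k_tau yt).
rewrite Zt in rt.
have [e1 cw _] := rt.
have w1 : w'.1 = chart_from c (lsubmx (x tau)).
  have : (covlift HA d (row_mx 0 (lsubmx (x tau)) : 'rV[R]_(1 + n)) (row_mx (const_mx (2 * (-1) ^+ false * v tau)) (k *: rsubmx (x tau)) : 'rV[R]_(1 + n))).1
    = (chart_from c (lsubmx (x tau)), 0) := hc_zero hC hut.
  by rewrite e1 => -[].
have cyw : chart_dom c w'.1 by rewrite w1.
have wE : w' = covlift GA c (lsubmx (x tau)) (w'.2 c).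
  by apply: (etrans (cot_lift gG Gc cyw cw)); rewrite w1 c2'.
rewrite wE in rt.
have := (hat_restrict_lift hA hphi hdphi hC _ _ hut).1 rt.
by rewrite row_mxKr => h2; rewrite -h2; exact: esym wE.
Qed.

End Orbit.

(** The oscillator is confined to the radius e * e rather than e: the bound k^-2 y^2 < e^2 is
    |sigma| < e, and e^2 <= e controls u and s as well, so the orbit stays in the chart of the
    double. *)
Lemma billiard_local (P0 : 'rV[R]_n) : `|P0| = 1 -> e <= r -> e <= 1 ->
  exists r1 K d0 : R, [/\ 0 < r1, 0 <= K, 0 < d0 & forall u P (k : R),
    `|row_mx u P - row_mx u0 P0| < r1 -> 0 < k -> k ^- 2 < d0 ->
    exists x1 : 'rV[R]_(n + n), let z1 := covlift GA c (lsubmx x1) (k *: rsubmx x1) in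
    [/\ `|lsubmx x1 - u0| < e, billiard_map A phi Hh (covlift GA c u (k *: P)) z1,
        forall z', billiard_map A phi Hh (covlift GA c u (k *: P)) z' -> z1 = z' &
        `|x1 - row_mx u P - (k ^- 2 * pi) *: sgrad (N0 Ct) (row_mx u P)| <= K * k ^- 2 ^+ 2]].
Proof.
move=> n1 er e1; have e0 := hc_e hC; have sC := nc_smC hN.
have ee0 : 0 < e * e by rewrite mulr_gt0.
have eee : e * e <= e by rewrite -{3}[e]mulr1 ler_pM2l.
have ee1 : e * e <= 1 by exact: le_trans e1.
have [x0 x0E] := exists_eq (row_mx u0 P0).
have inx x : `|x - x0| < e * e -> [/\ `|lsubmx x - u0| < e, in_base u0 r x & 0 < k0 Ct x].
  rewrite x0E -{1}(hsubmxK x) => hx; have [h1 h2] := near_sphere n1 ee0 ee1 hx.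
  have h3 := lt_le_trans h1 eee; have h4 := lt_le_trans h3 er; split; first exact: h3.
    by rewrite -(hsubmxK x); exact: (in_base_row hN).
  by rewrite -(hsubmxK x); exact: (k0_pos hB hN).
have EE x : Eq Ct (row_mx x 0) = k0 Ct x by rewrite /Eq row_mxKr mxE mul0r addr0.
have hx0 : `|x0 - x0| < e * e by rewrite subrr normr0.
have [_ b0 kp0] := inx x0 hx0.
have kp0' : 0 < Eq Ct (row_mx x0 0) by rewrite EE.
(* At eta = 0 the frequency function [Eq] is K_0, positive near the unit sphere of momenta. *)
have [r1 [K [d0 [r10 K0 d00 hF]]]] := osc_flow ee0 (smv_Gq sC (in_baseE b0)) (sm_Eq sC (in_baseE b0)) kp0'.
exists r1, K, d0; split => // u P k; rewrite -x0E => hx k_0 kd.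
have d1 : 0 < k ^- 2 < d0 by rewrite kd invr_gt0 exprn_gt0.
have [x [y [v [al [be [tau]]]]]] := hF (row_mx u P) (k ^- 2) hx d1.
rewrite EE; cbv zeta => -[[al0 tau0 taub xx0 [y0 v0]] hflow ypos [yt vt] est].
have h0 : al < 0 < be by rewrite al0 (lt_trans tau0).
have ht : al < tau < be by rewrite taub (lt_trans al0).
have hx' t : al < t < be -> [/\ `|lsubmx (x t) - u0| < e, k ^- 2 * (y t * y t) < e * e & k ^- 2 * (y t * y t) < e].
  move=> htt; have [h1 h2 _ _ _] := hflow t htt; have [i1 _ _] := inx _ h1.
  by split => //; exact: lt_le_trans eee.
have dx' t : al < t < be -> let z := row_mx (x t) (const_mx (k ^- 2 * (y t * y t))) in
  [/\ forall i, is_derive t (1 : R) (fun s : R => x s 0 i) (k ^- 2 * (y t * y t) * Gq Ct z 0 i),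
      is_derive t (1 : R) y (v t) & is_derive t (1 : R) v (- y t * Eq Ct z)].
  by move=> htt; have [_ _ h3 h4 h5] := hflow t htt.
exists (x tau); split.
- by have [] := hx' _ ht.
- move=> minus; have := @orbit_first_return x y v al be tau k er k_0 al0 tau0 taub y0 v0 yt vt hx' dx' ypos minus.
  by rewrite xx0 row_mxKl row_mxKr.
- move=> z' /(_ false) hz'; apply: (@orbit_unique x y v al be tau k er k_0 al0 tau0 taub y0 v0 yt vt hx' dx' ypos).
  by rewrite xx0 row_mxKl row_mxKr.
- have [h1 _ _ _ _] := hflow 0 h0; rewrite xx0 in h1; have [_ i2 i3] := inx _ h1.
  rewrite (sgrad_N0 sC i2 i3) scalerA.
  by rewrite (_ : k ^- 2 * pi * _ = k ^- 2 * (pi / (2 * Num.sqrt (k0 Ct (row_mx u P)) ^+ 3))) // -mulrA.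
Qed.

End LocalBilliard.

(** * Uniformity over the unit sphere of momenta *)

Lemma sphere_compact (R : realType) n : compact [set P : 'rV[R]_n | `|P| = 1].
Proof.
apply: bounded_closed_compact.
  by exists 1; split; [exact: num_real|move=> M M1 x /= ->; exact: ltW].
apply: (@preimage_closed _ _ (fun P : 'rV[R]_n => `|P|) [set 1]); last exact: closed_eq.
by move=> x _; exact: norm_continuous.
Qed.

Section Powers.
Context {R : realType}.

Lemma inv_sqr_lt (k L d : R) : 0 < d -> 1 <= L -> d^-1 < L -> L < k -> k ^- 2 < d.
Proof.
move=> d0 L1 dL Lk; have L0 : 0 < L by exact: lt_le_trans L1.
have k_0 : 0 < k by exact: lt_trans Lk.
have k1 : 1 < k := le_lt_trans L1 Lk.
rewrite invf_plt ?posrE ?exprn_gt0 //; apply: lt_trans dL _; apply: lt_trans Lk _.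
by rewrite expr2 -[X in X < _]mulr1 (ltr_pM2l k_0).
Qed.

(** Converts errors in powers of k = |p|, the coordinate norm, into powers of the intrinsic norm N
    <= b k. *)
Lemma inv_pow_le (k b N : R) m : 0 < k -> 0 < N -> N <= b * k -> k ^- m <= b ^+ m * N ^- m.
Proof.
move=> k_0 N0 h; have b0 : 0 < b by rewrite -(pmulr_lgt0 _ k_0); exact: lt_le_trans h.
rewrite -[N ^- m]exprVn -exprMn -exprVn; apply: lerXn2r; rewrite ?nnegrE ?invr_ge0 ?(ltW k_0) //.
  by rewrite mulr_ge0 ?invr_ge0 // ltW.
by rewrite ler_pdivlMr // mulrC ler_pdivrMr.
Qed.

End Powers.

Section PointLocal.
Context {R : realType} {n : nat} {M : topologicalType}.
Variables (A : set (chart R M n.+1)) (hA : amb A) (hM : hausdorff_space M).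
Variables (g : chart R M n.+1 -> M -> 'M[R]_n.+1) (hg : riemannian_metric A g).
Variables (phi : M -> R) (hphi : smooth_map A setT (line_atlas R) phi).
Variable hdphi : dphi_nonzero A phi.
Variables (W : set M) (eps0 : R) (q : M -> M) (X : M * R -> M)
  (B : chart R M n -> 'rV[R]_n -> R -> 'M[R]_n).
Variable hB : semigeodesic A g phi W eps0 q X B.
Local Notation GA := (Gamma_atlas A phi).
Local Notation HA := (Omega_hat_atlas A phi).
Variable Hh : chart R (M * R)%type n.+1 -> 'rV[R]_n.+1 -> 'rV[R]_n.+1 -> R.
Hypothesis hH : regularized_hamiltonian A g phi Hh.

Section OneChart.
Variables (c : chart R M n) (a : chart R M n.+1) (u0 : 'rV[R]_n) (Xt : 'rV[R]_(n + 1) -> 'rV[R]_n.+1)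
  (h : 'rV[R]_(n + 1) -> R) (Ct : 'rV[R]_(n + 1) -> 'M[R]_n) (r : R).
Hypothesis hN : normal_chart A g phi eps0 X B c a u0 Xt h Ct r.
Variables (e : R) (d : chart R (M * R)%type n.+1) (kp : 'rV[R]_(1 + n) -> R).
Hypothesis hC : hat_chart A phi Hh c u0 Ct e d kp.

Definition both_flows (L : R) (u P : 'rV[R]_n) (k : R) : Prop :=
  exists x1 x2 : 'rV[R]_(n + n),
  let z := covlift GA c u (k *: P) in
  let z1 := covlift GA c (lsubmx x1) (k *: rsubmx x1) in
  let z2 := covlift GA c (lsubmx x2) (k *: rsubmx x2) in
  [/\ `|lsubmx x1 - u0| < e /\ `|lsubmx x2 - u0| < e,
      billiard_map A phi Hh z z1 /\ (forall z', billiard_map A phi Hh z z' -> z1 = z'),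
      N_flow_pi A g phi B z z2 /\ (forall z', N_flow_pi A g phi B z z' -> z2 = z'),
      `|x1 - x2| <= L * k ^- 4 & `|N1 Ct (row_mx u P)| <= L].

(** L plays three parts at once, as inverse radius in u, threshold for k and error constant; the
    statement then holds for all large L near each P0, the form in which compactness of the sphere
    yields a single L. *)
Lemma sphere_local (al : R) (P0 : 'rV[R]_n) : e <= r -> e <= 1 -> 0 < al ->
  (forall u, `|u - u0| < e -> forall p, al * `|p| <= dual_norm A g c u p) -> `|P0| = 1 ->
  exists2 r1 : R, 0 < r1 & exists L0 : R, forall P L, `|P - P0| < r1 -> L0 < L ->
    forall u k, `|u - u0| < L^-1 -> L < k -> both_flows L u P k.
Proof.
move=> er e1 al0 hD n1; have e0 := hc_e hC; have sC := nc_smC hN.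
have [r1 [K1 [d1 [r10 K10 d10 h1]]]] := billiard_local hA hM hphi hdphi hB hH hN hC n1 er e1.
have [r2 [K2 [d2 [r20 K20 d20 h2]]]] := N_flow_local hA hM hg hB hN n1 e0 er e1 al0 hD.
have uu : `|u0 - u0| < r by rewrite subrr normr0 (nc_pos hN).
have P00 : P0 != 0 by rewrite -normr_eq0 n1 oner_eq0.
have s1 := sm_N1 sC (in_base_row hN P0 uu) (k0_pos hB hN uu P00).
have /near_normP[r3 r30 h3] := cont_near_dist (sm_cont s1) ltr01.
pose r4 := Num.min (Num.min r1 r2) r3.
have r40 : 0 < r4 by rewrite !lt_min r10 r20.
have r41 : r4 <= r1 by rewrite !ge_min lexx.
have r42 : r4 <= r2 by rewrite !ge_min lexx orbT.
have r43 : r4 <= r3 by rewrite !ge_min lexx orbT.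
(* In order: L exceeds 1, the inverse radius, the inverse bounds on k^-2 of the two maps, the sum of
   their error constants, and a bound for [N1] near P0. *)
exists r4 => //; exists (Num.max (Num.max (Num.max 1 r4^-1) (Num.max (d1^-1) (d2^-1)))
  (Num.max (K1 + K2) (1 + `|N1 Ct (row_mx u0 P0)|))) => P L hP.
rewrite !gt_max => /andP[/andP[/andP[L1 Lr] /andP[Ld1 Ld2]] /andP[LK LN]] u k hu Lk.
have L0 : 0 < L by exact: lt_trans L1.
have k_0 : 0 < k by exact: lt_trans Lk.
have k1 := inv_sqr_lt d10 (ltW L1) Ld1 Lk; have k2 := inv_sqr_lt d20 (ltW L1) Ld2 Lk.
have hx : `|row_mx u P - row_mx u0 P0| < r4.
  apply: row_mx_near => //; apply: lt_trans hu _.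
  by rewrite invf_plt ?posrE.
have [x1 [i1 i2 i3 i4]] := h1 u P k (lt_le_trans hx r41) k_0 k1.
have [x2 [j1 j2 j3 j4]] := h2 u P k (lt_le_trans hx r42) k_0 k2.
exists x1, x2; split => //.
  (* Both maps move (u, P) to within O(k^-4) of this common point, so their difference is
     O(k^-4). *)
  have [y yE] := exists_eq (row_mx u P + (k ^- 2 * pi) *: sgrad (N0 Ct) (row_mx u P)).
  rewrite -[x1 - _ - _]addrA -opprD -yE in i4; rewrite -[x2 - _ - _]addrA -opprD -yE in j4.
  have -> : x1 - x2 = (x1 - y) - (x2 - y) by rewrite opprB addrA subrK.
  apply: le_trans (ler_normB _ _) _; apply: le_trans (lerD i4 j4) _.
  have kk : k ^- 4 = k ^- 2 ^+ 2 by have kn := lt0r_neq0 k_0; field.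
  rewrite -mulrDl kk; by apply: ler_wpM2r; [exact: sqr_ge0|exact: ltW].
have := h3 _ (lt_le_trans hx r43) => h4.
rewrite -[N1 _ _](subrK (N1 Ct (row_mx u0 P0))); apply: le_trans (ler_normD _ _) _.
by apply: le_trans (ltW LN); apply: lerD.
Qed.

Lemma sphere_uniform (al : R) : e <= r -> e <= 1 -> 0 < al ->
  (forall u, `|u - u0| < e -> forall p, al * `|p| <= dual_norm A g c u p) ->
  exists2 L : R, 1 < L & forall P u k, `|P| = 1 -> `|u - u0| < L^-1 -> L < k -> both_flows L u P k.
Proof.
move=> er e1 al0 hD; have /compact_near_coveringP hc := @sphere_compact R n.
have := hc R (pinfty_nbhs R) (fun L P => forall u k, `|u - u0| < L^-1 -> L < k -> both_flows L u P k) _.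
feed; first exact: _.
feed.
  move=> P0 n1; have [r1 r10 [L0 hL]] := sphere_local er e1 al0 hD n1.
  exists ([set P | `|P - P0| < r1], [set L | L0 < L]) => [|[P L] /= [h1 h2]]; last exact: hL.
  split=> /=; last by apply: nbhs_pinfty_gt; exact: num_real.
  by have := @near_dist_lt R _ P0 P0 r1; rewrite subrr normr0 => /(_ r10).
move=> hn; have h1 : \forall L \near +oo, 1 < L :> R by apply: nbhs_pinfty_gt; exact: num_real.
have [L [L1 L2]] : exists L : R, 1 < L /\ forall P, `|P| = 1 -> forall u k, `|u - u0| < L^-1 -> L < k -> both_flows L u P k.
  by have [L hL] := filter_ex (filterI h1 hn); exists L.
by exists L => // P u k hP; exact: L2.
Qed.

End OneChart.

(** The set V records where the end points land; this later excludes end points in a chart domain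
    whose closure misses the base point. *)
Definition comparison c (V : set M) (L : R) (z : covector R M n) : Prop :=
  [/\ exists! z1, billiard_map A phi Hh z z1, exists! z2, N_flow_pi A g phi B z z2,
      forall z1 z2, billiard_map A phi Hh z z1 -> N_flow_pi A g phi B z z2 ->
        [/\ V z1.1, V z2.1,
            forall j, `|chart_to c z1.1 0 j - chart_to c z2.1 0 j| <= L * norm_cov A g phi z ^- 4 &
            forall j, `|z1.2 c 0 j - z2.2 c 0 j| <= L * norm_cov A g phi z ^- 3] &
      `|fiber_eval GA (N_ham B) z - - (fiber_eval GA (K0 B) z `^ (- (1 / 2)))| <= L * norm_cov A g phi z ^- 3].

(** Write p = k P with |P| = 1, apply [sphere_uniform], and convert k into the intrinsic norm by
    [dual_norm_bounds]. The estimate of N + K_0^(-1/2) is the homogeneity of [N1] of degree - 3. *)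
Lemma point_local c y0 (V : set M) : GA c -> chart_dom c y0 -> open V -> V y0 ->
  exists L0 : R, \forall y \near y0, forall L, L0 <= L -> forall z, cotangent GA z -> z.1 = y ->
    L <= norm_cov A g phi z -> comparison c (V `&` chart_dom c) L z.
Proof.
move=> Gc cy oV Vy; have gG : good_atlas GA by exact: (sub_good hA).
have inv := sub_inv Gc cy.
have [al [be [al0 be0 nD]]] := dual_norm_bounds hA hg Gc cy.
have nV : \forall u \near chart_to c y0, V (chart_from c u).
  by apply: (near_cont_comp (P := V) (sub_from_cont Gc cy)); rewrite inv; exact: open_near oV Vy.
have /near_normP[e1 e10 he] := near_and nD nV.
have [a [Xt [h [Ct [r [_ hN]]]]]] := normal_chart_exists hA hg hphi hdphi hB Gc cy.
have e20 : 0 < Num.min e1 1 by rewrite lt_min e10 ltr01.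
have [e [d [kp [er ee hC]]]] := hat_chart_exists hA hg hphi hdphi hH hB e20 cy hN.
have [u0 u0E] := exists_eq (chart_to c y0); rewrite -u0E in hN hC he.
have ee1 : e <= e1 by apply: le_trans ee _; rewrite ge_min lexx.
have eo1 : e <= 1 by apply: le_trans ee _; rewrite ge_min lexx orbT.
have hD u : `|u - u0| < e -> forall p, al * `|p| <= dual_norm A g c u p.
  by move=> hu p; have [/(_ p)/andP[]] := he u (lt_le_trans hu ee1).
have [L1 L11 hL] := sphere_uniform hN hC er eo1 al0 hD.
have L10 : 0 < L1 by exact: lt_trans L11.
have e0 := hc_e hC.
have nu : \forall y \near y0, chart_dom c y -> `|chart_to c y - u0| < Num.min e L1^-1.
  have [a' Aa ay] := am_cover hA y0; have [E [sE nE]] := sub_to hA Gc cy Aa ay.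
  have m0 : 0 < Num.min e L1^-1 by rewrite lt_min e0 invr_gt0.
  have E0 : E (chart_to a' y0) = u0 by rewrite -(nbhs_singleton nE) // u0E.
  have n1 : \forall v \near chart_to a' y0, `|E v - u0| < Num.min e L1^-1.
    by rewrite -E0; exact: (cont_near_lt (smv_cont sE)).
  by apply: near_imp (near_and nE (near_cont_comp (am_to hA Aa ay) n1)) => y [h1 h2] /h1 ->.
have nc : \forall y \near y0, Gamma phi y -> chart_dom c y := sub_near Gc cy.
(* The first bound forces k > [L1], as the norm is at most [be] k; the others absorb the powers of
   [be] lost in the conversion. *)
exists (Num.max (be * L1 + 1) (Num.max (L1 * be ^+ 4) (L1 * be ^+ 3))).
apply: near_imp (near_and nu nc) => y [hu hc] L + z hz zy hL0; rewrite -zy in hu hc; rewrite !ge_max => /andP[LL /andP[L4 L3]].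
have cz : chart_dom c z.1.
  by apply: hc; have [[c' Gc' cz'] _ _] := hz; exact: (GA_in Gc' cz').
have := hu cz; rewrite lt_min => /andP[hue huL].
have [u uE] := exists_eq (chart_to c z.1); have [p pE] := exists_eq (z.2 c).
have [k kE] := exists_eq `|p|; have [N NE] := exists_eq (norm_cov A g phi z); rewrite -NE in hL0 *.
have NE' : N = dual_norm A g c u p.
  by rewrite NE /norm_cov (fiber_evalE Gc cz hz (dual_norm_invariant hA hg Gc cz)) -uE -pE.
rewrite -uE in hue huL.
have [hb hV] := he u (lt_le_trans hue ee1).
have hb1 : N <= be * k by have /andP[_] := hb p; rewrite NE' kE.
have hk : L1 < k.
  rewrite -(ltr_pM2l be0); apply: lt_le_trans hb1; apply: lt_le_trans hL0; apply: lt_le_trans LL.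
  by rewrite ltrDl ltr01.
have k_0 : 0 < k by exact: lt_trans hk.
have N_0 : 0 < N by apply: lt_le_trans hL0; apply: lt_le_trans LL; rewrite addr_gt0 // mulr_gt0.
have [P PE] := exists_eq (k^-1 *: p).
have P1 : `|P| = 1 by rewrite PE normrZ normfV (gtr0_norm k_0) -kE mulVf // gt_eqF.
have kP : k *: P = p by rewrite PE scalerA divff ?scale1r // gt_eqF.
have zE : z = covlift GA c u (k *: P) by rewrite kP uE pE; exact: (cot_lift gG Gc cz hz).
have [x1 [x2]] := hL P u k P1 huL hk; rewrite -zE; cbv zeta => -[[e1' e2'] [b1 b2] [n1 n2] d12 bN].
have hur : `|u - u0| < r := lt_le_trans hue er.
split.
- by exists (covlift GA c (lsubmx x1) (k *: rsubmx x1)).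
- by exists (covlift GA c (lsubmx x2) (k *: rsubmx x2)).
- move=> z1 z2 bz nz; have w1E := b2 z1 bz; have w2E := n2 z2 nz.
  have fs := covlift_dom hA hN (k *: rsubmx x1) (lt_le_trans e1' er).
  have gs := covlift_dom hA hN (k *: rsubmx x2) (lt_le_trans e2' er).
  have V1 : V (covlift GA c (lsubmx x1) (k *: rsubmx x1)).1 by have [_] := he _ (lt_le_trans e1' ee1).
  have V2 : V (covlift GA c (lsubmx x2) (k *: rsubmx x2)).1 by have [_] := he _ (lt_le_trans e2' ee1).
  rewrite w1E in fs V1; rewrite w2E in gs V2.
  have [f1 f2 _ f4] := fs; have [g1 g2 _ g4] := gs.
  have c4 : L1 * k ^- 4 <= L * N ^- 4.
    apply: (@le_trans _ _ (L1 * (be ^+ 4 * N ^- 4))).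
      by apply: ler_wpM2l; [exact: ltW|exact: inv_pow_le].
    by rewrite mulrA; apply: ler_wpM2r => //; rewrite invr_ge0 exprn_ge0 // ltW.
  (* The factor k of p = k P turns the error k^-4 of P into k^-3. *)
  have c3 : k * (L1 * k ^- 4) <= L * N ^- 3.
    have -> : k * (L1 * k ^- 4) = L1 * k ^- 3 by have kn := lt0r_neq0 k_0; field.
    apply: (@le_trans _ _ (L1 * (be ^+ 3 * N ^- 3))).
      by apply: ler_wpM2l; [exact: ltW|exact: inv_pow_le].
    by rewrite mulrA; apply: ler_wpM2r => //; rewrite invr_ge0 exprn_ge0 // ltW.
  rewrite -NE; split; [exact: (conj V1 f1)|exact: (conj V2 g1)| |] => j.
    rewrite f2 g2; apply: le_trans c4; apply: le_trans d12.
    have -> : lsubmx x1 0 j - lsubmx x2 0 j = (x1 - x2) 0 (lshift n j) by rewrite !mxE.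
    exact: coord_le_norm.
  rewrite f4 g4; apply: le_trans c3.
  have -> : (k *: rsubmx x1) 0 j - (k *: rsubmx x2) 0 j = k * (x1 - x2) 0 (rshift n j) by rewrite !mxE; ring.
  rewrite normrM (gtr0_norm k_0); apply: ler_wpM2l; first exact: ltW.
  by apply: le_trans d12; exact: coord_le_norm.
- rewrite -NE (fiber_evalE Gc cz hz (N_invariant hA hg hB Gc cz)) (fiber_evalE Gc cz hz (K0_invariant hA hg hB Gc cz)).
  rewrite -uE -pE; have p0 : p != 0 by rewrite -normr_eq0 -kE gt_eqF.
  have k0p := k0_pos hB hN hur p0.
  rewrite (N_link hB hN hur p0) (K0_link hN p hur) div1r powRN (powR12_sqrt (ltW k0p)) opprK /Nf /N0 addrAC addNr add0r.
  rewrite -kP -dscale_p2 (N1_scale (nc_smC hN) (in_base_row hN P hur) k_0) normrM.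
  rewrite (@ger0_norm _ (k ^- 3)); last by rewrite invr_ge0 exprn_ge0 // ltW.
  apply: (@le_trans _ _ (be ^+ 3 * N ^- 3 * L1)).
    apply: ler_pM => //; first by rewrite invr_ge0 exprn_ge0 // ltW.
    exact: inv_pow_le.
  rewrite mulrC mulrA; apply: ler_wpM2r => //; rewrite invr_ge0 exprn_ge0 // ltW //.
Qed.

End PointLocal.

(** * Uniformity over Gamma and the global statement *)

Section Uniform.
Context {R : realType} {n : nat} {M : topologicalType}.
Variables (A : set (chart R M n.+1)) (g : chart R M n.+1 -> M -> 'M[R]_n.+1) (phi : M -> R).
Local Notation GA := (Gamma_atlas A phi).

(** The local claims hold near each base point for all large L, so compactness of Gamma, used with
    the filter of large L, gives one threshold. *)
Lemma Gamma_uniform (Q : R -> covector R M n -> Prop) : compact (Gamma phi) ->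
  (forall y0, Gamma phi y0 -> exists L0 : R, \forall y \near y0, forall L, L0 <= L ->
     forall z, cotangent GA z -> z.1 = y -> L <= norm_cov A g phi z -> Q L z) ->
  exists L0 : R, forall L, L0 <= L -> forall z, cotangent GA z -> L <= norm_cov A g phi z -> Q L z.
Proof.
move=> /compact_near_coveringP hc hQ.
have := hc R (pinfty_nbhs R) (fun L0 y => forall L, L0 <= L ->
     forall z, cotangent GA z -> z.1 = y -> L <= norm_cov A g phi z -> Q L z) _.
feed; first exact: _.
feed.
  move=> y0 /hQ[L0 nL].
  exists ([set y | forall L, L0 <= L -> forall z, cotangent GA z -> z.1 = y -> L <= norm_cov A g phi z -> Q L z],
    [set L | L0 < L]) => [|[y L] /= [h1 h2] L' LL']; last by apply: h1; exact: le_trans (ltW h2) LL'.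
  by split=> /=; [exact: nL|apply: nbhs_pinfty_gt; exact: num_real].
move=> hn; have [L0 hL] := filter_ex hn; exists L0 => L LL z hz.
by apply: (hL z.1) => //; have [[c Gc cz] _ _] := hz; exact: (GA_in Gc cz).
Qed.

End Uniform.

Theorem proposition5p2 (R : realType) (n : nat) (M : topologicalType)
  (A : set (chart R M n.+1)) (hM : smooth_manifold A)
  (g : chart R M n.+1 -> M -> 'M[R]_n.+1) (hg : riemannian_metric A g)
  (phi : M -> R) (hphi : smooth_map A setT (line_atlas R) phi)
  (hGamma : compact (Gamma phi)) (hdphi : dphi_nonzero A phi)
  (W : set M) (eps0 : R) (q : M -> M) (X : M * R -> M)
  (B : chart R M n -> 'rV[R]_n -> R -> 'M[R]_n)
  (hB : semigeodesic A g phi W eps0 q X B)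
  (Hh : chart R (M * R)%type n.+1 -> 'rV[R]_n.+1 -> 'rV[R]_n.+1 -> R)
  (hH : regularized_hamiltonian A g phi Hh) :
  (exists2 eps1 : R, 0 < eps1 &
    forall eps : R, 0 < eps < eps1 ->
      (forall z, U_set A g phi eps z ->
         (exists! z1, billiard_map A phi Hh z z1) /\
         (exists! z2, N_flow_pi A g phi B z z2)) /\
      (forall (m : nat) (c e : 'I_m -> chart R M n),
         finite_extended_atlas A phi c e ->
         exists K r : R, forall z z1 z2,
           U_set A g phi eps z -> r <= norm_cov A g phi z ->
           billiard_map A phi Hh z z1 -> N_flow_pi A g phi B z z2 ->
           forall i, chart_dom (c i) z1.1 \/ chart_dom (c i) z2.1 ->
             [/\ chart_dom (e i) z1.1, chart_dom (e i) z2.1,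
                 (forall j, `|chart_to (e i) z1.1 0 j
                              - chart_to (e i) z2.1 0 j|
                            <= K * norm_cov A g phi z ^- 4) &
                 (forall j, `|z1.2 (e i) 0 j - z2.2 (e i) 0 j|
                            <= K * norm_cov A g phi z ^- 3)])) /\
  (exists K r : R, forall z, cotangent (Gamma_atlas A phi) z ->
     r <= norm_cov A g phi z ->
     `|fiber_eval (Gamma_atlas A phi) (N_ham B) z
       - - (fiber_eval (Gamma_atlas A phi) (K0 B) z `^ (- (1 / 2)))|
     <= K * norm_cov A g phi z ^- 3).
Proof.
have [hT _ _ _ _] := hM; have hA := amb_manifold hM.
have local (y0 : M) (V : set M) : Gamma phi y0 -> open V -> V y0 -> exists2 c, Gamma_atlas A phi c &
    exists L0 : R, \forall y \near y0, forall L, L0 <= L -> forall z, cotangent (Gamma_atlas A phi) z -> z.1 = y ->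
      L <= norm_cov A g phi z -> comparison A g phi B Hh c (V `&` chart_dom c) L z.
  move=> Gy oV Vy; have [c Gc cy] := level_set_chart hA hphi hdphi Gy.
  by exists c => //; exact: (point_local hA hT hg hphi hdphi hB hH Gc cy oV Vy).
split.
- have [|L0 hL] := @Gamma_uniform R n M A g phi (fun _ z => (exists! z1, billiard_map A phi Hh z z1) /\
      (exists! z2, N_flow_pi A g phi B z z2)) hGamma.
    move=> y0 Gy; have [c _ [L0 nL]] := local y0 setT Gy openT I.
    exists L0; apply: near_imp nL => y h L LL z hz zy hn.
    by have [h1 h2 _ _] := h L LL z hz zy hn.
  have m0 : 0 < Num.max L0 1 by rewrite lt_max ltr01 orbT.
  (* For eps below this value eps^-1 exceeds the threshold [L0]; the maximum with 1 makes the
     inverse positive. *)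
  exists (Num.max L0 1)^-1; first by rewrite invr_gt0.
  move=> eps /andP[eps_0 eps1]; split.
    move=> z [hz hn]; apply: (hL eps^-1) => //.
    apply: ltW; apply: (@le_lt_trans _ _ (Num.max L0 1)); first by rewrite le_max lexx.
    by rewrite invf_pgt ?posrE.
  move=> m c e [hcov he].
  have hi (i : 'I_m) : exists L0 : R, forall L, L0 <= L -> forall z, cotangent (Gamma_atlas A phi) z -> L <= norm_cov A g phi z ->
      forall z1 z2, billiard_map A phi Hh z z1 -> N_flow_pi A g phi B z z2 ->
      chart_dom (c i) z1.1 \/ chart_dom (c i) z2.1 ->
      [/\ chart_dom (e i) z1.1, chart_dom (e i) z2.1,
          (forall j, `|chart_to (e i) z1.1 0 j - chart_to (e i) z2.1 0 j| <= L * norm_cov A g phi z ^- 4) &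
          (forall j, `|z1.2 (e i) 0 j - z2.2 (e i) 0 j| <= L * norm_cov A g phi z ^- 3)].
    apply: (Gamma_uniform hGamma) => y0 Gy; have [Gc Ge ce _] := he i.
    (* If y0 is in the closure of the domain of c i, then e i is a chart around y0 and the
       comparison is made in it. Otherwise the end points stay in the complement of that closure, so
       near y0 the premise on chart domains is contradictory. *)
    have [cly|cly] := pselect (closure (chart_dom (c i)) y0).
      have [L1 nL] := point_local hA hT hg hphi hdphi hB hH Ge (ce _ cly) openT I.
      exists L1; apply: near_imp nL => y h L LL z hz zy hn z1 z2 b1 b2 _.
      by have [_ _ /(_ z1 z2 b1 b2)[[_ h1] [_ h2] h3 h4] _] := h L LL z hz zy hn.
    have oV : open (~` closure (chart_dom (c i))) by apply: closed_openC; exact: closed_closure.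
    have [c' _ [L1 nL]] := local y0 _ Gy oV cly.
    exists L1; apply: near_imp nL => y h L LL z hz zy hn z1 z2 b1 b2 hd.
    have [_ _ /(_ z1 z2 b1 b2)[[h1 _] [h2 _] _ _] _] := h L LL z hz zy hn.
    by case: hd => /subset_closure hd; [case: (h1 hd)|case: (h2 hd)].
  have [Lf hf] := choice hi.
  (* The sum dominates every [Lf i], so one constant serves all the charts. *)
  exists (\sum_i `|Lf i|), (\sum_i `|Lf i|) => z z1 z2 [hz _] hn b1 b2 i; apply: (hf i) => //.
  apply: le_trans (ler_norm _) _; rewrite (bigD1 i) //= lerDl.
  by apply: sumr_ge0 => j _; exact: normr_ge0.
- have [|L0 hL] := @Gamma_uniform R n M A g phi (fun L z =>
     `|fiber_eval (Gamma_atlas A phi) (N_ham B) z - - (fiber_eval (Gamma_atlas A phi) (K0 B) z `^ (- (1 / 2)))|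
     <= L * norm_cov A g phi z ^- 3) hGamma.
    move=> y0 Gy; have [c _ [L0 nL]] := local y0 setT Gy openT I.
    exists L0; apply: near_imp nL => y h L LL z hz zy hn.
    by have [_ _ _ h4] := h L LL z hz zy hn.
  by exists L0, L0 => z hz hn; exact: (hL L0 (lexx _)).
Qed.
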